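(* Let $N\ge2$, let $\eta^\pm:\mathbb R^{N-1}\to\mathbb R$ be Lipschitz with $\eta^-<\eta^+$ everywhere, and let $\Omega=\{(x',x_N)\in\mathbb R^{N-1}\times\mathbb R:\eta^-(x')<x_N<\eta^+(x')\}$. Let $L=|\eta^-|_{0,1}+|\eta^+|_{0,1}$ be the sum of the Lipschitz constants, assumed positive. Let $1<p<\infty$ and $0<s<1$ with $sp>1$. (1) There exists $C=C(N,s,p,L)>0$ such that for all $u\in\dot W^{s,p}(\Omega)$, $$\int_{\mathbb R^{N-1}}\frac{|\mathrm{Tr}(u)(x',\eta^+(x'))-\mathrm{Tr}(u)(x',\eta^-(x'))|^p}{(\eta^+(x')-\eta^-(x'))^{sp-1}}\,dx'\le C|u|^p_{\dot W^{s,p}(\Omega)},$$ $$|\mathrm{Tr}(u)(\cdot,\eta^\pm(\cdot))|_{\tilde W^{s-1/p,p}_{\le(\eta^+-\eta^-)/(2L)}(\mathbb R^{N-1})}\le C|u|_{\dot W^{s,p}(\Omega)},$$ $$|\mathrm{Tr}(u)(\cdot,\eta^\pm(\cdot))|_{\tilde W^{s+1/p,p}_{\ge(\eta^+-\eta^-)/(2L)}(\mathbb R^{N-1})}\le C|u|_{\dot W^{s,p}(\Omega)}.$$ (2) Let $f^+,f^-\in L^p_{\rm loc}(\mathbb R^{N-1})$ be such that $$\int_{\mathbb R^{N-1}}\frac{|f^+(x')-f^-(x')|^p}{(\eta^+(x')-\eta^-(x'))^{sp-1}}\,dx'<\infty,\quad |f^\pm|_{\tilde W^{s-1/p,p}_{\le(\eta^+-\eta^-)/(2L)}(\mathbb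 R^{N-1})}<\infty,\quad |f^\pm|_{\tilde W^{s+1/p,p}_{\ge(\eta^+-\eta^-)/(2L)}(\mathbb R^{N-1})}<\infty.$$ Then there exists $u\in\dot W^{s,p}(\Omega)$ such that $\mathrm{Tr}(u)(x',\eta^\pm(x'))=f^\pm(x')$. Furthermore, $u$ can be chosen so that the map $(f^+,f^-)\mapsto u$ is linear and, for some $C=C(N,s,p,L)>0$ (independent of $f^\pm$), $$|u|^p_{\dot W^{s,p}(\Omega)}\le C\int_{\mathbb R^{N-1}}\frac{|f^+(x')-f^-(x')|^p}{(\eta^+(x')-\eta^-(x'))^{sp-1}}\,dx'+C\sum_{\pm}|f^\pm|^p_{\tilde W^{s-1/p,p}_{\le(\eta^+-\eta^-)/(2L)}(\mathbb R^{N-1})}+C\sum_{\pm}|f^\pm|^p_{\tilde W^{s+1/p,p}_{\ge(\eta^+-\eta^-)/(2L)}(\mathbb R^{N-1})}.$$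
   Context: For $U\subseteq\mathbb R^d$ open, $0<s<1$, $1\le p<\infty$, $\dot W^{s,p}(U)$ is the space of $u\in L^p_{\rm loc}(U)$ with finite seminorm $|u|_{\dot W^{s,p}(U)}=\left(\int_U\int_U\frac{|u(x)-u(y)|^p}{\|x-y\|^{d+sp}}\,dy\,dx\right)^{1/p}$. For $\sigma>0$, a positive function $\eta$ on $U$, and $g$ measurable on $U\subseteq\mathbb R^d$, define the screened seminorms $$|g|_{\tilde W^{\sigma,p}_{\le\eta}(U)}=\left(\int_U\int_{U\cap B(x,\eta(x))}\frac{|g(x)-g(y)|^p}{\|x-y\|^{d+\sigma p}}\,dy\,dx\right)^{1/p},$$ $$|g|_{\tilde W^{\sigma,p}_{\ge\eta}(U)}=\left(\int_U\int_{U\setminus B(x,\eta(x))}\eta(x)\eta(y)\frac{|g(x)-g(y)|^p}{\|x-y\|^{d+\sigma p}}\,dy\,dx\right)^{1/p}.$$ Here they are used with $U=\mathbb R^{N-1}$, $d=N-1$, so for $\sigma=s-1/p$ the kernel exponent is $N-2+sp$ and for $\sigma=s+1/p$ it is $N+sp$. $|\eta|_{0,1}$ is the optimal Lipschitz constant of $\eta$. $\mathrm{Tr}(u)$ denotes the boundary trace of $u$ on $\partial\Omega$: for $sp>1$ a function $u\in\dot W^{s,p}(\Omega)$ belongs to $W^{s,p}$ of bounded Lipschitz subdomains, and $\mathrm{Tr}(u)$ is given locally by the standard continuous trace operator on $W^{s,p}$ of Lipschitz domains (the continuous extension of restriction to the boundary). *)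

(* Defs.v *)
From HB Require Import structures.
From mathcomp Require Import all_boot all_order all_algebra.
From mathcomp Require Import all_classical all_reals all_analysis.

Set Implicit Arguments.
Unset Strict Implicit.
Unset Printing Implicit Defensive.

Import Order.TTheory GRing.Theory Num.Theory.
Import numFieldNormedType.Exports.

Local Open Scope classical_set_scope.
Local Open Scope ring_scope.

(* 'rV[R]_d carries the sigma-algebra generated by its coordinates (the same
   construction as for n.-tuple), i.e. the Borel sigma-algebra of R^d. *)
Section rV_measurable.
Context {R : realType} (d : nat).

Let coord_rV : 'I_d -> 'rV[R]_d -> measurableTypeR R := fun i x => x ord0 i.

Let rV_set0 : g_sigma_preimage coord_rV set0.
Proof. exact: sigma_algebra0. Qed.

Let rV_setC A : g_sigma_preimage coord_rV A -> g_sigma_preimage coord_rV (~` A).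
Proof. exact: sigma_algebraC. Qed.

Let rV_bigcup (F : (set 'rV[R]_d)^nat) :
  (forall i, g_sigma_preimage coord_rV (F i)) ->
  g_sigma_preimage coord_rV (\bigcup_i (F i)).
Proof. exact: sigma_algebra_bigcup. Qed.

HB.instance Definition _ := @isMeasurable.Build default_measure_display
  'rV[R]_d (g_sigma_preimage coord_rV) rV_set0 rV_setC rV_bigcup.

End rV_measurable.

Section lebesgue_rV.
Context {R : realType}.

Lemma measurable_coord_rV d (i : 'I_d) :
  measurable_fun [set: 'rV[R]_d] (fun x => x ord0 i : R).
Proof.
move=> _ Y mY; rewrite setTI; apply: sub_sigma_algebra => /=.
rewrite -bigcup_seq/=; exists i => /=; first by rewrite mem_index_enum.
by exists Y => //; rewrite setTI.
Qed.

Lemma measurable_fun_rV d dT (T : measurableType dT) (f : T -> 'rV[R]_d) :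
  (forall i, measurable_fun setT (fun x => f x ord0 i : R)) ->
  measurable_fun setT f.
Proof.
move=> mf _ A mA; rewrite setTI.
pose c := fun (i : 'I_d) (x : 'rV[R]_d) => x ord0 i : measurableTypeR R.
suff : g_sigma_preimage (fun i => c i \o f) `<=` measurable.
  by apply; rewrite g_sigma_preimage_comp; exists A => //; rewrite setTI.
apply: smallest_sub; first exact: sigma_algebra_measurable.
case: d => [|d] in f mf A mA c *; first by rewrite big_ord0.
rewrite -bigcup_mkord_ord; apply: bigcup_sub => i _ B [C mC <-].
exact: mf.
Qed.

Definition rV_cons d (z : 'rV[R]_d * R) : 'rV[R]_d.+1 :=
  row_mx (z.2%:M : 'rV_1) z.1.

Lemma measurable_rV_cons d : measurable_fun setT (@rV_cons d).
Proof.
apply: measurable_fun_rV => i; rewrite /rV_cons.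
case: (@splitP 1 d i) => j ij.
  have -> : i = lshift d j by apply/val_inj.
  rewrite (_ : (fun z => _) = snd); first exact: measurable_snd.
  by apply/funext => z; rewrite (@row_mxEl _ 1 1 d) [j]ord1 mxE.
have -> : i = rshift 1 j by apply/val_inj.
rewrite (_ : (fun z => _) = (fun x : 'rV[R]_d => x ord0 j) \o fst).
  exact: measurableT_comp (measurable_coord_rV j) measurable_fst.
by apply/funext => z; rewrite (@row_mxEr _ 1 1 d).
Qed.

Fixpoint lebesgue_rV d : {measure set 'rV[R]_d -> \bar R} :=
  match d with
  | 0 => \d_(0 : 'rV[R]_0)
  | d.+1 => measure_function_pushforward__canonical__measure_function_Measure
      (lebesgue_rV d \x @lebesgue_measure R)%E (@measurable_rV_cons d)
  end.
End lebesgue_rV.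

(* R^N is represented as R^(N-1) x R, i.e. points (x', x_N); below d = N - 1. *)
Definition lebesgue_graph {R : realType} (d : nat) :
    set ('rV[R]_d * measurableTypeR R) -> \bar R :=
  (lebesgue_rV d \x @lebesgue_measure R)%E.
Arguments lebesgue_graph {R} d _.
HB.instance Definition _ (R : realType) (d : nat) :=
  Measure.on (@lebesgue_graph R d).

(* The library norms on 'rV[R]_d and on products are sup norms. *)
Definition enorm {R : realType} (d : nat) (x : 'rV[R]_d) : R :=
  Num.sqrt (\sum_(i < d) x ord0 i ^+ 2).

Definition enorm_pair {R : realType} (d : nat) (z : 'rV[R]_d * R) : R :=
  Num.sqrt (enorm z.1 ^+ 2 + z.2 ^+ 2).

Section lipschitz.
Context {R : realType} (d : nat).

Definition lipschitz_bound (eta : 'rV[R]_d -> R) : set R :=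
  [set K | 0 <= K /\ forall x y, `|eta x - eta y| <= K * enorm (x - y)].

Definition is_lipschitz (eta : 'rV[R]_d -> R) := lipschitz_bound eta !=set0.

Definition lipschitz_const (eta : 'rV[R]_d -> R) : R :=
  inf (lipschitz_bound eta).

End lipschitz.

Section local_spaces.
Context {R : realType} (d : nat).
Local Open Scope ereal_scope.

Definition Lploc_rV (p : R) (f : 'rV[R]_d -> R) :=
  measurable_fun setT f /\
  forall K : set 'rV[R]_d, compact K ->
    \int[lebesgue_rV d]_(x in K) (`|f x| `^ p)%:E < +oo.

Definition Lploc (p : R) (U : set ('rV[R]_d * R)) (u : 'rV[R]_d * R -> R) :=
  measurable_fun U u /\
  forall K : set ('rV[R]_d * R), compact K -> K `<=` U ->
    \int[lebesgue_graph d]_(x in K) (`|u x| `^ p)%:E < +oo.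

(* The integrands below are 0 on the diagonal: 0 `^ p = 0 for p != 0. *)

(* The ambient dimension is d + 1, hence the exponent (d + 1) + s p. *)
Definition gagliardo (s p : R) (U : set ('rV[R]_d * R))
    (u : 'rV[R]_d * R -> R) : \bar R :=
  (\int[lebesgue_graph d]_(x in U) \int[lebesgue_graph d]_(y in U)
     (`|u x - u y| `^ p / enorm_pair (x - y) `^ (d.+1%:R + s * p))%:E)
  `^ p^-1.

Definition Wdot (s p : R) (U : set ('rV[R]_d * R)) (u : 'rV[R]_d * R -> R) :=
  Lploc p U u /\ gagliardo s p U u < +oo.

Definition Lp_norm (p : R) (U : set ('rV[R]_d * R)) (u : 'rV[R]_d * R -> R)
    : \bar R :=
  (\int[lebesgue_graph d]_(x in U) (`|u x| `^ p)%:E) `^ p^-1.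

Definition screened_le (sigma p : R) (eta : 'rV[R]_d -> R) (U : set 'rV[R]_d)
    (g : 'rV[R]_d -> R) : \bar R :=
  (\int[lebesgue_rV d]_(x in U)
   \int[lebesgue_rV d]_(y in U `&` [set y | (enorm (x - y) < eta x)%R])
     (`|g x - g y| `^ p / enorm (x - y) `^ (d%:R + sigma * p))%:E)
  `^ p^-1.

Definition screened_ge (sigma p : R) (eta : 'rV[R]_d -> R) (U : set 'rV[R]_d)
    (g : 'rV[R]_d -> R) : \bar R :=
  (\int[lebesgue_rV d]_(x in U)
   \int[lebesgue_rV d]_(y in U `\` [set y | (enorm (x - y) < eta x)%R])
     (eta x * eta y *
      (`|g x - g y| `^ p / enorm (x - y) `^ (d%:R + sigma * p)))%:E)
  `^ p^-1.

End local_spaces.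

Section strip.
Context {R : realType} (d : nat).
Variables (etam etap : 'rV[R]_d -> R).
Local Open Scope ereal_scope.

Definition strip : set ('rV[R]_d * R) :=
  [set z | (etam z.1 < z.2 < etap z.1)%R].

(* When etam < etap are Lipschitz this is a bounded Lipschitz domain, and these
   domains exhaust the strip together with its boundary. *)
Definition strip_ball (r : R) : set ('rV[R]_d * R) :=
  strip `&` [set z | (enorm z.1 < r)%R].

(* [is_trace s p eta u f], for eta = etam or eta = etap: the trace of u on the
   graph of eta, read in the graph coordinates x', is (a representative of) f.
   On each strip_ball r, the trace operator of W^{s,p} is the continuous
   extension, from the W^{s,p} norm to the L^p norm of the boundary, of the
   restriction of functions that are continuous up to the boundary; as eta is
   Lipschitz, the L^p norms for the surface measure on the graph and for
   Lebesgue measure in x' are equivalent. *)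
Definition is_trace (s p : R) (eta : 'rV[R]_d -> R) (u : 'rV[R]_d * R -> R)
    (f : 'rV[R]_d -> R) :=
  measurable_fun setT f /\
  forall r : R, (0 < r)%R -> exists v : ('rV[R]_d * R -> R)^nat,
    [/\ forall n, {within closure (strip_ball r), continuous (v n)},
        Lp_norm p (strip_ball r) (fun z => v n z - u z)%R @[n --> \oo] --> 0,
        gagliardo s p (strip_ball r) (fun z => v n z - u z)%R @[n --> \oo]
          --> 0 &
        \int[lebesgue_rV d]_(x in [set x | (enorm x < r)%R])
          (`|v n (x, eta x) - f x| `^ p)%:E @[n --> \oo] --> 0].

Definition jump (s p : R) (fp fm : 'rV[R]_d -> R) : \bar R :=
  \int[lebesgue_rV d]_x
    (`|fp x - fm x| `^ p / (etap x - etam x) `^ (s * p - 1))%:E.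

Definition screen (L : R) (x : 'rV[R]_d) : R :=
  ((etap x - etam x) / (2 * L))%R.

Definition trace_data (s p L : R) (fp fm : 'rV[R]_d -> R) :=
  [/\ Lploc_rV p fp /\ Lploc_rV p fm,
      jump s p fp fm < +oo,
      screened_le (s - p^-1) p (screen L) setT fp < +oo /\
      screened_le (s - p^-1) p (screen L) setT fm < +oo &
      screened_ge (s + p^-1) p (screen L) setT fp < +oo /\
      screened_ge (s + p^-1) p (screen L) setT fm < +oo].

End strip.

(* Main.v *)
Require Import Defs.
From HB Require Import structures.
From mathcomp Require Import all_boot all_order all_algebra.
From mathcomp Require Import all_classical all_reals all_analysis.
From mathcomp Require Import measurable_realfun ring lra.

Set Implicit Arguments.
Unset Strict Implicit.
Unset Printing Implicit Defensive.

Import Order.TTheory GRing.Theory Num.Theory.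
Import numFieldNormedType.Exports.

Local Open Scope classical_set_scope.
Local Open Scope ring_scope.

(** Let tau be the vertical distance of a point z of the strip to one of the two
graphs and w the width of the strip.  Telescoping u along z, half-way to the
graph, and so on, and comparing consecutive points through u on a ball, one gets
Hardy's inequality: the integral of |u - f|^p tau^(-sp) is bounded by the
Gagliardo energy when sp > 1, f being the trace.  Writing
f x - f y = (f x - u z) + (u z - u z') + (u z' - f y) and averaging over z, z' in
the columns above x and y, of height comparable to |x - y| when this is small
against w and of full height otherwise, bounds the two screened seminorms;
with x = y and both traces it bounds the jump.

Conversely f is extended by its mean over a ball of radius c tau.  The energy of
this extension is Lipschitz-controlled when rho(z, z') is small against tau, and
otherwise splits by the triangle inequality through f x - f y.  The extensions
from the two graphs are glued with the weight tau / w, at the price of the jump.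

A function of finite energy has f as a trace as soon as the Hardy integral is
finite: squeezing it towards the middle of the strip by a factor 2^-n and
mollifying at the smaller scale 2^-n(1+a) gives continuous approximations whose
boundary values differ from f by a power of 2^-n.  The same rate makes them
Cauchy, which gives the existence of traces. *)

(** * Sigma-finite Lebesgue measures *)

(** Constants may depend on [N], [s], [p], [L] alone, so each estimate is proved for an abstract
    [side], its constant chosen before the graph. Telescoping needs weights [q ^+ j] with q near 1:
    a convexity constant 2^(p-1) at every step would exceed the gain 2^(s p - 1), since s < 1. A
    trace is known only through approximations continuous up to the boundary, so Hardy's inequality
    is first proved for these on bounded pieces, then passed to the limit. Conversely such
    approximations must be built although the strip may become arbitrarily thin at infinity: no
    fixed ratio of ball radius to squeezing depth keeps the balls inside on every bounded piece,
    while a radius of smaller order serves all pieces with one sequence. The L^p rate stays a power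
    of 2^-n above the first, and exactly one power is lost when boundary values are compared through
    a slab of height 2^-n. The kernel exponents of the two screened seminorms differ by 2 because
    averaging over two columns of height proportional to |x - y| contributes |x - y|^2, whereas full
    columns contribute w x * w y. *)

Section cube.
Context {R : realType}.

(** Cubes are products of intervals, so the recursion defining [lebesgue_rV] computes their volume;
    exhausting the space by them gives sigma-finiteness. *)
Definition cube d (r : R) : set 'rV[R]_d := [set x | forall i, `|x ord0 i| < r].

Lemma measurable_cube d r : measurable (@cube d r).
Proof.
rewrite (_ : cube r = \bigcap_(i in [set: 'I_d]) [set x : 'rV[R]_d | `|x ord0 i| < r]).
  apply: fin_bigcap_measurable => // i _.
  rewrite -[X in measurable X]setTI.
  have mb : measurable_fun setT (fun x : 'rV[R]_d => `|x ord0 i| < r).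
    apply: measurable_fun_ltr => //; apply: measurableT_comp => //; exact: measurable_coord_rV.
  by have := mb measurableT [set true] I.
by apply/seteqP; split=> x h i; [move=> _; exact: h|exact: (h i I)].
Qed.

Lemma preimage_cube d r : @rV_cons R d @^-1` (cube r) = cube r `*` [set x : R | `|x| < r].
Proof.
apply/seteqP; split=> -[x t] /=; rewrite /rV_cons /cube /=.
- move=> h; split=> [i|].
    by have := h (rshift 1 i); rewrite (@row_mxEr _ 1 1 d).
  by have := h (@lshift 1 d ord0); rewrite (@row_mxEl _ 1 1 d) mxE.
- move=> [h1 h2] i; case: (@splitP 1 d i) => j ij.
    have -> : i = lshift d j by apply/val_inj.
    by rewrite (@row_mxEl _ 1 1 d) [j]ord1 mxE.
  have -> : i = rshift 1 j by apply/val_inj.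
  by rewrite (@row_mxEr _ 1 1 d).
Qed.

Lemma lebesgue_rV_cube d r : 0 < r ->
  lebesgue_rV d (cube r) = ((2 * r) ^+ d)%:E.
Proof.
move=> r0; elim: d => [|d IH].
  rewrite /= diracE mem_set// => i; by case: i.
rewrite /= /pushforward /= preimage_cube product_measure1E//; last 2 first.
  exact: measurable_cube.
  have -> : [set x : R | `|x| < r] = `](-r), r[%classic.
    by apply/seteqP; split=> x /=; rewrite in_itv/= ltr_norml.
  exact: measurable_itv.
have -> : [set x : R | `|x| < r] = `](-r), r[%classic.
  by apply/seteqP; split=> x /=; rewrite in_itv/= ltr_norml.
transitivity (lebesgue_rV d (cube r) * @lebesgue_measure R `](- r)%R, r[%classic)%E => //.
rewrite IH lebesgue_measure_itv/= lte_fin ifT ?gtrN//.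
by rewrite opprK -EFinD -EFinM exprSr mulrDl mul1r.
Qed.

End cube.

(* Synonyms of the two measures, needed to equip them with sigma-finiteness. *)
Definition lam {R : realType} (d : nat) : set 'rV[R]_d -> \bar R := lebesgue_rV d.
Arguments lam {R} d _.
HB.instance Definition _ (R : realType) d := Measure.on (@lam R d).

Section sf.
Context {R : realType}.
Lemma lam_sigma_finite d : sigma_finite setT (@lam R d).
Proof.
exists (fun n => cube n.+1%:R); last first.
  move=> n; split; first exact: measurable_cube.
  by rewrite /lam lebesgue_rV_cube// ltry.
apply/esym/seteqP; split => // x _.
have [n hn] : exists n : nat, \sum_i `|x ord0 i| < n%:R.
  exists (Num.truncn (\sum_i `|x ord0 i|)).+1.
  exact: truncnS_gt.
exists n => // i; apply: le_lt_trans (lt_trans hn _); last by rewrite ltr_nat.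
by rewrite (bigD1 i)//= lerDl sumr_ge0.
Qed.
HB.instance Definition _ d := Measure_isSigmaFinite.Build _ _ _ (@lam R d) (lam_sigma_finite d).
End sf.

Section mu_def.
Context {R : realType} (d : nat).
Definition mu : set ('rV[R]_d * measurableTypeR R) -> \bar R :=
  (@lam R d \x @lebesgue_measure R)%E.
HB.instance Definition _ := Measure.on mu.
Lemma mu_sigma_finite : sigma_finite setT mu.
Proof.
exists (fun n => cube n.+1%:R `*` `](- n.+1%:R), n.+1%:R[%classic); last first.
  move=> n; have mF : measurable (@cube R d n.+1%:R) by exact: measurable_cube.
  split; first by apply: measurableX => //; exact: measurable_itv.
  rewrite /mu product_measure1E//.
  rewrite [X in (_ * X)%E](_ : _ = (n.+1%:R + n.+1%:R)%:E); last first.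
    transitivity (@lebesgue_measure R `](- n.+1%:R), n.+1%:R[%classic) => //.
    by rewrite lebesgue_measure_itv/= lte_fin gtrN// opprK EFinD.
  rewrite [X in (X * _)%E](_ : _ = lebesgue_rV d (@cube R d n.+1%:R))//.
  by rewrite lebesgue_rV_cube// -EFinM ltry.
apply/esym/seteqP; split => // -[x t] _.
pose S := \sum_i `|x ord0 i| + `|t|.
have hS : S < (Num.truncn S).+1%:R by exact: truncnS_gt.
have xS i : `|x ord0 i| <= S.
  by rewrite /S (bigD1 i)//= -addrA lerDl addr_ge0// sumr_ge0.
exists (Num.truncn S) => //; split => /=.
  by move=> i; exact: le_lt_trans (xS i) hS.
rewrite in_itv/= -ltr_norml; apply: le_lt_trans hS.
by rewrite /S lerDr sumr_ge0.
Qed.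
HB.instance Definition _ := Measure_isSigmaFinite.Build _ _ _ mu mu_sigma_finite.
End mu_def.
Arguments mu {R} d _.

Section bridge.
Context {R : realType} (d : nat).
Lemma int_lam (D : set 'rV[R]_d) f : (\int[lebesgue_rV d]_(x in D) f x = \int[lam d]_(x in D) f x)%E.
Proof. exact: eq_measure_integral. Qed.
Lemma int_mu D f : (\int[@lebesgue_graph R d]_(x in D) f x = \int[mu d]_(x in D) f x)%E.
Proof. exact: eq_measure_integral. Qed.
Lemma int_mu2 (f : 'rV[R]_d * measurableTypeR R -> \bar R) : measurable_fun setT f -> (forall z, 0 <= f z)%E ->
  (\int[mu d]_z f z = \int[lam d]_x \int[lebesgue_measure]_t f (x, t))%E.
Proof. move=> mf f0; exact: fubini_tonelli1. Qed.
End bridge.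

(** * Integrals of nonnegative functions *)

Section intlem.
Local Open Scope ereal_scope.
Context d (T : measurableType d) (R : realType) (m : {measure set T -> \bar R}).
Import HBNNSimple.

(** The integral of a nonnegative function is a supremum over the simple functions below it, and a
    larger function has more of them below it. *)
Lemma le_integral_nng (f g : T -> \bar R) : (forall x, 0 <= f x) -> (forall x, f x <= g x) ->
  \int[m]_x f x <= \int[m]_x g x.
Proof.
move=> f0 fg; have g0 x : 0 <= g x := le_trans (f0 x) (fg x).
rewrite !ge0_integralTE//; apply: ereal_sup_le => _ [h /= hf <-].
by exists h => // x; exact: le_trans (hf x) (fg x).
Qed.

(** A simple function below [k * f], divided by k, is one below f. The reverse inequality is this
    one for [k^-1]. *)
Lemma integral_nngZ_le (f : T -> \bar R) (k : R) : (0 < k)%R -> (forall x, 0 <= f x) ->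
  \int[m]_x (k%:E * f x) <= k%:E * \int[m]_x f x.
Proof.
move=> k0 f0; have k0' : (0 <= k^-1)%R by rewrite invr_ge0 ltW.
rewrite !ge0_integralTE//; last by move=> x; rewrite mule_ge0// lee_fin ltW.
apply: ge_ereal_sup => _ [h /= hf <-].
rewrite -lee_pdivrMl// -sintegralrM.
apply: ereal_sup_ubound => /=; exists (scale_nnsfun h k0') => //.
move=> x /=; have := hf x; rewrite -(@lee_pdivrMl _ k)//.
Qed.

Lemma integral_nngZ (f : T -> \bar R) (k : R) : (0 <= k)%R -> (forall x, 0 <= f x) ->
  \int[m]_x (k%:E * f x) = k%:E * \int[m]_x f x.
Proof.
rewrite le_eqVlt => /orP[/eqP <-|k0] f0.
  by rewrite mul0e integral0_eq// => x _; rewrite mul0e.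
apply/eqP; rewrite eq_le integral_nngZ_le//= -lee_pdivlMl//.
apply: le_trans (integral_nngZ_le _ _) => //; rewrite ?invr_gt0//; last first.
  by move=> x; rewrite mule_ge0// lee_fin ltW.
apply: le_integral_nng => // x; rewrite muleA -EFinM mulVf ?gt_eqF// mul1e//.
Qed.

Lemma integral_nngZr (f : T -> \bar R) (k : R) : (0 <= k)%R -> (forall x, 0 <= f x) ->
  \int[m]_x (f x * k%:E) = (\int[m]_x f x) * k%:E.
Proof. by move=> k0 f0; rewrite muleC -integral_nngZ//; apply: eq_integral => x _; rewrite muleC. Qed.

Lemma integral_nngZR (f : T -> R) (k : R) : (0 <= k)%R -> (forall x, 0 <= f x)%R ->
  \int[m]_x (k * f x)%:E = k%:E * \int[m]_x (f x)%:E.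
Proof. by move=> k0 f0; rewrite -integral_nngZ. Qed.

Lemma integral_nngD (f g : T -> \bar R) : measurable_fun setT f -> measurable_fun setT g ->
  (forall x, 0 <= f x) -> (forall x, 0 <= g x) ->
  \int[m]_x (f x + g x) = \int[m]_x f x + \int[m]_x g x.
Proof. by move=> mf mg f0 g0; rewrite ge0_integralD. Qed.

Lemma eq_integral_setT (f g : T -> \bar R) : f =1 g -> \int[m]_x f x = \int[m]_x g x.
Proof. by move=> fg; apply: eq_integral => x _. Qed.

(** Domains of integration become boolean factors, so that every later integral runs over the whole
    space and set inclusions become inequalities between indicators. *)
Lemma int_dom (D : set T) (b : T -> bool) (f : T -> R) : (forall x, D x <-> b x) ->
  \int[m]_(x in D) (f x)%:E = \int[m]_x ((b x)%:R * f x)%:E.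
Proof.
move=> Db; rewrite integral_mkcond; apply: eq_integral => x _.
rewrite /patch; have [Dx|Dx] := boolP (x \in D).
  by rewrite (_ : b x) ?mul1r//; apply/Db; rewrite inE in Dx.
case: (boolP (b x)) => [/Db bx|_]; last by rewrite mul0r.
by rewrite (mem_set bx) in Dx.
Qed.

Lemma int_dome (D : set T) (b : T -> bool) (f : T -> \bar R) : (forall x, D x <-> b x) ->
  \int[m]_(x in D) f x = \int[m]_x ((b x)%:R%:E * f x).
Proof.
move=> Db; rewrite integral_mkcond; apply: eq_integral => x _.
rewrite /patch; have [Dx|Dx] := boolP (x \in D).
  by rewrite (_ : b x) ?mul1e//; apply/Db; rewrite inE in Dx.
case: (boolP (b x)) => [/Db bx|_]; last by rewrite mul0e.
by rewrite (mem_set bx) in Dx.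
Qed.

End intlem.

Section tonelli.
Local Open Scope ereal_scope.
Context d1 d2 (T1 : measurableType d1) (T2 : measurableType d2) (R : realType).
Variable m1 : {sigma_finite_measure set T1 -> \bar R}.
Variable m2 : {sigma_finite_measure set T2 -> \bar R}.

Lemma measurable_intl (f : T1 -> T2 -> \bar R) :
  measurable_fun setT (fun q => f q.1 q.2) -> (forall x y, 0 <= f x y) ->
  measurable_fun setT (fun x => \int[m2]_y f x y).
Proof. by move=> mf f0; exact: (measurable_fun_fubini_tonelli_F (fun q => f q.1 q.2)). Qed.

Lemma integral_swap (f : T1 -> T2 -> \bar R) :
  measurable_fun setT (fun q => f q.1 q.2) -> (forall x y, 0 <= f x y) ->
  \int[m1]_x \int[m2]_y f x y = \int[m2]_y \int[m1]_x f x y.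
Proof. by move=> mf f0; exact: (@fubini_tonelli _ _ _ _ _ m1 m2 (fun q => f q.1 q.2)). Qed.
End tonelli.

(** * Norms and measurability *)

Section norms.
Context {R : realType} (d : nat).
Implicit Types x y : 'rV[R]_d.

Lemma coord_le_norm x i : `|x ord0 i| <= `|x|.
Proof.
rewrite [leRHS]mx_normrE; apply: (@le_bigmax _ _ _ 0 (fun ij : 'I_1 * 'I_d => `|x ij.1 ij.2|) (ord0, i)).
Qed.

Lemma norm_rV_ltP x r : 0 < r -> reflect (forall i, `|x ord0 i| < r) (`|x| < r).
Proof.
move=> r0; apply: (iffP idP) => [xr i|h]; first exact: le_lt_trans (coord_le_norm x i) xr.
rewrite [ltLHS]mx_normrE; apply/bigmax_ltP; split => // -[i j] _ /=.
by rewrite [i]ord1.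
Qed.

Lemma enorm_ge0 x : 0 <= enorm x. Proof. exact: sqrtr_ge0. Qed.

Lemma norm_le_enorm x : `|x| <= enorm x.
Proof.
rewrite [leLHS]mx_normrE; apply/bigmax_leP; split; first exact: enorm_ge0.
move=> [i j] _ /=; rewrite [i]ord1 /enorm -sqrtr_sqr ler_wsqrtr//.
by rewrite (bigD1 j)//= lerDl sumr_ge0// => k _; rewrite sqr_ge0.
Qed.

Lemma enorm_le_norm x : enorm x <= d%:R * `|x|.
Proof.
have n0 : 0 <= d%:R * `|x| by rewrite mulr_ge0.
rewrite /enorm -[leRHS]ger0_norm// -sqrtr_sqr ler_wsqrtr//.
apply: (@le_trans _ _ (\sum_(i < d) `|x| ^+ 2)).
  apply: ler_sum => i _; rewrite -real_normK ?num_real//.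
  by rewrite lerXn2r ?nnegrE//; exact: coord_le_norm.
rewrite sumr_const card_ord -[leLHS]mulr_natl exprMn; apply: ler_wpM2r; first exact: sqr_ge0.
rewrite -natrX ler_nat; clear; by case: d => // k; rewrite expnS expn1 leq_pmulr.
Qed.

(** Equivalent to the Euclidean distance, but additive in the horizontal and the vertical
    displacement, which is how Lipschitz graphs act on points. *)
Definition rho (z z' : 'rV[R]_d * measurableTypeR R) : R := `|z.1 - z'.1| + `|(z.2 : R) - z'.2|.

Lemma rhoC z z' : rho z z' = rho z' z.
Proof. by rewrite /rho distrC [X in _ + X]distrC. Qed.
Lemma rho_ge0 z z' : 0 <= rho z z'. Proof. by rewrite addr_ge0. Qed.
Lemma rho_tri z1 z2 z3 : rho z1 z3 <= rho z1 z2 + rho z2 z3.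
Proof.
rewrite /rho addrACA lerD//; first by rewrite -[z1.1 - z3.1](subrKA z2.1) ler_normD.
by rewrite -[_ - z3.2](subrKA (z2.2 : R)) ler_normD.
Qed.
Lemma rho_eq0 z z' : rho z z' = 0 -> z = z'.
Proof.
rewrite /rho => /eqP; rewrite paddr_eq0// !normr_eq0 !subr_eq0 => /andP[/eqP h1 /eqP h2].
by case: z z' h1 h2 => [a b] [a' b'] /= -> ->.
Qed.

Lemma enorm_pairE (z z' : 'rV[R]_d * measurableTypeR R) :
  rho z z' <= 2 * enorm_pair (z - z' : 'rV[R]_d * R) /\
  enorm_pair (z - z' : 'rV[R]_d * R) <= d.+1%:R * rho z z'.
Proof.
rewrite /enorm_pair /rho /=; set a := z.1 - z'.1; set b := (z.2 : R) - z'.2.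
have n1 : `|a| <= Num.sqrt (enorm a ^+ 2 + b ^+ 2).
  apply: le_trans (norm_le_enorm _) _.
  by rewrite -[leLHS]ger0_norm ?enorm_ge0// -sqrtr_sqr ler_wsqrtr// lerDl sqr_ge0.
have n2 : `|b| <= Num.sqrt (enorm a ^+ 2 + b ^+ 2).
  by rewrite -sqrtr_sqr ler_wsqrtr// lerDr sqr_ge0.
split; first by rewrite mulr_natl mulr2n lerD.
have h0 : 0 <= d.+1%:R * (`|a| + `|b|) by rewrite mulr_ge0// addr_ge0.
have e0 := enorm_ge0 a; have eb := enorm_le_norm a.
rewrite -[leRHS]ger0_norm// -sqrtr_sqr ler_wsqrtr//.
apply: (@le_trans _ _ ((enorm a + `|b|) ^+ 2)).
  by rewrite -(real_normK (num_real b)) sqrrD; have := normr_ge0 b; nra.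
rewrite lerXn2r ?nnegrE ?addr_ge0// mulrDr lerD//.
  by apply: le_trans eb _; rewrite ler_wpM2r// ler_nat.
by rewrite ler_peMl// ler1n.
Qed.

Lemma measurable_norm_rV : measurable_fun [set: 'rV[R]_d] (fun x => `|x| : R).
Proof.
rewrite (_ : (fun x => _) = (fun x : 'rV[R]_d => \big[Num.max/0]_(ij : 'I_1 * 'I_d) `|x ij.1 ij.2|)); last first.
  by apply/funext => x; exact: mx_normrE.
elim: (index_enum _) => [|ij l IH].
  by under eq_fun do rewrite big_nil; exact: measurable_cst.
under eq_fun do rewrite big_cons.
apply: (@measurable_maxr _ _ _ _ (fun x : 'rV[R]_d => `|x ij.1 ij.2|)) => //.
apply: measurableT_comp => //; case: ij => i j /=; rewrite [i]ord1.
exact: measurable_coord_rV.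
Qed.

Lemma measurable_enorm : measurable_fun [set: 'rV[R]_d] (@enorm R d).
Proof.
rewrite /enorm.
apply: (@measurableT_comp _ _ _ _ _ _ (@Num.sqrt R)).
  by apply: continuous_measurable_fun; exact: sqrt_continuous.
apply: measurable_sum => i; apply: measurable_funX; exact: measurable_coord_rV.
Qed.

End norms.
Arguments rho {R d}.

Section msub.
Context {R : realType} (d : nat) dT (T : measurableType dT).
Lemma measurable_subrV (f g : T -> 'rV[R]_d) : measurable_fun setT f -> measurable_fun setT g ->
  measurable_fun setT (fun t => f t - g t).
Proof.
move=> mf mg; apply: measurable_fun_rV => i.
under eq_fun do rewrite !mxE.
by apply: measurable_funB; exact: measurableT_comp (measurable_coord_rV i) _.
Qed.
Lemma measurable_addrV (f g : T -> 'rV[R]_d) : measurable_fun setT f -> measurable_fun setT g ->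
  measurable_fun setT (fun t => f t + g t).
Proof.
move=> mf mg; apply: measurable_fun_rV => i.
under eq_fun do rewrite !mxE.
by apply: measurable_funD; exact: measurableT_comp (measurable_coord_rV i) _.
Qed.
Lemma measurable_indR (b : T -> bool) : measurable_fun setT b ->
  measurable_fun setT (fun t => (b t)%:R : R).
Proof.
move=> mb; apply: (@measurableT_comp _ _ _ _ _ _ (fun b : bool => b%:R : R)) => //.
Qed.
Lemma measurable_setb (b : T -> bool) : measurable_fun setT b -> measurable [set t | b t].
Proof. by move=> mb; have := mb measurableT [set true] I; rewrite setTI. Qed.
End msub.

Section opens.
Context {R : realType} (d : nat).
Local Notation Z := ('rV[R]_d * measurableTypeR R)%type.

(** The sigma-algebra is generated by coordinates; an open set is the union of the countably many
    boxes with rational centre and radius [q.2.+1%:R^-1] that it contains. *)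
Lemma open_measurable_Z (U : set ('rV[R]_d * R)) : open U -> measurable (U : set Z).
Proof.
move=> oU.
pose B (q : 'rV[rat]_d * rat * nat) : set ('rV[R]_d * R) :=
  [set z : 'rV[R]_d * R | (forall i, `|z.1 ord0 i - ratr (q.1.1 ord0 i)| < q.2.+1%:R^-1) /\ `|z.2 - ratr q.1.2| < q.2.+1%:R^-1].
have mB q : measurable (B q : set Z).
  rewrite (_ : B q = (\bigcap_(i in [set: 'I_d]) [set z : Z | `|z.1 ord0 i - ratr (q.1.1 ord0 i)| < q.2.+1%:R^-1]) `&` [set z : Z | `|(z.2 : R) - ratr q.1.2| < q.2.+1%:R^-1]); last first.
    by apply/seteqP; split=> z [h1 h2]; split => // i; [move=> _|]; apply: h1.
  apply: measurableI.
    apply: fin_bigcap_measurable => // i _; apply: measurable_setb.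
    apply: measurable_fun_ltr => //; apply: measurableT_comp => //.
    apply: measurable_funB => //.
    exact: measurableT_comp (measurable_coord_rV i) measurable_fst.
  apply: measurable_setb; apply: measurable_fun_ltr => //; apply: measurableT_comp => //.
  by apply: measurable_funB => //; exact: measurable_snd.
rewrite (_ : U = \bigcup_q (if `[< B q `<=` U >] then B q else set0)).
  apply: countable_bigcupT_measurable => [|q]; first exact: countableP.
  by case: ifP.
apply/seteqP; split=> [z Uz|z [q _]]; last by case: ifPn => [/asboolP|//]; apply.
have /nbhs_ballP[e /= e0 eU] : nbhs z U by apply: open_nbhs_nbhs; split.
have [n ne] : exists n : nat, n.+1%:R^-1 < e / 2.
  have h : 0 < e / 2 by rewrite divr_gt0.
  exists (Num.truncn (e / 2)^-1); rewrite invf_plt ?posrE//.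
  exact: truncnS_gt.
have n0 : 0 < n.+1%:R^-1 :> R by rewrite invr_gt0.
have rat_near (t : R) : exists q : rat, `|t - ratr q| < n.+1%:R^-1.
  have /rat_in_itvoo[q] : t - n.+1%:R^-1 < t + n.+1%:R^-1 by move: (n.+1%:R^-1) n0 => *; lra.
  rewrite in_itv/= => hq; exists q; rewrite ltr_norml; move: hq.
  by move: (n.+1%:R^-1 : R) (ratr q : R) => a b; lra.
have [q1 hq1] := choice (fun i => rat_near (z.1 ord0 i)).
have [q2 hq2] := rat_near z.2.
exists ((\row_i q1 i, q2), n) => //.
have Bz : B (\row_i q1 i, q2, n) z by split => //= i; rewrite mxE.
rewrite ifT//; apply/asboolP => y [/= y1 y2]; apply: eU; split => /=.
  rewrite mx_norm_ball /ball_ /=; apply/norm_rV_ltP => // i.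
  rewrite !mxE; have := y1 i; have := hq1 i; rewrite mxE.
  move: (z.1 _ _) (y.1 _ _) (ratr (q1 i) : R) ne; move: (n.+1%:R^-1 : R) => k a b c.
  by rewrite !ltr_norml; lra.
move: y2 hq2 ne; rewrite /ball /=; move: (ratr q2 : R) => c.
by move: (n.+1%:R^-1 : R) => k; rewrite !ltr_norml; lra.
Qed.

Lemma within_continuous_measurable (D A : set ('rV[R]_d * R)) (f : 'rV[R]_d * R -> R) :
  measurable (D : set Z) -> D `<=` A -> {within A, continuous f} -> measurable_fun (D : set Z) (f : Z -> R).
Proof.
move=> mD DA /continuousP cf; apply: (measurability _ (RGenOpens.measurableE R)).
move=> _ [_ [a [b ->] <-]].
have /cf/open_subspaceP[V oV VD] : open (`]a, b[%classic : set R) by exact: interval_open.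
rewrite (_ : D `&` _ = D `&` V).
  by apply: measurableI => //; exact: open_measurable_Z.
apply/seteqP; split=> z [Dz h]; split => //.
  have : (V `&` A) z by rewrite VD; split => //; exact: DA.
  by case.
have : (V `&` A) z by split => //; exact: DA.
by rewrite VD => -[].
Qed.

Lemma continuous_measurable_Z (f : 'rV[R]_d * R -> R) : continuous f -> measurable_fun setT (f : Z -> R).
Proof.
move=> cf; apply: (@within_continuous_measurable setT setT) => //.
exact: continuous_subspaceT.
Qed.

(** The function is composed with [fst], where measurability of open sets is available, and then
    restricted to a horizontal slice. *)
Lemma continuous_measurable_rV (f : 'rV[R]_d -> R) : continuous f -> measurable_fun setT f.
Proof.
move=> cf.
have h : measurable_fun setT ((f \o fst) : Z -> R).
  apply: continuous_measurable_Z => z; apply: continuous_comp; first exact: cvg_fst.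
  exact: cf.
have mg : measurable_fun setT (fun x : 'rV[R]_d => (x, 0) : Z) by exact: measurable_fun_pair.
exact: (measurableT_comp h mg).
Qed.

End opens.

Section norm_rV_section.
Context {R : realType} dT (T : measurableType dT).
Lemma measurable_normR (f : T -> R) : measurable_fun setT f -> measurable_fun setT (fun t => `|f t|).
Proof. by move=> mf; exact: measurableT_comp. Qed.
Lemma measurable_norm_rVf d (f : T -> 'rV[R]_d) : measurable_fun setT f -> measurable_fun setT (fun t => `|f t| : R).
Proof. by move=> mf; exact: (measurableT_comp (@measurable_norm_rV R d) mf). Qed.
End norm_rV_section.

Section measurable_rho_section.
Context {R : realType} (d : nat) dT (T : measurableType dT).
Local Notation Z := ('rV[R]_d * measurableTypeR R)%type.
Lemma measurable_rho (f g : T -> Z) : measurable_fun setT f -> measurable_fun setT g ->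
  measurable_fun setT (fun t => rho (f t) (g t) : R).
Proof.
move=> mf mg; apply: measurable_funD.
  apply: (measurableT_comp (@measurable_norm_rV R d)); apply: measurable_subrV.
    exact: (measurableT_comp measurable_fst mf).
  exact: (measurableT_comp measurable_fst mg).
apply: measurableT_comp => //; apply: measurable_funB.
  exact: (measurableT_comp measurable_snd mf).
exact: (measurableT_comp measurable_snd mg).
Qed.
End measurable_rho_section.

(* [nn] and [mm] close nonnegativity and measurability goals structurally. *)
Ltac nn := repeat first
  [ done | assumption | exact: ltW | apply: mulr_ge0 | apply: addr_ge0 | apply: powR_ge0
  | apply: normr_ge0 | apply: ler0n | apply: rho_ge0 | apply: enorm_ge0
  | (rewrite invr_ge0) | apply: exprn_ge0
  | (rewrite lee_fin) | apply: mule_ge0 | apply: adde_ge0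
  | (apply: integral_ge0 => ? _) | apply: nneseries_ge0 => ? _ _| (move=> ?) ].

Ltac mm1 := first [ match goal with |- measurable_fun _ (fun _ => ?c) => let k := constr:(c) in exact: measurable_cst end | lazymatch goal with
  | |- measurable_fun _ (fun x => x) => exact: measurable_id
  | |- measurable_fun _ (fun x => (@?f x)%:E) => apply/measurable_EFinP
  | |- measurable_fun _ (fun x => (@?f x, @?g x)) => refine (@measurable_fun_pair _ _ _ _ _ _ f g _ _)
  | |- measurable_fun _ (fun x => fst (@?f x)) => refine (@measurableT_comp _ _ _ _ _ _ fst _ f measurable_fst _)
  | |- measurable_fun _ (fun x => snd (@?f x)) => refine (@measurableT_comp _ _ _ _ _ _ snd _ f measurable_snd _)
  | |- measurable_fun _ (fun x => rho (@?f x) (@?g x)) => refine (@measurable_rho _ _ _ _ f g _ _)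
  | |- measurable_fun _ (fun x => enorm (@?f x)) => refine (@measurableT_comp _ _ _ _ _ _ (@enorm _ _) _ f (@measurable_enorm _ _) _)
  | |- measurable_fun _ (fun x => powR (@?f x) ?c) => refine (@measurableT_comp _ _ _ _ _ _ (@powR _ ^~ c) _ f (@measurable_powR _ c) _)
  | |- measurable_fun _ (fun x => (nat_of_bool (@?f x))%:R) => refine (@measurable_indR _ _ _ f _)
  | |- measurable_fun _ (fun x => `|@?f x|%E) => refine (@measurableT_comp _ _ _ _ _ _ abse _ f (@abse_measurable _ _) _)
  | |- measurable_fun _ (fun x => `|@?f x|%R) => first
     [ refine (@measurable_normR _ _ _ f _) | refine (@measurable_norm_rVf _ _ _ _ f _) ]
  | |- measurable_fun _ (fun x => (@?f x - @?g x)%R) => first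
     [ refine (@measurable_funB _ _ _ _ f g _ _) | refine (@measurable_subrV _ _ _ _ f g _ _)]
  | |- measurable_fun _ (fun x => (@?f x + @?g x)%R) => first
     [ refine (@measurable_funD _ _ _ _ f g _ _) | refine (@measurable_addrV _ _ _ _ f g _ _)]
  | |- measurable_fun _ (fun x => (- @?f x)%R) => refine (@measurable_funN _ _ _ _ f _)
  | |- measurable_fun _ (fun x => (@?f x * @?g x)%R) => refine (@measurable_funM _ _ _ _ f g _ _)
  | |- measurable_fun _ (fun x => (@?f x ^+ ?n)%R) => refine (@measurable_funX _ _ _ _ f n _)
  | |- measurable_fun _ (fun x => (@?f x + @?g x)%E) => refine (@emeasurable_funD _ _ _ _ f g _ _)
  | |- measurable_fun _ (fun x => (@?f x * @?g x)%E) => refine (@emeasurable_funM _ _ _ _ f g _ _)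
  | |- measurable_fun _ (fun x => (@?f x < @?g x)%R) => refine (@measurable_fun_ltr _ _ _ _ f g _ _)
  | |- measurable_fun _ (fun x => (@?f x <= @?g x)%R) => refine (@measurable_fun_ler _ _ _ _ f g _ _)
  | |- measurable_fun _ (fun x => (@?f x == @?g x)%R) => refine (@measurable_fun_eqr _ _ _ _ f g _ _)
  | |- measurable_fun _ (fun x => (@?f x && @?g x)) => refine (@measurable_and _ _ _ f g _ _)
  | |- measurable_fun _ (fun x => (@?f x || @?g x)) => refine (@measurable_or _ _ _ f g _ _)
  | |- measurable_fun _ (fun x => (~~ @?f x)) => refine (@measurable_neg _ _ _ f _)
  | |- measurable_fun _ (fun x => Order.max (@?f x) (@?g x)) => refine (@measurable_maxr _ _ _ _ f g _ _)
  | |- measurable_fun _ (fun x => Order.min (@?f x) (@?g x)) => refine (@measurable_minr _ _ _ _ f g _ _)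
  | |- measurable_fun _ (fun x => integral ?m setT (@?f x)) =>
      refine (@measurable_intl _ _ _ _ _ _ f _ _); [|by nn]
  | H : measurable_fun setT ?h |- measurable_fun _ (fun x => ?h (@?f x)) =>
      refine (@measurableT_comp _ _ _ _ _ _ h _ f H _)
  end ].
Ltac mm := repeat first [ assumption | done | mm1 ].

Section ind.
Context {R : realType}.
Lemma ind_eq (a b : bool) : (a -> b) -> (b -> a) -> a%:R = b%:R :> R.
Proof. by move=> h1 h2; congr (nat_of_bool _)%:R; apply/idP/idP. Qed.
Lemma ind_le (a b : bool) : (a -> b) -> a%:R <= b%:R :> R.
Proof. by case: a; case: b => //= h; have := h isT. Qed.
Lemma indM (a b : bool) : a%:R * b%:R = (a && b)%:R :> R.
Proof. by rewrite -natrM mulnb. Qed.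
Lemma ind_le_mul (a : bool) (x y : R) : (a -> x <= y) -> a%:R * x <= a%:R * y.
Proof. by case: a => h; rewrite ?mul1r ?mul0r//; exact: h. Qed.
Lemma rho_lt d (z z0 : 'rV[R]_d * measurableTypeR R) r : rho z z0 < r -> (`|z.1 - z0.1| < r) && (`|(z.2 : R) - z0.2| < r).
Proof.
rewrite /rho; have := normr_ge0 (z.1 - z0.1); have := normr_ge0 ((z.2 : R) - z0.2).
move: (`|z.1 - z0.1| : R) (`|(z.2 : R) - z0.2|) => a b *; apply/andP; split; lra.
Qed.
End ind.

(** * Affine changes of variables and volumes of balls *)

Section affine.
Local Open Scope ereal_scope.
Context {R : realType}.
Notation leb := (@lebesgue_measure R).

(** The image of Lebesgue measure under the affine map, rescaled by a, agrees with Lebesgue measure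
    on half-open intervals, hence everywhere by uniqueness. *)
Lemma int_affine (a b : R) (F : measurableTypeR R -> \bar R) : (0 < a)%R -> measurable_fun setT F -> (forall t, 0 <= F t) ->
  \int[leb]_t F (a * t + b)%R = (a^-1)%:E * \int[leb]_t F t.
Proof.
move=> a0 mF F0.
pose phi (t : measurableTypeR R) : measurableTypeR R := (a * t + b)%R.
have mphi : measurable_fun setT phi.
  by apply: measurable_funD => //; exact: measurable_funM.
have a0' : (0 <= a)%R by exact: ltW.
pose pf : {measure set (measurableTypeR R) -> \bar R} := measure_function_pushforward__canonical__measure_function_Measure leb mphi.
pose m2 : {measure set (measurableTypeR R) -> \bar R} := mscale (NngNum a0') pf.
have m2E A : measurable A -> leb A = m2 A.
  apply: lebesgue_measure_unique => _ [[x y] /= _ <-].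
  rewrite /m2 /mscale /= /pushforward.
  rewrite (_ : phi @^-1` `]x, y]%classic = `](x - b) / a, (y - b) / a]%classic)%R; last first.
    apply/seteqP; split=> t; rewrite /phi /= !in_itv/= ltr_pdivrMr// ler_pdivlMr// ltrBlDr lerBrDr mulrC//.
  rewrite !lebesgue_measure_itv/= !lte_fin ltr_pM2r ?invr_gt0// ltrD2r.
  case: ifP => _; last by rewrite mule0.
  by rewrite -!EFinD -EFinM -mulrBl mulrCA divff ?gt_eqF// mulr1 opprB addrA subrK.
transitivity (\int[pf]_t F t).
  by rewrite /pf ge0_integral_pushforward.
have -> : \int[leb]_t F t = \int[m2]_t F t by apply: eq_measure_integral => A mA _; exact: m2E.
rewrite /m2 ge0_integral_mscale//= muleA -EFinM mulVf ?gt_eqF// mul1e//.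
Qed.

Lemma int_lamS d (F : 'rV[R]_d.+1 -> \bar R) : measurable_fun setT F -> (forall x, 0 <= F x) ->
  \int[lam d.+1]_x F x = \int[lam d]_x \int[leb]_t F (rV_cons (x, t)).
Proof.
move=> mF F0.
transitivity (\int[measure_function_pushforward__canonical__measure_function_Measure (@lam R d \x leb) (@measurable_rV_cons R d)]_x F x).
  exact: eq_measure_integral.
rewrite ge0_integral_pushforward//; last exact: measurable_rV_cons.
rewrite preimage_setT fubini_tonelli1; [by []| |by move=> x; exact: F0].
exact: (measurableT_comp mF (@measurable_rV_cons R d)).
Qed.

(** Induction on the dimension: the first coordinate is shifted by the one-dimensional case, the
    remaining ones by the induction hypothesis. *)
Lemma int_lam_shift d (h : 'rV[R]_d) (F : 'rV[R]_d -> \bar R) : measurable_fun setT F -> (forall x, 0 <= F x) ->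
  \int[lam d]_x F (x + h)%R = \int[lam d]_x F x.
Proof.
elim: d h F => [|d IH] h F mF F0.
  by apply: eq_integral_setT => x; rewrite (_ : x + h = x)%R// [LHS]thinmx0 [RHS]thinmx0.
have mFc (k : 'rV[R]_d.+1) : measurable_fun setT (fun x : 'rV[R]_d.+1 => F (x + k)%R).
  by apply: measurableT_comp => //; exact: measurable_addrV.
rewrite (int_lamS mF F0) (int_lamS (mFc h) (fun x => F0 (x + h)%R)).
pose h1 : 'rV[R]_d := (\row_j h ord0 (rshift 1 j))%R.
have E x t : (rV_cons (x, t) + h = rV_cons (x + h1, t + h ord0 ord0))%R.
  apply/rowP => i; rewrite /rV_cons; case: (@splitP 1 d i) => j ij.
    have -> : i = @lshift 1 d j by apply/val_inj.
    rewrite [LHS]mxE (@row_mxEl _ 1 1 d) [RHS](@row_mxEl _ 1 1 d) [j]ord1 /= !mxE eqxx !mulr1n.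
    by congr (_ + h _ _)%R; apply/val_inj.
  have -> : i = rshift 1 j by apply/val_inj.
  by rewrite [LHS]mxE (@row_mxEr _ 1 1 d) [RHS](@row_mxEr _ 1 1 d) /= !mxE.
under eq_integral do under eq_integral do rewrite E.
have mG : measurable_fun setT (fun q : 'rV[R]_d * measurableTypeR R => F (rV_cons q)).
  by apply: measurableT_comp => //; exact: measurable_rV_cons.
have mp (x : 'rV[R]_d) : measurable_fun setT (fun t : measurableTypeR R => (x, t)) by exact: measurable_fun_pair.
transitivity (\int[lam d]_x \int[leb]_t F (rV_cons (x + h1, t)%R)).
  apply: eq_integral_setT => x; rewrite -[RHS]mul1e -[X in X%:E](@invr1 R).
  rewrite -(@int_affine 1 (h ord0 ord0) (fun t => F (rV_cons (x + h1, t)%R)))//.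
    by under [RHS]eq_integral do rewrite mul1r.
  exact: (measurableT_comp mG (mp _)).
apply: (IH h1 (fun x => \int[leb]_t F (rV_cons (x, t)))).
  by apply: (measurable_fun_fubini_tonelli_F (m2 := @lebesgue_measure R) (fun q => F (rV_cons q))).
by move=> x; apply: integral_ge0.
Qed.

Variable d : nat.
Local Notation Z := ('rV[R]_d * measurableTypeR R)%type.

(** The vertical offset may depend on the horizontal position, so that this single change of
    variables covers dilations towards a graph, squeezing towards the middle graph, and
    translations. *)
Lemma int_mu_affine (a : R) (h : 'rV[R]_d) (b : 'rV[R]_d -> R) (F : Z -> \bar R) : (0 < a)%R ->
  measurable_fun setT b -> measurable_fun setT F -> (forall z, 0 <= F z) ->
  \int[mu d]_z F (z.1 + h, a * z.2 + b z.1)%R = (a^-1)%:E * \int[mu d]_z F z.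
Proof.
move=> a0 mb mF F0.
have mF' : measurable_fun setT (fun z : Z => F (z.1 + h, a * z.2 + b z.1)%R) by mm.
rewrite (int_mu2 mF') => [|z]; last exact: F0.
rewrite (int_mu2 mF F0).
transitivity (\int[lam d]_x ((a^-1)%:E * \int[leb]_t F (x + h, t)%R)).
  apply: eq_integral_setT => x; rewrite -(@int_affine a (b x) (fun t => F (x + h, t)%R) a0) => [//||t]; last exact: F0.
  by mm.
rewrite integral_nngZ; [|by rewrite invr_ge0 ltW|by move=> x; exact: integral_ge0].
congr (_ * _); apply: (@int_lam_shift _ h (fun x => \int[leb]_t F (x, t))).
  by apply: (measurable_fun_fubini_tonelli_F (m2 := @lebesgue_measure R) F).
by move=> x; exact: integral_ge0.
Qed.

Lemma vol_cube (y : 'rV[R]_d) (r : R) : (0 < r)%R ->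
  \int[lam d]_x (`|x - y| < r)%R%:R%:E = ((2 * r) ^+ d)%:E.
Proof.
move=> r0.
rewrite (@int_lam_shift _ (- y)%R (fun x : 'rV[R]_d => (`|x| < r)%R%:R%:E))//; last by mm.
rewrite -(@lebesgue_rV_cube R d r r0).
have := @integral_indic _ _ _ (@lam R d) setT measurableT _ (measurable_cube (d := d) r).
rewrite setIT => <-.
apply: eq_integral_setT => x; congr (_%:E); rewrite indicE; apply: ind_eq => /=.
  by move=> /norm_rV_ltP h; rewrite inE => i; apply: h.
by rewrite inE => h; apply/norm_rV_ltP.
Qed.

Lemma vol_interval (s r : R) : (0 < r)%R ->
  \int[leb]_t (`|(t : R) - s| < r)%R%:R%:E = (2 * r)%:E.
Proof.
move=> r0.
have -> : (2 * r)%:E = leb `](s - r)%R, (s + r)%R[%classic.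
  by rewrite lebesgue_measure_itv/= lte_fin ifT -?EFinB; [congr (_%:E); ring|lra].
have := @integral_indic _ _ _ leb setT measurableT _ (measurable_itv `](s - r)%R, (s + r)%R[).
rewrite setIT => <-.
apply: eq_integral_setT => x; congr (_%:E); rewrite indicE; apply: ind_eq => /=.
  by rewrite inE /= in_itv/= ltr_norml; move: (x : R) => y; lra.
by rewrite inE /= in_itv/= ltr_norml; move: (x : R) => y; lra.
Qed.

Lemma volZ_prod (z0 : Z) (r : R) : (0 < r)%R ->
  \int[mu d]_z ((`|z.1 - z0.1| < r)%R%:R * (`|(z.2 : R) - z0.2| < r)%R%:R)%:E = ((2 * r) ^+ d.+1)%:E.
Proof.
move=> r0; rewrite int_mu2; [|mm|nn].
transitivity (\int[lam d]_x ((2 * r)%:E * (`|x - z0.1| < r)%R%:R%:E)).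
  apply: eq_integral_setT => x /=; rewrite -(vol_interval z0.2 r0) -integral_nngZr//; apply: eq_integral_setT => t; by rewrite -EFinM mulrC.
by rewrite integral_nngZ ?vol_cube -?EFinM -?exprS// mulr_ge0// ltW.
Qed.

(** A [rho]-ball of radius r lies between the product boxes of half-side [r / 2] and r; the lower
    bound that follows uses the inner box. *)
Lemma volZ_le (z0 : Z) (r : R) : (0 < r)%R ->
  \int[mu d]_z (rho z z0 < r)%R%:R%:E <= ((2 * r) ^+ d.+1)%:E.
Proof.
move=> r0; rewrite -(volZ_prod z0 r0); apply: le_integral_nng => z; first by nn.
rewrite lee_fin indM; apply: ind_le; exact: rho_lt.
Qed.

Lemma volZ_ge (z0 : Z) (r : R) : (0 < r)%R ->
  (r ^+ d.+1)%:E <= \int[mu d]_z (rho z z0 < r)%R%:R%:E.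
Proof.
move=> r0; have r2 : (0 < r / 2)%R by lra.
have <- : ((2 * (r / 2)) ^+ d.+1)%:E = (r ^+ d.+1)%:E by congr ((_ ^+ _)%:E); field.
rewrite -(volZ_prod z0 r2); apply: le_integral_nng => z; first by nn.
rewrite lee_fin indM; apply: ind_le => /andP[]; rewrite /rho.
move: (`|z.1 - z0.1|)%R (`|(z.2 : R) - z0.2|)%R => a b; lra.
Qed.
End affine.

(** * Power inequalities *)

Section power.
Context {R : realType}.
Implicit Types a b c p q x y z : R.

Lemma powR_gt1 a r : 1 < a -> 0 < r -> 1 < a `^ r.
Proof.
move=> a1 r0; have <- : 1 `^ r = 1 by rewrite powR1.
by apply: gt0_ltr_powR; rewrite ?nnegrE//; lra.
Qed.

Lemma powR_lt1 a r : 1 < a -> 0 < r -> a `^ (- r) < 1.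
Proof. by move=> a1 r0; rewrite powRN invf_lt1 ?powR_gt1// powR_gt0//; lra. Qed.

Lemma powRD_gt0 a r s : 0 < a -> a `^ (r + s) = a `^ r * a `^ s.
Proof. by move=> a0; rewrite powRD// (gt_eqF a0) implybT. Qed.

Lemma powRB_gt0 a r s : 0 < a -> a `^ (r - s) = a `^ r / a `^ s.
Proof. by move=> a0; rewrite powRD_gt0// powRN. Qed.

Lemma powR_exp q e k : 0 <= q -> (q ^+ k) `^ e = (q `^ e) ^+ k.
Proof. by move=> q0; rewrite -(powR_mulrn _ q0) -(powR_mulrn _ (powR_ge0 q e)) powRAC. Qed.

Lemma powR_mono p a b : 0 <= p -> 0 <= a -> a <= b -> a `^ p <= b `^ p.
Proof. by move=> p0 a0 ab; apply: ge0_ler_powR => //; rewrite nnegrE// (le_trans a0). Qed.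

Lemma powR_anti e a b : 0 <= e -> 0 < a -> a <= b -> b `^ (- e) <= a `^ (- e).
Proof.
move=> e0 a0 ab; rewrite !powRN lef_pV2 ?posrE ?powR_gt0//; last exact: lt_le_trans ab.
by apply: powR_mono => //; exact: ltW.
Qed.

Lemma powR_max_le p a b : 0 <= p -> 0 <= a -> 0 <= b -> (Num.max a b) `^ p <= a `^ p + b `^ p.
Proof. by move=> p0 a0 b0; case: (leP a b) => _; rewrite ?lerDl ?lerDr powR_ge0. Qed.

Lemma powD2 p a b : 0 <= p -> 0 <= a -> 0 <= b -> (a + b) `^ p <= 2 `^ p * (a `^ p + b `^ p).
Proof.
move=> p0 a0 b0; have m0 : 0 <= Num.max a b by rewrite le_max a0.
apply: (@le_trans _ _ ((2 * Num.max a b) `^ p)).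
  apply: powR_mono => //; first exact: addr_ge0.
  by rewrite mulr_natl mulr2n lerD// le_max lexx ?orbT.
by rewrite powRM// ler_wpM2l ?powR_ge0// powR_max_le.
Qed.

Lemma powD3 p a b c : 0 <= p -> 0 <= a -> 0 <= b -> 0 <= c ->
  (a + b + c) `^ p <= 3 `^ p * (a `^ p + b `^ p + c `^ p).
Proof.
move=> p0 a0 b0 c0; have m0 : 0 <= Num.max a b by rewrite le_max a0.
have m1 : 0 <= Num.max (Num.max a b) c by rewrite le_max m0.
apply: (@le_trans _ _ ((3 * Num.max (Num.max a b) c) `^ p)).
  apply: powR_mono => //; first by rewrite !addr_ge0.
  have h1 : a <= Num.max (Num.max a b) c by rewrite !le_max lexx.
  have h2 : b <= Num.max (Num.max a b) c by rewrite !le_max lexx orbT.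
  have h3 : c <= Num.max (Num.max a b) c by rewrite !le_max lexx orbT.
  move: (Num.max (Num.max a b) c) h1 h2 h3 => m *; lra.
rewrite powRM// ler_wpM2l ?powR_ge0//; apply: le_trans (powR_max_le _ _ _) _ => //.
by rewrite lerD2r powR_max_le.
Qed.

Lemma dist2 p x y z : 0 <= p -> `|x - z| `^ p <= 2 `^ p * (`|x - y| `^ p + `|y - z| `^ p).
Proof.
move=> p0; apply: le_trans (powD2 p0 (normr_ge0 _) (normr_ge0 _)).
by apply: powR_mono => //; rewrite -[x - z](subrKA y) ler_normD.
Qed.

Lemma dist3 p x y z t : 0 <= p ->
  `|x - t| `^ p <= 3 `^ p * (`|x - y| `^ p + `|y - z| `^ p + `|z - t| `^ p).
Proof.
move=> p0; apply: le_trans (powD3 p0 (normr_ge0 _) (normr_ge0 _) (normr_ge0 _)).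
apply: powR_mono => //; apply: (@le_trans _ _ (`|x - z| + `|z - t|)).
  by rewrite -[x - t](subrKA z) ler_normD.
by rewrite lerD2r -[x - z](subrKA y) ler_normD.
Qed.

(** Split on [a <= k * b], where k is chosen so that [(k + 1) ^ p = q]: then either the sum is at
    most [(k + 1) * b], or b is below [a / k]. The factor q in front of b may thus be as close to 1
    as desired. *)
Lemma powD_eps p q : 0 < p -> 1 < q -> exists2 C, 0 < C &
  forall a b, 0 <= a -> 0 <= b -> (a + b) `^ p <= C * a `^ p + q * b `^ p.
Proof.
move=> p0 q1; have q0 : 0 < q by lra.
pose k := q `^ p^-1 - 1.
have k0 : 0 < k.
  by rewrite subr_gt0 powR_gt1 ?invr_gt0.
have ki : 0 < k^-1 by rewrite invr_gt0.
exists ((1 + k^-1) `^ p); first by rewrite powR_gt0// addr_gt0.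
move=> a b a0 b0; have [h|h] := leP a (k * b).
  apply: (@le_trans _ _ (q * b `^ p)); last by rewrite lerDr mulr_ge0// powR_ge0.
  apply: (@le_trans _ _ ((q `^ p^-1 * b) `^ p)).
    have -> : q `^ p^-1 = k + 1 by rewrite subrK.
    by apply: powR_mono; [exact: ltW|exact: addr_ge0|rewrite mulrDl mul1r lerD2r].
  have q0' := ltW q0; by rewrite powRM ?powR_ge0// -powRrM mulVf ?gt_eqF// powRr1.
apply: (@le_trans _ _ ((1 + k^-1) `^ p * a `^ p)); last by rewrite lerDl mulr_ge0 ?powR_ge0 ?ltW.
have ki' := ltW ki; rewrite -powRM ?addr_ge0//; apply: powR_mono; [exact: ltW|exact: addr_ge0|].
rewrite mulrDl mul1r lerD2l mulrC ler_pdivlMr// mulrC; exact: ltW.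
Qed.

(** Each use of [powD_eps] splits off the first increment with the constant C and multiplies the
    remaining telescope by q, so that C is paid only once per increment. *)
Lemma telescope_pow p q : 0 < p -> 1 < q -> exists2 C, 0 < C & forall n (a : nat -> R),
  `|a 0%N - a n| `^ p <= C * \sum_(j < n) q ^+ j * `|a j - a j.+1| `^ p.
Proof.
move=> p0 q1; have [C C0 hC] := powD_eps p0 q1; have q0 : 0 < q by lra.
exists C => //; elim=> [|n IH] a.
  by rewrite subrr normr0 powR0 ?gt_eqF// big_ord0 mulr0.
apply: (@le_trans _ _ ((`|a 0%N - a 1%N| + `|a 1%N - a n.+1|) `^ p)).
  by apply: powR_mono => //; [exact: ltW|rewrite -[a 0%N - _](subrKA (a 1%N)) ler_normD].
apply: le_trans (hC _ _ _ _) _ => //.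
rewrite big_ord_recl expr0 mul1r mulrDr lerD2l.
apply: le_trans (ler_wpM2l (ltW q0) (IH (fun k => a k.+1))) _.
rewrite mulrCA ler_pM2l// mulr_sumr; apply: ler_sum => i _.
by rewrite mulrA -exprS.
Qed.

(** The finite bounds are uniform in n; after taking p-th roots they form a closed condition on
    [a n] and pass to the limit. *)
Lemma telescope_pow_lim p q : 0 < p -> 1 < q -> exists2 C, 0 < C & forall (a : nat -> R) f,
  a n @[n --> \oo] --> f ->
  ((`|a 0%N - f| `^ p)%:E <= C%:E * \sum_(j <oo) (q ^+ j * `|a j - a j.+1| `^ p)%:E)%E.
Proof.
move=> p0 q1; have [C C0 hC] := telescope_pow p0 q1; have q0 : 0 < q by lra.
exists C => // a f af.
have t0 j : (0 <= (q ^+ j * `|a j - a j.+1| `^ p)%:E)%E by rewrite lee_fin mulr_ge0 ?powR_ge0 ?exprn_ge0 ?ltW.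
have [->|fin] := eqVneq (\sum_(j <oo) (q ^+ j * `|a j - a j.+1| `^ p)%:E)%E +oo%E.
  by rewrite gt0_muley ?lte_fin// leey.
have S0 : (0 <= \sum_(j <oo) (q ^+ j * `|a j - a j.+1| `^ p)%:E)%E by apply: nneseries_ge0.
have hn n : ((`|a 0%N - a n| `^ p)%:E <= C%:E * \sum_(j <oo) (q ^+ j * `|a j - a j.+1| `^ p)%:E)%E.
  apply: (@le_trans _ _ (C * \sum_(j < n) q ^+ j * `|a j - a j.+1| `^ p)%:E); first by rewrite lee_fin.
  rewrite EFinM lee_pmul2l ?fin_numE ?lte_fin//.
  rewrite -sumEFin -(big_mkord xpredT (fun j => (q ^+ j * `|a j - a j.+1| `^ p)%:E)).
  by apply: nneseries_lim_ge => // k _.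
have {fin} := fin; move: S0 hn; case: (\sum_(j <oo) _)%E => //= s s0 hn _.
rewrite -EFinM lee_fin.
rewrite lee_fin in s0; have Cs : 0 <= C * s by rewrite mulr_ge0// ltW.
have h1 n : `|a 0%N - a n| <= (C * s) `^ p^-1.
  have := hn n; rewrite -EFinM lee_fin => /(@powR_mono p^-1 _ _ _ (powR_ge0 _ _)).
  by rewrite -powRrM divff ?gt_eqF// powRr1//; apply; rewrite invr_ge0 ltW.
have h2 : `|a 0%N - f| <= (C * s) `^ p^-1.
  have h : `|a 0%N - a n| @[n --> \oo] --> `|a 0%N - f|.
    by apply: cvg_norm; apply: cvgB => //; exact: cvg_cst.
  rewrite -(cvg_lim _ h)//; apply: limr_le; first by apply/cvg_ex; exists `|a 0%N - f|.
  exact: nearW.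
have := powR_mono (ltW p0) (normr_ge0 _) h2.
by rewrite -powRrM mulVf ?gt_eqF// powRr1.
Qed.

Lemma geo_le q n : 0 <= q -> q < 1 -> \sum_(k < n) q ^+ k <= (1 - q)^-1.
Proof.
move=> q0 q1; rewrite -[leRHS]mul1r ler_pdivlMr ?subr_gt0// mulrC.
by rewrite -opprB mulNr -subrX1 opprB lerBlDr lerDl exprn_ge0.
Qed.

Lemma geo_series_le (F : nat -> \bar R) q (M : \bar R) : 0 <= q -> q < 1 -> (0 <= M)%E ->
  (forall k, 0 <= F k)%E -> (forall k, F k <= (q ^+ k)%:E * M)%E -> (\sum_(k <oo) F k <= ((1 - q)^-1)%:E * M)%E.
Proof.
move=> q0 q1 M0 F0 FM; apply: lime_le; first by apply: is_cvg_nneseries.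
apply: nearW => n; rewrite /= big_mkord.
apply: (@le_trans _ _ (\sum_(k < n) (q ^+ k)%:E * M)%E); first by apply: lee_sum.
rewrite -ge0_sume_distrl; last by move=> i _; rewrite lee_fin exprn_ge0.
by rewrite sumEFin lee_wpmul2r// lee_fin geo_le.
Qed.

End power.

Section jensen.
Context {R : realType} d (T : measurableType d) (m : {measure set T -> \bar R}).
Local Open Scope ereal_scope.

(** Jensen's inequality, up to the factor [2 ^ p], obtained by thresholding:
    [g <= a ^ (1 - p) * g ^ p + a] pointwise for every a > 0. This is integrated over a set of
    measure at most M and then optimised in a. *)
Lemma avg_power (p M k X : R) (b : T -> bool) (g : T -> R) : (1 < p)%R -> (0 < M)%R -> (0 < k)%R -> (0 <= X)%R ->
  measurable_fun setT b -> measurable_fun setT g -> (forall x, 0 <= g x)%R ->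
  \int[m]_x (b x)%:R%:E <= M%:E ->
  X%:E <= k%:E * \int[m]_x ((b x)%:R * g x)%:E ->
  (X `^ p)%:E <= (k `^ p * 2 `^ p * M `^ (p - 1))%:E * \int[m]_x ((b x)%:R * g x `^ p)%:E.
Proof.
move=> p1 M0 k0 X0 mb mg g0 hM hX.
have p0 : (0 < p)%R by lra.
have I0 : 0 <= \int[m]_x ((b x)%:R * g x `^ p)%:E by apply: integral_ge0 => x _; nn.
have [->|fin] := eqVneq (\int[m]_x ((b x)%:R * g x `^ p)%:E) +oo.
  by rewrite gt0_muley ?leey// lte_fin !mulr_gt0 ?powR_gt0.
have hr (a r : R) : (0 < a)%R -> \int[m]_x ((b x)%:R * g x `^ p)%:E = r%:E -> (X <= k * (a `^ (1 - p) * r + a * M))%R.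
  move=> a0 hr; rewrite -lee_fin; apply: le_trans hX _.
  rewrite EFinM lee_pmul2l ?fin_numE// ?lte_fin//.
  apply: (@le_trans _ _ (\int[m]_x ((a `^ (1 - p))%:E * ((b x)%:R * g x `^ p)%:E + a%:E * (b x)%:R%:E))).
    apply: le_integral_nng => x; first by nn.
    rewrite -!EFinM -EFinD lee_fin; case: (b x); rewrite ?mul0r ?mulr0 ?addr0// !mul1r mulr1.
    have [ga|ag] := leP (g x) a; first by rewrite ler_wpDl// mulr_ge0 ?powR_ge0.
    have gx0 : (0 < g x)%R by exact: lt_trans ag.
    apply: ler_wpDr; first exact: ltW.
    have {1}-> : (g x = g x `^ (1 - p) * g x `^ p)%R by rewrite -powRD_gt0// subrK powRr1// ltW.
    have gx1 := powR_ge0 (g x) p.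
    apply: ler_wpM2r => //; rewrite -[(1 - p)%R]opprB; apply: powR_anti => //; [lra|exact: ltW].
  rewrite integral_nngD; [|mm|mm|nn|nn]; try exact: ltW.
  have a0' := ltW a0; rewrite !integral_nngZ; [|exact: powR_ge0|by move=> x; nn|exact: a0'|by move=> x; nn].
  by rewrite hr EFinD !EFinM leeD2l// lee_pmul2l ?fin_numE// lte_fin.
move: I0 fin hr; case: (\int[m]_x _) => // r; rewrite lee_fin => r0 _ /(_ _ r _ erefl) hr.
rewrite -EFinM lee_fin; move: r0; rewrite le_eqVlt => /orP[/eqP r0|r0].
  (* When the integral of [g ^ p] vanishes there is no optimal threshold; sending a to 0 gives X =
     0. *)
  have : (X <= 0)%R.
    apply/ler_addgt0Pl => e e0; rewrite addr0.
    have e1 : (0 < e / (k * M))%R by rewrite divr_gt0// mulr_gt0.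
    apply: le_trans (hr _ e1) _; rewrite -r0 mulr0 add0r.
    by rewrite (_ : k * _ = e)%R//; field; rewrite !gt_eqF.
  move=> X1; rewrite (_ : X = 0)%R; last by apply/eqP; rewrite eq_le X1.
  by rewrite powR0 ?gt_eqF// -r0 mulr0.
(* This threshold makes the two terms of the bound equal, which is where the factor [2 ^ p] comes
   from. *)
pose a := ((r / M) `^ p^-1)%R.
have a0 : (0 < a)%R by apply: powR_gt0; exact: divr_gt0.
have ap : (a `^ p = r / M)%R by rewrite /a -powRrM mulVf ?gt_eqF// powRr1//; exact/ltW/divr_gt0.
have := hr _ a0; have -> : (a `^ (1 - p) * r = a * M)%R.
  rewrite powRB_gt0//.
  have a0' := ltW a0; by rewrite powRr1// ap; field; rewrite !gt_eqF.
move=> /(@powR_mono _ p _ _ (ltW p0) X0) h; apply: le_trans h _.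
have -> : (k * (a * M + a * M) = k * 2 * (a * M))%R by ring.
have -> : (M `^ (p - 1) = M `^ p / M)%R by have M0' := ltW M0; rewrite powRB_gt0// powRr1.
have M0' := ltW M0; have a0' := ltW a0; have k0' := ltW k0; rewrite !powRM ?mulr_ge0// ap le_eqVlt; apply/orP; left; apply/eqP.
by field; rewrite gt_eqF.
Qed.

End jensen.

(** * Powers of a distance integrated over dyadic shells *)

Section tails.
Context {R : realType} d (T : measurableType d) (m : {measure set T -> \bar R}).
Local Open Scope ereal_scope.
Variables (D V : R) (D0 : (0 <= D)%R) (V0 : (0 < V)%R).

(** f is dominated by the sum over k of [c k] times the indicator of the ball of radius [r k], and
    the integrals of these terms decay geometrically with ratio q. *)
Lemma dyadic_int (dist : T -> R) (q M : R) (c r : nat -> R) (f : T -> R) : measurable_fun setT dist ->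
  (forall s, (0 < s)%R -> \int[m]_x (dist x < s)%R%:R%:E <= (V * s `^ D)%:E) ->
  (0 <= q)%R -> (q < 1)%R -> (0 <= M)%R -> (forall k, 0 <= c k)%R -> (forall k, 0 < r k)%R ->
  (forall x, 0 <= f x)%R ->
  (forall x, f x = 0%R \/ exists k, (dist x < r k)%R /\ (f x <= c k)%R) ->
  (forall k, c k * (V * r k `^ D) <= q ^+ k * M)%R ->
  \int[m]_x (f x)%:E <= ((1 - q)^-1 * M)%:E.
Proof.
move=> md hV q0 q1 M0 c0 r0 f0 hf hc.
pose F k x : \bar R := (c k * (dist x < r k)%R%:R)%:E.
have F0 k x : 0 <= F k x by rewrite /F lee_fin mulr_ge0.
have mF k : measurable_fun setT (F k) by rewrite /F; mm.
apply: (@le_trans _ _ (\int[m]_x \sum_(k <oo) F k x)).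
  apply: le_integral_nng => x; first by rewrite lee_fin.
  case: (hf x) => [->|[k [h1 h2]]]; first by apply: nneseries_ge0.
  apply: (@le_trans _ _ (F k x)); first by rewrite /F h1 mulr1 lee_fin.
  apply: le_trans (nneseries_lim_ge k.+1 _); last by move=> n _ _.
  by rewrite big_nat_recr//= leeDr// sume_ge0.
rewrite integral_nneseries// EFinM; apply: geo_series_le => // k.
  by apply: integral_ge0 => x _.
rewrite /F integral_nngZR// -EFinM; apply: le_trans (lee_wpmul2l _ (hV _ (r0 k))) _; first by rewrite lee_fin.
by rewrite -EFinM lee_fin.
Qed.

(** On the shell from [2 ^+ k * a] to [2 ^+ k.+1 * a] the volume growth [s ^ D] cancels the power -D
    of the integrand, leaving a factor [2 ^ (- be)] per shell. *)
Lemma tail_int (be : R) : (0 < be)%R -> exists2 C : R, (0 < C)%R &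
  forall (dist : T -> R), measurable_fun setT dist -> (forall x, 0 <= dist x)%R ->
  (forall s, (0 < s)%R -> \int[m]_x (dist x < s)%R%:R%:E <= (V * s `^ D)%:E) ->
  forall a, (0 < a)%R -> \int[m]_x ((a <= dist x)%R%:R * dist x `^ (- (D + be)))%:E <= (C * a `^ (- be))%:E.
Proof.
move=> be0; pose q : R := (2 `^ (- be))%R.
have q0 : (0 < q)%R by rewrite powR_gt0.
have q1 : (q < 1)%R by apply: powR_lt1 => //; lra.
exists ((1 - q)^-1 * (V * 2 `^ D))%R.
  by rewrite !mulr_gt0 ?powR_gt0 ?invr_gt0 ?subr_gt0.
move=> dist md d0 hV a a0.
have ka k : (0 < 2 ^+ k * a :> R)%R by rewrite mulr_gt0 ?exprn_gt0.
rewrite -mulrA.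
apply: (@dyadic_int dist q _ (fun k => (2 ^+ k * a) `^ (- (D + be)))%R (fun k => 2 ^+ k.+1 * a)%R) => //.
- exact: ltW.
- by nn; exact: ltW.
- by move=> k; exact: powR_ge0.
- by move=> x; nn.
- move=> x; have [ax|_] := leP a (dist x); last by left; rewrite mul0r.
  right; rewrite mul1r.
  have [k hk1 hk2] : exists2 k, (2 ^+ k * a <= dist x)%R & (dist x < 2 ^+ k.+1 * a)%R.
    have ex : exists n, (dist x < 2 ^+ n * a)%R.
      exists (Num.truncn (dist x / a)).+1; rewrite -ltr_pdivrMr//.
      apply: lt_le_trans (truncnS_gt _) _; rewrite -natrX ler_nat; exact/ltnW/ltn_expl.
    (* The least exponent with [dist x < 2 ^+ n * a], less one, indexes the shell of x; the exponent
       0 is excluded by [a <= dist x]. *)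
    case: (ex_minnP ex) => -[|k] hk hmin.
      by move: hk; rewrite expr0 mul1r ltNge ax.
    by exists k => //; rewrite leNgt; apply/negP => /hmin; rewrite ltnn.
  by exists k; split => //; apply: powR_anti; [exact: addr_ge0 (ltW be0)|exact: ka|].
- move=> k; set t := (2 ^+ k * a)%R.
  have t0 : (0 < t)%R by exact: ka.
  have t0' := ltW t0.
  have -> : (2 ^+ k.+1 * a = 2 * t)%R by rewrite exprS mulrA.
  have a0' := ltW a0.
  have -> : (q ^+ k * (V * 2 `^ D * a `^ (- be)) = V * 2 `^ D * t `^ (- be))%R.
    by rewrite /t [in RHS]powRM ?exprn_ge0// powR_exp// mulrCA.
  clearbody t; rewrite powRM// opprD powRD_gt0// (powRN t D).
  have h1 : (t `^ D != 0)%R by rewrite gt_eqF ?powR_gt0.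
  by rewrite le_eqVlt; apply/orP; left; apply/eqP; field.
Qed.

(** The same decomposition with shells shrinking to the centre; the ratio is now [2 ^ (- (e - be))],
    so that integrability rests on be < e. *)
Lemma near_int (be e : R) : (0 < be)%R -> (be < e)%R -> exists2 C : R, (0 < C)%R &
  forall (dist : T -> R), measurable_fun setT dist -> (forall x, 0 <= dist x)%R ->
  (forall s, (0 < s)%R -> \int[m]_x (dist x < s)%R%:R%:E <= (V * s `^ D)%:E) ->
  forall a, (0 < a)%R -> \int[m]_x ((dist x < a)%R%:R * (dist x `^ e * dist x `^ (- (D + be))))%:E <= (C * a `^ (e - be))%:E.
Proof.
move=> be0 bee; pose q : R := (2^-1 `^ (e - be))%R.
have q0 : (0 < q)%R by rewrite powR_gt0 ?invr_gt0.
have q1 : (q < 1)%R.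
  by rewrite /q -powR_inv1// -powRrM mulN1r powR_lt1//; lra.
exists ((1 - q)^-1 * (V * 2 `^ (D + be)))%R.
  by rewrite !mulr_gt0 ?powR_gt0 ?invr_gt0 ?subr_gt0.
move=> dist md d0 hV a a0.
have ka k : (0 < 2^-1 ^+ k * a :> R)%R by rewrite mulr_gt0 ?exprn_gt0 ?invr_gt0.
rewrite -mulrA.
apply: (@dyadic_int dist q _ (fun k => (2^-1 ^+ k * a) `^ e * (2^-1 ^+ k.+1 * a) `^ (- (D + be)))%R (fun k => 2^-1 ^+ k * a)%R) => //.
- exact: ltW.
- by nn; exact: ltW.
- by move=> k; nn.
- by move=> x; nn.
- move=> x; have [ax|_] := ltP (dist x) a; last by left; rewrite mul0r.
  (* A point at distance 0 lies in no shell, but the integrand vanishes there because [0 ^ e = 0]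
     for e > 0. *)
  rewrite mul1r; have [dx0|dx0] := eqVneq (dist x) 0%R.
    by left; rewrite dx0 powR0 ?mul0r//; lra.
  have dx : (0 < dist x)%R by rewrite lt_def dx0 d0.
  right.
  have [k hk1 hk2] : exists2 k, (2^-1 ^+ k.+1 * a <= dist x)%R & (dist x < 2^-1 ^+ k * a)%R.
    have ex : exists n, (2^-1 ^+ n * a <= dist x)%R.
      exists (Num.truncn (a / dist x)).+1; rewrite exprVn mulrC ler_pdivrMr ?exprn_gt0// mulrC -ler_pdivrMr//.
      apply/ltW; apply: lt_le_trans (truncnS_gt _) _; rewrite -natrX ler_nat; exact/ltnW/ltn_expl.
    case: (ex_minnP ex) => -[|k] hk hmin.
      by move: hk; rewrite expr0 mul1r leNgt ax.
    by exists k => //; rewrite ltNge; apply/negP => /hmin; rewrite ltnn.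
  exists k; split => //; apply: ler_pM; rewrite ?powR_ge0//.
    by apply: powR_mono; [lra|exact: d0|exact: ltW].
  by apply: powR_anti; [exact: addr_ge0 (ltW be0)|exact: ka|].
- move=> k; set t := (2^-1 ^+ k * a)%R.
  have t0 : (0 < t)%R by exact: ka.
  have t0' := ltW t0; have a0' := ltW a0.
  have -> : (2^-1 ^+ k.+1 * a = 2^-1 * t)%R by rewrite exprS mulrA.
  have -> : (q ^+ k * (V * 2 `^ (D + be) * a `^ (e - be)) = V * 2 `^ (D + be) * t `^ (e - be))%R.
    by rewrite /t [in RHS]powRM ?exprn_ge0 ?invr_ge0// powR_exp ?invr_ge0// mulrCA.
  clearbody t; rewrite powRM ?invr_ge0// powRB_gt0// (powRN t) powRD_gt0// -(@powR_inv1 _ 2)// -powRrM mulrNN mul1r.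
  have h1 : (t `^ D != 0)%R by rewrite gt_eqF ?powR_gt0.
  have h2 : (t `^ be != 0)%R by rewrite gt_eqF ?powR_gt0.
  by rewrite le_eqVlt; apply/orP; left; apply/eqP; field; rewrite h1 h2.
Qed.
End tails.

(* Locked so that unification never unfolds iterated integrals over product
   measures.  For nonnegative integrands, monotonicity and scaling below need no
   measurability. *)
HB.lock Definition Int dsp (T : measurableType dsp) (R : realType)
  (m : {sigma_finite_measure set T -> \bar R}) (F : T -> \bar R) : \bar R := (\int[m]_x F x)%E.

Reserved Notation "\I[ m ]_ x F" (at level 36, F at level 36, m at level 10, x at level 0,
  format "'[' \I[ m ]_ x '/  '  F ']'").
Notation "\I[ m ]_ x F" := (Int m (fun x => F)) : ereal_scope.

Section IntTheory.
Local Open Scope ereal_scope.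
Context d (T : measurableType d) (R : realType) (m : {sigma_finite_measure set T -> \bar R}).
Implicit Types F G : T -> \bar R.

Lemma IntE F : Int m F = \int[m]_x F x. Proof. by rewrite unlock. Qed.
Lemma Int_ge0 F : (forall x, 0 <= F x) -> 0 <= Int m F.
Proof. by move=> F0; rewrite IntE; apply: integral_ge0. Qed.
Lemma le_Int F G : (forall x, 0 <= F x) -> (forall x, F x <= G x) -> Int m F <= Int m G.
Proof. by move=> F0 FG; rewrite !IntE; exact: le_integral_nng. Qed.
Lemma eq_Int F G : (forall x, F x = G x) -> Int m F = Int m G.
Proof. by move=> FG; rewrite !IntE; exact: eq_integral_setT. Qed.
Lemma IntZ (k : R) F : (0 <= k)%R -> (forall x, 0 <= F x) -> \I[m]_x (k%:E * F x) = k%:E * Int m F.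
Proof. by move=> k0 F0; rewrite !IntE; exact: integral_nngZ. Qed.
Lemma IntZr (k : R) F : (0 <= k)%R -> (forall x, 0 <= F x) -> \I[m]_x (F x * k%:E) = Int m F * k%:E.
Proof. by move=> k0 F0; rewrite !IntE; exact: integral_nngZr. Qed.
Lemma IntZR (k : R) (F : T -> R) : (0 <= k)%R -> (forall x, 0 <= F x)%R -> \I[m]_x (k * F x)%:E = k%:E * \I[m]_x (F x)%:E.
Proof. by move=> k0 F0; rewrite !IntE; exact: integral_nngZR. Qed.
Lemma IntD F G : measurable_fun setT F -> measurable_fun setT G ->
  (forall x, 0 <= F x) -> (forall x, 0 <= G x) -> \I[m]_x (F x + G x) = Int m F + Int m G.
Proof. by move=> mF mG F0 G0; rewrite !IntE; exact: integral_nngD. Qed.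
Lemma Int_series (F : nat -> T -> \bar R) : (forall n, measurable_fun setT (F n)) -> (forall n x, 0 <= F n x) ->
  \I[m]_x (\sum_(n <oo) F n x) = \sum_(n <oo) Int m (F n).
Proof.
move=> mF F0; rewrite IntE integral_nneseries//.
by apply: eq_eseriesr => n _; rewrite IntE.
Qed.
Lemma Int0 : \I[m]_x 0 = 0. Proof. by rewrite IntE integral0. Qed.
End IntTheory.

Section IntTonelli.
Local Open Scope ereal_scope.
Context d1 d2 (T1 : measurableType d1) (T2 : measurableType d2) (R : realType).
Variable m1 : {sigma_finite_measure set T1 -> \bar R}.
Variable m2 : {sigma_finite_measure set T2 -> \bar R}.
Lemma measurable_Int (f : T1 -> T2 -> \bar R) :
  measurable_fun setT (fun q => f q.1 q.2) -> (forall x y, 0 <= f x y) ->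
  measurable_fun setT (fun x => Int m2 (f x)).
Proof.
move=> mf f0; rewrite (_ : (fun x => _) = (fun x => \int[m2]_y f x y)%E); first exact: measurable_intl.
by apply/funext => x; rewrite IntE.
Qed.
Lemma Int_swap (f : T1 -> T2 -> \bar R) :
  measurable_fun setT (fun q => f q.1 q.2) -> (forall x y, 0 <= f x y) ->
  \I[m1]_x \I[m2]_y f x y = \I[m2]_y \I[m1]_x f x y.
Proof.
move=> mf f0; rewrite !IntE.
under eq_integral do rewrite IntE.
under [RHS]eq_integral do rewrite IntE.
exact: integral_swap.
Qed.
End IntTonelli.

Ltac nn1 := first
  [ assumption | apply: ltW; assumption | apply: mulr_ge0 | apply: addr_ge0 | apply: powR_ge0
  | apply: normr_ge0 | apply: ler0n | apply: rho_ge0 | apply: enorm_ge0 | apply: exprn_ge0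
  | (match goal with |- is_true (0 <= _%:E)%E => rewrite lee_fin end)
  | apply: mule_ge0 | apply: adde_ge0
  | (apply: Int_ge0 => ?) | (apply: integral_ge0 => ? _) | (apply: nneseries_ge0 => ? _ _)
  | (rewrite invr_ge0) | done | (progress intros) ].
Ltac nn ::= repeat nn1.

Ltac mm1 ::= first [ match goal with |- measurable_fun _ (fun _ => ?c) => let k := constr:(c) in exact: measurable_cst end | lazymatch goal with
  | |- measurable_fun _ (fun x => x) => exact: measurable_id
  | |- measurable_fun _ (fun x => (@?f x)%:E) => apply/measurable_EFinP
  | |- measurable_fun _ (fun x => (@?f x, @?g x)) => refine (@measurable_fun_pair _ _ _ _ _ _ f g _ _)
  | |- measurable_fun _ (fun x => fst (@?f x)) => refine (@measurableT_comp _ _ _ _ _ _ fst _ f measurable_fst _)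
  | |- measurable_fun _ (fun x => snd (@?f x)) => refine (@measurableT_comp _ _ _ _ _ _ snd _ f measurable_snd _)
  | |- measurable_fun _ (fun x => rho (@?f x) (@?g x)) => refine (@measurable_rho _ _ _ _ f g _ _)
  | |- measurable_fun _ (fun x => enorm (@?f x)) => refine (@measurableT_comp _ _ _ _ _ _ (@enorm _ _) _ f (@measurable_enorm _ _) _)
  | |- measurable_fun _ (fun x => powR (@?f x) ?c) => refine (@measurableT_comp _ _ _ _ _ _ (@powR _ ^~ c) _ f (@measurable_powR _ c) _)
  | |- measurable_fun _ (fun x => (nat_of_bool (@?f x))%:R) => refine (@measurable_indR _ _ _ f _)
  | |- measurable_fun _ (fun x => `|@?f x|%R) => first
    [ refine (@measurable_normR _ _ _ f _) | refine (@measurable_norm_rVf _ _ _ _ f _) ]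
  | |- measurable_fun _ (fun x => (@?f x - @?g x)%R) => first
     [ refine (@measurable_funB _ _ _ _ f g _ _) | refine (@measurable_subrV _ _ _ _ f g _ _)]
  | |- measurable_fun _ (fun x => (@?f x + @?g x)%R) => first
     [ refine (@measurable_funD _ _ _ _ f g _ _) | refine (@measurable_addrV _ _ _ _ f g _ _)]
  | |- measurable_fun _ (fun x => (- @?f x)%R) => refine (@measurable_funN _ _ _ _ f _)
  | |- measurable_fun _ (fun x => (@?f x * @?g x)%R) => refine (@measurable_funM _ _ _ _ f g _ _)
  | |- measurable_fun _ (fun x => (@?f x ^+ ?n)%R) => refine (@measurable_funX _ _ _ _ f n _)
  | |- measurable_fun _ (fun x => (@?f x + @?g x)%E) => refine (@emeasurable_funD _ _ _ _ f g _ _)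
  | |- measurable_fun _ (fun x => (@?f x * @?g x)%E) => refine (@emeasurable_funM _ _ _ _ f g _ _)
  | |- measurable_fun _ (fun x => (@?f x < @?g x)%R) => refine (@measurable_fun_ltr _ _ _ _ f g _ _)
  | |- measurable_fun _ (fun x => (@?f x <= @?g x)%R) => refine (@measurable_fun_ler _ _ _ _ f g _ _)
  | |- measurable_fun _ (fun x => (@?f x == @?g x)%R) => refine (@measurable_fun_eqr _ _ _ _ f g _ _)
  | |- measurable_fun _ (fun x => (@?f x && @?g x)) => refine (@measurable_and _ _ _ f g _ _)
  | |- measurable_fun _ (fun x => (@?f x || @?g x)) => refine (@measurable_or _ _ _ f g _ _)
  | |- measurable_fun _ (fun x => (~~ @?f x)) => refine (@measurable_neg _ _ _ f _)
  | |- measurable_fun _ (fun x => Order.max (@?f x) (@?g x)) => refine (@measurable_maxr _ _ _ _ f g _ _)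
  | |- measurable_fun _ (fun x => Int ?m (@?f x)) =>
      refine (@measurable_Int _ _ _ _ _ m f _ _); [|by nn]
  | H : measurable_fun setT ?h |- measurable_fun _ (fun x => ?h (@?f x)) =>
      refine (@measurableT_comp _ _ _ _ _ _ h _ f H _)
  | H : measurable_fun setT ?h |- measurable_fun _ ?h => exact H
  | H : measurable_fun setT (fun q => ?h (fst q) (snd q)) |- measurable_fun _ (fun x => ?h (@?f x) (@?g x)) =>
      refine (@measurableT_comp _ _ _ _ _ _ (fun q => h q.1 q.2) _ (fun x => (f x, g x)) H _)
  end ].
Ltac mm ::= repeat mm1.

Section measures.
Context {R : realType}.
Definition mX d : {sigma_finite_measure set 'rV[R]_d -> \bar R} := @lam R d.
Definition mZ d : {sigma_finite_measure set ('rV[R]_d * measurableTypeR R)%type -> \bar R} := @mu R d.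
Definition mR : {sigma_finite_measure set (measurableTypeR R) -> \bar R} := @lebesgue_measure R.
End measures.
Arguments mX {R} d.
Arguments mZ {R} d.
Arguments mR {R}.

Section bridge.
Local Open Scope ereal_scope.
Context {R : realType} (d : nat).
Local Notation Z := ('rV[R]_d * measurableTypeR R)%type.

Lemma IntX F : \I[mX d]_x F x = \int[@lebesgue_rV R d]_x F x.
Proof. by rewrite IntE int_lam. Qed.
Lemma IntXE F : \I[mX d]_x F x = \int[@lam R d]_x F x.
Proof. by rewrite IntE. Qed.
Lemma IntZE F : \I[mZ d]_x F x = \int[@mu R d]_x F x.
Proof. by rewrite IntE. Qed.
Lemma IntZm F : \I[mZ d]_x F x = \int[@lebesgue_graph R d]_x F x.
Proof. by rewrite IntE int_mu. Qed.
Lemma IntRE F : \I[mR]_x F x = \int[@lebesgue_measure R]_x F x.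
Proof. by rewrite IntE. Qed.

Lemma IntZ2 (f : Z -> \bar R) : measurable_fun setT f -> (forall z, 0 <= f z) ->
  \I[mZ d]_z f z = \I[mX d]_x \I[mR]_t f (x, t).
Proof.
move=> mf f0; rewrite IntZE int_mu2// IntXE; apply: eq_integral => x _; by rewrite IntRE.
Qed.

Lemma IntZ_affine (a : R) (h : 'rV[R]_d) (b : 'rV[R]_d -> R) (F : Z -> \bar R) : (0 < a)%R ->
  measurable_fun setT b -> measurable_fun setT F -> (forall z, 0 <= F z) ->
  \I[mZ d]_z F (z.1 + h, a * z.2 + b z.1)%R = (a^-1)%:E * \I[mZ d]_z F z.
Proof. by move=> a0 mb mF F0; rewrite !IntZE; exact: int_mu_affine. Qed.

Lemma IvolX (y : 'rV[R]_d) (r : R) : (0 < r)%R ->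
  \I[mX d]_x (`|x - y| < r)%R%:R%:E = ((2 * r) ^+ d)%:E.
Proof. by move=> r0; rewrite IntXE vol_cube. Qed.
Lemma IvolR (t0 r : R) : (0 < r)%R -> \I[mR]_t (`|(t : R) - t0| < r)%R%:R%:E = (2 * r)%:E.
Proof. by move=> r0; rewrite IntRE vol_interval. Qed.
Lemma IvolZ_le (z0 : Z) (r : R) : (0 < r)%R -> \I[mZ d]_z (rho z z0 < r)%R%:R%:E <= ((2 * r) ^+ d.+1)%:E.
Proof. by move=> r0; rewrite IntZE volZ_le. Qed.
Lemma IvolZ_ge (z0 : Z) (r : R) : (0 < r)%R -> (r ^+ d.+1)%:E <= \I[mZ d]_z (rho z z0 < r)%R%:R%:E.
Proof. by move=> r0; rewrite IntZE volZ_ge. Qed.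
End bridge.

Section Iavg.
Local Open Scope ereal_scope.
Context {R : realType} d (T : measurableType d) (m : {sigma_finite_measure set T -> \bar R}).
Lemma Iavg_power (p M k X : R) (b : T -> bool) (g : T -> R) : (1 < p)%R -> (0 < M)%R -> (0 < k)%R -> (0 <= X)%R ->
  measurable_fun setT b -> measurable_fun setT g -> (forall x, 0 <= g x)%R ->
  \I[m]_x (b x)%:R%:E <= M%:E ->
  X%:E <= k%:E * \I[m]_x ((b x)%:R * g x)%:E ->
  (X `^ p)%:E <= (k `^ p * 2 `^ p * M `^ (p - 1))%:E * \I[m]_x ((b x)%:R * g x `^ p)%:E.
Proof. rewrite !IntE; exact: avg_power. Qed.
End Iavg.
#[global] Opaque mX mZ mR.

(** * Kernels and the geometry of the strip *)

Section kernel.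
Context {R : realType} (d : nat).
Local Notation Z := ('rV[R]_d * measurableTypeR R)%type.
Variables (s p : R).
Hypotheses (p1 : 1 < p) (s0 : 0 < s) (s1 : s < 1) (sp1 : 1 < s * p).
(** The exponent N + s p of the Gagliardo kernel, the ambient dimension being N = d + 1. *)
Definition gam : R := d.+1%:R + s * p.

Lemma sp_lt_p : s * p < p.
Proof using p1 s0 s1. by rewrite -[ltRHS]mul1r ltr_pM2r//; move: p1; lra. Qed.

Lemma gam_gt0 : 0 < gam.
Proof using sp1. by rewrite /gam addr_gt0//; move: sp1; lra. Qed.

Lemma measurable_rhor (z : Z) : measurable_fun setT (fun z' => rho z z' : R).
Proof. mm. Qed.

Lemma vol_rho (z : Z) (r : R) : 0 < r ->
  (\I[mZ d]_z' (rho z z' < r)%R%:R%:E <= ((2 ^+ d.+1) * r `^ (d.+1%:R))%:E)%E.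
Proof.
move=> r0; rewrite powR_mulrn; last exact: ltW.
rewrite -exprMn; apply: le_trans (IvolZ_le z r0).
by apply: le_Int => z'; [nn|rewrite rhoC].
Qed.

Lemma tailZ : exists2 C, 0 < C & forall (z : Z) a, 0 < a ->
  (\I[mZ d]_z' ((a <= rho z z')%R%:R * rho z z' `^ (- gam))%:E <= (C * a `^ (- (s * p)))%:E)%E.
Proof using sp1.
have sp0 : 0 < s * p by move: sp1; lra.
have [||C C0 hC] := @tail_int R _ _ (@mu R d) d.+1%:R (2 ^+ d.+1) _ _ _ sp0 => //.
exists C => // z a a0; rewrite IntZE; apply: hC => //; first exact: measurable_rhor.
  by move=> z'; exact: rho_ge0.
by move=> r r0; rewrite -IntZE; exact: vol_rho.
Qed.

(** Since s < 1, s p < p, and a difference that is Lipschitz in [rho] has finite energy near the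
    diagonal. *)
Lemma nearZ : exists2 C, 0 < C & forall (z : Z) a, 0 < a ->
  (\I[mZ d]_z' ((rho z z' < a)%R%:R * (rho z z' `^ p * rho z z' `^ (- gam)))%:E <= (C * a `^ (p - s * p))%:E)%E.
Proof using p1 s0 s1 sp1.
have sp0 : 0 < s * p by move: sp1; lra.
have [||C C0 hC] := @near_int R _ _ (@mu R d) d.+1%:R (2 ^+ d.+1) _ _ _ p sp0 sp_lt_p => //.
exists C => // z a a0; rewrite IntZE; apply: hC => //; first exact: measurable_rhor.
  by move=> z'; exact: rho_ge0.
by move=> r r0; rewrite -IntZE; exact: vol_rho.
Qed.

Lemma tailR be : 0 < be -> exists2 C, 0 < C & forall (t0 : R) a, 0 < a ->
  (\I[mR]_t ((a <= `|(t : R) - t0|)%R%:R * `|(t : R) - t0| `^ (- (1 + be)))%:E <= (C * a `^ (- be))%:E)%E.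
Proof.
move=> be0.
have [||C C0 hC] := @tail_int R _ _ (@lebesgue_measure R) 1 2 _ _ _ be0 => //.
exists C => // t0 a a0; rewrite IntRE; apply: (hC (fun t => `|(t : R) - t0|)) => //; first by mm.
by move=> r r0; rewrite powRr1; [rewrite vol_interval|exact: ltW].
Qed.

(* Gagliardo energy with the sup-type distance [rho] in place of the Euclidean
   one, restricted to a boolean domain. *)
Definition gag (D : Z -> bool) (u : Z -> R) : \bar R :=
  (\I[mZ d]_z \I[mZ d]_z' ((D z)%:R * ((D z')%:R * (`|u z - u z'| `^ p * rho z z' `^ (- gam))))%:E)%E.

Lemma gag_ge0 D u : (0 <= gag D u)%E.
Proof. by apply: Int_ge0 => z; apply: Int_ge0 => z'; nn. Qed.

(** At distance at most [M * t] the kernel is at least [(M * t) ^ (- gam)]. At distance 0 the points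
    coincide and both sides vanish. This trades means over balls of radius comparable to t for
    Gagliardo energy. *)
Lemma ker_le (u : Z -> R) z z' M t : 0 < t -> 0 < M -> rho z z' <= M * t ->
  t `^ (- gam) * `|u z - u z'| `^ p <= M `^ gam * (`|u z - u z'| `^ p * rho z z' `^ (- gam)).
Proof using p1 sp1.
move=> t0 M0 h; have [rz|rz] := eqVneq (rho z z') 0.
  by rewrite (rho_eq0 rz) subrr normr0 powR0 ?mulr0 ?mul0r// gt_eqF//; move: p1; lra.
have r0 : 0 < rho z z' by rewrite lt_def rz rho_ge0.
have g0 := gam_gt0.
rewrite mulrC mulrCA ler_wpM2l ?powR_ge0//.
have -> : t = M^-1 * (M * t) by rewrite mulrA mulVf ?mul1r// gt_eqF.
have M0' := ltW M0; have Mt : 0 <= M * t by rewrite mulr_ge0// ltW.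
rewrite powRM ?invr_ge0// -(@powR_inv1 _ M)// -powRrM mulrNN mul1r.
by rewrite ler_wpM2l ?powR_ge0// powR_anti// ltW.
Qed.

(* One boundary graph of the strip, seen from inside: the strip is
   [0 < tau < w] with [tau z = sg * (eta z.1 - z.2)]; the top graph has [sg = 1],
   the bottom one [sg = -1]. *)
Record side (La L : R) (eta w : 'rV[R]_d -> R) (sg : R) : Prop := Side {
  side_sg : sg * sg = 1;
  side_eta_lip : forall x y, `|eta x - eta y| <= La * `|x - y|;
  side_w_lip : forall x y, `|w x - w y| <= La * `|x - y|;
  side_w_gt0 : forall x, 0 < w x;
  side_w_elip : forall x y, `|w x - w y| <= L * enorm (x - y);
  side_meta : measurable_fun setT eta;
  side_mw : measurable_fun setT w }.

Section strip.
Variables (eta w : 'rV[R]_d -> R) (sg La : R).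
Hypotheses (sgE : `|sg| = 1) (La0 : 0 <= La).
Hypotheses (eta_lip : forall x y, `|eta x - eta y| <= La * `|x - y|).
Hypotheses (w_lip : forall x y, `|w x - w y| <= La * `|x - y|).
Hypotheses (w_gt0 : forall x, 0 < w x).
Hypotheses (meta : measurable_fun setT eta) (mw : measurable_fun setT w).

Definition tau (z : Z) : R := sg * (eta z.1 - z.2).
Definition inO (z : Z) : bool := (0 < tau z) && (tau z < w z.1).
(** Vertical dilation towards the graph, dividing [tau] by 2^j. *)
Definition shrink (j : nat) (z : Z) : Z := (z.1, 2^-1 ^+ j * z.2 + (1 - 2^-1 ^+ j) * eta z.1).

Lemma measurable_tau : measurable_fun setT tau.
Proof using meta. rewrite /tau; mm. Qed.
Lemma measurable_inO : measurable_fun setT inO.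
Proof using meta mw. rewrite /inO /tau; mm. Qed.
Lemma measurable_shrink j : measurable_fun setT (shrink j).
Proof using meta. rewrite /shrink; mm. Qed.

Lemma sg_norm a : `|sg * a| = `|a|. Proof using sgE. by rewrite normrM sgE mul1r. Qed.
Lemma tau_norm z : `|tau z| = `|(z.2 : R) - eta z.1|.
Proof using sgE. by rewrite /tau sg_norm distrC. Qed.

Lemma tau_lip z z' : `|tau z - tau z'| <= (1 + La) * rho z z'.
Proof using sgE La0 eta_lip.
rewrite /tau -mulrBr sg_norm.
have -> : eta z.1 - z.2 - (eta z'.1 - z'.2) = (eta z.1 - eta z'.1) - ((z.2 : R) - z'.2) by ring.
apply: le_trans (ler_normB _ _) _.
apply: le_trans (lerD (eta_lip _ _) (lexx _)) _.
rewrite /rho; have := normr_ge0 (z.1 - z'.1); have := normr_ge0 ((z.2 : R) - z'.2).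
move: La0; move: (`|z.1 - z'.1|) (`|(z.2 : R) - z'.2|) => a b *; nra.
Qed.

Lemma tau_shrink j z : tau (shrink j z) = 2^-1 ^+ j * tau z.
Proof. rewrite /tau /shrink /=; ring. Qed.

Lemma rho_shrink z : inO z -> rho z (shrink 1 z) = 2^-1 * tau z.
Proof using sgE.
move=> /andP[t0 _]; rewrite /rho /shrink /= subrr normr0 add0r expr1.
have -> : (z.2 : R) - (2^-1 * z.2 + (1 - 2^-1) * eta z.1) = 2^-1 * (z.2 - eta z.1) by field.
by rewrite normrM -tau_norm !gtr0_norm.
Qed.

(** The half-way point has height [tau z / 2]. The condition on c bounds by [tau z / 4] the
    variation over the ball of both [tau] and the width, which leaves heights between one quarter
    and three quarters of [tau z], and widths above the latter. *)
Lemma ball_inO c z z' : 0 < c -> 4 * c * (1 + La) <= 1 -> inO z -> rho z' (shrink 1 z) < c * tau z -> inO z'.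
Proof using sgE La0 eta_lip w_lip.
move=> c0 hc /andP[t0 tw] hr.
have h1 := tau_lip z' (shrink 1 z); rewrite tau_shrink expr1 in h1.
have h2 := w_lip z'.1 z.1.
have h3 : `|z'.1 - z.1| <= rho z' (shrink 1 z) by rewrite /rho /shrink /= lerDl.
have h4 := rho_ge0 z' (shrink 1 z).
rewrite /inO; move: h1 h2; rewrite !ler_norml => /andP[h11 h12] /andP[h21 h22].
move: (tau z) (tau z') (w z.1) (w z'.1) (rho z' (shrink 1 z)) (`|z'.1 - z.1|) t0 tw hr h11 h12 h21 h22 h3 h4 => t t' a a' r n *.
have k1 : (1 + La) * r < 4^-1 * t by move: La0; nra.
have k2 : La * n <= (1 + La) * r by move: La0; nra.
by apply/andP; split; lra.
Qed.

Lemma int_shrink j (F : Z -> \bar R) : measurable_fun setT F -> (forall z, 0 <= F z)%E ->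
  (\I[mZ d]_z F (shrink j z) = (2 ^+ j)%:E * \I[mZ d]_z F z)%E.
Proof using meta.
move=> mF F0; have hj : 0 < 2^-1 ^+ j :> R by rewrite exprn_gt0.
have -> : (2 ^+ j)%:E = ((2^-1 ^+ j)^-1 : R)%:E :> \bar R by rewrite exprVn invrK.
rewrite -(@IntZ_affine R d (2^-1 ^+ j) 0 (fun x => (1 - 2^-1 ^+ j) * eta x)) => [|//||//|//].
  by apply: eq_Int => z; rewrite addr0.
by mm.
Qed.

(** Every z' in the ball of radius [c * tau z] about the half-way point is within [tau z] of both
    endpoints, since c is at most 1/2. Averaging u z - u z' and u z' - u (shrink 1 z) over that ball
    bounds the increment by two kernels; the Jacobian 2 of [shrink 1] in the second makes the total
    3 = 1 + 2. The domain D is arbitrary because the inequality will be applied to approximations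
    living only over a bounded base. *)
Lemma half_step c : 0 < c -> c <= 2^-1 -> 
  forall (E : 'rV[R]_d -> bool) (D : Z -> bool) (u : Z -> R),
  measurable_fun setT E -> measurable_fun setT D -> measurable_fun setT u ->
  (forall z, E z.1 -> inO z -> [/\ D z, D (shrink 1 z) & forall z', rho z' (shrink 1 z) < c * tau z -> D z']) ->
  (\I[mZ d]_z ((E z.1 && inO z)%:R * (tau z `^ (- (s * p)) * `|u z - u (shrink 1 z)| `^ p))%:E
   <= (c ^- d.+1 * 2 `^ p * 3)%:E * gag D u)%E.
Proof using p1 s0 s1 sp1 sgE meta mw.
move=> c0 c2; have g0 := gam_gt0.
move=> E D u mE mD mu_ hD.
have mtau := measurable_tau; have mO := measurable_inO; have mS := measurable_shrink 1.
pose K z z' := (D z)%:R * ((D z')%:R * (`|u z - u z'| `^ p * rho z z' `^ (- gam))).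
have K0 z z' : 0 <= K z z' by rewrite /K; nn.
have mK : measurable_fun setT (fun q : Z * Z => (K q.1 q.2)%:E) by rewrite /K; mm.
have mKz z : measurable_fun setT (fun z' => (K z z')%:E) by rewrite /K; mm.
have mK' : measurable_fun setT (fun z => \I[mZ d]_z' (K z z')%:E)%E.
  by apply: (@measurable_Int _ _ _ _ _ _ (fun z z' => (K z z')%:E)) => // *; rewrite lee_fin.
have KI0 z : (0 <= \I[mZ d]_z' (K z z')%:E)%E by apply: Int_ge0 => z'; rewrite lee_fin.
have mKs : measurable_fun setT (fun z => \I[mZ d]_z' (K (shrink 1 z) z')%:E)%E.
  exact: (measurableT_comp mK' mS).
have k0 : 0 <= c ^- d.+1 * 2 `^ p :> R by rewrite mulr_ge0 ?powR_ge0// invr_ge0 exprn_ge0// ltW.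
apply: (@le_trans _ _ (\I[mZ d]_z ((c ^- d.+1 * 2 `^ p)%:E *
    (\I[mZ d]_z' (K z z')%:E + \I[mZ d]_z' (K (shrink 1 z) z')%:E)))%E).
  apply: le_Int => z; first by nn.
  have [/andP[Ez Oz]|_] := boolP (E z.1 && inO z); last first.
    by rewrite mul0r mule_ge0 ?lee_fin// adde_ge0.
  have [Dz Ds Dz'] := hD _ Ez Oz; have /andP[t0 _] := Oz.
  rewrite mul1r; set A := `|u z - u (shrink 1 z)| `^ p.
  have A0 : 0 <= A by exact: powR_ge0.
  have [t tE] : exists t, tau z = t by exists (tau z).
  rewrite tE in t0 Dz' *.
  have ct0 : 0 < c * t by rewrite mulr_gt0.
  have -> : t `^ (- (s * p)) * A = (c ^- d.+1) * (t `^ (- gam) * A * (c * t) ^+ d.+1).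
    (* The volume [(c * t) ^+ d.+1] of the ball turns the kernel weight [t ^ (- gam)] into the Hardy
       weight. *)
    have -> : - (s * p) = - gam + d.+1%:R by rewrite /gam; lra.
    rewrite powRD_gt0// powR_mulrn ?ltW// exprMn.
    by field; rewrite expf_neq0// gt_eqF.
  rewrite [in leRHS]EFinM -[in leRHS]muleA EFinM lee_pmul2l ?lte_fin ?invr_gt0 ?exprn_gt0//.
  rewrite EFinM; apply: (@le_trans _ _ ((t `^ (- gam) * A)%:E * \I[mZ d]_z' (rho z' (shrink 1 z) < c * t)%R%:R%:E)%E).
    by rewrite lee_wpmul2l ?lee_fin ?mulr_ge0 ?powR_ge0// IvolZ_ge.
  rewrite -IntZ; [|by rewrite mulr_ge0 ?powR_ge0|by move=> z'; nn].
  rewrite -IntD; [|exact: mKz|exact: mKz|by move=> *; rewrite lee_fin|by move=> *; rewrite lee_fin].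
  rewrite -IntZ; [|exact: powR_ge0|by move=> z'; rewrite adde_ge0// lee_fin].
  apply: le_Int => z'; first by nn.
  rewrite -EFinD -!EFinM lee_fin; have [hz|_] := ltP (rho z' (shrink 1 z)) (c * t); last first.
    by rewrite mulr0 mulr_ge0 ?powR_ge0// addr_ge0.
  rewrite mulr1 /K Dz Ds (Dz' _ hz) !mul1r.
  have hr1 : rho z z' <= 1 * t.
    apply: le_trans (rho_tri _ (shrink 1 z) _) _; rewrite rho_shrink// (rhoC (shrink _ _)) tE.
    move: c2; nra.
  have hr2 : rho (shrink 1 z) z' <= 1 * t.
    rewrite rhoC; apply: le_trans (ltW hz) _; move: c2; nra.
  have k1 := ker_le u t0 ltr01 hr1; have k2 := ker_le u t0 ltr01 hr2.
  rewrite powR1 !mul1r in k1 k2.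
  apply: le_trans (ler_wpM2l (powR_ge0 _ _) (dist2 (u z) (u z') (u (shrink 1 z)) _)) _; first by move: p1; lra.
  rewrite mulrCA ler_wpM2l ?powR_ge0// mulrDr lerD//.
  by rewrite distrC.
rewrite (IntZ _ k0) => [|z]; last by rewrite adde_ge0.
rewrite [in leRHS]EFinM -muleA lee_wpmul2l ?lee_fin//.
rewrite (IntD _ mK' mKs KI0 (fun z => KI0 (shrink 1 z))).
rewrite (@int_shrink 1 _ mK' KI0) expr1 -/(gag D u) -{1}[gag D u]mul1e -ge0_muleDl ?lee_fin//.
Qed.
End strip.
End kernel.

Section shrink_iter.
Context {R : realType} (d : nat).
Local Notation Z := ('rV[R]_d * measurableTypeR R)%type.
Variables (eta w : 'rV[R]_d -> R) (sg La : R).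
Notation tau := (tau eta sg).
Notation inO := (inO eta w sg).
Notation shrink := (shrink eta).

Lemma shrinkS j z : shrink 1 (shrink j z) = shrink j.+1 z.
Proof. by rewrite /shrink /=; congr pair; rewrite expr1 exprS; ring. Qed.

Lemma inO_shrink j z : inO z -> inO (shrink j z).
Proof.
move=> /andP[t0 tw]; have h0 : 0 < 2^-1 ^+ j :> R by rewrite exprn_gt0.
rewrite /inO tau_shrink /= mulr_gt0//=; apply: le_lt_trans tw.
apply: ler_piMl; [exact: ltW|apply: exprn_ile1; lra].
Qed.

End shrink_iter.

(** * Hardy's inequality along the dilations *)

Section hardy.
Context {R : realType} (d : nat).
Local Notation Z := ('rV[R]_d * measurableTypeR R)%type.
Variables (s p : R).
Hypotheses (p1 : 1 < p) (s0 : 0 < s) (s1 : s < 1) (sp1 : 1 < s * p).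

(* With 1 < q < 2 ^ (s p - 1), the weight tau^(-sp) pulled back by the j-th
   dilation gains 2^(-j(sp-1)), which beats the factor q^j of the telescoping. *)
Lemma hardy_half : exists2 C, 0 < C & forall (eta w : 'rV[R]_d -> R) (sg : R), measurable_fun setT eta -> measurable_fun setT w ->
  forall (E : 'rV[R]_d -> bool) (u : Z -> R) (f : 'rV[R]_d -> R),
  measurable_fun setT E -> measurable_fun setT u ->
  (forall z, E z.1 -> (inO eta w sg) z -> u ((shrink eta) j z) @[j --> \oo] --> f z.1) ->
  (\I[mZ d]_z ((E z.1 && (inO eta w sg) z)%:R * ((tau eta sg) z `^ (- (s * p)) * `|u z - f z.1| `^ p))%:E
   <= C%:E * \I[mZ d]_z ((E z.1 && (inO eta w sg) z)%:R * ((tau eta sg) z `^ (- (s * p)) * `|u z - u ((shrink eta) 1 z)| `^ p))%:E)%E.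
Proof using p1 sp1.
have sp0 : 0 < s * p by move: sp1; lra.
have p0 : 0 < p by move: p1; lra.
(* Half of the gap above 1: the telescoping weight q = 2^b spends one half, and the other half
   leaves the summable ratio [q^-1]. *)
pose b : R := (s * p - 1) / 2; have b0 : 0 < b by rewrite /b; move: sp1; lra.
pose q : R := 2 `^ b; have q1 : 1 < q by apply: powR_gt1; lra.
have q0 : 0 <= q by lra.
have [C C0 hC] := telescope_pow_lim p0 q1.
have qi1 : q^-1 < 1 by rewrite invf_lt1; lra.
have qi0 : 0 <= q^-1 by rewrite invr_ge0.
exists (C * (1 - q^-1)^-1); first by rewrite mulr_gt0// invr_gt0 subr_gt0.
move=> eta w sg meta mw E u f mE mu_ cvf.
have mtau := measurable_tau sg meta; have mO := measurable_inO sg meta mw; have mS j := measurable_shrink meta j.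
pose Psi z : \bar R := ((E z.1 && (inO eta w sg) z)%:R * ((tau eta sg) z `^ (- (s * p)) * `|u z - u ((shrink eta) 1 z)| `^ p))%:E.
have Psi0 z : (0 <= Psi z)%E by rewrite /Psi; nn.
have mPsi : measurable_fun setT Psi by rewrite /Psi; have mS1 := mS 1%N; mm.
have mPsis j : measurable_fun setT (fun z => Psi ((shrink eta) j z)) by exact: (measurableT_comp mPsi (mS j)).
(* The second factor cancels the growth of the Hardy weight at the dilated point, whose height is
   [2^-1 ^+ j * tau z]. *)
pose cj (j : nat) : R := q ^+ j * (2^-1 ^+ j) `^ (s * p).
have qs (j : nat) : 0 <= cj j by rewrite mulr_ge0 ?powR_ge0// exprn_ge0.
have mcPsi j : measurable_fun setT (fun z => (cj j)%:E * Psi ((shrink eta) j z))%E.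
  by have := mPsis j => h; mm.
have cPsi0 j z : (0 <= (cj j)%:E * Psi ((shrink eta) j z))%E by rewrite mule_ge0// lee_fin.
have S0 z : (0 <= \sum_(j <oo) ((cj j)%:E * Psi ((shrink eta) j z)))%E by apply: nneseries_ge0.
have C0' := ltW C0.
apply: (@le_trans _ _ (\I[mZ d]_z (C%:E * \sum_(j <oo) ((cj j)%:E * Psi ((shrink eta) j z))))%E).
  apply: le_Int => z; first by nn.
  have [/andP[Ez Oz]|_] := boolP (E z.1 && (inO eta w sg) z); last by rewrite mul0r mule_ge0// lee_fin.
  have /andP[t0 tw] := Oz.
  have := hC _ _ (cvf z Ez Oz).
  have -> : (shrink eta) 0 z = z by case: (z) => x y; rewrite /shrink /= expr0 subrr mul0r addr0 mul1r.
  rewrite mul1r EFinM => h; apply: le_trans (lee_wpmul2l _ h) _; first by rewrite lee_fin powR_ge0.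
  rewrite muleCA lee_pmul2l ?fin_numE ?lte_fin// -nneseriesZl//; last first.
    by move=> j _; rewrite lee_fin mulr_ge0 ?powR_ge0// exprn_ge0.
  apply: lee_nneseries => [j _ _|j _]; first by rewrite -EFinM lee_fin !mulr_ge0 ?powR_ge0 ?exprn_ge0.
  rewrite /Psi (inO_shrink _ Oz) {1}/shrink /= Ez mul1r tau_shrink shrinkS -!EFinM lee_fin /cj.
  have h0 : 0 < 2^-1 ^+ j :> R by rewrite exprn_gt0.
  have h0' := ltW h0; have t0' := ltW t0.
  have e1 : (2^-1 ^+ j * (tau eta sg) z) `^ (- (s * p)) = ((2^-1 ^+ j) `^ (s * p))^-1 * (tau eta sg) z `^ (- (s * p)).
    by rewrite powRM// powRN.
  have hh : (2^-1 ^+ j : R) `^ (s * p) != 0 by rewrite gt_eqF ?powR_gt0.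
  by rewrite e1 le_eqVlt; apply/orP; left; apply/eqP; field.
rewrite (IntZ _ C0' S0) [in leRHS]EFinM -muleA lee_pmul2l ?fin_numE ?lte_fin//.
rewrite (Int_series _ mcPsi cPsi0).
apply: geo_series_le => //.
- exact: Int_ge0.
- by move=> j; exact: Int_ge0.
move=> j; rewrite (IntZ _ (qs j) (fun z => Psi0 ((shrink eta) j z))) (int_shrink meta j mPsi Psi0).
rewrite muleA -EFinM; apply: lee_wpmul2r; first exact: Int_ge0.
rewrite lee_fin /cj powR_exp// -!exprMn.
rewrite le_eqVlt; apply/orP; left; apply/eqP; congr (_ ^+ _).
rewrite -(@powR_inv1 _ 2)// -powRrM mulN1r -[X in _ * X](@powRr1 _ 2)// /q -!powRD_gt0//.
by rewrite -powRN; congr (_ `^ _); rewrite /b; field.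
Qed.

Lemma hardy c : 0 < c -> c <= 2^-1 -> exists2 C, 0 < C &
  forall (eta w : 'rV[R]_d -> R) (sg : R), `|sg| = 1 -> measurable_fun setT eta -> measurable_fun setT w ->
  forall (E : 'rV[R]_d -> bool) (D : Z -> bool) (u : Z -> R) (f : 'rV[R]_d -> R),
  measurable_fun setT E -> measurable_fun setT D -> measurable_fun setT u ->
  (forall z, E z.1 -> (inO eta w sg) z -> [/\ D z, D ((shrink eta) 1 z) & forall z', rho z' ((shrink eta) 1 z) < c * (tau eta sg) z -> D z']) ->
  (forall z, E z.1 -> (inO eta w sg) z -> u ((shrink eta) j z) @[j --> \oo] --> f z.1) ->
  (\I[mZ d]_z ((E z.1 && (inO eta w sg) z)%:R * ((tau eta sg) z `^ (- (s * p)) * `|u z - f z.1| `^ p))%:E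
   <= C%:E * gag s p D u)%E.
Proof using p1 s0 s1 sp1.
move=> c0 c2; have [C1 C10 h1] := hardy_half.
exists (C1 * (c ^- d.+1 * 2 `^ p * 3)); first by rewrite !mulr_gt0 ?powR_gt0// invr_gt0 exprn_gt0.
move=> eta w sg sgE meta mw E D u f mE mD mu_ hD cvf; apply: le_trans (h1 _ _ _ meta mw _ _ _ mE mu_ cvf) _.
by rewrite EFinM -muleA lee_pmul2l ?fin_numE ?lte_fin//; exact: half_step.
Qed.
End hardy.

Section mct.
Local Open Scope ereal_scope.
Context d (T : measurableType d) (R : realType) (m : {sigma_finite_measure set T -> \bar R}).

(** Monotone convergence; it reduces Hardy's inequality for a trace to bounded sets at positive
    height, where the weight is bounded. *)
Lemma Int_exhaust (b : nat -> T -> bool) (g : T -> R) (M : \bar R) :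
  (forall n, measurable_fun setT (b n)) -> measurable_fun setT g -> (forall x, 0 <= g x)%R ->
  (forall n x, b n x -> b n.+1 x) -> (forall x, g x = 0%R \/ exists n, b n x) ->
  (forall n, \I[m]_x ((b n x)%:R * g x)%:E <= M) -> \I[m]_x (g x)%:E <= M.
Proof.
move=> mb mg g0 bS ex h.
have bm n k x : b n x -> b (n + k)%N x.
  by elim: k => [|k IH] bn; rewrite ?addn0// addnS; apply/bS/IH.
pose f n x := ((b n x)%:R * g x)%:E.
have cvf x : f n x @[n --> \oo] --> (g x)%:E.
  have [gx0|[n bn]] := ex x.
    by rewrite /f gx0; under eq_fun do rewrite mulr0; exact: cvg_cst.
  apply: cvg_near_cst; exists n => // k /= nk.
  by rewrite /f -(subnKC nk) bm// mul1r.
have mf n : measurable_fun setT (f n) by have := mb n => h1; rewrite /f; mm.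
have f0 n x : 0 <= f n x by rewrite /f; nn.
have ndf x : {homo f ^~ x : k l / (k <= l)%N >-> k <= l}.
  move=> k l kl; rewrite /f lee_fin -(subnKC kl) ler_wpM2r// ind_le//; exact: bm.
rewrite IntE (_ : (fun x => _) = (fun x => limn (f ^~ x))); last first.
  by apply/funext => x; apply/esym/cvg_lim => //; exact: cvf.
rewrite monotone_convergence//.
apply: lime_le; last by apply: nearW => n; rewrite -IntE; exact: h.
by apply: ereal_nondecreasing_is_cvgn => k l kl; apply: le_integral_nng => // x; exact: ndf.
Qed.
End mct.

(** * Comparison of the two forms of the Gagliardo energy *)

Section gagliardo_gag.
Context {R : realType} (d : nat).
Local Notation Z := ('rV[R]_d * measurableTypeR R)%type.
Variables (s p : R).
Hypotheses (p1 : 1 < p) (sp1 : 1 < s * p).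
Notation gam := (gam d s p).

Lemma gagliardo_pow (U : set ('rV[R]_d * R)) (D : Z -> bool) (u : Z -> R) : (forall z, U z <-> D z) ->
  (gagliardo s p U u `^ p = \I[mZ d]_z \I[mZ d]_z' ((D z)%:R * ((D z')%:R * (`|u z - u z'| `^ p * enorm_pair (z - z' : 'rV[R]_d * R) `^ (- gam))))%:E)%E.
Proof using p1.
move=> UD; rewrite /gagliardo -poweRrM mulVf ?gt_eqF//; last by move: p1; lra.
rewrite poweRe1; last first.
  apply: integral_ge0 => z _; apply: integral_ge0 => z' _.
  by rewrite lee_fin mulr_ge0 ?powR_ge0// invr_ge0 powR_ge0.
rewrite (@int_dome _ _ R (@lebesgue_graph R d) U D)// -IntZm; apply: eq_Int => z.
rewrite (@int_dom _ _ R (@lebesgue_graph R d) U D)// -IntZm -IntZ//; last first.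
  by move=> z'; rewrite lee_fin !mulr_ge0 ?powR_ge0// invr_ge0 powR_ge0.
by apply: eq_Int => z'; rewrite -EFinM powRN.
Qed.

Lemma gagliardo_le_gag U (D : Z -> bool) (u : Z -> R) : (forall z, U z <-> D z) ->
  (gagliardo s p U u `^ p <= (2 `^ gam)%:E * gag s p D u)%E.
Proof using p1 sp1.
have p0 : p != 0 by rewrite gt_eqF//; move: p1; lra.
have g0 : 0 <= gam by apply/ltW/gam_gt0.
have c0 : 0 <= 2 `^ gam by exact: powR_ge0.
move=> UD; rewrite (gagliardo_pow _ UD) -IntZ//; last by move=> z; nn.
apply: le_Int => z; first by nn.
rewrite -IntZ//; last by move=> z'; nn.
apply: le_Int => z'; first by nn.
rewrite lee_fin [leRHS]mulrCA ler_wpM2l// [leRHS]mulrCA ler_wpM2l//.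
have [rz|rz] := eqVneq (rho z z') 0.
  by rewrite (rho_eq0 rz) subrr normr0 powR0// !mul0r mulr0.
have r0 : 0 < rho z z' by rewrite lt_def rz rho_ge0.
rewrite mulrCA ler_wpM2l ?powR_ge0//.
have [h1 h2] := enorm_pairE z z'.
have -> : 2 `^ gam * rho z z' `^ (- gam) = (2^-1 * rho z z') `^ (- gam).
  by rewrite powRM ?rho_ge0// -(@powR_inv1 _ 2)// -powRrM mulrNN mul1r.
by apply: powR_anti => //; [rewrite mulr_gt0|rewrite mulrC ler_pdivrMr// mulrC].
Qed.

Lemma gag_le_gagliardo U (D : Z -> bool) (u : Z -> R) : (forall z, U z <-> D z) ->
  (gag s p D u <= (d.+1%:R `^ gam)%:E * gagliardo s p U u `^ p)%E.
Proof using p1 sp1.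
have p0 : p != 0 by rewrite gt_eqF//; move: p1; lra.
have g0 : 0 <= gam by apply/ltW/gam_gt0.
have c0 : 0 <= d.+1%:R `^ gam by exact: powR_ge0.
move=> UD; rewrite (gagliardo_pow _ UD) -IntZ//; last by move=> z; nn.
apply: le_Int => z; first by nn.
rewrite -IntZ//; last by move=> z'; nn.
apply: le_Int => z'; first by nn.
rewrite lee_fin [leRHS]mulrCA ler_wpM2l// [leRHS]mulrCA ler_wpM2l//.
have [h1 h2] := enorm_pairE z z'.
have [rz|rz] := eqVneq (rho z z') 0.
  by rewrite (rho_eq0 rz) subrr normr0 powR0// !mul0r mulr0.
have r0 : 0 < rho z z' by rewrite lt_def rz rho_ge0.
have e0 : 0 < enorm_pair (z - z' : 'rV[R]_d * R) by move: h1 r0; lra.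
rewrite mulrCA ler_wpM2l ?powR_ge0//.
have -> : d.+1%:R `^ gam * enorm_pair (z - z' : 'rV[R]_d * R) `^ (- gam) = (d.+1%:R^-1 * enorm_pair (z - z' : 'rV[R]_d * R)) `^ (- gam).
  rewrite powRM ?invr_ge0//; last exact: ltW.
  by rewrite -(@powR_inv1 _ d.+1%:R)// -powRrM mulrNN mul1r.
by apply: powR_anti => //; [rewrite mulr_gt0// invr_gt0|rewrite mulrC ler_pdivrMr// mulrC].
Qed.

Lemma gag_mono (D D' : Z -> bool) (u : Z -> R) : (forall z, D z -> D' z) -> (gag s p D u <= gag s p D' u)%E.
Proof.
move=> DD; apply: le_Int => z; first by nn.
apply: le_Int => z'; first by nn.
by rewrite lee_fin !ler_pM ?mulr_ge0 ?powR_ge0 ?ind_le//; exact: DD.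
Qed.

Lemma gag_eq (D : Z -> bool) (u v : Z -> R) : (forall z, D z -> u z = v z) -> gag s p D u = gag s p D v.
Proof.
move=> uv; apply: eq_Int => z; apply: eq_Int => z'; congr (_%:E).
case: (boolP (D z)) => [/uv->|_]; rewrite ?mul0r//.
by case: (boolP (D z')) => [/uv->|_]; rewrite ?mul0r//.
Qed.

Lemma gag_add (D : Z -> bool) (u v t : Z -> R) : measurable_fun setT D ->
  measurable_fun setT u -> measurable_fun setT v -> (forall z, D z -> t z = u z + v z) ->
  (gag s p D t <= (2 `^ p)%:E * (gag s p D u + gag s p D v))%E.
Proof using p1.
move=> mD mu_ mv ht.
have k0 : 0 <= 2 `^ p by exact: powR_ge0.
pose K (u : Z -> R) z z' := ((D z)%:R * ((D z')%:R * (`|u z - u z'| `^ p * rho z z' `^ (- gam))))%:E.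
have K0 u1 z z' : (0 <= K u1 z z')%E by rewrite /K; nn.
have mK u1 : measurable_fun setT u1 -> measurable_fun setT (fun z => \I[mZ d]_z' K u1 z z')%E.
  by move=> mu1; rewrite /K; mm.
have mKz u1 z : measurable_fun setT u1 -> measurable_fun setT (K u1 z).
  by move=> mu1; rewrite /K; mm.
have KI u1 z : (0 <= \I[mZ d]_z' K u1 z z')%E by apply: Int_ge0.
rewrite /gag -(IntD _ (mK _ mu_) (mK _ mv) (KI u) (KI v)) -(IntZ _ k0) => [|z]; last by rewrite adde_ge0.
apply: le_Int => z; first by nn.
rewrite -(IntD _ (mKz u z mu_) (mKz v z mv) (K0 u z) (K0 v z)) -(IntZ _ k0) => [|z']; last by rewrite adde_ge0.
apply: le_Int => z'; first by nn.
rewrite /K -EFinD -EFinM lee_fin -!mulrDr [leRHS]mulrCA.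
apply: ind_le_mul => Dz; rewrite [leRHS]mulrCA; apply: ind_le_mul => Dz'.
rewrite (ht _ Dz) (ht _ Dz') -mulrDl mulrA ler_wpM2r ?powR_ge0//.
have -> : u z + v z - (u z' + v z') = (u z - u z') + (v z - v z') by ring.
apply: le_trans (powR_mono _ _ (ler_normD _ _)) _ => //; first by move: p1; lra.
by apply: powD2 => //; move: p1; lra.
Qed.
End gagliardo_gag.

(** * Hardy's inequality for traces *)

Section limits.
Context {R : realType}.
Local Open Scope ereal_scope.

Lemma cvg0_lt (a : nat -> \bar R) : a n @[n --> \oo] --> 0 -> forall e : R, (0 < e)%R ->
  \forall n \near \oo, a n < e%:E.
Proof.
move=> /fine_cvgP[hfin h] e e0.
move/cvgr0Pnorm_lt : h => /(_ _ e0) h.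
near=> n.
have hf : a n \is a fin_num by near: n.
rewrite -(fineK hf) lte_fin; apply: le_lt_trans (ler_norm _) _.
by near: n.
Unshelve. all: by end_near. Qed.

Lemma cvg0P (a : nat -> \bar R) : (forall n, 0 <= a n) ->
  (forall e : R, (0 < e)%R -> \forall n \near \oo, a n <= e%:E) -> a n @[n --> \oo] --> 0.
Proof.
move=> a0 h; apply/fine_cvgP; split.
  near=> n; rewrite ge0_fin_numE//; apply: (@le_lt_trans _ _ 1%:E); last exact: ltry.
  by near: n; apply: h.
apply/cvgr0Pnorm_le => e e0; near=> n.
have an : a n <= e%:E by near: n; apply: h.
have hf : a n \is a fin_num by rewrite ge0_fin_numE// (le_lt_trans an)// ltry.
by rewrite /= ger0_norm ?fine_ge0// -lee_fin fineK.
Unshelve. all: by end_near. Qed.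

Lemma poweR_lt_eps (p e : R) (x : \bar R) : (0 < p)%R -> (0 < e)%R -> 0 <= x -> x < (e `^ p^-1)%:E -> x `^ p < e%:E.
Proof.
move=> p0 e0; case: x => // x; rewrite lee_fin lte_fin => x0 xe.
rewrite poweR_EFin lte_fin.
have -> : (e = (e `^ p^-1) `^ p)%R by rewrite -powRrM mulVf ?gt_eqF// powRr1// ltW.
by rewrite gt0_ltr_powR// ?nnegrE// ?powR_ge0.
Qed.

Lemma poweR_le_eps (p e : R) (x : \bar R) : (0 < p)%R -> (0 < e)%R -> 0 <= x -> x `^ p <= (e `^ p)%:E -> x <= e%:E.
Proof.
move=> p0 e0; case: x => [x||]//; last by rewrite poweRyr ?gt_eqF.
rewrite lee_fin poweR_EFin lee_fin => x0 h.
rewrite lee_fin leNgt; apply/negP => ex; move: h; rewrite leNgt => /negP; apply.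
by rewrite gt0_ltr_powR// ?nnegrE//; exact: ltW.
Qed.

Lemma limit_le (X Y : \bar R) (K : R) : (0 <= K)%R -> (forall e : R, (0 < e)%R -> X <= Y + (K * e)%:E) -> X <= Y.
Proof.
move=> K0 h; apply/lee_addgt0Pr => e e0.
have K1 : (0 < K + 1)%R by rewrite ltr_wpDl.
apply: le_trans (h (e / (K + 1)) _)%R _; first by rewrite divr_gt0.
rewrite leeD2l// lee_fin mulrCA ler_piMr//; first exact: ltW.
by rewrite ler_pdivrMr// mul1r lerDl.
Qed.
End limits.

Section slices.
Context {R : realType} (d : nat).
Local Notation Z := ('rV[R]_d * measurableTypeR R)%type.
Variables (eta w : 'rV[R]_d -> R) (sg : R).
Hypotheses (sgE : sg * sg = 1) (w_gt0 : forall x, 0 < w x).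
Hypotheses (meta : measurable_fun setT eta) (mw : measurable_fun setT w).

Lemma sg_abs : `|sg| = 1.
Proof using sgE.
have : `|sg| ^+ 2 = 1 by rewrite real_normK ?num_real// expr2.
by move=> /eqP; rewrite sqrf_eq1 => /orP[/eqP//|/eqP h]; have := normr_ge0 sg; rewrite h; lra.
Qed.

Lemma slice_len x (a : R) : 0 < a ->
  (\I[mR]_t ((0 < tau eta sg (x, t)) && (tau eta sg (x, t) < a))%:R%:E = a%:E)%E.
Proof using sgE.
move=> a0; have a2 : 0 < a / 2 by lra.
have {2}-> : a = 2 * (a / 2) by field.
rewrite -(@IvolR _ (eta x - sg * (a / 2)) _ a2); apply: eq_Int => t; congr (_%:E).
have -> : `|(t : R) - (eta x - sg * (a / 2))| = `|a / 2 - tau eta sg (x, t)|.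
  rewrite -[LHS]mul1r -{1}sg_abs -normrM /tau /=; congr (`|_|).
  transitivity (sg * sg * (a / 2) - sg * (eta x - t)); first by ring.
  by rewrite sgE mul1r.
apply: ind_eq; rewrite ltr_norml; move: (tau _ _ _) => b; first by move=> /andP[]; lra.
by move=> /andP[h1 h2]; apply/andP; split; lra.
Qed.

(** Fubini: the column above x has length [w x], so a function of x alone is integrated over the
    strip with that weight. *)
Lemma Int_inO (F : 'rV[R]_d -> R) : measurable_fun setT F -> (forall x, 0 <= F x) ->
  (\I[mZ d]_z ((inO eta w sg z)%:R * F z.1)%:E = \I[mX d]_x (w x * F x)%:E)%E.
Proof using sgE w_gt0 meta mw.
move=> mF F0; have mO := measurable_inO sg meta mw.
rewrite IntZ2; [|mm|nn].
apply: eq_Int => x; rewrite EFinM -(slice_len x (w_gt0 x)) -IntZr; [|exact: F0|by nn].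
by apply: eq_Int => t; rewrite -EFinM.
Qed.
End slices.

(** Arithmetic showing that the ball attached to a point above [|x| < r1] stays above
    [|x| <= r1 + B]: its radius [c * tau] is at most the bound B on the width. *)
Lemma radius_bound (R : realFieldType) (c r1 B a1 a2 a3 a4 a5 a6 : R) : 0 < a4 -> a4 < a6 -> a5 < c * a4 ->
  a2 <= a5 -> a1 <= a2 + a3 -> a6 <= B -> c <= 2^-1 -> 0 < c -> a3 < r1 -> a1 <= r1 + B.
Proof.
move=> t0 tw hz h5 h6 h7 hc hc0 hE.
have k1 : c * a4 <= a4 by rewrite ler_piMl ?(ltW t0)//; lra.
lra.
Qed.

Section boundary.
Context {R : realType} (d : nat).
Local Notation Z := ('rV[R]_d * measurableTypeR R)%type.
Variables (s p : R).
Hypotheses (p1 : 1 < p) (s0 : 0 < s) (s1 : s < 1) (sp1 : 1 < s * p).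
Variables (La : R) (etam etap eta w : 'rV[R]_d -> R) (sg : R).
Hypotheses (La0 : 0 <= La) (sgE : sg * sg = 1).
Hypotheses (eta_lip : forall x y, `|eta x - eta y| <= La * `|x - y|).
Hypotheses (w_lip : forall x y, `|w x - w y| <= La * `|x - y|).
Hypotheses (w_gt0 : forall x, 0 < w x).
Hypotheses (meta : measurable_fun setT eta) (mw : measurable_fun setT w).
Notation O := (inO eta w sg).
Hypotheses (stripE : forall z, strip etam etap z <-> O z).

Lemma shrink_cvg (z : 'rV[R]_d * R) : (shrink eta j z : 'rV[R]_d * R) @[j --> \oo] --> ((z.1, eta z.1) : 'rV[R]_d * R).
Proof.
have h : (2^-1 ^+ j : R) @[j --> \oo] --> (0 : R).
  by apply: cvg_expr; rewrite ger0_norm; lra.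
have h1 : (fun j : nat => z.1) @ \oo --> z.1 by exact: cvg_cst.
have h2 : (2^-1 ^+ j * z.2 + (1 - 2^-1 ^+ j) * eta z.1) @[j --> \oo] --> eta z.1.
  have E : 0 * z.2 + (1 - 0) * eta z.1 = eta z.1 by ring.
  rewrite -[X in _ --> X]E; apply: cvgD; first by apply: cvgM => //; exact: cvg_cst.
  apply: cvgM; last exact: cvg_cst.
  by apply: cvgB => //; exact: cvg_cst.
exact: (cvg_pair h1 h2).
Qed.

(** The dilates of the midpoint of the column stay in the strip and converge to the boundary
    point. *)
Lemma boundary_closure r x : enorm x < r -> closure (strip_ball etam etap r) (x, eta x).
Proof using stripE w_gt0 sgE.
move=> xr B nB; have [j _ Bj] := @shrink_cvg (x, eta x - sg * (w x / 2)) B nB.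
have Oz : O (x, eta x - sg * (w x / 2)).
  rewrite /inO /tau /= opprB addrC subrK mulrA sgE mul1r.
  by have := w_gt0 x; move: (w x) => a a0; apply/andP; split; lra.
exists (shrink eta j (x, eta x - sg * (w x / 2))); split; last exact: (Bj j (leqnn j)).
by split => //; apply/stripE; apply: inO_shrink.
Qed.

(** Supplies the pointwise limit along dilations demanded by [hardy]: for a function continuous up
    to the closure it is the boundary value. *)
Lemma boundary_cvg r v z : {within closure (strip_ball etam etap r), continuous v} ->
  enorm z.1 < r -> O z -> v (shrink eta j z) @[j --> \oo] --> (v (z.1, eta z.1) : R).
Proof using stripE w_gt0 sgE.
move=> /subspace_continuousP cv xr Oz.
have closed_part := boundary_closure xr.
apply: cvg_trans (cv _ closed_part) => B /= nB; have h := @shrink_cvg z _ nB.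
case: h => N _ hN; exists N => // j Nj; apply: (hN j Nj).
by apply: subset_closure; split => //; apply/stripE; exact: inO_shrink.
Qed.

Definition in_strip_ball (r : R) (z : Z) : bool := O z && (enorm z.1 < r).
Lemma in_strip_ballP r z : strip_ball etam etap r z <-> in_strip_ball r z.
Proof using stripE.
split=> [[/stripE h1 h2]|/andP[/stripE h1 h2]]; last by split.
by apply/andP; split.
Qed.
Lemma measurable_in_strip_ball r : measurable_fun setT (in_strip_ball r).
Proof using meta mw. have mO := measurable_inO sg meta mw; rewrite /in_strip_ball; mm. Qed.

(** Functions of [Wdot] and approximations of traces are measurable only on their domain;
    multiplication by the indicator makes them globally measurable without changing the energies. *)
Lemma measurable_mask (S : set ('rV[R]_d * R)) (D : Z -> bool) (v : Z -> R) : (forall z, S z <-> D z) ->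
  measurable_fun setT D -> measurable_fun (S : set Z) v ->
  measurable_fun setT (fun z => (D z)%:R * v z).
Proof.
move=> SD mD; have mS : measurable (S : set Z).
  rewrite (_ : S = [set z | D z]); first exact: measurable_setb mD.
  by apply/seteqP; split=> z /SD.
move=> /(measurable_restrictT _ mS); congr (measurable_fun _ _).
apply/funext => z; rewrite /patch; have [h|h] := pselect (S z).
  by rewrite mem_set// (_ : D z) ?mul1r//; exact/SD.
by rewrite memNset//; case: (boolP (D z)) => [/SD//|_]; rewrite mul0r.
Qed.

Lemma measurable_vr r (v : 'rV[R]_d * R -> R) : {within closure (strip_ball etam etap r), continuous v} ->
  measurable_fun setT (fun z : Z => (in_strip_ball r z)%:R * v z).
Proof using stripE meta mw.
move=> cv; apply: measurable_mask (in_strip_ballP r) (measurable_in_strip_ball r) _.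
apply: within_continuous_measurable cv; last exact: subset_closure.
rewrite (_ : strip_ball etam etap r = [set z : Z | in_strip_ball r z]); first exact: measurable_setb (measurable_in_strip_ball r).
by apply/seteqP; split=> z /in_strip_ballP.
Qed.

(** The boundary values are pointwise limits of the measurable functions obtained by dilating the
    middle graph towards the boundary. *)
Lemma measurable_trace_vr r (v : 'rV[R]_d * R -> R) : {within closure (strip_ball etam etap r), continuous v} ->
  measurable_fun setT (fun x : 'rV[R]_d => (enorm x < r)%R%:R * v (x, eta x)).
Proof using stripE meta mw w_gt0 sgE.
move=> cv; have mv := measurable_vr cv.
pose q (x : 'rV[R]_d) : Z := (x, eta x - sg * (w x / 2)).
have mq : measurable_fun setT q by rewrite /q; mm.
have mS j := measurable_shrink meta j.
apply: (@measurable_realfun.measurable_fun_cvg _ _ _ _ (fun j x => (in_strip_ball r (shrink eta j (q x)))%:R * v (shrink eta j (q x)))).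
  move=> j; have mh : measurable_fun setT (fun x => shrink eta j (q x)) by exact: (measurableT_comp (mS j) mq).
  exact: (measurableT_comp mv mh).
move=> x _.
have Oq : O (q x).
  rewrite /inO /tau /= opprB addrC subrK mulrA sgE mul1r.
  by have := w_gt0 x; move: (w x) => a a0; apply/andP; split; lra.
have [xr|xr] := boolP (enorm x < r); last first.
  have -> : (fun j => (in_strip_ball r (shrink eta j (q x)))%:R * v (shrink eta j (q x))) = (fun=> 0).
    by apply/funext => j; rewrite /in_strip_ball /= (negbTE xr) andbF mul0r.
  by rewrite mul0r; exact: cvg_cst.
rewrite mul1r; apply: cvg_trans (boundary_cvg cv (z := q x) xr Oq).
rewrite (_ : (fun j => v _) = (fun j => (in_strip_ball r (shrink eta j (q x)))%:R * v (shrink eta j (q x))))//.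
apply/funext => j; rewrite /in_strip_ball (inO_shrink _ Oq) /= xr mul1r//.
Qed.

Lemma half_mem c z : 0 < c -> 4 * c * (1 + La) <= 1 -> O z ->
  [/\ O z, O (shrink eta 1 z) & forall z', rho z' (shrink eta 1 z) < c * tau eta sg z -> O z'].
Proof using sgE La0 eta_lip w_lip.
move=> c0 hc Oz; split => //; first exact: inO_shrink.
by move=> z' h; apply: (@ball_inO _ _ eta w sg La _ La0 eta_lip w_lip c z z') => //; exact: sg_abs.
Qed.

Let c := (4 * (1 + La))^-1.

(** Hardy's inequality requires pointwise limits along dilations, while a trace is a limit in L^p
    only. It is therefore applied to a continuous approximation v. On a truncated set, where the
    weight is bounded, replacing u by v and f by the boundary value of v costs O(e); the energy of v
    exceeds that of u, up to the factor [2 ^ p], by O(e). Then e tends to 0, and the truncation is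
    removed by [Int_exhaust]. *)
Lemma hardy_trace_of (CH : R) : 0 < CH ->
  (forall (E : 'rV[R]_d -> bool) (D : Z -> bool) (u : Z -> R) (f : 'rV[R]_d -> R),
    measurable_fun setT E -> measurable_fun setT D -> measurable_fun setT u ->
    (forall z, E z.1 -> O z -> [/\ D z, D (shrink eta 1 z) & forall z', rho z' (shrink eta 1 z) < c * tau eta sg z -> D z']) ->
    (forall z, E z.1 -> O z -> u (shrink eta j z) @[j --> \oo] --> f z.1) ->
    (\I[mZ d]_z ((E z.1 && O z)%:R * (tau eta sg z `^ (- (s * p)) * `|u z - f z.1| `^ p))%:E <= CH%:E * gag s p D u)%E) ->
  forall (u : Z -> R) (f : 'rV[R]_d -> R),
  measurable_fun (strip etam etap : set Z) u -> is_trace etam etap s p eta u f ->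
  (\I[mZ d]_z ((O z)%:R * (tau eta sg z `^ (- (s * p)) * `|u z - f z.1| `^ p))%:E
   <= (3 `^ p * (CH * 2 `^ p))%:E * gag s p O u)%E.
Proof using p1 s0 s1 sp1 La0 sgE eta_lip w_lip w_gt0 meta mw stripE.
move=> CH0 hH.
have La1 : 0 < 1 + La by move: La0; lra.
have c0 : 0 < c by rewrite invr_gt0 mulr_gt0.
have c1 : 4 * c * (1 + La) = 1 by rewrite /c; field; rewrite gt_eqF.
have c2 : c <= 2^-1 by move: La0; clearbody c; nra.
have p0 : 0 < p by move: p1; lra.
have p0' : 0 <= p by exact: ltW.
have mO := measurable_inO sg meta mw; have mtau := measurable_tau sg meta.
have sp0 : 0 <= s * p by move: sp1; lra.
move=> u f mu_ [mf htr].
pose u0 z := (O z)%:R * u z.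
have mu0 : measurable_fun setT u0 by exact: measurable_mask stripE mO mu_.
(* Truncation to a bounded base and to heights above 1/(n+1), where the Hardy weight is at most
   [K0]. *)
pose b n (z : Z) := (`|z.1| < n%:R) && (n.+1%:R^-1 < tau eta sg z).
pose g (z : Z) := (O z)%:R * (tau eta sg z `^ (- (s * p)) * `|u0 z - f z.1| `^ p).
have g0 z : 0 <= g z by rewrite /g; nn.
have mg : measurable_fun setT g by rewrite /g; mm.
have mb n : measurable_fun setT (b n) by rewrite /b; mm.
have -> : (\I[mZ d]_z ((O z)%:R * (tau eta sg z `^ (- (s * p)) * `|u z - f z.1| `^ p))%:E = \I[mZ d]_z (g z)%:E)%E.
  apply: eq_Int => z; rewrite /g /u0; case: (O z); last by rewrite !mul0r.
  by rewrite !mul1r.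
have -> : gag s p O u = gag s p O u0 by apply: gag_eq => z Oz; rewrite /u0 Oz mul1r.
apply: (Int_exhaust mb mg g0) => [n z /andP[h1 h2]|z|n].
- apply/andP; split; first by apply: lt_le_trans h1 _; rewrite ler_nat.
  by apply: le_lt_trans h2; rewrite lef_pV2 ?posrE// ler_nat.
- have [/andP[t0 _]|hO] := boolP (O z); last by left; rewrite /g (negbTE hO) mul0r.
  right; have [n1 hn1] : exists n : nat, `|z.1| < n%:R.
    by exists (Num.bound `|z.1|); apply: archi_boundP.
  have [n2 hn2] : exists n : nat, (tau eta sg z)^-1 < n%:R.
    by exists (Num.bound (tau eta sg z)^-1); apply: archi_boundP; rewrite invr_ge0 ltW.
  exists (n1 + n2)%N; apply/andP; split; first by apply: lt_le_trans hn1 _; rewrite ler_nat leq_addr.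
  rewrite -[ltRHS]invrK ltf_pV2 ?posrE ?invr_gt0//; apply: lt_trans hn2 _.
  by rewrite ltr_nat ltnS leq_addl.
pose r1 : R := n%:R; pose B := w 0 + La * r1.
have B0 : 0 < B by rewrite /B ltr_pwDl// mulr_ge0// /r1.
have wB x : `|x| < r1 -> w x <= B.
  move=> xr; have := w_lip x 0; rewrite subr0 ler_norml => /andP[_ h].
  have k : La * `|x| <= La * r1 by rewrite ler_wpM2l// ltW.
  by move: h k; rewrite /B; lra.
(* The approximation must live on all balls used by Hardy's inequality over [|x| < r1], hence over
   [|x| <= r1 + B]; the factor d converts the sup norm into the Euclidean norm of [strip_ball]. *)
pose r := d%:R * (r1 + B) + 1.
have r0 : 0 < r by rewrite ltr_wpDl// mulr_ge0// addr_ge0// ltW.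
have nr (x : 'rV[R]_d) : `|x| <= r1 + B -> enorm x < r.
  move=> h; apply: le_lt_trans (enorm_le_norm x) _; apply: (@le_lt_trans _ _ (d%:R * (r1 + B))).
    by rewrite ler_wpM2l.
  by rewrite /r ltrDl.
have [v [cv hLp hgag htrv]] := htr r r0.
pose K0 : R := n.+1%:R^-1 `^ (- (s * p)).
have K00 : 0 <= K0 by exact: powR_ge0.
apply: (@limit_le _ _ _ (3 `^ p * (K0 + CH * 2 `^ p * d.+1%:R `^ gam d s p + K0 * B))).
  by rewrite !(addr_ge0, mulr_ge0)// ?powR_ge0// ltW.
move=> e e0.
have ep0 : 0 < e `^ p^-1 by exact: powR_gt0.
have [k [[h1 h2] h3]] := filter_ex (filterI (filterI (cvg0_lt hLp ep0) (cvg0_lt hgag ep0)) (cvg0_lt htrv e0)).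
have cvk := cv k; move: (v k) h1 h2 h3 cvk => {hLp hgag htrv cv}v h1 h2 h3 cv.
have mD := measurable_in_strip_ball r.
pose v0 z := (in_strip_ball r z)%:R * v z; have mv0 : measurable_fun setT v0 by exact: measurable_vr.
pose fv x := (enorm x < r)%R%:R * v (x, eta x); have mfv : measurable_fun setT fv by exact: measurable_trace_vr.
pose E (x : 'rV[R]_d) := `|x| < r1; have mE : measurable_fun setT E by rewrite /E; mm.
have Er x : E x -> enorm x < r by move=> h; apply: nr; apply: (le_trans (ltW h)); rewrite lerDl ltW.
have DO z : in_strip_ball r z -> O z by move=> /andP[].
have h1' : (\I[mZ d]_z ((in_strip_ball r z)%:R * `|v0 z - u0 z| `^ p)%:E <= e%:E)%E.
  have := poweR_lt_eps p0 e0 (poweR_ge0 _ _) h1.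
  rewrite /Lp_norm -poweRrM mulVf ?gt_eqF// poweRe1; last by apply: integral_ge0 => z _; nn.
  rewrite (@int_dom _ _ R (@lebesgue_graph R d) _ (in_strip_ball r) _ (in_strip_ballP r)) -IntZm => /ltW; apply: le_trans.
  apply: le_Int => z; first by nn.
  rewrite lee_fin; apply: ind_le_mul => Dz; rewrite /v0 /u0 Dz (DO _ Dz) !mul1r//.
have h2' : (gag s p (in_strip_ball r) (fun z => v0 z - u0 z)%R <= (d.+1%:R `^ gam d s p * e)%:E)%E.
  have gg := poweR_ge0 (\int[lebesgue_graph d]_(x in strip_ball etam etap r) \int[lebesgue_graph d]_(y in strip_ball etam etap r) (`|v x - u x - (v y - u y)| `^ p / enorm_pair (x - y) `^ (d.+1%:R + s * p))%:E)%E p^-1.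
  have := poweR_lt_eps p0 e0 gg h2 => h4.
  rewrite (@gag_eq _ _ _ _ _ _ (fun z => v z - u z)); last first.
    by move=> z Dz; rewrite /v0 /u0 Dz (DO _ Dz) !mul1r.
  apply: le_trans (gag_le_gagliardo p1 sp1 _ (in_strip_ballP r)) _.
  by rewrite EFinM lee_wpmul2l ?lee_fin ?powR_ge0// ltW.
have h3' : (\I[mX d]_x ((enorm x < r)%R%:R * `|fv x - f x| `^ p)%:E <= e%:E)%E.
  have := ltW h3; rewrite (@int_dom _ _ R (@lebesgue_rV R d) _ (fun x => enorm x < r))// -IntX; apply: le_trans.
  apply: le_Int => x; first by nn.
  by rewrite lee_fin; apply: ind_le_mul => xr; rewrite /fv xr mul1r.
(* The three terms of the triangle inequality from u to f through v and its boundary value: F1 and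
   F3 are errors under the bounded weight, F2 is the Hardy integrand of v. *)
pose F1 z := K0 * ((in_strip_ball r z)%:R * `|v0 z - u0 z| `^ p).
pose F2 z := (E z.1 && O z)%:R * (tau eta sg z `^ (- (s * p)) * `|v0 z - fv z.1| `^ p).
pose F3 z := K0 * ((O z)%:R * ((E z.1)%:R * `|fv z.1 - f z.1| `^ p)).
have F10 z : (0 <= (F1 z)%:E)%E by rewrite /F1; nn.
have F20 z : (0 <= (F2 z)%:E)%E by rewrite /F2; nn.
have F30 z : (0 <= (F3 z)%:E)%E by rewrite /F3; nn.
have mF1 : measurable_fun setT (fun z => (F1 z)%:E) by rewrite /F1; mm.
have mF2 : measurable_fun setT (fun z => (F2 z)%:E) by rewrite /F2; mm.
have mF3 : measurable_fun setT (fun z => (F3 z)%:E) by rewrite /F3; mm.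
have F120 z : (0 <= (F1 z)%:E + (F2 z)%:E)%E by apply: adde_ge0.
have mF12 : measurable_fun setT (fun z => (F1 z)%:E + (F2 z)%:E)%E by apply: emeasurable_funD.
have F1230 z : (0 <= (3 `^ p)%:E * ((F1 z)%:E + (F2 z)%:E + (F3 z)%:E))%E.
  by apply: mule_ge0; [rewrite lee_fin powR_ge0|apply: adde_ge0].
apply: (@le_trans _ _ (\I[mZ d]_z ((3 `^ p)%:E * ((F1 z)%:E + (F2 z)%:E + (F3 z)%:E)))%E).
  apply: le_Int => z; first by nn.
  have [bz|_] := boolP (b n z); last by rewrite mul0r.
  have [Oz|Oz] := boolP (O z); last by rewrite /g (negbTE Oz) mul0r mulr0.
  have /andP[bz1 bz2] := bz; have Ez : E z.1 by [].
  have Dz : in_strip_ball r z by rewrite /in_strip_ball Oz Er.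
  rewrite -!EFinD -EFinM lee_fin /g /F1 /F2 /F3 Oz Dz Ez !mul1r.
  have tK : tau eta sg z `^ (- (s * p)) <= K0.
    by apply: powR_anti => //; exact: ltW.
  have h := dist3 (f z.1) (fv z.1) (v0 z) (u0 z) p0'.
  rewrite [`|u0 z - _|]distrC; apply: le_trans (ler_wpM2l (powR_ge0 _ _) h) _.
  rewrite mulrCA ler_wpM2l ?powR_ge0// !mulrDr addrC [`|fv z.1 - v0 z|]distrC [`|f z.1 - fv z.1|]distrC.
  by rewrite -addrA addrC; apply: lerD; [apply: lerD => //|]; apply: ler_wpM2r => //; exact: powR_ge0.
rewrite IntZ ?powR_ge0//; last by move=> z; apply: adde_ge0.
rewrite (IntD _ mF12 mF3 F120 F30) (IntD _ mF1 mF2 F10 F20).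
have I1 : (\I[mZ d]_z (F1 z)%:E <= (K0 * e)%:E)%E.
  by rewrite /F1 IntZR// EFinM lee_wpmul2l.
(* The error on the boundary is spread over columns, whose length is at most B. *)
have I3 : (\I[mZ d]_z (F3 z)%:E <= (K0 * (B * e))%:E)%E.
  rewrite /F3 IntZR//.
  rewrite EFinM lee_wpmul2l//.
  rewrite (@Int_inO _ _ eta w sg sgE w_gt0 meta mw (fun x => (E x)%:R * `|fv x - f x| `^ p)); [|mm|by move=> x; nn].
  apply: (@le_trans _ _ (B%:E * \I[mX d]_x ((enorm x < r)%R%:R * `|fv x - f x| `^ p)%:E)%E); last first.
    by rewrite EFinM; apply: lee_wpmul2l h3'; rewrite lee_fin ltW.
  have B0' := ltW B0; rewrite -IntZR//.
  apply: le_Int => x; first by have := ltW (w_gt0 x) => w0'; nn.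
  rewrite lee_fin; have [xE|xE] := boolP (E x); last by rewrite mul0r mulr0; nn.
  by rewrite Er// !mul1r ler_wpM2r ?powR_ge0// wB.
have I2 : (\I[mZ d]_z (F2 z)%:E <= CH%:E * ((2 `^ p)%:E * (gag s p O u0 + (d.+1%:R `^ gam d s p * e)%:E)))%E.
  apply: le_trans (hH E (in_strip_ball r) v0 fv mE mD mv0 _ _) _.
  - move=> z Ez Oz; have c4 : 4 * c * (1 + La) <= 1 by rewrite c1.
    have [_ O1 O2] := half_mem c0 c4 Oz.
    split; [by rewrite /in_strip_ball Oz Er|by rewrite /in_strip_ball O1 Er|move=> z' hz'].
    rewrite /in_strip_ball (O2 _ hz') /=; apply: nr.
    have h5 : `|z'.1 - z.1| <= rho z' (shrink eta 1 z) by rewrite /rho /shrink /= lerDl.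
    have h6 : `|z'.1| <= `|z'.1 - z.1| + `|z.1| by rewrite -{1}(subrK z.1 z'.1) ler_normD.
    have h7 := wB _ Ez; move: Oz hz' h5 h6 h7 c2 c0 Ez => /andP[]; rewrite /E.
    move: (`|z'.1|) (`|z'.1 - z.1|) (`|z.1|) (tau eta sg z) (rho _ _) (w z.1) => a1 a2 a3 a4 a5 a6.
    clearbody B r1 c => t0 tw hz h5 h6 h7 hc hc0 hE.
    exact: radius_bound t0 tw hz h5 h6 h7 hc hc0 hE.
  - move=> z Ez Oz; rewrite /fv Er// mul1r; apply: cvg_trans (boundary_cvg cv (Er _ Ez) Oz).
    rewrite (_ : (fun j => v _) = (fun j => v0 (shrink eta j z)))//.
    by apply/funext => j; rewrite /v0 /in_strip_ball (inO_shrink _ Oz) /= Er// mul1r.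
  rewrite lee_wpmul2l ?lee_fin ?(ltW CH0)//.
  have mvu : measurable_fun setT (fun z => v0 z - u0 z) by mm.
  apply: le_trans (@gag_add _ _ s p p1 (in_strip_ball r) u0 (fun z => v0 z - u0 z) v0 mD mu0 mvu _) _.
    by move=> z _; rewrite addrC subrK.
  by rewrite lee_wpmul2l ?lee_fin ?powR_ge0// leeD// gag_mono.
have gg0 := gag_ge0 s p O u0.
apply: (@le_trans _ _ ((3 `^ p)%:E * ((K0 * e)%:E + CH%:E * ((2 `^ p)%:E * (gag s p O u0 + (d.+1%:R `^ gam d s p * e)%:E)) + (K0 * (B * e))%:E))%E).
  by rewrite lee_wpmul2l ?lee_fin ?powR_ge0// !leeD.
move: (gag s p O u0) gg0 (powR_gt0 p (ltr0Sn R 2)) (powR_gt0 p (ltr0Sn R 1)) => [G||]//.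
  move=> _ _ _; change ((3 `^ p * (K0 * e + CH * (2 `^ p * (G + d.+1%:R `^ gam d s p * e)) + K0 * (B * e)))%:E <=
    (3 `^ p * (CH * 2 `^ p) * G + 3 `^ p * (K0 + CH * 2 `^ p * d.+1%:R `^ gam d s p + K0 * B) * e)%:E)%E.
  by rewrite lee_fin le_eqVlt; apply/orP; left; apply/eqP; ring.
move=> _ k1 k2; rewrite [in leRHS]gt0_muley ?lte_fin ?mulr_gt0// addye// leey.
by [].
Qed.
End boundary.

(** The Hardy constant depends on [La] only and is fixed before the graphs, as uniformity in the
    strip requires. *)
Lemma hardy_trace (R : realType) (d : nat) (s p La L : R) : 1 < p -> 0 < s -> s < 1 -> 1 < s * p -> 0 <= La ->
  exists2 C, 0 < C & forall (etam etap eta w : 'rV[R]_d -> R) (sg : R), side La L eta w sg ->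
  (forall z, strip etam etap z <-> inO eta w sg z) ->
  forall (u : 'rV[R]_d * measurableTypeR R -> R) (f : 'rV[R]_d -> R),
  measurable_fun (strip etam etap : set ('rV[R]_d * measurableTypeR R)) u -> is_trace etam etap s p eta u f ->
  (\I[mZ d]_z ((inO eta w sg z)%:R * (tau eta sg z `^ (- (s * p)) * `|u z - f z.1| `^ p))%:E
   <= C%:E * gag s p (inO eta w sg) u)%E.
Proof.
move=> p1 s0 s1 sp1 La0; pose c := (4 * (1 + La))^-1.
have La1 : 0 < 1 + La by move: La0; lra.
have c0 : 0 < c by rewrite invr_gt0 mulr_gt0.
have c1 : 4 * c * (1 + La) = 1 by rewrite /c; field; rewrite gt_eqF.
have c2 : c <= 2^-1 by move: La0; clearbody c; nra.
have [CH CH0 hH] := hardy d p1 s0 s1 sp1 c0 c2.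
exists (3 `^ p * (CH * 2 `^ p)); first by rewrite !mulr_gt0 ?powR_gt0.
move=> etam etap eta w sg [sgE eta_lip w_lip w_gt0 w_elip meta mw] stripE.
apply: (hardy_trace_of p1 s0 s1 sp1 La0 sgE eta_lip w_lip w_gt0 meta mw stripE CH0).
exact: (hH eta w sg (sg_abs sgE) meta mw).
Qed.

(** * Necessity of the trace conditions *)

Section fubini.
Context {R : realType} (d : nat).
Local Notation Z := ('rV[R]_d * measurableTypeR R)%type.
Local Open Scope ereal_scope.
Lemma fubini4 (G : Z -> Z -> \bar R) : measurable_fun setT (fun q : Z * Z => G q.1 q.2) -> (forall z z', 0 <= G z z') ->
  \I[mZ d]_z \I[mZ d]_z' G z z' = \I[mX d]_x \I[mX d]_y \I[mR]_t \I[mR]_t' G (x, t) (y, t').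
Proof.
move=> mG G0; have mI : measurable_fun setT (fun z => \I[mZ d]_z' G z z') by apply: measurable_Int.
have I0 z : 0 <= \I[mZ d]_z' G z z' by apply: Int_ge0.
rewrite (IntZ2 mI I0); apply: eq_Int => x.
have mGz z : measurable_fun setT (G z).
  have h : measurable_fun setT (fun z' : Z => (z, z')) by apply: measurable_fun_pair.
  exact: (measurableT_comp mG h).
have E t : \I[mZ d]_z' G (x, t) z' = \I[mX d]_y \I[mR]_t' G (x, t) (y, t').
  by rewrite IntZ2.
under [in LHS]eq_Int do rewrite E.
apply: (@Int_swap _ _ _ _ _ mR (mX d) (fun t y => \I[mR]_t' G (x, t) (y, t'))) => [|t y]; last exact: Int_ge0.
apply: (@measurable_Int _ _ _ _ _ mR (fun q t' => G (x, q.1) (q.2, t'))) => // q.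
have h : measurable_fun setT (fun q : (measurableTypeR R * 'rV[R]_d) * measurableTypeR R => ((x, q.1.1) : Z, (q.1.2, q.2) : Z)) by mm.
exact: (measurableT_comp mG h).
Qed.

Lemma three_term_le (a b : R) (G H : \bar R) : (0 <= a)%R -> (0 <= b)%R -> 0 <= G -> 0 <= H ->
  a%:E * H + G + b%:E * H <= (a + 1 + b)%:E * (G + H).
Proof.
move=> a0 b0 G0 H0; rewrite addeAC -ge0_muleDl ?lee_fin// addeC ge0_muleDr//; apply: leeD.
  rewrite -[leLHS]mul1e; apply: lee_wpmul2r => //; rewrite lee_fin; move: a0 b0; lra.
by apply: lee_wpmul2r => //; rewrite lee_fin; move: a0 b0; lra.
Qed.
End fubini.

Section Int2.
Local Open Scope ereal_scope.
Context {R : realType} d1 d2 (T1 : measurableType d1) (T2 : measurableType d2).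
Variable m1 : {sigma_finite_measure set T1 -> \bar R}.
Variable m2 : {sigma_finite_measure set T2 -> \bar R}.

Lemma Int2D (F G : T1 -> T2 -> \bar R) : measurable_fun setT (fun q => F q.1 q.2) -> (forall x y, 0 <= F x y) ->
  measurable_fun setT (fun q => G q.1 q.2) -> (forall x y, 0 <= G x y) ->
  \I[m1]_x \I[m2]_y (F x y + G x y) = \I[m1]_x \I[m2]_y F x y + \I[m1]_x \I[m2]_y G x y.
Proof.
have mz (H : T1 -> T2 -> \bar R) x : measurable_fun setT (fun q => H q.1 q.2) -> measurable_fun setT (H x).
  move=> mH; have h : measurable_fun setT (fun y : T2 => (x, y)) by apply: measurable_fun_pair.
  exact: (measurableT_comp mH h).
have mi (H : T1 -> T2 -> \bar R) : measurable_fun setT (fun q => H q.1 q.2) -> (forall x y, 0 <= H x y) -> measurable_fun setT (fun x => \I[m2]_y H x y).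
  by move=> mH H0; apply: measurable_Int.
move=> mF F0 mG G0; rewrite -(IntD _ (mi _ mF F0) (mi _ mG G0) (fun z => Int_ge0 _ (F0 z)) (fun z => Int_ge0 _ (G0 z))).
by apply: eq_Int => z; rewrite (IntD _ (mz _ z mF) (mz _ z mG) (F0 z) (G0 z)).
Qed.

Lemma Int2Z (k : R) (F : T1 -> T2 -> \bar R) : (0 <= k)%R -> (forall x y, 0 <= F x y) ->
  \I[m1]_x \I[m2]_y (k%:E * F x y) = k%:E * \I[m1]_x \I[m2]_y F x y.
Proof.
move=> k0 F0; rewrite -IntZ//; last by move=> x; exact: Int_ge0.
by apply: eq_Int => x; rewrite IntZ.
Qed.
End Int2.

Section screened.
Context {R : realType} (d : nat).
Local Notation Z := ('rV[R]_d * measurableTypeR R)%type.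
Variables (s p : R).
Hypotheses (p1 : 1 < p) (sp1 : 1 < s * p).
Notation gam := (gam d s p).

(** The exponent d + (s - 1/p) p equals [gam - 2], while for s + 1/p it equals [gam]. The two
    missing powers come from averaging over two columns whose height is proportional to |x - y|. *)
Lemma screened_le_pow (del f : 'rV[R]_d -> R) :
  (screened_le (s - p^-1) p del setT f `^ p =
   \I[mX d]_x \I[mX d]_y ((enorm (x - y) < del x)%R%:R * (`|f x - f y| `^ p * enorm (x - y) `^ (- (gam - 2))))%:E)%E.
Proof using p1.
have p0 : p != 0 by rewrite gt_eqF//; move: p1; lra.
rewrite /screened_le -poweRrM mulVf// poweRe1; last first.
  by apply: integral_ge0 => x _; apply: integral_ge0 => y _; rewrite lee_fin mulr_ge0 ?powR_ge0// invr_ge0 powR_ge0.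
rewrite IntX; apply: eq_integral => x _.
rewrite (@int_dom _ _ R (@lebesgue_rV R d) _ (fun y => enorm (x - y) < del x)) -?IntX; last first.
  by move=> y; split => [[]|].
apply: eq_Int => y; rewrite -powRN; congr ((_ * (_ * _ `^ _))%:E).
by rewrite /gam mulrBl mulVf// -natr1; ring.
Qed.

Lemma screened_ge_pow (del f : 'rV[R]_d -> R) : (forall x, 0 <= del x) ->
  (screened_ge (s + p^-1) p del setT f `^ p =
   \I[mX d]_x \I[mX d]_y ((~~ (enorm (x - y) < del x)%R)%:R * (del x * del y * (`|f x - f y| `^ p * enorm (x - y) `^ (- gam))))%:E)%E.
Proof using p1.
move=> del0; have p0 : p != 0 by rewrite gt_eqF//; move: p1; lra.
rewrite /screened_ge -poweRrM mulVf// poweRe1; last first.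
  apply: integral_ge0 => x _; apply: integral_ge0 => y _; rewrite lee_fin mulr_ge0 ?mulr_ge0 ?powR_ge0//.
  by rewrite invr_ge0 powR_ge0.
rewrite IntX; apply: eq_integral => x _.
rewrite (@int_dom _ _ R (@lebesgue_rV R d) _ (fun y => ~~ (enorm (x - y) < del x))) -?IntX; last first.
  by move=> y; split => [[_ /negP]|/negP].
apply: eq_Int => y; rewrite -powRN; congr ((_ * (_ * (_ * _ `^ _)))%:E).
by rewrite /gam mulrDl mulVf// -natr1; ring.
Qed.

Lemma jumpE (etam etap w fp fm : 'rV[R]_d -> R) : (forall x, w x = etap x - etam x) ->
  (jump etam etap s p fp fm = \I[mX d]_x (`|fp x - fm x| `^ p * w x `^ (- (s * p - 1)))%:E)%E.
Proof. by move=> wE; rewrite /jump -IntX; apply: eq_Int => x; rewrite powRN wE. Qed.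

End screened.

Section slices.
Context {R : realType} (d : nat).
Local Notation Z := ('rV[R]_d * measurableTypeR R)%type.
Variables (eta : 'rV[R]_d -> R) (sg : R).
Hypothesis sgE : sg * sg = 1.
Notation tau := (tau eta sg).

Lemma slice2 x y (a b : R) : 0 < a -> 0 < b ->
  (\I[mR]_t \I[mR]_t' (((0 < tau (x, t)) && (tau (x, t) < a))%:R * ((0 < tau (y, t')) && (tau (y, t') < b))%:R)%:E = (a * b)%:E)%E.
Proof using sgE.
move=> a0 b0; rewrite EFinM -(slice_len eta sgE x a0) -IntZr; [|exact: ltW|by move=> ?; nn].
apply: eq_Int => t; rewrite -(slice_len eta sgE y b0) -IntZ//.
Qed.

(** Lifts a boundary term K to the strip: it is averaged over a segment of height a in the column
    above x and one of height b in the column above y. *)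
Lemma slices_le (P : Z -> Z -> bool) (x y : 'rV[R]_d) (a b K : R) : 0 < a -> 0 < b -> 0 <= K ->
  (forall t t', 0 < tau (x, t) -> tau (x, t) < a -> 0 < tau (y, t') -> tau (y, t') < b -> P (x, t) (y, t')) ->
  ((a * b * K)%:E <= \I[mR]_t \I[mR]_t' ((P (x, t) (y, t'))%:R * K)%:E)%E.
Proof using sgE.
move=> a0 b0 K0 hP; rewrite EFinM -(slice2 x y a0 b0) -IntZr//; last by move=> t; nn.
apply: le_Int => t; first by nn.
rewrite -IntZr//.
apply: le_Int => t'; first by nn.
rewrite -EFinM lee_fin ler_wpM2r// indM ind_le// => /andP[/andP[h1 h2] /andP[h3 h4]]; exact: hP.
Qed.

Variable La : R.
Hypothesis eta_lip : forall x y, `|eta x - eta y| <= La * `|x - y|.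

Lemma rho_le_tau z z' : 0 < tau z -> 0 < tau z' -> rho z z' <= (1 + La) * `|z.1 - z'.1| + tau z + tau z'.
Proof using sgE eta_lip.
move=> t0 t0'; rewrite /rho.
have -> : (z.2 : R) - z'.2 = (eta z.1 - eta z'.1) - sg * tau z + sg * tau z'.
  by rewrite /tau !mulrA sgE !mul1r; ring.
have h := ler_normD (eta z.1 - eta z'.1 - sg * tau z) (sg * tau z').
have h' := ler_normB (eta z.1 - eta z'.1) (sg * tau z).
have h2 := eta_lip z.1 z'.1.
rewrite normrM (sg_abs sgE) mul1r (gtr0_norm t0) in h'; rewrite normrM (sg_abs sgE) mul1r (gtr0_norm t0') in h.
move: h h'.
move: h2; move: (`|eta z.1 - eta z'.1|) (`|eta z.1 - eta z'.1 - sg * tau z|) (`|eta z.1 - eta z'.1 - sg * tau z + sg * tau z'|) (tau z) (tau z') (`|z.1 - z'.1|) => *; lra.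
Qed.

End slices.

Section far.
Context {R : realType} (d : nat).
Local Notation Z := ('rV[R]_d * measurableTypeR R)%type.
Variables (s p : R).
Hypotheses (p1 : 1 < p) (sp1 : 1 < s * p).
Notation gam := (gam d s p).

(** For fixed z the kernel has mass of order [tau z ^ (- (s * p))] beyond the distance [c * tau z],
    which is exactly the Hardy weight. *)
Lemma far_l c : 0 < c -> exists2 C, 0 < C & forall (eta w : 'rV[R]_d -> R) (sg : R) (g : Z -> R), measurable_fun setT g -> (forall z, 0 <= g z) ->
  (\I[mZ d]_z \I[mZ d]_z' (((inO eta w sg) z)%:R * (g z * ((c * (tau eta sg) z <= rho z z')%R%:R * rho z z' `^ (- gam))))%:E
   <= C%:E * \I[mZ d]_z (((inO eta w sg) z)%:R * ((tau eta sg) z `^ (- (s * p)) * g z))%:E)%E.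
Proof using sp1.
move=> c0; have [C C0 hC] := tailZ d sp1.
exists (C * c `^ (- (s * p))); first by rewrite mulr_gt0// powR_gt0.
move=> eta w sg g mg g0; have k0 : 0 <= C * c `^ (- (s * p)) by rewrite mulr_ge0 ?powR_ge0// ltW.
rewrite -IntZR//; last by move=> z; have := g0 z => ?; nn.
apply: le_Int => z; first by have := g0 z => ?; nn.
have [/andP[t0 _]|_] := boolP ((inO eta w sg) z); last first.
  by rewrite mul0r mulr0; under eq_Int do rewrite mul0r; rewrite Int0.
under eq_Int do rewrite mul1r.
rewrite IntZR//; last by move=> z'; nn.
apply: (@le_trans _ _ ((g z)%:E * (C * (c * (tau eta sg) z) `^ (- (s * p)))%:E)%E).
  by apply: lee_wpmul2l; [rewrite lee_fin|apply: hC; rewrite mulr_gt0].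
rewrite -EFinM lee_fin powRM; [|exact: ltW|exact: ltW].
by rewrite mul1r le_eqVlt; apply/orP; left; apply/eqP; ring.
Qed.

Lemma far_r c : 0 < c -> exists2 C, 0 < C & forall (eta w : 'rV[R]_d -> R) (sg : R), measurable_fun setT eta -> measurable_fun setT w ->
  forall g : Z -> R, measurable_fun setT g -> (forall z, 0 <= g z) ->
  (\I[mZ d]_z \I[mZ d]_z' (((inO eta w sg) z')%:R * (g z' * ((c * (tau eta sg) z' <= rho z z')%R%:R * rho z z' `^ (- gam))))%:E
   <= C%:E * \I[mZ d]_z (((inO eta w sg) z)%:R * ((tau eta sg) z `^ (- (s * p)) * g z))%:E)%E.
Proof using sp1.
move=> c0; have [C C0 hC] := far_l c0; exists C => // eta w sg meta mw g mg g0.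
apply: le_trans (hC eta w sg g mg g0).
have mO := measurable_inO sg meta mw; have mtau := measurable_tau sg meta.
rewrite (@Int_swap _ _ _ _ _ (mZ d) (mZ d) (fun z z' => (((inO eta w sg) z')%:R * (g z' * ((c * (tau eta sg) z' <= rho z z')%R%:R * rho z z' `^ (- gam))))%:E)%E).
- rewrite le_eqVlt; apply/orP; left; apply/eqP.
  by apply: eq_Int => z; apply: eq_Int => z'; rewrite rhoC.
- by mm.
- by move=> z z'; have := g0 z' => ?; nn.
Qed.

Variables (La L : R).
Hypotheses (La0 : 0 <= La) (L0 : 0 < L).

(** Heights bounded by a multiple of |x - y| make [rho z z'] comparable to |x - y|, so the boundary
    kernel may be replaced by the interior one. In the splitting of f x - f y through u z and u z'
    the middle term is Gagliardo energy. The outer terms depend on one point each and are integrated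
    in the other by [far_l] and [far_r]. *)
Lemma jump_le (M : R) : 0 < M -> exists2 C, 0 < C & forall (eta w : 'rV[R]_d -> R) (sg : R), side La L eta w sg ->
  forall (P : Z -> Z -> bool) (u : Z -> R) (f : 'rV[R]_d -> R),
  measurable_fun setT (fun q : Z * Z => P q.1 q.2) -> measurable_fun setT u -> measurable_fun setT f ->
  (forall z z', P z z' -> [/\ (inO eta w sg) z, (inO eta w sg) z', (tau eta sg) z <= M * enorm (z.1 - z'.1) & (tau eta sg) z' <= M * enorm (z.1 - z'.1)]) ->
  (\I[mZ d]_z \I[mZ d]_z' ((P z z')%:R * (`|f z.1 - f z'.1| `^ p * enorm (z.1 - z'.1) `^ (- gam)))%:E
   <= C%:E * (gag s p (inO eta w sg) u + \I[mZ d]_z (((inO eta w sg) z)%:R * ((tau eta sg) z `^ (- (s * p)) * `|u z - f z.1| `^ p))%:E))%E.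
Proof using La0 p1 sp1.
(* From [tau z <= M * |x - y|] and [|x - y| <= d.+1%:R * rho z z'], so that the pair is far relative
   to both heights. *)
move=> M0; pose c := (M * d.+1%:R)^-1; have c0 : 0 < c by rewrite invr_gt0 mulr_gt0.
have [Cl Cl0 hl] := far_l c0; have [Cr Cr0 hr] := far_r c0.
(* By [rho_le_tau]: the displacement along the graph costs 1 + La and the two heights cost M
   each. *)
pose K := 1 + La + 2 * M; have K0 : 0 < K by rewrite /K; move: La0; lra.
pose k := 3 `^ p * K `^ gam; have k0 : 0 < k by rewrite mulr_gt0 ?powR_gt0.
exists (k * (Cl + 1 + Cr)); first by rewrite mulr_gt0// !addr_gt0.
move=> eta w sg sd P u f mP mu_ mf hP.
have [sgE eta_lip w_lip w_gt0 w_elip meta mw] := sd.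
have mO := measurable_inO sg meta mw; have mtau := measurable_tau sg meta.
pose g z := `|u z - f z.1| `^ p; have g0 z : 0 <= g z by exact: powR_ge0.
have mg : measurable_fun setT g by rewrite /g; mm.
pose A z z' := (((inO eta w sg) z)%:R * (g z * ((c * (tau eta sg) z <= rho z z')%R%:R * rho z z' `^ (- gam))))%:E.
pose B z z' := (((inO eta w sg) z')%:R * (g z' * ((c * (tau eta sg) z' <= rho z z')%R%:R * rho z z' `^ (- gam))))%:E.
pose U z z' := (((inO eta w sg) z)%:R * (((inO eta w sg) z')%:R * (`|u z - u z'| `^ p * rho z z' `^ (- gam))))%:E.
have A0 z z' : (0 <= A z z')%E by rewrite /A; have := g0 z => ?; nn.
have B0 z z' : (0 <= B z z')%E by rewrite /B; have := g0 z' => ?; nn.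
have U0 z z' : (0 <= U z z')%E by rewrite /U; nn.
have mA : measurable_fun setT (fun q : Z * Z => A q.1 q.2) by rewrite /A; mm.
have mB : measurable_fun setT (fun q : Z * Z => B q.1 q.2) by rewrite /B; mm.
have mU : measurable_fun setT (fun q : Z * Z => U q.1 q.2) by rewrite /U; mm.
apply: (@le_trans _ _ (\I[mZ d]_z \I[mZ d]_z' (k%:E * (A z z' + U z z' + B z z')))%E).
  apply: le_Int => z; first by nn.
  apply: le_Int => z'; first by nn.
  have [Pz|_] := boolP (P z z'); last first.
    by rewrite mul0r; apply: mule_ge0; [rewrite lee_fin ltW|apply: adde_ge0; [apply: adde_ge0|]].
  have [Oz Oz' t1 t2] := hP _ _ Pz; have /andP[tz _] := Oz; have /andP[tz' _] := Oz'.
  have n1 := norm_le_enorm (z.1 - z'.1).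
  have n2 : enorm (z.1 - z'.1) <= d.+1%:R * rho z z'.
    apply: le_trans (enorm_le_norm _) _; apply: ler_pM => //; first by rewrite ler_nat.
    by rewrite /rho lerDl.
  have f1 : c * (tau eta sg) z <= rho z z'.
    by rewrite /c mulrC ler_pdivrMr ?mulr_gt0//; apply: le_trans t1 _; rewrite mulrCA ler_pM2l// mulrC.
  have f2 : c * (tau eta sg) z' <= rho z z'.
    by rewrite /c mulrC ler_pdivrMr ?mulr_gt0//; apply: le_trans t2 _; rewrite mulrCA ler_pM2l// mulrC.
  have r0 : 0 < rho z z' by apply: lt_le_trans f1; rewrite mulr_gt0.
  have e0 : 0 < enorm (z.1 - z'.1) by rewrite -(pmulr_rgt0 _ M0); exact: lt_le_trans tz t1.
  have hrho : rho z z' <= K * enorm (z.1 - z'.1).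
    apply: le_trans (rho_le_tau sgE eta_lip tz tz') _.
    have n3 : (1 + La) * `|z.1 - z'.1| <= (1 + La) * enorm (z.1 - z'.1).
      by rewrite ler_wpM2l// addr_ge0.
    move: n3 t1 t2; rewrite /K; move: ((1 + La) * `|z.1 - z'.1|) (enorm (z.1 - z'.1)) ((tau eta sg) z) ((tau eta sg) z') => *; lra.
  have ke : enorm (z.1 - z'.1) `^ (- gam) <= K `^ gam * rho z z' `^ (- gam).
    have -> : enorm (z.1 - z'.1) = K^-1 * (K * enorm (z.1 - z'.1)) by rewrite mulrA mulVf ?mul1r// gt_eqF.
    have Ki : 0 <= K^-1 by rewrite invr_ge0 ltW.
    have Ke : 0 <= K * enorm (z.1 - z'.1) by rewrite mulr_ge0// ltW.
    rewrite powRM// -(@powR_inv1 _ K) ?(ltW K0)// -powRrM mulrNN mul1r ler_wpM2l ?powR_ge0//.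
    by rewrite powR_anti// ltW// gam_gt0.
  rewrite /A /B /U Oz Oz' f1 f2 !mul1r -!EFinD -EFinM lee_fin -!mulrDl /k mulrACA.
  apply: ler_pM => //; rewrite ?powR_ge0//.
  have p0 : 0 <= p := ltW (lt_trans ltr01 p1).
  have := dist3 (f z.1) (u z) (u z') (f z'.1) p0.
  by rewrite [`|f z.1 - u z|]distrC.
have k0' := ltW k0.
have AU0 z z' : (0 <= A z z' + U z z')%E by apply: adde_ge0.
have AUB0 z z' : (0 <= A z z' + U z z' + B z z')%E by apply: adde_ge0.
rewrite (Int2Z _ _ k0' AUB0).
have mAU : measurable_fun setT (fun q : Z * Z => A q.1 q.2 + U q.1 q.2)%E by exact: emeasurable_funD.
rewrite (Int2D _ _ mAU AU0 mB B0) (Int2D _ _ mA A0 mU U0) [in leRHS]EFinM -muleA.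
apply: lee_wpmul2l; first by rewrite lee_fin.
set H := (\I[mZ d]_z (((inO eta w sg) z)%:R * (_ * _))%:E)%E.
have H0 : (0 <= H)%E by apply: Int_ge0 => z; nn.
have G0 := gag_ge0 s p (inO eta w sg) u.
apply: (@le_trans _ _ (Cl%:E * H + gag s p (inO eta w sg) u + Cr%:E * H)%E).
  by apply: leeD; [apply: leeD => //; exact: hl|exact: hr].
by apply: three_term_le => //; exact: ltW.
Qed.

Lemma enorm_eq0 (x y : 'rV[R]_d) : enorm (x - y) = 0 -> x = y.
Proof.
move=> e0; have := norm_le_enorm (x - y); rewrite e0 => h.
by apply/eqP; rewrite -subr_eq0 -normr_eq0 eq_le h normr_ge0.
Qed.

Lemma measurable_tail (f : 'rV[R]_d -> R) : measurable_fun setT f -> forall (P : Z -> Z -> bool), measurable_fun setT (fun q : Z * Z => P q.1 q.2) ->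
  measurable_fun setT (fun q : Z * Z => ((P q.1 q.2)%:R * (`|f q.1.1 - f q.2.1| `^ p * enorm (q.1.1 - q.2.1) `^ (- gam)))%:E).
Proof. by move=> mf P mP; mm. Qed.

(** When |x - y| < w x / (2 L), segments of height L |x - y| fit into both columns: twice this
    height is below [w x], and [w y] is at least [w x - L * |x - y|]. Their product (L |x - y|)^2
    raises the exponent from [gam - 2] to [gam]. *)
Lemma screened_le_bound : exists2 C, 0 < C & forall (eta w : 'rV[R]_d -> R) (sg : R), side La L eta w sg ->
  forall (u : Z -> R) (f : 'rV[R]_d -> R),
  measurable_fun setT u -> measurable_fun setT f ->
  (\I[mX d]_x \I[mX d]_y ((enorm (x - y) < (w x / (2 * L)))%R%:R * (`|f x - f y| `^ p * enorm (x - y) `^ (- (gam - 2))))%:E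
   <= C%:E * (gag s p (inO eta w sg) u + \I[mZ d]_z (((inO eta w sg) z)%:R * ((tau eta sg) z `^ (- (s * p)) * `|u z - f z.1| `^ p))%:E))%E.
Proof using La0 p1 sp1 L0.
have [C C0 hC] := jump_le L0.
have L2 : 0 < L ^- 2 by rewrite invr_gt0 exprn_gt0.
exists (L ^- 2 * C); first exact: mulr_gt0.
move=> eta w sg sd u f mu_ mf.
have [sgE eta_lip w_lip w_gt0 w_elip meta mw] := sd.
 have mtau := measurable_tau sg meta.
pose e (z z' : Z) := enorm (z.1 - z'.1).
pose P z z' := (e z z' < (w z.1 / (2 * L))) && ((0 < (tau eta sg) z) && ((tau eta sg) z < L * e z z')) && ((0 < (tau eta sg) z') && ((tau eta sg) z' < L * e z z')).
have mP : measurable_fun setT (fun q : Z * Z => P q.1 q.2) by rewrite /P /e; mm.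
have := hC eta w sg sd P u f mP mu_ mf; rewrite EFinM -muleA => h.
apply: (@le_trans _ _ ((L ^- 2)%:E * \I[mZ d]_z \I[mZ d]_z' ((P z z')%:R * (`|f z.1 - f z'.1| `^ p * enorm (z.1 - z'.1) `^ (- gam)))%:E)%E); last first.
  apply: lee_wpmul2l; first by rewrite lee_fin ltW.
  apply: h => z z' /andP[/andP[h1 /andP[h2 h3]] /andP[h4 h5]].
  have h6 := w_elip z.1 z'.1; move: h1; rewrite ltr_pdivlMr ?mulr_gt0// => h1.
  rewrite ler_norml in h6; have /andP[_ h6'] := h6.
  rewrite /inO h2 h4 /=; rewrite /e in h1 h3 h5 *.
  split; [|
    |exact: ltW|exact: ltW]; apply: lt_trans (_ : L * enorm (z.1 - z'.1) < _) => //.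
    have := enorm_ge0 (z.1 - z'.1); move: h1 L0; move: (enorm _) (w z.1) => a b *; nra.
  move: h1 h6' h3 h2; move: (enorm _) (w z.1) (w z'.1) ((tau eta sg) z) => a b b' t *; nra.
rewrite fubini4; [|exact: measurable_tail|by move=> z z'; nn].
have L2' := ltW L2; rewrite -IntZ//; last by move=> x; nn.
apply: le_Int => x; first by nn.
rewrite -IntZ//; last by move=> y; nn.
apply: le_Int => y; first by nn.
have [hd|_] := boolP (enorm (x - y) < (w x / (2 * L))); last first.
  by rewrite mul0r mule_ge0 ?lee_fin//; nn.
have pn : p != 0 by rewrite gt_eqF//; move: p1; lra.
have [e0|e0] := eqVneq (enorm (x - y)) 0.
  rewrite [in leLHS](enorm_eq0 e0) subrr normr0 powR0// mul0r mulr0.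
  by rewrite mule_ge0 ?lee_fin//; nn.
have {}e0 : 0 < enorm (x - y) by rewrite lt_def e0 enorm_ge0.
have Le0 : 0 < L * enorm (x - y) by rewrite mulr_gt0.
have K0 : 0 <= `|f x - f y| `^ p * enorm (x - y) `^ (- gam) by nn.
apply: (@le_trans _ _ ((L ^- 2)%:E * (L * enorm (x - y) * (L * enorm (x - y)) * (`|f x - f y| `^ p * enorm (x - y) `^ (- gam)))%:E)%E).
  rewrite -EFinM lee_fin mul1r.
  have -> : - (gam - 2) = - gam + 1 + 1 by ring.
  rewrite !powRD_gt0// powRr1; last exact: ltW.
  rewrite le_eqVlt; apply/orP; left; apply/eqP; field; exact: lt0r_neq0.
apply: lee_wpmul2l; first by rewrite lee_fin.
apply: (slices_le (eta := eta) sgE (P := P)) => // t t' h1 h2 h3 h4.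
by rewrite /P /e /= hd h1 h2 h3 h4.
Qed.

(** When |x - y| >= w x / (2 L), the full columns are used and contribute [w x * w y]. Since
    [w x <= 2 * L * |x - y|], the Lipschitz bound gives [w y <= 3 * L * |x - y|], so both heights
    are of order |x - y|. *)
Lemma screened_ge_bound : exists2 C, 0 < C & forall (eta w : 'rV[R]_d -> R) (sg : R), side La L eta w sg ->
  forall (u : Z -> R) (f : 'rV[R]_d -> R),
  measurable_fun setT u -> measurable_fun setT f ->
  (\I[mX d]_x \I[mX d]_y ((~~ (enorm (x - y) < (w x / (2 * L)))%R)%:R * ((w x / (2 * L)) * (w y / (2 * L)) * (`|f x - f y| `^ p * enorm (x - y) `^ (- gam))))%:E
   <= C%:E * (gag s p (inO eta w sg) u + \I[mZ d]_z (((inO eta w sg) z)%:R * ((tau eta sg) z `^ (- (s * p)) * `|u z - f z.1| `^ p))%:E))%E.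
Proof using La0 p1 sp1 L0.
have L3 : 0 < 3 * L by rewrite mulr_gt0.
have [C C0 hC] := jump_le L3.
have L2 : 0 < (2 * L) ^- 2 by rewrite invr_gt0 exprn_gt0// mulr_gt0.
exists ((2 * L) ^- 2 * C); first exact: mulr_gt0.
move=> eta w sg sd u f mu_ mf.
have [sgE eta_lip w_lip w_gt0 w_elip meta mw] := sd.
 have mtau := measurable_tau sg meta; have mO := measurable_inO sg meta mw.
pose e (z z' : Z) := enorm (z.1 - z'.1).
pose P z z' := ~~ (e z z' < (w z.1 / (2 * L))) && (inO eta w sg) z && (inO eta w sg) z'.
have mP : measurable_fun setT (fun q : Z * Z => P q.1 q.2) by rewrite /P /e; mm.
have := hC eta w sg sd P u f mP mu_ mf; rewrite EFinM -muleA => h.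
apply: (@le_trans _ _ (((2 * L) ^- 2)%:E * \I[mZ d]_z \I[mZ d]_z' ((P z z')%:R * (`|f z.1 - f z'.1| `^ p * enorm (z.1 - z'.1) `^ (- gam)))%:E)%E); last first.
  apply: lee_wpmul2l; first by rewrite lee_fin ltW.
  apply: h => z z' /andP[/andP[h1 Oz] Oz'].
  have h6 := w_elip z.1 z'.1; move: h1; rewrite -leNgt ler_pdivrMr ?mulr_gt0// => h1.
  rewrite ler_norml in h6; have /andP[h6' _] := h6.
  have /andP[_ h2] := Oz; have /andP[_ h4] := Oz'.
  have e0 := enorm_ge0 (z.1 - z'.1); rewrite /e in h1.
  have Le : 0 <= L * enorm (z.1 - z'.1) by rewrite mulr_ge0// ltW.
  by split => //; move: h1 h6' h2 h4 Le; move: (enorm _) (w z.1) (w z'.1) ((tau eta sg) z) ((tau eta sg) z') => a b b' t t' *; lra.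
rewrite fubini4; [|exact: measurable_tail|by move=> z z'; nn].
have L2' := ltW L2; rewrite -IntZ//; last by move=> x; nn.
have d0 x : 0 <= (w x / (2 * L)) by rewrite divr_ge0 ?mulr_ge0// ltW.
apply: le_Int => x; first by have := d0 x => ?; apply: Int_ge0 => y; have := d0 y => ?; nn.
rewrite -IntZ//; last by move=> y; nn.
apply: le_Int => y; first by have := d0 x => ?; have := d0 y => ?; nn.
have [hd|_] := boolP (~~ (enorm (x - y) < (w x / (2 * L)))); last first.
  by rewrite mul0r mule_ge0 ?lee_fin//; nn.
have K0 : 0 <= `|f x - f y| `^ p * enorm (x - y) `^ (- gam) by nn.
apply: (@le_trans _ _ (((2 * L) ^- 2)%:E * (w x * w y * (`|f x - f y| `^ p * enorm (x - y) `^ (- gam)))%:E)%E).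
  rewrite -EFinM lee_fin mul1r le_eqVlt; apply/orP; left; apply/eqP; field; exact: lt0r_neq0.
apply: lee_wpmul2l; first by rewrite lee_fin.
apply: (slices_le (eta := eta) sgE (P := P)) => // t t' h1 h2 h3 h4.
by rewrite /P /e /= hd /inO h1 h2 h3 h4.
Qed.
End far.

Section jump.
Context {R : realType} (d : nat).
Local Notation Z := ('rV[R]_d * measurableTypeR R)%type.
Variables (s p : R).
Hypotheses (p1 : 1 < p) (sp1 : 1 < s * p).
Variables (eta eta' w : 'rV[R]_d -> R) (sg sg' : R).
Hypotheses (sgE : sg * sg = 1) (w_gt0 : forall x, 0 < w x).
Hypotheses (meta : measurable_fun setT eta) (meta' : measurable_fun setT eta') (mw : measurable_fun setT w).
Hypothesis OO : forall z, inO eta w sg z = inO eta' w sg' z.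

(** The difference of the traces is constant along a column, so its weight w^(1 - sp) is the
    integral of w^(-sp) over the column; and w^(-sp) is at most the Hardy weight of either graph, as
    heights are below w. *)
Lemma jump_bound (u : Z -> R) (f f' : 'rV[R]_d -> R) : measurable_fun setT u -> measurable_fun setT f -> measurable_fun setT f' ->
  (\I[mX d]_x (`|f x - f' x| `^ p * w x `^ (- (s * p - 1)))%:E
   <= (2 `^ p)%:E * (\I[mZ d]_z ((inO eta w sg z)%:R * (tau eta sg z `^ (- (s * p)) * `|u z - f z.1| `^ p))%:E +
      \I[mZ d]_z ((inO eta' w sg' z)%:R * (tau eta' sg' z `^ (- (s * p)) * `|u z - f' z.1| `^ p))%:E))%E.
Proof using p1 sp1 sgE w_gt0 meta meta' mw OO.
move=> mu_ mf mf'; have mO := measurable_inO sg meta mw; have mtau := measurable_tau sg meta.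
have mO' := measurable_inO sg' meta' mw; have mtau' := measurable_tau sg' meta'.
pose F x := w x `^ (- (s * p)) * `|f x - f' x| `^ p.
have F0 x : 0 <= F x by rewrite /F; nn.
have mF : measurable_fun setT F by rewrite /F; mm.
have -> : (\I[mX d]_x (`|f x - f' x| `^ p * w x `^ (- (s * p - 1)))%:E = \I[mX d]_x (w x * F x)%:E)%E.
  apply: eq_Int => x; congr (_%:E); rewrite /F.
  have -> : - (s * p - 1) = - (s * p) + 1 by ring.
  by rewrite powRD_gt0// powRr1 ?(ltW (w_gt0 x))//; ring.
rewrite -(Int_inO sgE w_gt0 meta mw mF F0).
pose A z := ((inO eta w sg z)%:R * (tau eta sg z `^ (- (s * p)) * `|u z - f z.1| `^ p))%:E.
pose B z := ((inO eta' w sg' z)%:R * (tau eta' sg' z `^ (- (s * p)) * `|u z - f' z.1| `^ p))%:E.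
have A0 z : (0 <= A z)%E by rewrite /A; nn.
have B0 z : (0 <= B z)%E by rewrite /B; nn.
have mA : measurable_fun setT A by rewrite /A; mm.
have mB : measurable_fun setT B by rewrite /B; mm.
rewrite -(IntD _ mA mB A0 B0) -IntZ ?powR_ge0//; last by move=> z; exact: adde_ge0.
apply: le_Int => z; first by have := F0 z.1 => ?; nn.
rewrite /A /B -OO; have [Oz|_] := boolP (inO eta w sg z); last first.
  by rewrite !mul0r; apply: mule_ge0; [rewrite lee_fin powR_ge0|exact: adde_ge0].
have Oz' := Oz; rewrite OO in Oz'; have /andP[t0 tw] := Oz; have /andP[t0' tw'] := Oz'.
rewrite !mul1r -EFinD -EFinM lee_fin /F.
have p0 : 0 <= p := ltW (lt_trans ltr01 p1).
have sp0 : 0 <= s * p by move: sp1; lra.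
apply: le_trans (ler_wpM2l (powR_ge0 _ _) (dist2 (f z.1) (u z) (f' z.1) p0)) _.
rewrite mulrCA ler_wpM2l ?powR_ge0// mulrDr distrC; apply: lerD; apply: ler_wpM2r; rewrite ?powR_ge0//; apply: powR_anti => //; exact: ltW.
Qed.
End jump.

(** * Weighted averages *)

HB.lock Definition RI dsp (T : measurableType dsp) (R : realType)
  (m : {sigma_finite_measure set T -> \bar R}) (F : T -> R) : R := (\int[m]_x F x)%R.

Section RI.
Context d (T : measurableType d) (R : realType) (m : {sigma_finite_measure set T -> \bar R}).
Implicit Types (F G u f : T -> R).

Lemma eq_RI F G : (forall x, F x = G x) -> RI m F = RI m G.
Proof. by move=> /funext ->. Qed.

Lemma RI_integrable F : measurable_fun setT F -> (\I[m]_x (`|F x|)%:E < +oo)%E -> m.-integrable setT (EFin \o F).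
Proof.
move=> mF iF; apply/integrableP; split; first exact/measurable_EFinP.
by move: iF; rewrite IntE.
Qed.

Lemma RI_lin (a : R) F G : measurable_fun setT F -> (\I[m]_x (`|F x|)%:E < +oo)%E ->
  measurable_fun setT G -> (\I[m]_x (`|G x|)%:E < +oo)%E ->
  RI m (fun x => a * F x + G x) = a * RI m F + RI m G.
Proof.
move=> mF iF mG iG; have iF' := RI_integrable mF iF; have iG' := RI_integrable mG iG.
rewrite unlock RintegralD//; last first.
  apply: RI_integrable; first by mm.
  apply: (@le_lt_trans _ _ (`|a|%:E * \I[m]_x (`|F x|)%:E)%E).
    rewrite -IntZ//; apply: le_Int => x; first by nn.
    by rewrite -EFinM lee_fin normrM.
  by apply: lte_mul_pinfty => //; rewrite lee_fin.
by rewrite RintegralZl.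
Qed.

Lemma RI_norm F : measurable_fun setT F -> (\I[m]_x (`|F x|)%:E < +oo)%E -> ((`|RI m F|)%:E <= \I[m]_x (`|F x|)%:E)%E.
Proof.
move=> mF iF; have iF' := RI_integrable mF iF.
rewrite unlock EFin_normr_Rintegral// IntE.
by apply: (le_abse_integral m _ (measurable_int _ iF')) => //; exact: measurableT.
Qed.

Lemma RI_cst_ge0 F (c : R) : (forall x, 0 <= F x) -> (\I[m]_x (F x)%:E = c%:E)%E -> RI m F = c.
Proof. by move=> F0 h; rewrite RI.unlock /Rintegral -IntE h. Qed.

Variables (phi : T -> R) (c : R).
Hypotheses (mphi : measurable_fun setT phi) (phi0 : forall x, 0 <= phi x) (phic : (\I[m]_x (phi x)%:E = c%:E)%E).

Lemma int_norm_weight u : (\I[m]_x (`|phi x * u x|)%:E = \I[m]_x (phi x * `|u x|)%:E)%E.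
Proof using phi0. by apply: eq_Int => x; rewrite normrM ger0_norm. Qed.

Lemma wavg_const u a : measurable_fun setT u -> (\I[m]_x (phi x * `|u x|)%:E < +oo)%E ->
  ((`|RI m (fun x => phi x * u x) - c * a|)%:E <= \I[m]_x (phi x * `|u x - a|)%:E)%E.
Proof using mphi phi0 phic.
move=> mu_ iu; rewrite -int_norm_weight in iu.
have iphi : (\I[m]_x (`|phi x|)%:E < +oo)%E.
  by under eq_Int do rewrite ger0_norm//; rewrite phic ltry.
have mu2 : measurable_fun setT (fun x => phi x * u x) by mm.
have E : RI m (fun x => phi x * u x) - c * a = RI m (fun x => phi x * (u x - a)).
  rewrite -(RI_cst_ge0 phi0 phic) addrC -mulNr mulrC mulrN -mulNr -(RI_lin _ mphi iphi mu2 iu).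
  by apply: eq_RI => x; ring.
have [->|hfin] := eqVneq (\I[m]_x (phi x * `|u x - a|)%:E)%E +oo%E; first exact: leey.
rewrite E; apply: le_trans (RI_norm _ _) _; [by mm| |].
  by rewrite int_norm_weight ltey.
by rewrite int_norm_weight.
Qed.

(** The deviation of a weighted mean from a is at most the mean deviation; the weight is dominated
    by [e] times an indicator, which puts the bound in the form required by [Iavg_power]. *)
Lemma wavg_pow u a (p e : R) (b : T -> bool) (M : R) : 1 < p -> 0 < c -> 0 < e -> 0 < M -> measurable_fun setT b ->
  (forall x, phi x <= e * (b x)%:R) -> (\I[m]_x (b x)%:R%:E <= M%:E)%E ->
  measurable_fun setT u -> (\I[m]_x (phi x * `|u x|)%:E < +oo)%E ->
  ((`|c^-1 * RI m (fun x => phi x * u x) - a| `^ p)%:E <= ((e / c) `^ p * 2 `^ p * M `^ (p - 1))%:E * \I[m]_x ((b x)%:R * `|u x - a| `^ p)%:E)%E.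
Proof using mphi phi0 phic.
move=> p1 c0 e0 M0 mb hphi hM mu_ iu.
apply: Iavg_power => //; first by rewrite divr_gt0.
  by mm.
have -> : c^-1 * RI m (fun x => phi x * u x) - a = c^-1 * (RI m (fun x => phi x * u x) - c * a).
  by field; rewrite gt_eqF.
have ci : 0 <= c^-1 by rewrite invr_ge0 ltW.
rewrite normrM ger0_norm// EFinM [(e / c)%:E]EFinM [(e%:E * _)%E]muleC -muleA.
apply: lee_wpmul2l; first by rewrite lee_fin.
apply: le_trans (wavg_const a mu_ iu) _; have e0' := ltW e0; rewrite -IntZ//.
apply: le_Int => x; first by have := phi0 x => ?; nn.
by rewrite -EFinM lee_fin mulrA ler_wpM2r.
Qed.

Variable psi : T -> R.
Hypotheses (mpsi : measurable_fun setT psi) (psi0 : forall x, 0 <= psi x) (psic : (\I[m]_x (psi x)%:E = c%:E)%E).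

(** As the two weights have the same mass, their difference integrates to 0 and any constant a may
    be subtracted from u. *)
Lemma wavg_diff u a : measurable_fun setT u -> (\I[m]_x (phi x * `|u x|)%:E < +oo)%E -> (\I[m]_x (psi x * `|u x|)%:E < +oo)%E ->
  ((`|RI m (fun x => phi x * u x) - RI m (fun x => psi x * u x)|)%:E <= \I[m]_x (`|phi x - psi x| * `|u x - a|)%:E)%E.
Proof using mphi phi0 phic mpsi psi0 psic.
move=> mu_ iu iu'; have iu2 := iu; have iu2' := iu'; rewrite -int_norm_weight in iu2.
have iuE : (\I[m]_x (`|psi x * u x|)%:E = \I[m]_x (psi x * `|u x|)%:E)%E.
  by apply: eq_Int => x; rewrite normrM ger0_norm.
rewrite -iuE in iu2'.
have iphi : (\I[m]_x (`|phi x|)%:E < +oo)%E.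
  by under eq_Int do rewrite ger0_norm//; rewrite phic ltry.
have ipsi : (\I[m]_x (`|psi x|)%:E < +oo)%E.
  by under eq_Int do rewrite ger0_norm//; rewrite psic ltry.
have mu1 : measurable_fun setT (fun x => phi x * u x) by mm.
have mu2 : measurable_fun setT (fun x => psi x * u x) by mm.
pose A x := -1 * (psi x * u x) + phi x * u x.
pose B x := -1 * psi x + phi x.
have mA : measurable_fun setT A by rewrite /A; mm.
have mB : measurable_fun setT B by rewrite /B; mm.
have iA : (\I[m]_x (`|A x|)%:E < +oo)%E.
  apply: (@le_lt_trans _ _ (\I[m]_x ((`|psi x * u x|)%:E + (`|phi x * u x|)%:E)))%E.
    apply: le_Int => x; first by nn.
    by rewrite -EFinD lee_fin; apply: le_trans (ler_normD _ _) _; rewrite mulN1r normrN.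
  by rewrite IntD ?lte_add_pinfty//; mm.
have iB : (\I[m]_x (`|B x|)%:E < +oo)%E.
  apply: (@le_lt_trans _ _ (\I[m]_x ((`|psi x|)%:E + (`|phi x|)%:E)))%E.
    apply: le_Int => x; first by nn.
    by rewrite -EFinD lee_fin; apply: le_trans (ler_normD _ _) _; rewrite mulN1r normrN.
  by rewrite IntD ?lte_add_pinfty//; mm.
have eA : RI m A = -1 * RI m (fun x => psi x * u x) + RI m (fun x => phi x * u x) by exact: RI_lin.
have eB : RI m B = -1 * RI m psi + RI m phi by exact: RI_lin.
rewrite (RI_cst_ge0 phi0 phic) (RI_cst_ge0 psi0 psic) mulN1r addNr in eB.
have E : RI m (fun x => phi x * u x) - RI m (fun x => psi x * u x) = RI m (fun x => (phi x - psi x) * (u x - a)).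
  have -> : RI m (fun x => (phi x - psi x) * (u x - a)) = - a * RI m B + RI m A.
    by rewrite -RI_lin//; apply: eq_RI => x; rewrite /A /B; ring.
  by rewrite eB eA; ring.
rewrite E -[X in (_ <= X)%E](eq_Int _ (fun x => congr1 EFin (normrM _ _))).
have [->|hfin] := eqVneq (\I[m]_x (`|(phi x - psi x) * (u x - a)|)%:E)%E +oo%E; first exact: leey.
by apply: RI_norm; [mm|rewrite ltey].
Qed.
End RI.

Section RIm.
Context d1 d2 (T1 : measurableType d1) (T2 : measurableType d2) (R : realType).
Variable m2 : {sigma_finite_measure set T2 -> \bar R}.
Lemma measurable_RI (f : T1 -> T2 -> R) : measurable_fun setT (fun q => f q.1 q.2) ->
  measurable_fun setT (fun x => RI m2 (f x)).
Proof.
move=> mf; rewrite (_ : (fun x => _) = (fun x => fine (\int[m2]_y ((f x y)%:E))%E)); last first.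
  by apply/funext => x; rewrite unlock.
apply: (@measurableT_comp _ _ _ _ _ _ (@fine R)) => //.
rewrite (_ : (fun x => _) = (fun x => (\I[m2]_y (Num.max (f x y) 0)%:E - \I[m2]_y (Num.max (- f x y) 0)%:E)%E)); last first.
  apply/funext => x; rewrite integralE !IntE; congr (_ - _)%E; apply: eq_integral => y _.
    by rewrite funepos.unlock EFin_max.
  by rewrite funeneg.unlock EFin_max.
have m0 x : 0 <= Num.max x 0 :> R by rewrite le_max lexx orbT.
apply: emeasurable_funB.
  by apply: (@measurable_Int _ _ _ _ _ m2 (fun x y => (Num.max (f x y) 0)%:E)) => [|x y]; [mm|rewrite lee_fin].
by apply: (@measurable_Int _ _ _ _ _ m2 (fun x y => (Num.max (- f x y) 0)%:E)) => [|x y]; [mm|rewrite lee_fin].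
Qed.
End RIm.

Section RIshift.
Context {R : realType} (d : nat).
Local Notation Z := ('rV[R]_d * measurableTypeR R)%type.
Lemma RI_shift (z0 : Z) (F : Z -> R) : measurable_fun setT F ->
  RI (mZ d) (fun z => F (z.1 + z0.1, (z.2 : R) + z0.2)) = RI (mZ d) F.
Proof.
move=> mF; rewrite unlock /Rintegral; congr fine.
have m0 x : 0 <= Num.max x 0 :> R by rewrite le_max lexx orbT.
have pos (G : Z -> R) : (\int[mZ d]_x ((EFin \o G)^\+)%E x = \I[mZ d]_x (Num.max (G x) 0)%:E)%E.
  by rewrite IntE; apply: eq_integral => y _; rewrite funepos.unlock EFin_max.
have neg (G : Z -> R) : (\int[mZ d]_x ((EFin \o G)^\-)%E x = \I[mZ d]_x (Num.max (- G x) 0)%:E)%E.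
  by rewrite IntE; apply: eq_integral => y _; rewrite funeneg.unlock EFin_max.
rewrite integralE [RHS]integralE !pos !neg; congr (_ - _)%E.
  have := @IntZ_affine R d 1 z0.1 (fun=> z0.2 : R) (fun x => (Num.max (F x) 0)%:E) ltr01.
  rewrite invr1 mul1e => <-; [|mm|mm|by move=> z; rewrite lee_fin].
  by apply: eq_Int => z; rewrite mul1r.
have := @IntZ_affine R d 1 z0.1 (fun=> z0.2 : R) (fun x => (Num.max (- F x) 0)%:E) ltr01.
rewrite invr1 mul1e => <-; [|mm|mm|by move=> z; rewrite lee_fin].
by apply: eq_Int => z; rewrite mul1r.
Qed.
End RIshift.

(** * Mollification *)

Section bump.
Context {R : realType} (d : nat).
Local Notation Z := ('rV[R]_d * measurableTypeR R)%type.
Implicit Types (z : Z) (u : Z -> R).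

(** A cone rather than an indicator: its Lipschitz dependence on the centre makes the averages
    continuous. *)
Definition bump (e : R) z z' : R := Num.max 0 (e - rho z z').
Definition shiftZ z0 z : Z := (z.1 + z0.1, (z.2 : R) + z0.2).
Definition ball_ind (e : R) z z' : bool := rho z z' < e.

Lemma bump_ge0 e z z' : 0 <= bump e z z'. Proof. by rewrite le_max lexx. Qed.
Lemma bump_le e z z' : 0 < e -> bump e z z' <= e * (ball_ind e z z')%:R.
Proof.
move=> e0; rewrite /bump /ball_ind; have := rho_ge0 z z'; move: (rho z z') => r r0.
have [h|h] := ltP r e; last by rewrite max_l ?mulr0//; lra.
by rewrite mulr1 max_r; lra.
Qed.
Lemma bump_ge e z z' : 0 < e -> e / 2 * (ball_ind (e / 2) z z')%:R <= bump e z z'.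
Proof.
move=> e0; rewrite /bump /ball_ind; have := rho_ge0 z z'; move: (rho z z') => r r0.
have [h|h] := ltP r (e / 2); last by rewrite mulr0 le_max lexx.
by rewrite mulr1 le_max; apply/orP; right; lra.
Qed.
Lemma bump_lip e z0 z1 z' : 0 < e ->
  `|bump e z0 z' - bump e z1 z'| <= rho z0 z1 * (ball_ind e z0 z' || ball_ind e z1 z')%:R.
Proof.
move=> e0; rewrite /bump /ball_ind; have := rho_tri z0 z1 z'; have := rho_tri z1 z0 z'; rewrite (rhoC z1 z0).
move: (rho z0 z') (rho z1 z') (rho z0 z1) => a b r h1 h2.
have [ha|ha] := ltP a e; have [hb|hb] := ltP b e; rewrite /= ?mulr1 ?mulr0 ler_norml.
- by rewrite !max_r; [apply/andP; split; lra|lra|lra].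
- by rewrite max_r ?max_l; [apply/andP; split; lra|lra|lra].
- by rewrite max_l ?max_r; [apply/andP; split; lra|lra|lra].
- by rewrite !max_l ?subrr ?oppr0 ?lexx//; lra.
Qed.
Lemma measurable_bump e : measurable_fun setT (fun q : Z * Z => bump e q.1 q.2).
Proof. by rewrite /bump; mm. Qed.
Lemma measurable_bump_section e z : measurable_fun setT (bump e z).
Proof. by rewrite /bump; mm. Qed.
Lemma measurable_shiftZ z0 : measurable_fun setT (shiftZ z0).
Proof. by rewrite /shiftZ; mm. Qed.
Lemma rho_shift z0 z z' : rho (shiftZ z0 z) (shiftZ z0 z') = rho z z'.
Proof. by rewrite /rho /shiftZ /=; congr (_ + _); congr (`|_|); rewrite opprD addrACA subrr addr0. Qed.

Lemma Int_shift z0 (F : Z -> \bar R) : measurable_fun setT F -> (forall z, 0 <= F z)%E ->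
  (\I[mZ d]_z F (shiftZ z0 z) = \I[mZ d]_z F z)%E.
Proof.
move=> mF F0; have := @IntZ_affine R d 1 z0.1 (fun=> z0.2 : R) F ltr01.
rewrite invr1 mul1e => <-; [|mm|done|done].
by apply: eq_Int => z; rewrite mul1r.
Qed.

Definition mass (e : R) : R := fine (\I[mZ d]_z (bump e (0, 0%R) z)%:E)%E.
Lemma shiftZ0 z : shiftZ z (0, 0%R) = z.
Proof. by case: z => x t; rewrite /shiftZ /= !add0r. Qed.

Lemma ball_vol e z : 0 < e -> (\I[mZ d]_z' (ball_ind e z z')%:R%:E <= ((2 * e) ^+ d.+1)%:E)%E.
Proof.
by move=> e0; rewrite -(@eq_Int _ _ _ _ (fun z' => (rho z' z < e)%R%:R%:E)) ?IvolZ_le// => z'; rewrite rhoC.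
Qed.

Lemma massE e z : 0 < e -> (\I[mZ d]_z' (bump e z z')%:E = (mass e)%:E)%E.
Proof.
move=> e0; have mb := measurable_bump_section e z.
have -> : (\I[mZ d]_z' (bump e z z')%:E = \I[mZ d]_z' (bump e (0, 0%R) z')%:E)%E.
  rewrite -(@Int_shift z (fun z' => (bump e z z')%:E)); [|by mm|by move=> z'; rewrite lee_fin bump_ge0].
  by apply: eq_Int => z'; rewrite /bump -{1}(shiftZ0 z) rho_shift.
rewrite /mass fineK// ge0_fin_numE; last by apply: Int_ge0 => z'; rewrite lee_fin bump_ge0.
apply: (@le_lt_trans _ _ (e%:E * \I[mZ d]_z' (ball_ind e (0%R, 0%R) z')%:R%:E)%E).
  have e0' := ltW e0; rewrite -IntZ//; apply: le_Int => z'; first by rewrite lee_fin bump_ge0.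
  by rewrite -EFinM lee_fin bump_le.
apply: lte_mul_pinfty; rewrite ?lee_fin ?ltW//.
by apply: le_lt_trans (ball_vol _ e0) _; exact: ltry.
Qed.

Lemma mass_ge e : 0 < e -> e / 2 * (e / 2) ^+ d.+1 <= mass e.
Proof.
move=> e0; have e2 : 0 < e / 2 by lra.
rewrite -lee_fin -(massE (0, 0%R) e0) EFinM.
apply: (@le_trans _ _ ((e / 2)%:E * \I[mZ d]_z' (ball_ind (e / 2) (0%R, 0%R) z')%:R%:E)%E).
  apply: lee_wpmul2l; first by rewrite lee_fin ltW.
  by rewrite -(@eq_Int _ _ _ _ (fun z' => (rho z' (0%R, 0%R) < e / 2)%R%:R%:E)) ?IvolZ_ge// => z'; rewrite rhoC.
have e2' := ltW e2; rewrite -IntZ//; apply: le_Int => z'; first by nn.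
by rewrite -EFinM lee_fin bump_ge.
Qed.

Lemma mass_gt0 e : 0 < e -> 0 < mass e.
Proof. by move=> e0; apply: lt_le_trans (mass_ge e0); rewrite mulr_gt0 ?exprn_gt0//; lra. Qed.

Definition avg (e : R) u z0 : R := (mass e)^-1 * RI (mZ d) (fun z' => bump e z0 z' * u z').

Lemma measurable_avg e u : measurable_fun setT u -> measurable_fun setT (avg e u).
Proof.
move=> mu_; rewrite /avg; apply: measurable_funM => //.
apply: (@measurable_RI _ _ _ _ _ (mZ d) (fun z0 z' => bump e z0 z' * u z')).
by have := measurable_bump e => h; apply: measurable_funM => //; mm.
Qed.

Definition locint e u z0 := (\I[mZ d]_z' ((ball_ind e z0 z')%:R * `|u z'|)%:E < +oo)%E.

Lemma locint_bump e u z0 : 0 < e -> locint e u z0 -> (\I[mZ d]_z' (bump e z0 z' * `|u z'|)%:E < +oo)%E.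
Proof.
move=> e0 h; apply: (@le_lt_trans _ _ (e%:E * \I[mZ d]_z' ((ball_ind e z0 z')%:R * `|u z'|)%:E)%E).
  have e0' := ltW e0; rewrite -IntZ//; apply: le_Int => z'; first by have := bump_ge0 e z0 z' => ?; nn.
  by rewrite -EFinM lee_fin mulrA ler_wpM2r// bump_le.
by apply: lte_mul_pinfty => //; rewrite lee_fin ltW.
Qed.

Variables (p : R).
Hypothesis p1 : 1 < p.
Definition avgC : R := (2 ^+ d.+2) `^ p * 2 `^ p * (2 ^+ d.+1) `^ (p - 1).

Lemma avgC_gt0 : 0 < avgC.
Proof. by rewrite /avgC !mulr_gt0// powR_gt0// exprn_gt0. Qed.

(** By [mass_ge], [e / mass e] is at most 2^(d+2) e^(-(d+1)); the exponents of e then add up to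
    -(d+1) p + (d+1)(p - 1) = -(d+1). *)
Lemma avgC_le e : 0 < e -> (e / mass e) `^ p * 2 `^ p * ((2 * e) ^+ d.+1) `^ (p - 1) <= avgC * e ^- d.+1.
Proof using p1.
move=> e0; have m0 := mass_gt0 e0; have mg := mass_ge e0.
have ed : 0 < e ^+ d.+1 by rewrite exprn_gt0.
have p0 : 0 <= p by move: p1; lra.
have h : e / mass e <= 2 ^+ d.+2 * e ^- d.+1.
  rewrite ler_pdivrMr// ; apply: le_trans (_ : 2 ^+ d.+2 * e ^- d.+1 * (e / 2 * (e / 2) ^+ d.+1) <= _); last first.
    by rewrite ler_wpM2l// mulr_ge0 ?exprn_ge0// invr_ge0 exprn_ge0// ltW.
  rewrite expr_div_n le_eqVlt; apply/orP; left; apply/eqP; rewrite [2 ^+ d.+2]exprS; field.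
  by rewrite !expf_neq0// gt_eqF.
have h2 : (e / mass e) `^ p <= (2 ^+ d.+2) `^ p * (e ^- d.+1) `^ p.
  have e1 : 0 <= e ^- d.+1 by rewrite invr_ge0 ltW.
  by rewrite -powRM ?exprn_ge0//; apply: powR_mono => //; rewrite divr_ge0// ltW.
rewrite /avgC exprMn; have ed' := ltW ed; have e0' := ltW e0; rewrite [(2 ^+ d.+1 * _) `^ _]powRM ?exprn_ge0//.
have -> : ((2 : R) ^+ d.+2) `^ p * 2 `^ p * (2 ^+ d.+1) `^ (p - 1) * e ^- d.+1 =
  (((2 : R) ^+ d.+2) `^ p * (e ^- d.+1) `^ p) * 2 `^ p * ((2 ^+ d.+1) `^ (p - 1) * (e ^+ d.+1) `^ (p - 1)).
  have {1}-> : e ^- d.+1 = (e ^- d.+1) `^ p * (e ^+ d.+1) `^ (p - 1).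
    rewrite -(@powR_inv1 _ (e ^+ d.+1))// -powRrM -powRD_gt0// mulN1r; congr (_ `^ _); ring.
  move: ((e ^- d.+1) `^ p) ((e ^+ d.+1) `^ (p - 1)) (((2 : R) ^+ d.+2) `^ p) (2 `^ p) ((2 ^+ d.+1) `^ (p - 1)) => a1 a2 a3 a4 a5.
  by ring.
by rewrite ler_wpM2r ?mulr_ge0 ?powR_ge0// ler_wpM2r ?powR_ge0.
Qed.

Lemma avg_pow e u z0 a : 0 < e -> measurable_fun setT u -> locint e u z0 ->
  ((`|avg e u z0 - a| `^ p)%:E <= (avgC * e ^- d.+1)%:E * \I[mZ d]_z' ((ball_ind e z0 z')%:R * `|u z' - a| `^ p)%:E)%E.
Proof using p1.
move=> e0 mu_ lu; have M0 : 0 < (2 * e) ^+ d.+1 by rewrite exprn_gt0// mulr_gt0.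
have mb : measurable_fun setT (ball_ind e z0) by rewrite /ball_ind; mm.
have := @wavg_pow _ _ _ (mZ d) _ _ (measurable_bump_section e z0) (bump_ge0 e z0) (massE z0 e0) u a p e _ _ p1 (mass_gt0 e0) e0 M0 mb (fun x => bump_le z0 x e0) (ball_vol z0 e0) mu_ (locint_bump e0 lu).
move=> h; apply: (le_trans h); apply: lee_wpmul2r; first by apply: Int_ge0 => z'; nn.
by rewrite lee_fin avgC_le.
Qed.

Lemma avg_shift e u z0 : measurable_fun setT u ->
  RI (mZ d) (fun z' => bump e z0 z' * u z') = RI (mZ d) (fun h => bump e (0, 0%R) h * u (shiftZ z0 h)).
Proof.
move=> mu_; rewrite -(@RI_shift R d z0 (fun z' => bump e z0 z' * u z')); last first.
  by have := measurable_bump_section e z0 => h; mm.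
by apply: eq_RI => z; rewrite /bump -{1}(shiftZ0 z0) rho_shift.
Qed.

Lemma locint_shift e u z0 : measurable_fun setT u -> locint e u z0 -> locint e (fun h => u (shiftZ z0 h)) (0, 0%R).
Proof.
move=> mu_; rewrite /locint -(@Int_shift z0); last 2 first.
- by rewrite /ball_ind; mm.
- by move=> z; nn.
by under eq_Int do rewrite /ball_ind -{1}(shiftZ0 z0) rho_shift.
Qed.

(** Translating both averages to the origin puts them under one weight, so their difference is the
    mean of a difference of translates, to which Jensen's inequality applies. *)
Lemma avg_diff_pow e u z0 z1 : 0 < e -> measurable_fun setT u -> locint e u z0 -> locint e u z1 ->
  ((`|avg e u z0 - avg e u z1| `^ p)%:E <= (avgC * e ^- d.+1)%:E *
     \I[mZ d]_h ((ball_ind e (0%R, 0%R) h)%:R * `|u (shiftZ z0 h) - u (shiftZ z1 h)| `^ p)%:E)%E.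
Proof using p1.
move=> e0 mu_ l0 l1.
have m0 : measurable_fun setT (fun h => u (shiftZ z0 h)) by exact: (measurableT_comp mu_ (measurable_shiftZ z0)).
have m1 : measurable_fun setT (fun h => u (shiftZ z1 h)) by exact: (measurableT_comp mu_ (measurable_shiftZ z1)).
pose v h := -1 * u (shiftZ z1 h) + u (shiftZ z0 h).
have ms0 := measurable_shiftZ z0; have ms1 := measurable_shiftZ z1.
have mv : measurable_fun setT v by rewrite /v; mm.
have l0' := locint_shift mu_ l0; have l1' := locint_shift mu_ l1.
have b0 := locint_bump e0 l0'; have b1 := locint_bump e0 l1'.
have nb f : (\I[mZ d]_z' (`|bump e (0%R, 0%R) z' * f z'|)%:E = \I[mZ d]_z' (bump e (0%R, 0%R) z' * `|f z'|)%:E)%E.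
  by apply: int_norm_weight => z; exact: bump_ge0.
have mbz := measurable_bump_section e (0, 0%R).
have E : avg e u z0 - avg e u z1 = avg e v (0, 0%R) - 0.
  rewrite /avg subr0 -mulrBr; congr (_ * _); rewrite !(avg_shift e _ mu_) addrC -mulN1r -RI_lin; [|mm|by rewrite nb|mm|by rewrite nb].
  by apply: eq_RI => z; rewrite /v; ring.
have lv : locint e v (0, 0%R).
  have mb : measurable_fun setT (ball_ind e (0, 0%R)) by rewrite /ball_ind; mm.
  apply: (@le_lt_trans _ _ (\I[mZ d]_h (((ball_ind e (0%R, 0%R) h)%:R * `|u (shiftZ z1 h)|)%:E + ((ball_ind e (0%R, 0%R) h)%:R * `|u (shiftZ z0 h)|)%:E))%E).
    apply: le_Int => z; first by nn.
    rewrite -EFinD lee_fin -mulrDr ler_wpM2l//; apply: le_trans (ler_normD _ _) _.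
    by rewrite mulN1r normrN.
  rewrite IntD; [exact: lte_add_pinfty|mm|mm|by move=> z; nn|by move=> z; nn].
rewrite E; apply: le_trans (avg_pow 0 e0 mv lv) _.
rewrite le_eqVlt; apply/orP; left; apply/eqP; congr (_ * _)%E; apply: eq_Int => z.
by rewrite /v subr0 mulN1r addrC.
Qed.

(** The cone is 1-Lipschitz in its centre. The constant degenerates as e tends to 0, but only
    continuity for fixed e is drawn from it. *)
Lemma avg_lip e u (K : Z -> bool) z0 z1 : 0 < e -> measurable_fun setT u -> measurable_fun setT K ->
  (\I[mZ d]_z ((K z)%:R * `|u z|)%:E < +oo)%E ->
  (forall z', rho z0 z' < e -> K z') -> (forall z', rho z1 z' < e -> K z') ->
  `|avg e u z0 - avg e u z1| <= (mass e)^-1 * fine (\I[mZ d]_z ((K z)%:R * `|u z|)%:E)%E * rho z0 z1.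
Proof.
move=> e0 mu_ mK iK k0 k1; have m0 := mass_gt0 e0.
have loc z : (forall z', rho z z' < e -> K z') -> locint e u z.
  move=> kz; apply: le_lt_trans iK; apply: le_Int => z'; first by nn.
  by rewrite lee_fin ler_wpM2r// ind_le// => /kz.
have := @wavg_diff _ _ _ (mZ d) _ _ (measurable_bump_section e z0) (bump_ge0 e z0) (massE z0 e0) _ (measurable_bump_section e z1) (bump_ge0 e z1) (massE z1 e0) u 0 mu_ (locint_bump e0 (loc _ k0)) (locint_bump e0 (loc _ k1)).
set I := (\I[mZ d]_z ((K z)%:R * `|u z|)%:E)%E in iK * => h.
have h2 : ((`|RI (mZ d) (fun z' => bump e z0 z' * u z') - RI (mZ d) (fun z' => bump e z1 z' * u z')|)%:E <= (rho z0 z1)%:E * I)%E.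
  apply: (le_trans h); rewrite -IntZ ?rho_ge0//.
  apply: le_Int => z; first by nn.
  rewrite -EFinM lee_fin subr0 mulrA ler_wpM2r//; apply: le_trans (bump_lip _ _ _ e0) _.
  by rewrite ler_wpM2l ?rho_ge0// ind_le// => /orP[/k0|/k1].
have Ifin : I \is a fin_num by rewrite ge0_fin_numE//; apply: Int_ge0 => z; nn.
move: h2; rewrite -(fineK Ifin) -EFinM lee_fin => h2.
rewrite /avg -mulrBr normrM ger0_norm ?invr_ge0 ?(ltW m0)// -mulrA ler_wpM2l ?invr_ge0 ?(ltW m0)//.
by rewrite mulrC.
Qed.
End bump.

(** * Averages around points squeezed towards the middle graph *)

Section squeeze.
Context {R : realType} (d : nat).
Local Notation Z := ('rV[R]_d * measurableTypeR R)%type.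
Variables (s p : R).
Hypotheses (p1 : 1 < p) (s0 : 0 < s) (s1 : s < 1) (sp1 : 1 < s * p).
Variables (eta w : 'rV[R]_d -> R) (sg La : R).
Hypotheses (sgE : sg * sg = 1) (La0 : 0 <= La).
Hypotheses (eta_lip : forall x y, `|eta x - eta y| <= La * `|x - y|).
Hypotheses (w_lip : forall x y, `|w x - w y| <= La * `|x - y|).
Hypotheses (w_gt0 : forall x, 0 < w x).
Hypotheses (meta : measurable_fun setT eta) (mw : measurable_fun setT w).
Notation O := (inO eta w sg).
Notation tau := (tau eta sg).
Notation gam := (gam d s p).

Definition mid x := eta x - sg * (w x / 2).
(* Moves [z] towards the mid-graph, so that a ball of radius much smaller than
   [k * w] around [squeeze k z] stays inside the strip. *)
Definition squeeze k (z : Z) : Z := (z.1, (1 - k) * z.2 + k * mid z.1).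

Lemma measurable_squeeze k : measurable_fun setT (squeeze k).
Proof using meta mw. rewrite /squeeze /mid; mm. Qed.

Lemma tau_squeeze k z : tau (squeeze k z) = (1 - k) * tau z + k * (w z.1 / 2).
Proof using sgE.
rewrite /tau /squeeze /mid /=; transitivity (sg * (1 - k) * (eta z.1 - z.2) + sg * sg * (k * (w z.1 / 2))); first by ring.
by rewrite sgE; ring.
Qed.

(** The squeezed height is the convex combination of [tau z] and [w z.1 / 2], hence at distance at
    least [k * (w z.1 / 2)] from both ends; moving by e costs (1 + La) e in the height and La e in
    the width. *)
Lemma squeeze_deep k e z z' : 0 <= k -> k <= 1 -> 0 <= tau z -> tau z <= w z.1 ->
  rho (squeeze k z) z' < e ->
  k * (w z.1 / 2) - (1 + 2 * La) * e <= tau z' /\ k * (w z.1 / 2) - (1 + 2 * La) * e <= w z'.1 - tau z'.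
Proof using sgE La0 eta_lip w_lip w_gt0.
move=> k0 k1 t0 tw hr.
have h1 := tau_lip (sg_abs sgE) La0 eta_lip (squeeze k z) z'; rewrite tau_squeeze in h1.
have h2 := w_lip z.1 z'.1.
have h3 : `|z.1 - z'.1| <= rho (squeeze k z) z' by rewrite /rho /= lerDl.
have h4 := rho_ge0 (squeeze k z) z'; have h5 := w_gt0 z.1.
move: h1 h2; rewrite !ler_norml => /andP[h11 h12] /andP[h21 h22].
move: (tau z) (tau z') (w z.1) (w z'.1) (rho (squeeze k z) z') (`|z.1 - z'.1|) t0 tw hr h11 h12 h21 h22 h3 h4 h5 => t t' a a' r n t0 tw hr h11 h12 h21 h22 h3 h4 h5.
have k1' : (1 + La) * r <= (1 + La) * e by rewrite ler_wpM2l ?ltW//; move: La0; lra.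
have k2 : La * n <= La * e by rewrite ler_wpM2l//; move: h3 hr; lra.
have k3 : 0 <= (1 - k) * t by rewrite mulr_ge0//; lra.
have k4 : (1 - k) * t <= (1 - k) * a by rewrite ler_wpM2l//; lra.
have k5 : 0 <= La * e by rewrite mulr_ge0//; move: h4 hr; lra.
by split; lra.
Qed.

Lemma squeeze_dist k z : 0 <= k -> 0 <= tau z -> tau z <= w z.1 -> rho (squeeze k z) z <= k * w z.1.
Proof using sgE.
move=> k0 t0 tw; rewrite /rho /= subrr normr0 add0r.
have -> : (1 - k) * z.2 + k * mid z.1 - z.2 = k * (sg * (tau z - w z.1 / 2)).
  rewrite /mid /tau; transitivity (k * (sg * sg * (eta z.1 - z.2) - sg * (w z.1 / 2))); last by ring.
  by rewrite sgE; ring.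
rewrite !normrM (sg_abs sgE) mul1r ger0_norm// ler_wpM2l// ler_norml.
by move: (tau z) (w z.1) t0 tw => t a *; apply/andP; split; lra.
Qed.

Lemma squeeze_lip k z z' : 0 <= k -> k <= 1 -> rho (squeeze k z) (squeeze k z') <= (1 + 2 * La) * rho z z'.
Proof using sgE La0 eta_lip w_lip.
move=> k0 k1; rewrite /rho /=.
have -> : (1 - k) * z.2 + k * mid z.1 - ((1 - k) * z'.2 + k * mid z'.1) =
  (1 - k) * ((z.2 : R) - z'.2) + k * ((eta z.1 - eta z'.1) - sg * ((w z.1 - w z'.1) / 2)) by rewrite /mid; ring.
have h := ler_normD ((1 - k) * ((z.2 : R) - z'.2)) (k * ((eta z.1 - eta z'.1) - sg * ((w z.1 - w z'.1) / 2))).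
have h' := ler_normB (eta z.1 - eta z'.1) (sg * ((w z.1 - w z'.1) / 2)).
have he := eta_lip z.1 z'.1; have hw := w_lip z.1 z'.1.
have k1' : 0 <= 1 - k by lra.
rewrite [`|(1 - k) * _|]normrM [`|k * _|]normrM (ger0_norm k0) (ger0_norm k1') in h.
rewrite [`|sg * _|]normrM (sg_abs sgE) mul1r normrM [`|2^-1|]ger0_norm ?invr_ge0// in h'.
have n1 := normr_ge0 (z.1 - z'.1); have n2 := normr_ge0 ((z.2 : R) - z'.2).
have n3 := normr_ge0 (eta z.1 - eta z'.1 - sg * ((w z.1 - w z'.1) / 2)); move: h h' he hw n1 n2 n3.
move: (`|z.1 - z'.1|) (`|(z.2 : R) - z'.2|) (`|eta z.1 - eta z'.1|) (`|w z.1 - w z'.1|) => a b c c'.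
move: (`|eta z.1 - eta z'.1 - _|) (`|_ + k * _|) => x y h h' he hw n1 n2 n3.
have e1 : k * x <= x by rewrite ler_piMl.
have e2 : (1 - k) * b <= b by rewrite ler_piMl//; lra.
have e3 : 0 <= La * a by rewrite mulr_ge0.
have e4 : 0 <= La * b by rewrite mulr_ge0.
lra.
Qed.

Definition mollify k e u z := avg e u (squeeze k z).
Lemma measurable_mollify k e u : measurable_fun setT u -> measurable_fun setT (mollify k e u).
Proof using meta mw.
move=> mu_; exact: (measurableT_comp (measurable_avg e mu_) (measurable_squeeze k)).
Qed.

(** Jensen's inequality with the constant u z; every point of the averaging ball is within (B + 1) k
    of z, where the kernel is bounded below. The centre map q is left free: it is used both for
    squeezed points and for squeezed boundary points. *)
Lemma avg_near u (D : Z -> bool) (q : Z -> Z) k e B : measurable_fun setT u -> measurable_fun setT D -> measurable_fun setT q ->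
  0 < e -> e <= k -> 0 <= B ->
  (forall z, D z -> [/\ O z, locint e u (q z), forall z', rho (q z) z' < e -> O z' & rho (q z) z <= B * k]) ->
  (\I[mZ d]_z ((D z)%:R * `|avg e u (q z) - u z| `^ p)%:E <=
    (avgC d p * e ^- d.+1 * (k `^ gam * (B + 1) `^ gam))%:E * gag s p O u)%E.
Proof using p1 sp1 meta mw.
move=> mu_ mD mq e0 ek B0 hD; have k0 : 0 < k by exact: lt_le_trans ek.
have C0 := avgC_gt0 d p; have mO := measurable_inO sg meta mw.
have Ce : 0 <= avgC d p * e ^- d.+1 by rewrite mulr_ge0 ?(ltW C0)// invr_ge0 exprn_ge0// ltW.
have kk : 0 <= k `^ gam * (B + 1) `^ gam by rewrite mulr_ge0 ?powR_ge0.
rewrite /gag EFinM -muleA -IntZ//; last by move=> z; nn.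
rewrite -IntZ//; last by move=> z; apply: mule_ge0; [rewrite lee_fin|nn].
apply: le_Int => z; first by nn.
have [Dz|_] := boolP (D z); last first.
  by rewrite mul0r; apply: mule_ge0; [rewrite lee_fin|apply: mule_ge0; [rewrite lee_fin|nn]].
have [Oz lz bz rz] := hD _ Dz.
rewrite mul1r; apply: le_trans (avg_pow p1 (u z) e0 mu_ lz) _.
apply: lee_wpmul2l; first by rewrite lee_fin.
rewrite -IntZ//; last by move=> z'; nn.
apply: le_Int => z'; first by nn.
rewrite -EFinM lee_fin Oz mul1r; have [hb|_] := boolP (ball_ind e (q z) z'); last first.
  by rewrite mul0r; nn.
rewrite (bz _ hb) !mul1r.
have rr : rho z z' <= (B + 1) * k.
  apply: le_trans (rho_tri _ (q z) _) _; rewrite (rhoC z); move: hb rz; rewrite /ball_ind.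
  move: (rho (q z) z') (rho (q z) z) => a b h1 h2; lra.
have B1 : 0 < B + 1 by lra.
have := ker_le p1 sp1 u k0 B1 rr; rewrite distrC.
have kg : 0 < k `^ gam by rewrite powR_gt0.
move: (`|u z' - u z| `^ p) => X h.
have {1}-> : X = k `^ gam * (k `^ (- gam) * X) by rewrite mulrA -powRD_gt0// subrr powRr0 mul1r.
by rewrite -mulrA ler_pM2l.
Qed.

(** Close to the diagonal the mollification has no more energy than u, uniformly in e and k. Its
    increments are means over h of increments of u between [squeeze k z] and [squeeze k z']
    translated by h. These points are at most (1 + 2 La) times farther apart, and the Jacobian 1 - k
    >= 1/2 costs a factor 2 in each variable, whence the 4. The volume of the h-ball cancels
    [e ^- d.+1]. *)
Lemma near_squeeze u (D : Z -> bool) k e del : measurable_fun setT u -> measurable_fun setT D ->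
  0 < e -> 0 <= k -> k <= 2^-1 ->
  (forall z, D z -> locint e u (squeeze k z) /\ forall z', rho (squeeze k z) z' < e -> O z') ->
  (\I[mZ d]_z \I[mZ d]_z' ((D z)%:R * ((D z')%:R * ((rho z z' < del)%R%:R * (`|mollify k e u z - mollify k e u z'| `^ p * rho z z' `^ (- gam)))))%:E
   <= (avgC d p * 2 ^+ d.+1 * 4 * (1 + 2 * La) `^ gam)%:E *
     \I[mZ d]_z \I[mZ d]_z' ((O z)%:R * ((O z')%:R * ((rho z z' < (1 + 2 * La) * del)%R%:R * (`|u z - u z'| `^ p * rho z z' `^ (- gam)))))%:E)%E.
Proof using p1 sp1 meta mw sgE La0 eta_lip w_lip.
move=> mu_ mD e0 k0 k2 hD; have k1 : k <= 1 by lra.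
have M0 : 0 < 1 + 2 * La by move: La0; lra.
have C0 := avgC_gt0 d p; have mO := measurable_inO sg meta mw; have mS := measurable_squeeze k.
have Ce : 0 <= avgC d p * e ^- d.+1 by rewrite mulr_ge0 ?(ltW C0)// invr_ge0 exprn_ge0// ltW.
pose N (z z' : Z) : R := (rho z z' < del)%R%:R * rho z z' `^ (- gam).
have N0 z z' : 0 <= N z z' by rewrite /N; nn.
have mN : measurable_fun setT (fun q : Z * Z => N q.1 q.2) by rewrite /N; mm.
pose T h z z' := (D z)%:R * ((D z')%:R * (N z z' * `|u (shiftZ (squeeze k z) h) - u (shiftZ (squeeze k z') h)| `^ p)).
have T0 h z z' : 0 <= T h z z' by rewrite /T; have := N0 z z' => ?; nn.
have mT : measurable_fun setT (fun q : Z * (Z * Z) => T q.1 q.2.1 q.2.2).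
  have ms : measurable_fun setT (fun q : Z * Z => shiftZ q.1 q.2) by rewrite /shiftZ; mm.
  rewrite /T; mm.
pose b (h : Z) := ball_ind e (0%R, 0%R) h : bool.
have mb : measurable_fun setT (b : Z -> bool) by rewrite /b /ball_ind; mm.
pose G z z' := ((O z)%:R * ((O z')%:R * ((rho z z' < (1 + 2 * La) * del)%R%:R * (`|u z - u z'| `^ p * rho z z' `^ (- gam)))))%:E.
have G0 z z' : (0 <= G z z')%E by rewrite /G; nn.
have mG : measurable_fun setT (fun q : Z * Z => G q.1 q.2) by rewrite /G; mm.
apply: (@le_trans _ _ (\I[mZ d]_z \I[mZ d]_z' ((avgC d p * e ^- d.+1)%:E * \I[mZ d]_h ((b h)%:R * T h z z')%:E))%E).
  apply: le_Int => z; first by nn.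
  apply: le_Int => z'; first by nn.
  have TT0 : (0 <= (avgC d p * e ^- d.+1)%:E * \I[mZ d]_h ((b h)%:R * T h z z')%:E)%E.
    by apply: mule_ge0; [rewrite lee_fin|apply: Int_ge0 => h; have := T0 h z z' => ?; nn].
  have [Dz|_] := boolP (D z); last by rewrite mul0r.
  have [Dz'|_] := boolP (D z'); last by rewrite mul0r mulr0.
  have [l1 _] := hD _ Dz; have [l2 _] := hD _ Dz'.
  have -> : (true%:R * (true%:R * ((rho z z' < del)%R%:R * (`|mollify k e u z - mollify k e u z'| `^ p * rho z z' `^ (- gam)))))%:E =
     ((N z z')%:E * (`|mollify k e u z - mollify k e u z'| `^ p)%:E)%E by rewrite -EFinM /N !mul1r; congr (_%:E); ring.
  have := avg_diff_pow p1 e0 mu_ l1 l2 => h.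
  apply: le_trans (lee_wpmul2l _ h) _; first by rewrite lee_fin.
  rewrite muleCA; apply: lee_wpmul2l; first by rewrite lee_fin.
  rewrite -IntZ//.
  apply: le_Int => y; first by have := N0 z z' => ?; nn.
  by rewrite -EFinM lee_fin /T Dz Dz' !mul1r mulrCA.
have TI0 z z' : (0 <= \I[mZ d]_h ((b h)%:R * T h z z')%:E)%E by apply: Int_ge0 => h; have := T0 h z z' => ?; nn.
rewrite (Int2Z _ _ Ce TI0).
(* The displacement h is moved outermost, so that for each fixed h the points z and z' can be
   substituted. *)
have -> : (\I[mZ d]_z \I[mZ d]_z' \I[mZ d]_h ((b h)%:R * T h z z')%:E = \I[mZ d]_h \I[mZ d]_z \I[mZ d]_z' ((b h)%:R * T h z z')%:E)%E.
  transitivity (\I[mZ d]_z \I[mZ d]_h \I[mZ d]_z' ((b h)%:R * T h z z')%:E)%E.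
    apply: eq_Int => z; apply: (@Int_swap _ _ _ _ _ (mZ d) (mZ d) (fun z' h => ((b h)%:R * T h z z')%:E)) => [|z' h]; last by rewrite lee_fin mulr_ge0.
    have h1 : measurable_fun setT (fun q : Z * Z => (q.2, (z, q.1))) by mm.
    have h2 := measurableT_comp mT h1; have h3 : measurable_fun setT (fun q : Z * Z => T q.2 z q.1) := h2.
    by mm.
  apply: (@Int_swap _ _ _ _ _ (mZ d) (mZ d) (fun z h => \I[mZ d]_z' ((b h)%:R * T h z z')%:E)%E) => [|z h]; last first.
    by apply: Int_ge0 => z'; rewrite lee_fin mulr_ge0.
  apply: (@measurable_Int _ _ _ _ _ (mZ d) (fun q z' => ((b q.2)%:R * T q.2 q.1 z')%:E)) => [|q z']; last by rewrite lee_fin mulr_ge0.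
  have h1 : measurable_fun setT (fun q : (Z * Z) * Z => (q.1.2, (q.1.1, q.2))) by mm.
  have h2 := measurableT_comp mT h1; have h3 : measurable_fun setT (fun q : (Z * Z) * Z => T q.1.2 q.1.1 q.2) := h2.
  by mm.
have key h : (\I[mZ d]_z \I[mZ d]_z' ((b h)%:R * T h z z')%:E <= (b h)%:R%:E * ((4 * (1 + 2 * La) `^ gam)%:E * \I[mZ d]_z \I[mZ d]_z' G z z'))%E.
  have [bh|_] := boolP (b h); last first.
    rewrite mul0e; under eq_Int do under eq_Int do rewrite mul0r.
    by under eq_Int do rewrite Int0; rewrite Int0.
  rewrite mul1e.
  have Mg : 0 <= (1 + 2 * La) `^ gam by exact: powR_ge0.
  pose y z := shiftZ (squeeze k z) h.
  have yE z : y z = (z.1 + h.1, (1 - k) * z.2 + (k * mid z.1 + h.2)).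
    by rewrite /y /shiftZ /squeeze /=; congr (_, _); [exact: addrC|rewrite addrC -addrA].
  have my : measurable_fun setT y.
    by rewrite (_ : y = fun z => (z.1 + h.1, (1 - k) * z.2 + (k * mid z.1 + h.2))); [rewrite /mid; mm|exact/funext].
  (* Squeezing followed by translation is affine along each column, with slope 1 - k. *)
  have aff (F : Z -> \bar R) : measurable_fun setT F -> (forall z, 0 <= F z)%E -> (\I[mZ d]_z F (y z) <= 2%:E * \I[mZ d]_z F z)%E.
    move=> mF F0; have k1' : 0 < 1 - k by lra.
    have := @IntZ_affine R d (1 - k) h.1 (fun x => k * mid x + h.2) F k1'.
    under eq_Int do rewrite -yE.
    move=> ->//; last by rewrite /mid; mm.
    apply: lee_wpmul2r; first exact: Int_ge0.
    by rewrite lee_fin -[leRHS]invrK lef_pV2 ?posrE ?invr_gt0//; lra.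
  have mGz z : measurable_fun setT (G z).
    have h1 : measurable_fun setT (fun z' : Z => (z, z')) by mm.
    exact: (measurableT_comp mG h1).
  have mIG : measurable_fun setT (fun z => \I[mZ d]_z' G z z')%E by apply: measurable_Int.
  have IG0 z : (0 <= \I[mZ d]_z' G z z')%E by apply: Int_ge0.
  apply: (@le_trans _ _ (\I[mZ d]_z \I[mZ d]_z' (((1 + 2 * La) `^ gam)%:E * G (y z) (y z')))%E).
    apply: le_Int => z; first by apply: Int_ge0 => z'; rewrite lee_fin mulr_ge0.
    apply: le_Int => z'; first by rewrite lee_fin mulr_ge0.
    rewrite mul1r; have GG0 : (0 <= ((1 + 2 * La) `^ gam)%:E * G (y z) (y z'))%E by apply: mule_ge0 => //; rewrite lee_fin.
    rewrite /T -/(y z) -/(y z') /N.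
    have [Dz|_] := boolP (D z); last by rewrite mul0r.
    have [Dz'|_] := boolP (D z'); last by rewrite mul0r mulr0.
    have [rd|_] := boolP (rho z z' < del); last by rewrite !mul0r !mulr0.
    have [rz|rz] := eqVneq (rho z z') 0.
      by rewrite (rho_eq0 rz) in GG0 *; rewrite subrr normr0 (@powR0 _ p) ?mulr0// gt_eqF//; move: p1; lra.
    have r0 : 0 < rho z z' by rewrite lt_def rz rho_ge0.
    have ry : rho (y z) (y z') = rho (squeeze k z) (squeeze k z').
      by rewrite /rho /y /shiftZ /=; congr (_ + _); congr (`|_|); rewrite opprD addrACA subrr add0r.
    have rs : rho (y z) (y z') <= (1 + 2 * La) * rho z z' by rewrite ry squeeze_lip.
    have Oy z1 : D z1 -> O (y z1).
      move=> Dz1; apply: (hD _ Dz1).2; rewrite /y -{1}(shiftZ0 (squeeze k z1)) rho_shift//.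
    rewrite /G (Oy _ Dz) (Oy _ Dz') (_ : _ < _ * del); last by apply: le_lt_trans rs _; rewrite ltr_pM2l.
    by rewrite !mul1r -EFinM lee_fin; exact: ker_le.
  have GG0 z z' : (0 <= G (y z) (y z'))%E by [].
  rewrite (Int2Z _ _ Mg GG0) [(4 * _)%R]mulrC EFinM -[in leRHS]muleA; apply: lee_wpmul2l; first by rewrite lee_fin.
  apply: (@le_trans _ _ (\I[mZ d]_z (2%:E * \I[mZ d]_z' G (y z) z'))%E).
    by apply: le_Int => z; [exact: Int_ge0|apply: aff].
  rewrite IntZ//.
  have -> : (4%:E = 2%:E * 2%:E :> \bar R)%E by rewrite -EFinM; congr (_%:E); ring.
  rewrite -[in leRHS]muleA; apply: lee_wpmul2l; first by rewrite lee_fin.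
  exact: aff mIG IG0.
have K0 : (0 <= (4 * (1 + 2 * La) `^ gam)%:E * \I[mZ d]_z \I[mZ d]_z' G z z')%E.
  by apply: mule_ge0; [rewrite lee_fin mulr_ge0 ?powR_ge0|apply: Int_ge0 => z; exact: Int_ge0].
apply: (@le_trans _ _ ((avgC d p * e ^- d.+1)%:E * (((2 * e) ^+ d.+1)%:E * ((4 * (1 + 2 * La) `^ gam)%:E * \I[mZ d]_z \I[mZ d]_z' G z z')))%E).
  apply: lee_wpmul2l; first by rewrite lee_fin.
  apply: (@le_trans _ _ (\I[mZ d]_h ((b h)%:R%:E * ((4 * (1 + 2 * La) `^ gam)%:E * \I[mZ d]_z \I[mZ d]_z' G z z')))%E).
    by apply: le_Int => // h; apply: Int_ge0 => z; apply: Int_ge0 => z'; rewrite lee_fin mulr_ge0.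
  move: ((4 * (1 + 2 * La) `^ gam)%:E * _)%E K0 => X.
  case: X => [x||]// X0; last by rewrite gt0_muley ?leey// lte_fin exprn_gt0// mulr_gt0.
  rewrite IntZr//.
  by apply: lee_wpmul2r => //; exact: ball_vol.
rewrite muleA -EFinM muleA -EFinM; apply: lee_wpmul2r; first by apply: Int_ge0 => z; exact: Int_ge0.
rewrite lee_fin exprMn le_eqVlt; apply/orP; left; apply/eqP; field.
by rewrite expf_neq0// gt_eqF.
Qed.
End squeeze.

(** * Existence of traces *)

Section topo.
Context {R : realType} (d : nat).
Local Notation Z := ('rV[R]_d * measurableTypeR R)%type.
Local Notation ZT := ('rV[R]_d * R)%type.

Lemma near_rho (x : ZT) (e : R) : 0 < e -> \forall t \near x, rho (x : Z) t < e.
Proof.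
move=> e0; have e2 : 0 < e / 2 by lra.
have h1 : \forall t \near x, `|x.1 - t.1| < e / 2.
  by apply: (@cvgr_dist_lt _ _ _ (nbhs x) _ fst x.1 _ _ e2); exact: cvg_fst.
have h2 : \forall t \near x, `|x.2 - t.2| < e / 2.
  by apply: (@cvgr_dist_lt _ _ _ (nbhs x) _ snd x.2 _ _ e2); exact: cvg_snd.
near=> t; rewrite /rho.
have : `|x.1 - t.1| < e / 2 by near: t.
have : `|x.2 - t.2| < e / 2 by near: t.
by move: (`|x.1 - t.1| : R) (`|x.2 - t.2|) => *; lra.
Unshelve. all: by end_near. Qed.

Lemma lip_within (A : set ZT) (f : ZT -> R) M : (forall z z', A z -> A z' -> `|f z - f z'| <= M * rho (z : Z) z') ->
  {within A, continuous f}.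
Proof.
move=> h; apply/subspace_continuousP => x Ax; apply/cvgrPdist_lt => e e0.
have M1 : 0 < `|M| + 1 by rewrite ltr_wpDl.
have eM : 0 < e / (`|M| + 1) by rewrite divr_gt0.
have hn := near_rho x eM.
rewrite /within /prop_near1 /=; apply: filterS hn => t ht At.
apply: le_lt_trans (h _ _ Ax At) _; move: ht; rewrite ltr_pdivlMr// mulrC.
apply: le_lt_trans; apply: ler_wpM2r; first exact: rho_ge0.
by apply: le_trans (ler_norm M) _; rewrite lerDl.
Qed.

Lemma lip_continuous (f : ZT -> R) M : (forall z z', `|f z - f z'| <= M * rho (z : Z) z') -> continuous f.
Proof.
move=> h; apply/continuous_subspace_setT; apply: (@lip_within _ _ M) => z z' _ _; exact: h.
Qed.

Lemma lip_continuous_rV (f : 'rV[R]_d -> R) M : (forall x y, `|f x - f y| <= M * `|x - y|) -> continuous f.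
Proof.
move=> h x; have M0 : 0 <= `|M| by [].
have c1 : continuous (f \o fst : ZT -> R).
  apply: (@lip_continuous _ `|M|) => z z'; apply: le_trans (h _ _) _.
  apply: le_trans (ler_wpM2r _ (ler_norm M)) _ => //; rewrite ler_wpM2l// /rho lerDl//.
apply: (@continuous_comp _ _ _ (fun x : 'rV[R]_d => (x, 0) : ZT) (f \o fst)); last exact: c1.
have h1 : (fun y : 'rV[R]_d => y) @ x --> x by exact: cvg_id.
have h2 : (fun _ : 'rV[R]_d => 0) @ nbhs x --> (0 : R) by apply: cvg_cst.
exact: (cvg_pair h1 h2).
Qed.

Lemma closure_approx (A : set ZT) z e : 0 < e -> closure A z -> exists2 z', A z' & rho (z : Z) z' < e.
Proof. by move=> e0 cA; have [z' [Az' h]] := cA _ (near_rho z e0); exists z'. Qed.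

Lemma compact_ball (r : R) : compact [set x : 'rV[R]_d | `|x| <= r].
Proof.
apply: bounded_closed_compact.
  by exists r; split; [exact: num_real|move=> x rx y /= /le_trans; apply; exact: ltW].
have cn : continuous (fun x : 'rV[R]_d => `|x|) by move=> x; exact: norm_continuous.
exact: (closed_comp (fun x _ => cn x) (@closed_le R r)).
Qed.

Lemma compact_levels (f1 f2 : ZT -> R) (r M c : R) : continuous f1 -> continuous f2 ->
  (forall z, `|z.1| <= r -> c <= f1 z -> c <= f2 z -> `|z.2| <= M) ->
  compact [set z : ZT | [/\ `|z.1| <= r, c <= f1 z & c <= f2 z]].
Proof.
move=> c1 c2 hM.
have cX := @compact_ball r.
have cXR := compact_setX cX (@segment_compact R (- M) M).
apply: (subclosed_compact _ cXR); last first.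
  by move=> z [h1 h2 h3]; split => //=; rewrite in_itv /= -ler_norml; exact: hM.
have -> : [set z : ZT | [/\ `|z.1| <= r, c <= f1 z & c <= f2 z]] =
   (fun z : ZT => `|z.1|) @^-1` [set t | t <= r] `&` (f1 @^-1` [set t | c <= t] `&` f2 @^-1` [set t | c <= t]).
  by apply/seteqP; split=> z /= => [[]|[? []]].
have cn : continuous (fun z : ZT => `|z.1|).
  move=> z; apply: (@continuous_comp _ _ _ fst (fun x : 'rV[R]_d => `|x|)); first exact: cvg_fst.
  exact: norm_continuous.
apply: closedI; first exact: (closed_comp (fun x _ => cn x) (@closed_le R r)).
by apply: closedI; apply: (closed_comp _ (@closed_ge R c)) => x _; [exact: c1|exact: c2].
Qed.
End topo.

Lemma pow_small {R : realType} (a c : R) : 0 < a -> 0 < c -> \forall n \near \oo, (2^-1 ^+ n) `^ a < c.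
Proof.
move=> a0 c0; pose q : R := 2^-1 `^ a.
have q0 : 0 <= q by exact: powR_ge0.
have q1 : `|q| < 1.
  rewrite ger0_norm// /q -(@powR_inv1 _ 2)// -powRrM mulN1r; apply: powR_lt1 => //; lra.
have h2 : \forall n \near \oo, `|0 - q ^+ n| < c by exact: (@cvgr_dist_lt _ _ _ \oo _ (fun n => q ^+ n) 0 (cvg_expr q1) _ c0).
near=> n; rewrite powR_exp ?invr_ge0// -/q.
have : `|0 - q ^+ n| < c by near: n; exact: h2.
by rewrite sub0r normrN ger0_norm// exprn_ge0.
Unshelve. all: by end_near. Qed.

(** * Approximations continuous up to the boundary *)

Section moll.
Context {R : realType} (d : nat).
Local Notation Z := ('rV[R]_d * measurableTypeR R)%type.
Variables (s p : R).
Hypotheses (p1 : 1 < p) (s0 : 0 < s) (s1 : s < 1) (sp1 : 1 < s * p).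
Variables (etam etap eta w : 'rV[R]_d -> R) (sg La : R).
Hypotheses (sgE : sg * sg = 1) (La0 : 0 <= La).
Hypotheses (eta_lip : forall x y, `|eta x - eta y| <= La * `|x - y|).
Hypotheses (w_lip : forall x y, `|w x - w y| <= La * `|x - y|).
Hypotheses (w_gt0 : forall x, 0 < w x).
Hypotheses (meta : measurable_fun setT eta) (mw : measurable_fun setT w).
Notation O := (inO eta w sg).
Notation tau := (tau eta sg).
Notation gam := (gam d s p).
Hypotheses (stripE : forall z, strip etam etap z <-> O z).

Variable u : Z -> R.
Hypotheses (mu_ : measurable_fun setT u).
Hypothesis u_loc : forall K : set ('rV[R]_d * R), compact K -> K `<=` strip etam etap ->
  (\int[lebesgue_graph d]_(x in K) (`|u x| `^ p)%:E < +oo)%E.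
Hypothesis u_gag : (gag s p O u < +oo)%E.

(* The mollification radius is dyad n ^ (1 + a): small compared with the
   squeezing depth, yet large enough that eps^-(d+1) dyad^gam still tends to 0. *)
Let a : R := (s * p - 1) / (2 * d.+1%:R).
(** The midpoint of 1 and s p, and the exponent of the L^p rate by [eps_rate]. As b > 1, the rate
    survives division by the thickness [dyad n] of a boundary slab. *)
Let b : R := (s * p + 1) / 2.
Definition dyad (n : nat) : R := 2^-1 ^+ n.
Let eps n : R := dyad n `^ (1 + a).
Definition mollified n : Z -> R := mollify eta w sg (dyad n) (eps n) u.

Lemma dyad_gt0 n : 0 < dyad n. Proof. by rewrite exprn_gt0// invr_gt0. Qed.
Lemma dyad_le1 n : dyad n <= 1. Proof. by rewrite exprn_ile1 ?invr_ge0// invf_le1// ler1n. Qed.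
Lemma a_gt0 : 0 < a. Proof using sp1. by rewrite divr_gt0 ?mulr_gt0// subr_gt0. Qed.
Lemma eps_gt0 n : 0 < eps n. Proof. by rewrite powR_gt0 ?dyad_gt0. Qed.
Lemma eps_E n : eps n = dyad n `^ a * dyad n.
Proof. by rewrite /eps powRD_gt0 ?dyad_gt0// powRr1 ?(ltW (dyad_gt0 n))// mulrC. Qed.
Lemma eps_le n : eps n <= dyad n.
Proof using sp1.
rewrite eps_E ler_piMl ?(ltW (dyad_gt0 n))//.
have := @powR_mono R a (dyad n) 1 (ltW a_gt0) (ltW (dyad_gt0 n)) (dyad_le1 n); by rewrite powR1.
Qed.
Lemma eps_rate n : eps n ^- d.+1 * dyad n `^ gam = dyad n `^ b.
Proof.
rewrite /eps -powR_mulrn ?powR_ge0// -powRrM -powRN -powRD_gt0 ?dyad_gt0//; congr (_ `^ _).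
have D0 : (d.+1%:R : R) != 0 by rewrite pnatr_eq0.
by rewrite /gam /a /b; move: (d.+1%:R : R) D0 => D D0; field.
Qed.

(** Defined by non-strict inequalities, so as to contain the closure of [strip_ball] and in
    particular the points of the graphs. *)
Definition closed_part r (z : Z) : bool := [&& `|z.1| <= r, 0 <= tau z & tau z <= w z.1].

Lemma measurable_closed_part r : measurable_fun setT (closed_part r).
Proof using meta mw. have mtau := measurable_tau sg meta; rewrite /closed_part; mm. Qed.

Lemma closure_closed_part r z : closure (strip_ball etam etap r) z -> closed_part r z.
Proof using stripE sgE La0 eta_lip w_lip.
move=> cz; have h e : 0 < e -> [/\ `|z.1| <= r + e, - ((1 + La) * e) <= tau z & tau z <= w z.1 + (1 + 2 * La) * e].
  move=> e0; have [z' [/stripE/andP[t0 tw] /= zr] hr] := closure_approx e0 cz.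
  have h1 := tau_lip (sg_abs sgE) La0 eta_lip z z'; have h2 := w_lip z.1 z'.1.
  have h3 : `|z.1 - z'.1| <= rho z z' by rewrite /rho lerDl.
  have h4 : `|z.1| <= `|z.1 - z'.1| + `|z'.1| by rewrite -{1}(subrK z'.1 z.1) ler_normD.
  have h5 := le_lt_trans (norm_le_enorm z'.1) zr; have h6 := rho_ge0 z z'.
  have k1 : (1 + La) * rho z z' <= (1 + La) * e by rewrite ler_wpM2l ?(ltW hr)//; move: La0; lra.
  have k2 : La * `|z.1 - z'.1| <= La * e by rewrite ler_wpM2l// (le_trans h3)// ltW.
  move: h1 h2; rewrite !ler_norml => /andP[h11 h12] /andP[h21 h22].
  move: (tau z) (tau z') (w z.1) (w z'.1) (rho z z') (`|z.1 - z'.1|) (`|z.1|) (`|z'.1|) t0 tw hr h11 h12 h21 h22 h3 h4 h5 k1 k2.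
  by move=> t t' v v' q n n1 n2 *; split; lra.
have lim0 (x y c : R) : 0 <= c -> (forall e, 0 < e -> x <= y + c * e) -> x <= y.
  move=> c0 hh; rewrite -lee_fin; apply: (@limit_le _ _ _ c c0) => e e0.
  by rewrite -EFinD lee_fin; exact: hh.
apply/and3P; split.
- by apply: (lim0 _ _ 1) => // e /h[h1 _ _]; rewrite mul1r.
- apply: (lim0 _ _ (1 + La)); first by move: La0; lra.
  by move=> e /h[_ h1 _]; rewrite -lerBlDr sub0r.
- apply: (lim0 _ _ (1 + 2 * La)); first by move: La0; lra.
  by move=> e /h[_ _ h1].
Qed.

(** The width is positive but may tend to 0 at infinity; compactness bounds it below on bounded
    sets, and the thresholds on n below depend on r for this reason. *)
Lemma width_lower r : exists2 c, 0 < c & forall x, `|x| <= r -> c <= w x.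
Proof using w_lip w_gt0.
have [r0|r0] := ltP r 0.
  by exists 1 => // x; rewrite leNgt (lt_le_trans r0).
have cX := @compact_ball R d r.
have cw := lip_continuous_rV w_lip.
have [|c _ hc] := EVT_min_rV _ cX (continuous_subspaceT cw).
  by exists 0; rewrite /= normr0.
by exists (w c) => // x xr; apply: hc; exact: mem_set.
Qed.

Lemma width_upper r x : `|x| <= r -> w x <= w 0 + La * r.
Proof using La0 w_lip.
move=> xr; have := w_lip x 0; rewrite subr0 ler_norml => /andP[_ h].
have k : La * `|x| <= La * r by rewrite ler_wpM2l.
by move: h k; lra.
Qed.

(** The region is compact inside the strip, so u is p-integrable on it; its volume is finite, and
    [|u|] is at most 1 + [|u| ^ p]. *)
Lemma integrable_deep (r c : R) : 0 < c ->
  (\I[mZ d]_z (([&& `|z.1| <= r, c <= tau z & c <= w z.1 - tau z])%:R * `|u z|)%:E < +oo)%E.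
Proof using sgE La0 eta_lip w_lip meta mw stripE mu_ u_loc p1.
move=> c0; have mtau := measurable_tau sg meta.
pose K (z : Z) := [&& `|z.1| <= r, c <= tau z & c <= w z.1 - tau z].
have mK : measurable_fun setT K by rewrite /K; mm.
have ct : continuous (tau : 'rV[R]_d * R -> R).
  by apply: (@lip_continuous R d _ (1 + La)) => z z'; exact: tau_lip (sg_abs sgE) La0 eta_lip z z'.
have cw : continuous (fun z : 'rV[R]_d * R => w z.1 - tau z).
  move=> z; apply: cvgB; last exact: ct.
  apply: (@continuous_comp _ _ _ fst w); first exact: cvg_fst.
  exact: (lip_continuous_rV w_lip).
have tb z : `|z.1| <= r -> c <= tau z -> c <= w z.1 - tau z -> `|z.2 : R| <= `|eta 0| + La * r + (w 0 + La * r).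
  move=> zr h1 h2; have h3 := width_upper zr; have h4 := tau_norm eta (sg_abs sgE) z.
  have h5 := eta_lip z.1 0; rewrite subr0 in h5.
  have h6 : La * `|z.1| <= La * r by rewrite ler_wpM2l.
  have h7 : `|z.2 : R| <= `|(z.2 : R) - eta z.1| + `|eta z.1 - eta 0| + `|eta 0|.
    apply: le_trans (_ : `|(z.2 : R) - eta z.1 + (eta z.1 - eta 0) + eta 0| <= _); first by rewrite addrA !subrK.
    by apply: le_trans (ler_normD _ _) _; rewrite lerD2r ler_normD.
  have t0 : 0 <= tau z by apply: le_trans h1; exact: ltW.
  rewrite -h4 (ger0_norm t0) in h7.
  by move: h7 h5 h6 h3 h2; move: (tau z) (w z.1) (`|eta z.1 - eta 0|) (La * `|z.1|) (`|(z.2 : R)|) => *; lra.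
have cK := compact_levels ct cw tb.
have KS : [set z : 'rV[R]_d * R | [/\ `|z.1| <= r, c <= tau z & c <= w z.1 - tau z]] `<=` strip etam etap.
  move=> z [h1 h2 h3]; apply/stripE; apply/andP; split; first exact: lt_le_trans h2.
  by move: h3 c0; move: (tau z) (w z.1) => *; lra.
have KE (z : Z) : [/\ `|z.1| <= r, c <= tau z & c <= w z.1 - tau z] <-> K z by split => [[*]|/and3P[]]; [apply/and3P|].
have := u_loc cK KS; rewrite (@int_dom _ _ R (@lebesgue_graph R d) _ K _ KE) -IntZm => h.
have one : (\I[mZ d]_z (K z)%:R%:E < +oo)%E.
  pose M := `|eta 0| + La * r + (w 0 + La * r).
  have M0 : 0 < `|r| + `|M| + 1 by rewrite ltr_wpDl.
  apply: le_lt_trans (_ : (\I[mZ d]_z (rho z (0%R, 0%R) < (`|r| + `|M| + 1))%R%:R%:E < +oo)%E); last first.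
    by apply: le_lt_trans (IvolZ_le _ M0) _; exact: ltry.
  apply: le_Int => z; first by nn.
  rewrite lee_fin ind_le// => /and3P[h1 h2 h3]; rewrite /rho /= !subr0.
  have h4 := tb _ h1 h2 h3; have h5 := ler_norm r; have h6 := ler_norm M.
  by move: h1 h4 h5 h6; rewrite -/M; move: (`|z.1|) (`|(z.2 : R)|) (`|r|) (`|M|) => *; lra.
apply: (@le_lt_trans _ _ (\I[mZ d]_z ((K z)%:R%:E + ((K z)%:R * `|u z| `^ p)%:E)))%E; last first.
  rewrite IntD; [exact: lte_add_pinfty|mm|mm|by move=> z; nn|by move=> z; nn].
apply: le_Int => z; first by nn.
rewrite -EFinD lee_fin -{2}[(K z)%:R]mulr1 -mulrDr ler_wpM2l//.
have [h1|h1] := lerP `|u z| 1; first by apply: le_trans h1 _; rewrite lerDl powR_ge0.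
apply: le_trans (_ : `|u z| `^ p <= _); last by rewrite lerDr.
by rewrite -{1}[`|u z|]powRr1// ler_powR// ltW.
Qed.

(** With c a lower bound for the width, squeezing gains [dyad n * c / 2] of depth. The averaging
    ball loses (1 + 2 La) eps, eventually at most half of this, since eps / dyad = dyad^a tends to
    0. *)
Lemma squeeze_eventually_deep r : exists n0 : nat, forall n, (n0 <= n)%N ->
  [/\ 0 < dyad n, dyad n <= 2^-1, forall z, closed_part r z -> dyad n < w z.1 &
   exists2 c, 0 < c & forall z z', closed_part r z -> rho (squeeze eta w sg (dyad n) z) z' < eps n ->
     [&& `|z'.1| <= r + 1, c <= tau z' & c <= w z'.1 - tau z'] ].
Proof using sgE La0 eta_lip w_lip w_gt0 sp1.
have [c c0 hc] := width_lower r.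
have M0 : 0 < 4 * (1 + 2 * La) by rewrite mulr_gt0//; move: La0; lra.
have cM : 0 < c / (4 * (1 + 2 * La)) by rewrite divr_gt0.
have [N1 _ h1] := pow_small a_gt0 cM.
have [N2 _ h2] := @pow_small R 1 c ltr01 c0.
exists (maxn (maxn N1 N2) 1) => n; rewrite !geq_max => /andP[/andP[n1 n2] n3].
have k0 := dyad_gt0 n; split => //.
- by rewrite /dyad -(subnKC n3) exprS ler_piMr ?invr_ge0// exprn_ile1 ?invr_ge0// invf_le1// ler1n.
- move=> z /and3P[zr _ _]; apply: lt_le_trans (hc _ zr); have := h2 n n2; rewrite powRr1//; exact: ltW.
exists (dyad n * (c / 4)); first by rewrite !mulr_gt0.
move=> z z' /and3P[zr t0 tw] hr.
have [d1 d2] := squeeze_deep sgE La0 eta_lip w_lip w_gt0 (ltW k0) (dyad_le1 n) t0 tw hr.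
have key : dyad n * (c / 4) <= dyad n * (w z.1 / 2) - (1 + 2 * La) * eps n.
  rewrite eps_E; have h3 := h1 n n1; have h4 := hc _ zr.
  rewrite ltr_pdivlMr// in h3.
  have h5 : dyad n * (dyad n `^ a * (4 * (1 + 2 * La))) <= dyad n * c by rewrite ler_pM2l// ltW.
  have h6 : dyad n * c <= dyad n * w z.1 by rewrite ler_pM2l.
  by move: h5 h6; move: (dyad n `^ a) (dyad n) (w z.1) => x y v *; lra.
apply/and3P; split; [|exact: le_trans d1|exact: le_trans d2].
have h3 : `|z.1 - z'.1| <= rho (squeeze eta w sg (dyad n) z) z' by rewrite /rho /= lerDl.
have h4 : `|z'.1| <= `|z.1 - z'.1| + `|z.1| by rewrite distrC -{1}(subrK z.1 z'.1) ler_normD.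
have h5 := eps_le n; have h6 := dyad_le1 n.
apply: (le_trans h4); rewrite addrC; apply: lerD zr _; apply: (le_trans h3); apply: ltW.
exact: (lt_le_trans hr (le_trans h5 h6)).
Qed.

Lemma mollified_facts r : exists n0 : nat, forall n, (n0 <= n)%N ->
  [/\ dyad n <= 2^-1, forall z, closed_part r z -> dyad n < w z.1,
   forall z, closed_part r z -> locint (eps n) u (squeeze eta w sg (dyad n) z) /\ forall z', rho (squeeze eta w sg (dyad n) z) z' < eps n -> O z' &
   {within closure (strip_ball etam etap r), continuous (mollified n : 'rV[R]_d * R -> R)}].
Proof using sgE La0 eta_lip w_lip w_gt0 sp1 meta mw stripE mu_ u_loc p1.
have [n0 h] := squeeze_eventually_deep r; exists n0 => n /h[k0 k2 kw [c c0 hc]].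
pose K (z : Z) := [&& `|z.1| <= r + 1, c <= tau z & c <= w z.1 - tau z].
have mtau := measurable_tau sg meta.
have mK : measurable_fun setT K by rewrite /K; mm.
have iK := integrable_deep (r + 1) c0.
have e0 := eps_gt0 n.
split => //.
  move=> z zc; split.
    apply: le_lt_trans iK; apply: le_Int => z'; first by nn.
    by rewrite lee_fin ler_wpM2r// ind_le// => h1; exact: hc h1.
  move=> z' h1; have /and3P[_ h2 h3] := hc _ _ zc h1; apply/andP; split; first exact: lt_le_trans h2.
  by move: h3 c0; move: (tau z') (w z'.1) => *; lra.
(* All averaging balls over the closure lie in one deep region K where u is integrable, so [avg_lip]
   gives a Lipschitz constant common to the whole closure, though depending on n. *)
apply: (@lip_within _ _ _ _ ((mass d (eps n))^-1 * fine (\I[mZ d]_z ((K z)%:R * `|u z|)%:E)%E * (1 + 2 * La))).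
move=> z z' /closure_closed_part zc /closure_closed_part zc'.
have := @avg_lip R d (eps n) u K (squeeze eta w sg (dyad n) z) (squeeze eta w sg (dyad n) z') e0 mu_ mK iK.
move=> /(_ (fun y => hc z y zc) (fun y => hc z' y zc')) h1.
apply: (le_trans h1); rewrite -[leRHS]mulrA; apply: ler_wpM2l.
  rewrite mulr_ge0 ?invr_ge0 ?(ltW (mass_gt0 _ e0))//; apply: fine_ge0; apply: Int_ge0 => y; nn.
by apply: squeeze_lip => //; [exact: ltW|exact: dyad_le1].
Qed.
End moll.

Section mono.
Local Open Scope ereal_scope.
Context {R : realType} d (T : measurableType d) (m : {sigma_finite_measure set T -> \bar R}).
Lemma Int_mono_cvg (F : nat -> T -> \bar R) (G : T -> \bar R) : (forall n, measurable_fun setT (F n)) ->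
  (forall n x, 0 <= F n x) -> (forall x, {homo F ^~ x : k l / (k <= l)%N >-> k <= l}) ->
  (forall x, F n x @[n --> \oo] --> G x) -> Int m (F n) @[n --> \oo] --> Int m G.
Proof.
move=> mF F0 hF cF; rewrite (_ : (fun n => Int m (F n)) = (fun n => \int[m]_x F n x)); last first.
  by apply/funext => n; rewrite IntE.
have -> : Int m G = \int[m]_x (limn (F ^~ x)).
  by rewrite IntE; apply: eq_integral => x _; apply/esym/cvg_lim => //; exact: cF.
exact: cvg_monotone_convergence.
Qed.
End mono.

Section exhaust2.
Local Open Scope ereal_scope.
Context {R : realType} d1 d2 (T1 : measurableType d1) (T2 : measurableType d2).
Variable m1 : {sigma_finite_measure set T1 -> \bar R}.
Variable m2 : {sigma_finite_measure set T2 -> \bar R}.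

Lemma Int2_exhaust (b : nat -> T1 -> T2 -> bool) (g : T1 -> T2 -> R) (M : \bar R) :
  (forall n, measurable_fun setT (fun q => b n q.1 q.2)) -> measurable_fun setT (fun q => g q.1 q.2) ->
  (forall x y, 0 <= g x y)%R ->
  (forall n x y, b n x y -> b n.+1 x y) -> (forall x y, g x y = 0%R \/ exists n, b n x y) ->
  (forall n, \I[m1]_x \I[m2]_y ((b n x y)%:R * g x y)%:E <= M) -> \I[m1]_x \I[m2]_y (g x y)%:E <= M.
Proof.
move=> mb mg g0 bS ex h.
have bm n k x y : b n x y -> b (n + k)%N x y.
  by elim: k => [|k IH] bn; rewrite ?addn0// addnS; apply/bS/IH.
pose F n x y := ((b n x y)%:R * g x y)%:E.
have F0 n x y : 0 <= F n x y by rewrite /F lee_fin mulr_ge0.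
have mF n : measurable_fun setT (fun q => F n q.1 q.2) by have := mb n => h1; rewrite /F; mm.
have hF x y : {homo (fun n => F n x y) : k l / (k <= l)%N >-> k <= l}.
  move=> k l kl; rewrite /F lee_fin -(subnKC kl) ler_wpM2r// ind_le//; exact: bm.
have cF x y : F n x y @[n --> \oo] --> (g x y)%:E.
  have [gx0|[n bn]] := ex x y.
    by rewrite /F gx0; under eq_fun do rewrite mulr0; exact: cvg_cst.
  apply: cvg_near_cst; exists n => // k /= nk.
  by rewrite /F -(subnKC nk) bm// mul1r.
have mFx n x : measurable_fun setT (F n x).
  have h1 : measurable_fun setT (fun y : T2 => (x, y)) by apply: measurable_fun_pair.
  exact: (measurableT_comp (mF n) h1).
have mI n : measurable_fun setT (fun x => \I[m2]_y F n x y) by apply: measurable_Int.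
have I0 n x : 0 <= \I[m2]_y F n x y by exact: Int_ge0.
have hI x : {homo (fun n => \I[m2]_y F n x y) : k l / (k <= l)%N >-> k <= l}.
  by move=> k l kl; apply: le_Int => // y; exact: hF.
have c1 x : (\I[m2]_y F n x y) @[n --> \oo] --> \I[m2]_y (g x y)%:E.
  by apply: (Int_mono_cvg (F := fun n y => F n x y)).
have c2 := @Int_mono_cvg _ _ _ m1 _ _ mI I0 hI c1.
rewrite -(cvg_lim _ c2)//; apply: lime_le; first by apply/cvg_ex; exists (\I[m1]_x \I[m2]_y (g x y)%:E).
by apply: nearW => n; exact: h.
Qed.
End exhaust2.

(** * Limits of sequences with geometrically weighted increments *)

Section telescope_pow.
Context {R : realType}.
Variables p q : R.
Hypotheses (p0 : 0 < p) (q1 : 1 < q).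

(** Each term is at most the sum of the series, so the increments decay like q^(-j/p) and the
    telescoping series converges absolutely. *)
Lemma tele_cvg (a : nat -> R) : (\sum_(j <oo) (q ^+ j * `|a j - a j.+1| `^ p)%:E < +oo)%E -> cvgn a.
Proof using p0 q1.
set S := (\sum_(j <oo) _)%E => Sfin; have q0 : 0 < q by move: q1; lra.
have t0 j : (0 <= (q ^+ j * `|a j - a j.+1| `^ p)%:E)%E by rewrite lee_fin mulr_ge0 ?powR_ge0 ?exprn_ge0 ?ltW.
have S0 : (0 <= S)%E by apply: nneseries_ge0.
have Sf : S \is a fin_num by rewrite ge0_fin_numE.
have tS j : q ^+ j * `|a j - a j.+1| `^ p <= fine S.
  rewrite -lee_fin fineK//; apply: le_trans (nneseries_lim_ge j.+1 (fun k _ _ => t0 k)).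
  by rewrite big_mkcond big_nat_recr//= leeDr// sume_ge0// => k _; exact: t0.
pose r := q^-1 `^ p^-1.
have r0 : 0 <= r by exact: powR_ge0.
have r1 : r < 1 by rewrite /r -(@powR_inv1 _ q) ?(ltW q0)// -powRrM mulN1r; apply: powR_lt1; rewrite ?invr_gt0.
have d1 j : `|telescope a j| <= fine S `^ p^-1 * r ^+ j.
  rewrite /telescope distrC.
  have h : `|a j - a j.+1| `^ p <= fine S * (q^-1) ^+ j.
    by rewrite exprVn ler_pdivlMr ?exprn_gt0// mulrC.
  have -> : `|a j - a j.+1| = (`|a j - a j.+1| `^ p) `^ p^-1 by rewrite -powRrM mulfV ?gt_eqF// powRr1.
  rewrite /r -powR_exp ?invr_ge0 ?(ltW q0)// -powRM ?fine_ge0 ?exprn_ge0 ?invr_ge0 ?(ltW q0)//.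
  by apply: powR_mono; rewrite ?invr_ge0 ?(ltW p0) ?powR_ge0.
have c1 : cvgn (series (fun j => fine S `^ p^-1 * r ^+ j)).
  by apply: is_cvg_geometric_series; rewrite ger0_norm.
have c2 : cvgn (series (telescope a)).
  apply: normed_cvg; apply: series_le_cvg c1 => [n|n|n]; [exact: normr_ge0|by rewrite mulr_ge0 ?powR_ge0 ?exprn_ge0|exact: d1].
have -> : a = (fun n => a 0%N + series (telescope a) n) by apply/funext => n; rewrite -eq_sum_telescope.
by apply: is_cvgD => //; exact: is_cvg_cst.
Qed.

(** The upper limit is defined for every sequence and depends measurably on it. Where the series is
    finite it is the actual limit; elsewhere the right-hand side is infinite. *)
Lemma tele_esup : exists2 C, 0 < C & forall (a : nat -> R) n,
  ((`|a n - fine (limn_esup (fun k => (a k)%:E))| `^ p)%:E <= C%:E * \sum_(j <oo) (q ^+ j * `|a (n + j)%N - a (n + j).+1| `^ p)%:E)%E.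
Proof using p0 q1.
have [C C0 hC] := telescope_pow_lim p0 q1; exists C => // a n; have q0 : 0 < q by move: q1; lra.
have [h|h] := eqVneq (\sum_(j <oo) (q ^+ j * `|a (n + j)%N - a (n + j).+1| `^ p)%:E)%E +oo%E.
  by rewrite h gt0_muley ?leey// lte_fin.
pose a' j := a (n + j)%N.
have ca' : cvgn a'.
  by apply: tele_cvg; rewrite lt_def leey andbT eq_sym; under eq_eseriesr do rewrite /a' addnS.
have aa' : a' @ \oo --> limn a' by [].
have ca : a @ \oo --> limn a'.
  rewrite -(cvg_shiftn n) (_ : (fun _ => _) = a')//.
  by apply/funext => j; rewrite /a' addnC.
have -> : fine (limn_esup (fun k => (a k)%:E)) = limn a'.
  have ce : (fun k => (a k)%:E) @ \oo --> (limn a')%:E by apply: cvg_comp ca _; exact: cvg_id.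
  by rewrite (cvg_limn_einf_sup ce).2.
have := hC a' _ aa'; rewrite {1}/a' addn0; under eq_eseriesr do rewrite /a' addnS.
by [].
Qed.
End telescope_pow.

Section slab.
Context {R : realType} (d : nat).
Local Notation Z := ('rV[R]_d * measurableTypeR R)%type.
Variables (eta : 'rV[R]_d -> R) (sg : R).
Hypotheses (sgE : sg * sg = 1) (meta : measurable_fun setT eta).
Notation tau := (tau eta sg).

(** Two functions on the base are compared through the values of u in a slab of height k along the
    graph. Dividing by k later costs one power of the height, which the exponents b > 1 and s p > 1
    absorb. *)
Lemma slab_dist (p k : R) (E : 'rV[R]_d -> bool) (h f : 'rV[R]_d -> R) (u : Z -> R) : 0 <= p -> 0 < k ->
  measurable_fun setT E -> measurable_fun setT h -> measurable_fun setT f -> measurable_fun setT u ->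
  (k%:E * \I[mX d]_x ((E x)%:R * `|h x - f x| `^ p)%:E <= (2 `^ p)%:E *
    (\I[mZ d]_z ((E z.1 && (0 < tau z < k))%:R * `|h z.1 - u z| `^ p)%:E +
     \I[mZ d]_z ((E z.1 && (0 < tau z < k))%:R * `|u z - f z.1| `^ p)%:E))%E.
Proof using sgE meta.
move=> p0 k0 mE mh mf mu_; have mtau := measurable_tau sg meta; have k0' := ltW k0.
have F0 x : 0 <= (E x)%:R * `|h x - f x| `^ p by nn.
rewrite -IntZR//.
rewrite -(@Int_inO _ _ eta (fun=> k) sg sgE _ meta _ (fun x => (E x)%:R * `|h x - f x| `^ p))//; last by mm.
rewrite -IntD; [|mm|mm|by move=> z; nn|by move=> z; nn].
rewrite -IntZ ?powR_ge0//; last by move=> z; rewrite adde_ge0// lee_fin; nn.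
apply: le_Int => z; first by nn.
rewrite /inO; have [Ez|_] := boolP (E z.1); last by rewrite !mul0r mulr0 add0e mule0.
have [tz|_] := boolP (0 < tau z < k); last by rewrite !mul0r add0e mule0.
by rewrite !mul1r -EFinD -EFinM lee_fin; exact: dist2.
Qed.
End slab.

(** * Rates of convergence of the approximations *)

Section rates.
Context {R : realType} (d : nat).
Local Notation Z := ('rV[R]_d * measurableTypeR R)%type.
Variables (s p : R).
Hypotheses (p1 : 1 < p) (s0 : 0 < s) (s1 : s < 1) (sp1 : 1 < s * p).
Variables (etam etap eta w : 'rV[R]_d -> R) (sg La : R).
Hypotheses (sgE : sg * sg = 1) (La0 : 0 <= La).
Hypotheses (eta_lip : forall x y, `|eta x - eta y| <= La * `|x - y|).
Hypotheses (w_lip : forall x y, `|w x - w y| <= La * `|x - y|).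
Hypotheses (w_gt0 : forall x, 0 < w x).
Hypotheses (meta : measurable_fun setT eta) (mw : measurable_fun setT w).
Notation O := (inO eta w sg).
Notation tau := (tau eta sg).
Notation gam := (gam d s p).
Hypotheses (stripE : forall z, strip etam etap z <-> O z).

Variable u : Z -> R.
Hypotheses (mu_ : measurable_fun setT u).
Hypothesis u_loc : forall K : set ('rV[R]_d * R), compact K -> K `<=` strip etam etap ->
  (\int[lebesgue_graph d]_(x in K) (`|u x| `^ p)%:E < +oo)%E.
Hypothesis u_gag : (gag s p O u < +oo)%E.

Let a : R := (s * p - 1) / (2 * d.+1%:R).
Let b : R := (s * p + 1) / 2.
Let eps n : R := dyad n `^ (1 + a).
Notation mollified := (mollified s p eta w sg u).
Notation closed_part := (closed_part eta w sg).
Let G : R := fine (gag s p O u).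

Let kap0 n : 0 < (dyad n : R). Proof. exact: dyad_gt0. Qed.
Let eps0 n : 0 < eps n. Proof. exact: eps_gt0. Qed.
Let epsk n : eps n <= dyad n. Proof. exact: eps_le. Qed.
Let GE : gag s p O u = G%:E.
Proof. by rewrite /G fineK// ge0_fin_numE// gag_ge0. Qed.
Let G0 : 0 <= G. Proof. by apply: fine_ge0; exact: gag_ge0. Qed.

Let facts_ := mollified_facts p1 sp1 sgE La0 eta_lip w_lip w_gt0 meta mw stripE mu_ u_loc.

Lemma measurable_mollified n : measurable_fun setT (mollified n).
Proof using meta mw mu_. exact: measurable_mollify. Qed.

(** Over a bounded base the width is bounded by B, so squeezing moves points by at most B times
    [dyad n]; [avg_near] then gives the power computed in [eps_rate]. *)
Lemma mollified_rate r : exists2 C, 0 <= C & exists n0 : nat, forall n, (n0 <= n)%N ->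
  (\I[mZ d]_z ((closed_part r z && O z)%:R * `|mollified n z - u z| `^ p)%:E <= (C * dyad n `^ b)%:E)%E.
Proof using p1 sp1 sgE La0 eta_lip w_lip w_gt0 meta mw stripE mu_ u_loc u_gag.
have [n0 h] := facts_ r; pose B := `|w 0 + La * r|.
have mcl := measurable_closed_part sg meta mw r; have mO := measurable_inO sg meta mw.
have C0 := avgC_gt0 d p; have Bg : 0 <= (B + 1) `^ gam by exact: powR_ge0.
exists (avgC d p * (B + 1) `^ gam * G); first by rewrite mulr_ge0 ?mulr_ge0 ?(ltW C0).
exists n0 => n /h[k2 kw hl _].
have k0 : 0 < (dyad n : R) := kap0 n.
have mS : measurable_fun setT (squeeze eta w sg (dyad n)) by exact: measurable_squeeze.
have mD : measurable_fun setT (fun z => closed_part r z && O z) by apply: measurable_and.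
have := @avg_near _ d s p p1 sp1 eta w sg meta mw u (fun z => closed_part r z && O z) (squeeze eta w sg (dyad n)) (dyad n) (eps n) B mu_ mD mS (eps0 n) (epsk n) (normr_ge0 _).
move=> /(_ _) hh; apply: le_trans (hh _) _.
  move=> z /andP[zc Oz]; have [l1 l2] := hl _ zc; split => //.
  have /and3P[zr t0 tw] := zc.
  apply: le_trans (squeeze_dist sgE (ltW k0) t0 tw) _.
  by rewrite mulrC ler_wpM2r ?(ltW k0)// (le_trans (width_upper La0 w_lip zr))// ler_norm.
rewrite GE -EFinM lee_fin -(eps_rate d s p n) le_eqVlt; apply/orP; left; apply/eqP; rewrite -/(eps n) -/(dyad n); ring.
Qed.

(** The value at the boundary point below or above z is also an average of u over a ball within a
    multiple of [dyad n] of z, as long as z has height less than [dyad n]. The slab of that height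
    lies in the strip once [dyad n] is below the width. *)
Lemma mollified_edge_rate r : exists2 C, 0 <= C & exists n0 : nat, forall n, (n0 <= n)%N ->
  (forall z, (`|z.1| <= r) && (0 < tau z < dyad n) -> O z) /\
  (\I[mZ d]_z (((`|z.1| <= r) && (0 < tau z < dyad n))%:R * `|mollified n (z.1, eta z.1) - u z| `^ p)%:E <= (C * dyad n `^ b)%:E)%E.
Proof using p1 sp1 sgE La0 eta_lip w_lip w_gt0 meta mw stripE mu_ u_loc u_gag.
have [n0 h] := facts_ r; pose B := `|w 0 + La * r| + 1.
have mtau := measurable_tau sg meta.
have C0 := avgC_gt0 d p; have Bg : 0 <= (B + 1) `^ gam by exact: powR_ge0.
exists (avgC d p * (B + 1) `^ gam * G); first by rewrite mulr_ge0 ?mulr_ge0 ?(ltW C0).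
exists n0 => n /h[k2 kw hl _].
have k0 : 0 < (dyad n : R) := kap0 n.
pose D (z : Z) := (`|z.1| <= r) && (0 < tau z < dyad n).
have clb z : D z -> closed_part r (z.1, eta z.1).
  by move=> /andP[zr _]; rewrite /closed_part /= zr /tau /= subrr mulr0 lexx ltW.
have DO z : D z -> O z.
  move=> Dz; have := kw _ (clb z Dz); have /andP[_ /andP[h1 h2]] := Dz.
  by move=> /= h3; rewrite /inO h1 /=; exact: lt_trans h2 h3.
split => //.
pose e0 (z : Z) : Z := (z.1, eta z.1).
have me0 : measurable_fun setT e0 by rewrite /e0; mm.
have mS : measurable_fun setT (squeeze eta w sg (dyad n)) by exact: measurable_squeeze.
have mq : measurable_fun setT (fun z => squeeze eta w sg (dyad n) (e0 z)) by exact: (measurableT_comp mS me0).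
have mD : measurable_fun setT D by rewrite /D; mm.
have B0 : 0 <= B by rewrite addr_ge0.
have := @avg_near _ d s p p1 sp1 eta w sg meta mw u D (fun z => squeeze eta w sg (dyad n) (e0 z)) (dyad n) (eps n) B mu_ mD mq (eps0 n) (epsk n) B0.
move=> /(_ _) hh; apply: le_trans (hh _) _.
  move=> z Dz; have zc := clb _ Dz; have [l1 l2] := hl _ zc; split => //; first exact: DO.
  have /and3P[zr t0 tw] := zc.
  apply: le_trans (rho_tri _ (e0 z) _) _; rewrite /B mulrDl mul1r; apply: lerD.
    apply: le_trans (squeeze_dist sgE (ltW k0) t0 tw) _.
    by rewrite mulrC ler_wpM2r ?(ltW k0)// (le_trans (width_upper La0 w_lip zr))// ler_norm.
  rewrite /rho /= subrr normr0 add0r distrC -(tau_norm eta (sg_abs sgE)).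
  by have /andP[_ /andP[h1 h2]] := Dz; rewrite gtr0_norm// ltW.
rewrite GE -EFinM lee_fin -(eps_rate d s p n) le_eqVlt; apply/orP; left; apply/eqP; rewrite -/(eps n) -/(dyad n); ring.
Qed.

(** Absolute continuity of the integral, by contradiction. If every neighbourhood of the diagonal
    carried more than e of the energy G, the complements would carry at most G - e; exhausting by
    them would give G <= G - e, the diagonal itself contributing 0. *)
Lemma diag_small e : 0 < e -> exists2 del, 0 < del &
  (\I[mZ d]_z \I[mZ d]_z' ((O z)%:R * ((O z')%:R * ((rho z z' < del)%R%:R * (`|u z - u z'| `^ p * rho z z' `^ (- gam)))))%:E <= e%:E)%E.
Proof using p1 sp1 meta mw mu_ u_gag.
move=> e0; apply: contrapT => hn.
have mO := measurable_inO sg meta mw.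
pose g (z z' : Z) : R := (O z)%:R * ((O z')%:R * (`|u z - u z'| `^ p * rho z z' `^ (- gam))).
have g0 z z' : 0 <= g z z' by rewrite /g; nn.
have mg : measurable_fun setT (fun q : Z * Z => g q.1 q.2) by rewrite /g; mm.
pose bb n (z z' : Z) := dyad n <= rho z z'.
have mb n : measurable_fun setT (fun q : Z * Z => bb n q.1 q.2) by rewrite /bb; mm.
have key n : (\I[mZ d]_z \I[mZ d]_z' ((bb n z z')%:R * g z z')%:E <= (G - e)%:E)%E.
  have mA : measurable_fun setT (fun q : Z * Z => ((bb n q.1 q.2)%:R * g q.1 q.2)%:E) by have := mb n => ?; mm.
  have mB : measurable_fun setT (fun q : Z * Z => ((~~ bb n q.1 q.2)%:R * g q.1 q.2)%:E) by have := mb n => ?; mm.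
  have A0 z z' : (0 <= ((bb n z z')%:R * g z z')%:E)%E by rewrite lee_fin mulr_ge0.
  have B0 z z' : (0 <= ((~~ bb n z z')%:R * g z z')%:E)%E by rewrite lee_fin mulr_ge0.
  have := Int2D (mZ d) (mZ d) mA A0 mB B0.
  have -> : (\I[mZ d]_z \I[mZ d]_z' (((bb n z z')%:R * g z z')%:E + ((~~ bb n z z')%:R * g z z')%:E) = G%:E)%E.
    rewrite -GE; apply: eq_Int => z; apply: eq_Int => z'; rewrite -EFinD; congr (_%:E).
    by rewrite -/(g z z'); case: (bb n z z'); rewrite /= ?mul1r ?mul0r ?addr0 ?add0r.
  have : (e%:E < \I[mZ d]_z \I[mZ d]_z' ((~~ bb n z z')%:R * g z z')%:E)%E.
    rewrite ltNge; apply/negP => h; apply: hn; exists (dyad n); first exact: dyad_gt0.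
    apply: le_trans h; rewrite le_eqVlt; apply/orP; left; apply/eqP.
    apply: eq_Int => z; apply: eq_Int => z'; congr (_%:E); rewrite /g /bb -ltNge; ring.
  move: (\I[mZ d]_z \I[mZ d]_z' ((~~ bb n z z')%:R * g z z')%:E)%E => Y hY.
  have : (0 <= \I[mZ d]_z \I[mZ d]_z' ((bb n z z')%:R * g z z')%:E)%E by apply: Int_ge0 => z; exact: Int_ge0.
  move: (\I[mZ d]_z \I[mZ d]_z' ((bb n z z')%:R * g z z')%:E)%E => X X0.
  case: X X0 => [x||]//; case: Y hY => [y||]//=.
  by rewrite lte_fin lee_fin => hy hx [hG]; rewrite lee_fin; lra.
have := @Int2_exhaust R _ _ _ _ (mZ d) (mZ d) bb g (G - e)%:E mb mg g0 _ _ key.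
have -> : (\I[mZ d]_z \I[mZ d]_z' (g z z')%:E)%E = G%:E by rewrite -GE.
move=> h; suff : (G%:E <= (G - e)%:E)%E by rewrite lee_fin; lra.
apply: h => [n z z' h|z z'].
  apply: le_trans h; rewrite /dyad exprS ler_piMl ?exprn_ge0 ?invr_ge0// invf_le1// ler1n//.
have [rz|rz] := eqVneq (rho z z') 0.
  left; rewrite /g (rho_eq0 rz) subrr normr0 powR0 ?mul0r ?mulr0//; by rewrite gt_eqF//; move: p1; lra.
right; have r0 : 0 < rho z z' by rewrite lt_def rz rho_ge0.
have [n _ hN] := @pow_small R 1 _ ltr01 r0; exists n; rewrite /bb ltW//.
by have := hN n (leqnn n); rewrite powRr1// ltW// dyad_gt0.
Qed.

Lemma far_cut : exists2 C, 0 < C & forall (D : Z -> bool) (g : Z -> R) del, 0 < del -> measurable_fun setT D -> measurable_fun setT g ->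
  (forall z, 0 <= g z) ->
  (\I[mZ d]_z \I[mZ d]_z' ((D z)%:R * (g z * ((del <= rho z z')%R%:R * rho z z' `^ (- gam))))%:E <=
    (C * del `^ (- (s * p)))%:E * \I[mZ d]_z ((D z)%:R * g z)%:E)%E.
Proof using sp1.
have [C C0 hC] := tailZ d sp1; exists C => // D g del d0 mD mg g0.
have k0 : 0 <= C * del `^ (- (s * p)) by rewrite mulr_ge0 ?powR_ge0// ltW.
rewrite -IntZ//; last by move=> z; rewrite lee_fin mulr_ge0.
apply: le_Int => z; first by apply: Int_ge0 => z'; have := g0 z => ?; nn.
have -> : (\I[mZ d]_z' ((D z)%:R * (g z * ((del <= rho z z')%R%:R * rho z z' `^ (- gam))))%:E = ((D z)%:R * g z)%:E * \I[mZ d]_z' ((del <= rho z z')%R%:R * rho z z' `^ (- gam))%:E)%E.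
  rewrite -IntZR; [by apply: eq_Int => z'; rewrite mulrA|by rewrite mulr_ge0|by move=> z'; nn].
by rewrite muleC; apply: lee_wpmul2r; [rewrite lee_fin mulr_ge0|exact: hC].
Qed.

(** Near the diagonal the energies of u and of its mollifications are small uniformly in n, by
    [diag_small] and [near_squeeze]. Away from it the kernel has finite mass, and the L^p rate sends
    the remaining part to 0. *)
Lemma mollified_gag r : (gag s p (fun z => closed_part r z && O z) (fun z => mollified n z - u z)%R @[n --> \oo] --> 0)%E.
Proof using p1 sp1 sgE La0 eta_lip w_lip w_gt0 meta mw stripE mu_ u_loc u_gag.
apply: cvg0P => [n|e e0]; first exact: gag_ge0.
have [Cf Cf0 hf] := far_cut.
have [Cr Cr0 [n1 hr]] := mollified_rate r; have [n0 hfacts] := facts_ r.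
have mcl := measurable_closed_part sg meta mw r; have mO := measurable_inO sg meta mw.
pose D z := closed_part r z && O z.
have mD : measurable_fun setT D by apply: measurable_and.
pose M := 1 + 2 * La; have M1 : 1 <= M by rewrite /M; move: La0; lra.
have M0 : 0 < M by lra.
pose C1 := avgC d p * 2 ^+ d.+1 * 4 * M `^ gam.
have C10 : 0 < C1 by rewrite /C1 !mulr_gt0 ?exprn_gt0 ?powR_gt0 ?avgC_gt0.
pose K := 3 `^ p * (C1 + 1 + 2 * (Cf * Cr + 1)).
have P3 : 0 < 3 `^ p :> R by rewrite powR_gt0.
have P30 := ltW P3.
have e1 : 0 < e / (3 `^ p * 2 * (C1 + 1)) by rewrite divr_gt0// !mulr_gt0// addr_gt0.
have [del del0 hdel] := diag_small e1.
(* [near_squeeze] enlarges the neighbourhood of the diagonal by the factor M, so dd keeps the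
   enlarged one within del. *)
pose dd := del / M; have dd0 : 0 < dd by rewrite divr_gt0.
have ddM : M * dd = del by rewrite /dd mulrC divfK// gt_eqF.
have ddd : dd <= del by rewrite ler_pdivrMr// ler_peMr// ltW.
(* Bound demanded of [dyad n ^ b] so that the two far terms together use at most e / 2, the near
   terms using the other half. *)
pose c3 := e / (3 `^ p * 4 * (Cf * dd `^ (- (s * p)) * (Cr + 1))).
have c30 : 0 < c3 by rewrite divr_gt0// !mulr_gt0 ?powR_gt0// ltr_wpDl.
have b0 : 0 < b by rewrite /b; move: sp1; lra.
have [n2 _ h2] := pow_small b0 c30.
exists (maxn (maxn n0 n1) n2) => // n; rewrite /= !geq_max => /andP[/andP[n0n n1n] n2n].
have [k2 kw hl _] := hfacts n n0n.
have k0 : 0 < (dyad n : R) := kap0 n.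
have mV := measurable_mollified n.
pose g z := `|mollified n z - u z| `^ p.
have g0 z : 0 <= g z by exact: powR_ge0.
have mg : measurable_fun setT g by rewrite /g; mm.
pose A z z' := ((D z)%:R * ((D z')%:R * ((rho z z' < dd)%R%:R * (`|mollified n z - mollified n z'| `^ p * rho z z' `^ (- gam)))))%:E.
pose B z z' := ((O z)%:R * ((O z')%:R * ((rho z z' < del)%R%:R * (`|u z - u z'| `^ p * rho z z' `^ (- gam)))))%:E.
pose P z z' := ((D z)%:R * (g z * ((dd <= rho z z')%R%:R * rho z z' `^ (- gam))))%:E.
pose Q z z' := ((D z')%:R * (g z' * ((dd <= rho z z')%R%:R * rho z z' `^ (- gam))))%:E.
have A0 z z' : (0 <= A z z')%E by rewrite /A; nn.
have B0 z z' : (0 <= B z z')%E by rewrite /B; nn.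
have P0 z z' : (0 <= P z z')%E by rewrite /P; have := g0 z => ?; nn.
have Q0 z z' : (0 <= Q z z')%E by rewrite /Q; have := g0 z' => ?; nn.
have mA : measurable_fun setT (fun q : Z * Z => A q.1 q.2) by rewrite /A; mm.
have mB : measurable_fun setT (fun q : Z * Z => B q.1 q.2) by rewrite /B; mm.
have mP : measurable_fun setT (fun q : Z * Z => P q.1 q.2) by rewrite /P; mm.
have mQ : measurable_fun setT (fun q : Z * Z => Q q.1 q.2) by rewrite /Q; mm.
have AB0 z z' : (0 <= A z z' + B z z')%E by exact: adde_ge0.
have PQ0 z z' : (0 <= P z z' + Q z z')%E by exact: adde_ge0.
have mAB : measurable_fun setT (fun q : Z * Z => A q.1 q.2 + B q.1 q.2)%E by exact: emeasurable_funD.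
have mPQ : measurable_fun setT (fun q : Z * Z => P q.1 q.2 + Q q.1 q.2)%E by exact: emeasurable_funD.
have S0 z z' : (0 <= (A z z' + B z z') + (P z z' + Q z z'))%E by exact: adde_ge0.
apply: (@le_trans _ _ (\I[mZ d]_z \I[mZ d]_z' ((3 `^ p)%:E * ((A z z' + B z z') + (P z z' + Q z z'))))%E).
  apply: le_Int => z; first by nn.
  apply: le_Int => z'; first by nn.
  have SS : (0 <= (3 `^ p)%:E * ((A z z' + B z z') + (P z z' + Q z z')))%E by apply: mule_ge0 => //; rewrite lee_fin.
  rewrite -/(D z) -/(D z').
  have [Dz|_] := boolP (D z); last by rewrite mul0r.
  have [Dz'|_] := boolP (D z'); last by rewrite mul0r mulr0.
  have /andP[_ Oz] := Dz; have /andP[_ Oz'] := Dz'.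
  have p0' : 0 <= p := ltW (lt_trans ltr01 p1).
  have p23 : 2 `^ p <= 3 `^ p :> R by apply: powR_mono => //; rewrite ler_nat.
  rewrite /A /B /P /Q Dz Dz' Oz Oz' !mul1r -!EFinD -EFinM lee_fin.
  have kr := powR_ge0 (rho z z') (- gam).
  have [rd|rd] := ltP (rho z z') dd.
    rewrite (lt_le_trans rd ddd) !mul1r mul0r !mulr0 !addr0 -mulrDl mulrA ler_wpM2r//.
    apply: le_trans (_ : 2 `^ p * (`|mollified n z - mollified n z'| `^ p + `|u z - u z'| `^ p) <= _); last first.
      by rewrite ler_wpM2r// addr_ge0 ?powR_ge0.
    apply: le_trans (powD2 p0' (normr_ge0 _) (normr_ge0 _)); apply: powR_mono => //.
    have -> : mollified n z - u z - (mollified n z' - u z') = (mollified n z - mollified n z') - (u z - u z') by ring.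
    exact: ler_normB.
  rewrite !mul0r add0r !mul1r -mulrDl mulrDr; apply: ler_wpDl; first by rewrite !mulr_ge0 ?ler0n ?powR_ge0.
  rewrite mulrA ler_wpM2r//.
  apply: le_trans (_ : 2 `^ p * (g z + g z') <= _); last by rewrite ler_wpM2r// addr_ge0 ?powR_ge0.
  by apply: le_trans (powD2 p0' (normr_ge0 _) (normr_ge0 _)); apply: powR_mono => //; exact: ler_normB.
rewrite (Int2Z _ _ P30 S0) (Int2D _ _ mAB AB0 mPQ PQ0) (Int2D _ _ mA A0 mB B0) (Int2D _ _ mP P0 mQ Q0).
have IA : (\I[mZ d]_z \I[mZ d]_z' A z z' <= (C1 * (e / (3 `^ p * 2 * (C1 + 1))))%:E)%E.
  have hD z : D z -> locint (eps n) u (squeeze eta w sg (dyad n) z) /\ forall z', rho (squeeze eta w sg (dyad n) z) z' < eps n -> O z'.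
    by move=> /andP[zc _]; exact: hl.
  apply: le_trans (@near_squeeze _ d s p p1 sp1 eta w sg La sgE La0 eta_lip w_lip meta mw u D (dyad n) (eps n) dd mu_ mD (eps0 n) (ltW k0) k2 hD) _.
  by rewrite -/M ddM -/C1 [in leRHS]EFinM; apply: lee_wpmul2l => //; rewrite lee_fin ltW.
have rate : (\I[mZ d]_z ((D z)%:R * g z)%:E <= (Cr * c3)%:E)%E.
  apply: le_trans (hr n n1n) _; rewrite lee_fin ler_wpM2l// ltW//; exact: h2.
have kf : 0 <= Cf * dd `^ (- (s * p)) by rewrite mulr_ge0 ?powR_ge0// ltW.
have IP : (\I[mZ d]_z \I[mZ d]_z' P z z' <= (Cf * dd `^ (- (s * p)) * (Cr * c3))%:E)%E.
  by apply: le_trans (hf D g dd dd0 mD mg g0) _; rewrite [in leRHS]EFinM; apply: lee_wpmul2l => //; rewrite lee_fin.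
have IQ : (\I[mZ d]_z \I[mZ d]_z' Q z z' <= (Cf * dd `^ (- (s * p)) * (Cr * c3))%:E)%E.
  apply: le_trans IP; rewrite (@Int_swap _ _ _ _ _ (mZ d) (mZ d) Q mQ Q0) le_eqVlt; apply/orP; left; apply/eqP.
  by apply: eq_Int => z; apply: eq_Int => z'; rewrite /P /Q rhoC.
apply: (@le_trans _ _ ((3 `^ p)%:E * (((C1 * (e / (3 `^ p * 2 * (C1 + 1))))%:E + (e / (3 `^ p * 2 * (C1 + 1)))%:E) + ((Cf * dd `^ (- (s * p)) * (Cr * c3))%:E + (Cf * dd `^ (- (s * p)) * (Cr * c3))%:E)))%E).
  by apply: lee_wpmul2l; [rewrite lee_fin|rewrite !leeD].
rewrite -!EFinD -EFinM lee_fin /c3.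
have Cr1 : 0 < Cr + 1 by rewrite ltr_wpDl.
have X0 : 0 < Cf * dd `^ (- (s * p)) by rewrite mulr_gt0 ?powR_gt0.
move: (Cf * dd `^ (- (s * p))) X0 (3 `^ p) P3 => X X0 Y Y0.
have -> : Y * (C1 * (e / (Y * 2 * (C1 + 1))) + e / (Y * 2 * (C1 + 1)) + (X * (Cr * (e / (Y * 4 * (X * (Cr + 1))))) + X * (Cr * (e / (Y * 4 * (X * (Cr + 1))))))) = e / 2 + e / 2 * (Cr / (Cr + 1)).
  by field; rewrite !gt_eqF// ltr_wpDl// ltW.
have : Cr / (Cr + 1) <= 1 by rewrite ler_pdivrMr// mul1r lerDl.
move=> ht; apply: le_trans (_ : e / 2 + e / 2 * 1 <= _); last by rewrite mulr1 -splitr.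
by rewrite lerD2l ler_wpM2l// divr_ge0// ltW.
Qed.
End rates.

(** * Boundary values of the approximations *)

Section edge.
Context {R : realType} (d : nat).
Local Notation Z := ('rV[R]_d * measurableTypeR R)%type.
Variables (s p : R).
Hypotheses (p1 : 1 < p) (s0 : 0 < s) (s1 : s < 1) (sp1 : 1 < s * p).
Variables (etam etap eta w : 'rV[R]_d -> R) (sg La : R).
Hypotheses (sgE : sg * sg = 1) (La0 : 0 <= La).
Hypotheses (eta_lip : forall x y, `|eta x - eta y| <= La * `|x - y|).
Hypotheses (w_lip : forall x y, `|w x - w y| <= La * `|x - y|).
Hypotheses (w_gt0 : forall x, 0 < w x).
Hypotheses (meta : measurable_fun setT eta) (mw : measurable_fun setT w).
Notation O := (inO eta w sg).
Notation tau := (tau eta sg).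
Notation gam := (gam d s p).
Hypotheses (stripE : forall z, strip etam etap z <-> O z).

Variable u : Z -> R.
Hypotheses (mu_ : measurable_fun setT u).
Hypothesis u_loc : forall K : set ('rV[R]_d * R), compact K -> K `<=` strip etam etap ->
  (\int[lebesgue_graph d]_(x in K) (`|u x| `^ p)%:E < +oo)%E.
Hypothesis u_gag : (gag s p O u < +oo)%E.

Let a : R := (s * p - 1) / (2 * d.+1%:R).
Let b : R := (s * p + 1) / 2.
Let eps n : R := dyad n `^ (1 + a).
Notation mollified := (mollified s p eta w sg u).
Notation closed_part := (closed_part eta w sg).
Let G : R := fine (gag s p O u).

Let kap0 n : 0 < (dyad n : R). Proof. exact: dyad_gt0. Qed.
Let eps0 n : 0 < eps n. Proof. exact: eps_gt0. Qed.
Let epsk n : eps n <= dyad n. Proof. exact: eps_le. Qed.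
Let GE : gag s p O u = G%:E.
Proof. by rewrite /G fineK// ge0_fin_numE// gag_ge0. Qed.
Let G0 : 0 <= G. Proof. by apply: fine_ge0; exact: gag_ge0. Qed.

Let facts_ := mollified_facts p1 sp1 sgE La0 eta_lip w_lip w_gt0 meta mw stripE mu_ u_loc.

Let b1 : 0 < b - 1. Proof. by rewrite /b; move: sp1; lra. Qed.
Let edge n (x : 'rV[R]_d) : R := mollified n (x, eta x).
Let p0 : 0 <= p. Proof. by move: p1; lra. Qed.

Lemma measurable_edge n : measurable_fun setT (edge n).
Proof using meta mw mu_.
have mV : measurable_fun setT (mollified n) by exact: measurable_mollified.
have me : measurable_fun setT (fun x : 'rV[R]_d => (x, eta x) : Z) by mm.
exact: (measurableT_comp mV me).
Qed.

Let dyadS n : (dyad n.+1 : R) = dyad n / 2. Proof. by rewrite /dyad exprSr. Qed.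
Let kapb n : (dyad n : R) `^ b = dyad n `^ (b - 1) * dyad n.
Proof. by rewrite -{3}[dyad n]powRr1 ?(ltW (kap0 n))// -powRD_gt0// subrK. Qed.

(** Consecutive boundary values are compared through u on the slab of height [dyad n.+1]: a rate
    [dyad n ^ b] divided by that height leaves the exponent b - 1 > 0. *)
Lemma edge_diff r : exists2 C, 0 <= C & exists n0 : nat, forall n, (n0 <= n)%N ->
  (\I[mX d]_x ((`|x| <= r)%R%:R * `|edge n x - edge n.+1 x| `^ p)%:E <= (C * dyad n `^ (b - 1))%:E)%E.
Proof using p1 sp1 sgE La0 eta_lip w_lip w_gt0 meta mw stripE mu_ u_loc u_gag.
have [C C0 [n0 h]] := mollified_edge_rate p1 sp1 sgE La0 eta_lip w_lip w_gt0 meta mw stripE mu_ u_loc u_gag r.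
exists (4 * 2 `^ p * C); first by rewrite !mulr_ge0 ?powR_ge0.
exists n0 => n hn; have [_ h1] := h n hn; have [_ h2] := h n.+1 (leq_trans hn (leqnSn n)).
have k0 := kap0 n; have k0' := kap0 n.+1.
have me := measurable_edge n; have me' := measurable_edge n.+1.
have mE : measurable_fun setT (fun x : 'rV[R]_d => `|x| <= r) by mm.
have := @slab_dist R d eta sg sgE meta p (dyad n.+1) (fun x => `|x| <= r) (edge n) (edge n.+1) u p0 k0' mE me me' mu_.
set I := (\I[mX d]_x _)%E; set A := (\I[mZ d]_z _)%E; set B := (\I[mZ d]_z _)%E => hs.
have kk : dyad n.+1 <= dyad n :> R by rewrite dyadS ler_pdivrMr// ler_peMr ?(ltW k0)// ler1n.
have bb : 0 <= b by move: b1; lra.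
have hA : (A <= (C * dyad n `^ b)%:E)%E.
  apply: le_trans h1; apply: le_Int => z; first by nn.
  rewrite lee_fin ler_wpM2r ?powR_ge0// ind_le// => /andP[-> /andP[-> h3]] /=; exact: lt_le_trans h3 kk.
have hB : (B <= (C * dyad n `^ b)%:E)%E.
  apply: (@le_trans _ _ (C * dyad n.+1 `^ b)%:E); last by rewrite lee_fin ler_wpM2l// powR_mono// ltW.
  apply: le_trans h2; apply: le_Int => z; first by nn.
  by rewrite distrC.
rewrite -(@lee_pmul2l _ (dyad n.+1)%:E) ?lte_fin//; apply: (le_trans hs).
apply: (@le_trans _ _ ((2 `^ p)%:E * ((C * dyad n `^ b)%:E + (C * dyad n `^ b)%:E))%E).
  by apply: lee_wpmul2l; [rewrite lee_fin powR_ge0|exact: leeD].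
by rewrite -EFinD -!EFinM lee_fin kapb dyadS le_eqVlt; apply/orP; left; apply/eqP; field.
Qed.

(** The geometric decay in [edge_diff] allows telescoping with weights (2^c)^j while keeping a
    convergent series, so the upper limit of the boundary values is their limit in L^p over every
    bounded base. *)
Lemma edge_limit : exists2 f : 'rV[R]_d -> R, measurable_fun setT f & forall r,
  (\I[mX d]_x ((`|x| <= r)%R%:R * `|edge n x - f x| `^ p)%:E @[n --> \oo] --> 0)%E.
Proof using p1 sp1 sgE La0 eta_lip w_lip w_gt0 meta mw stripE mu_ u_loc u_gag.
(* Half of the available decay: the weight 2^c per step against 2^(-2c) leaves the ratio 2^(-c). *)
pose c := (b - 1) / 2; have c0 : 0 < c by rewrite divr_gt0.
have pp : 0 < p by move: p1; lra.
have q1 : 1 < 2 `^ c :> R by apply: powR_gt1 => //; lra.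
have q0 : 0 <= 2 `^ c :> R by exact: powR_ge0.
have [C C0 hC] := tele_esup pp q1.
pose f x := fine (limn_esup (fun k => (edge k x)%:E)).
have me := measurable_edge.
have mf : measurable_fun setT f.
  apply: (@measurableT_comp _ _ _ _ _ _ (@fine R)) => //.
  by apply: measurable_fun_limn_esup => k; have := me k => h; mm.
exists f => // r; apply: cvg0P => [n|e e0]; first by apply: Int_ge0 => x; nn.
have [D D0 [n0 hD]] := edge_diff r.
pose rr : R := 2 `^ (- c); have rr1 : rr < 1 by apply: powR_lt1 => //; lra.
have rr0 : 0 <= rr by exact: powR_ge0.
have i0 : 0 < (1 - rr)^-1 by rewrite invr_gt0 subr_gt0.
pose K := C * ((1 - rr)^-1 * (D + 1)); have K0 : 0 < K by rewrite !mulr_gt0// ltr_wpDl.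
have [n1 _ hn1] := pow_small b1 (divr_gt0 e0 K0).
exists (maxn n0 n1) => // n; rewrite /= geq_max => /andP[n0n n1n].
have C0' := ltW C0.
have t0 j x : (0 <= ((`|x| <= r)%R%:R * ((2 `^ c) ^+ j * `|edge (n + j)%N x - edge (n + j).+1 x| `^ p))%:E)%E.
  by rewrite lee_fin !mulr_ge0 ?powR_ge0 ?exprn_ge0.
have mt j : measurable_fun setT (fun x : 'rV[R]_d => ((`|x| <= r)%R%:R * ((2 `^ c) ^+ j * `|edge (n + j)%N x - edge (n + j).+1 x| `^ p))%:E).
  by have h1 := me (n + j)%N; have h2 := me (n + j).+1; mm.
have s0' x : (0 <= \sum_(j <oo) ((`|x| <= r)%R%:R * ((2 `^ c) ^+ j * `|edge (n + j)%N x - edge (n + j).+1 x| `^ p))%:E)%E by apply: nneseries_ge0.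
apply: (@le_trans _ _ (\I[mX d]_x (C%:E * \sum_(j <oo) ((`|x| <= r)%R%:R * ((2 `^ c) ^+ j * `|edge (n + j)%N x - edge (n + j).+1 x| `^ p))%:E))%E).
  apply: le_Int => x; first by nn.
  have [xr|_] := boolP (`|x| <= r); last first.
    by rewrite mul0r mule_ge0//; apply: nneseries_ge0 => j _ _; rewrite mul0r.
  rewrite mul1r; apply: le_trans (hC (fun k => edge k x) n) _; apply: lee_wpmul2l; first by rewrite lee_fin.
  by rewrite le_eqVlt; apply/orP; left; apply/eqP; apply: eq_eseriesr => j _; rewrite mul1r.
rewrite (IntZ _ C0' s0') (Int_series _ mt t0).
have kb0 : 0 <= D * dyad n `^ (b - 1) by rewrite mulr_ge0 ?powR_ge0.
apply: (@le_trans _ _ (C%:E * ((1 - rr)^-1%:E * (D * dyad n `^ (b - 1))%:E))%E).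
  apply: lee_wpmul2l; first by rewrite lee_fin.
  apply: geo_series_le => //.
    by move=> j; apply: Int_ge0.
  move=> j; apply: (@le_trans _ _ (((2 `^ c) ^+ j)%:E * \I[mX d]_x ((`|x| <= r)%R%:R * `|edge (n + j)%N x - edge (n + j).+1 x| `^ p)%:E)%E).
    rewrite -IntZR; [|by rewrite exprn_ge0|by move=> x; nn].
    by apply: le_Int => // x; rewrite lee_fin mulrCA.
  apply: le_trans (lee_wpmul2l _ (hD (n + j)%N (leq_trans n0n (leq_addr j n)))) _; first by rewrite lee_fin exprn_ge0.
  rewrite -!EFinM lee_fin /dyad exprD powRM ?exprn_ge0 ?invr_ge0// !powR_exp ?invr_ge0//.
  have -> : rr ^+ j = (2 `^ c) ^+ j * ((2^-1 `^ (b - 1)) ^+ j).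
    rewrite -exprMn; congr (_ ^+ _); rewrite -(@powR_inv1 _ 2)// -powRrM mulN1r -powRD_gt0//; congr (_ `^ _).
    by rewrite /c; field.
  rewrite le_eqVlt; apply/orP; left; apply/eqP; ring.
rewrite -!EFinM lee_fin; have := hn1 n n1n; rewrite ltr_pdivlMr// mulrC => /ltW; apply: le_trans.
have kk : 0 <= dyad n `^ (b - 1) :> R by exact: powR_ge0.
rewrite /K -!mulrA ler_wpM2l// ler_wpM2l ?(ltW i0)// ler_wpM2r// lerDl//.
Qed.

(** On the slab below height [dyad n] the Hardy weight is at least [dyad n ^ (- (s * p))], so the
    mass of [|u - f| ^ p] there is O(dyad^(sp)); after division by the height the exponent s p - 1
    is positive. *)
Lemma edge_hardy (f : 'rV[R]_d -> R) : measurable_fun setT f ->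
  (\I[mZ d]_z ((O z)%:R * (tau z `^ (- (s * p)) * `|u z - f z.1| `^ p))%:E < +oo)%E -> forall r,
  (\I[mX d]_x ((`|x| <= r)%R%:R * `|edge n x - f x| `^ p)%:E @[n --> \oo] --> 0)%E.
Proof using p1 sp1 sgE La0 eta_lip w_lip w_gt0 meta mw stripE mu_ u_loc u_gag.
move=> mf; set HH := (\I[mZ d]_z _)%E => Hfin r.
have HH0 : (0 <= HH)%E by apply: Int_ge0 => z; nn.
pose H := fine HH; have HE : HH = H%:E by rewrite /H fineK// ge0_fin_numE.
have H0 : 0 <= H by exact: fine_ge0.
apply: cvg0P => [n|e e0]; first by apply: Int_ge0 => x; nn.
have [C C0 [n0 h]] := mollified_edge_rate p1 sp1 sgE La0 eta_lip w_lip w_gt0 meta mw stripE mu_ u_loc u_gag r.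
have sp0 : 0 <= s * p by move: sp1; lra.
have sp2 : 0 < s * p - 1 by move: sp1; lra.
have P2 : 0 < 2 `^ p :> R by exact: powR_gt0.
have e1 : 0 < e / (2 * 2 `^ p * (C + 1)) by rewrite divr_gt0// !mulr_gt0// ltr_wpDl.
have e2 : 0 < e / (2 * 2 `^ p * (H + 1)) by rewrite divr_gt0// !mulr_gt0// ltr_wpDl.
have [n1 _ hn1] := pow_small b1 e1; have [n2 _ hn2] := pow_small sp2 e2.
exists (maxn (maxn n0 n1) n2) => // n; rewrite /= !geq_max => /andP[/andP[n0n n1n] n2n].
have [hO h1] := h n n0n; have k0 := kap0 n.
have me := measurable_edge n; have mtau := measurable_tau sg meta.
have mE : measurable_fun setT (fun x : 'rV[R]_d => `|x| <= r) by mm.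
have := @slab_dist R d eta sg sgE meta p (dyad n) (fun x => `|x| <= r) (edge n) f u p0 k0 mE me mf mu_.
set I := (\I[mX d]_x _)%E; set A := (\I[mZ d]_z _)%E; set B := (\I[mZ d]_z _)%E => hs.
have hB : (B <= (dyad n `^ (s * p) * H)%:E)%E.
  rewrite EFinM -HE -IntZ ?powR_ge0//; last by move=> z; nn.
  apply: le_Int => z; first by nn.
  have [zD|_] := boolP ((`|z.1| <= r) && (0 < tau z < dyad n)); last by rewrite mul0r; nn.
  have /andP[_ /andP[t0 tk]] := zD.
  rewrite mul1r (hO _ zD) mul1r -EFinM lee_fin mulrA ler_peMl ?powR_ge0//.
  rewrite powRN -ler_pdivrMr ?invr_gt0 ?powR_gt0// mul1r invrK; apply: powR_mono => //; exact: ltW.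
rewrite -(@lee_pmul2l _ (dyad n)%:E) ?lte_fin//; apply: (le_trans hs).
apply: (@le_trans _ _ ((2 `^ p)%:E * ((C * dyad n `^ b)%:E + (dyad n `^ (s * p) * H)%:E))%E).
  by apply: lee_wpmul2l; [rewrite lee_fin ltW|exact: leeD].
have kE : (dyad n : R) `^ (s * p) = dyad n `^ (s * p - 1) * dyad n.
  by rewrite -{3}[dyad n]powRr1 ?(ltW k0)// -powRD_gt0// subrK.
rewrite -EFinD -!EFinM lee_fin kapb kE.
have a1 := ltW (hn1 n n1n); have a2 := ltW (hn2 n n2n); rewrite -/(dyad n) in a1 a2.
have C1 : 0 < C + 1 by rewrite ltr_wpDl.
have H1 : 0 < H + 1 by rewrite ltr_wpDl.
rewrite ler_pdivlMr in a1; last by rewrite !mulr_gt0.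
rewrite ler_pdivlMr in a2; last by rewrite !mulr_gt0.
have -> : 2 `^ p * (C * (dyad n `^ (b - 1) * dyad n) + dyad n `^ (s * p - 1) * dyad n * H) =
  dyad n * (2 `^ p * (C * dyad n `^ (b - 1) + H * dyad n `^ (s * p - 1))) by ring.
rewrite ler_pM2l//.
have x0 : 0 <= dyad n `^ (b - 1) :> R by exact: powR_ge0.
have y0 : 0 <= dyad n `^ (s * p - 1) :> R by exact: powR_ge0.
move: (dyad n `^ (b - 1)) (dyad n `^ (s * p - 1)) (2 `^ p) P2 x0 y0 a1 a2 => x y P P0 x0 y0 a1 a2.
have q1 : 0 <= P * x by rewrite mulr_ge0// ltW.
have q2 : 0 <= P * y by rewrite mulr_ge0// ltW.
by lra.
Qed.

Lemma root_cvg0 (X : nat -> \bar R) : (forall n, 0 <= X n)%E -> (X n @[n --> \oo] --> 0)%E -> ((X n `^ p^-1) @[n --> \oo] --> 0)%E.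
Proof using p1.
have pp : 0 < p by move: p1; lra.
move=> X0 cX; apply: cvg0P => [n|e e0]; first exact: poweR_ge0.
have ep : 0 < e `^ p by exact: powR_gt0.
have h := cvg0_lt cX ep; near=> n.
apply: (poweR_le_eps pp e0); first exact: poweR_ge0.
rewrite -poweRrM mulVf ?gt_eqF// poweRe1//; apply: ltW; near: n; exact: h.
Unshelve. all: by end_near. Qed.

Lemma is_trace_edge (f : 'rV[R]_d -> R) : measurable_fun setT f ->
  (forall r, (\I[mX d]_x ((`|x| <= r)%R%:R * `|edge n x - f x| `^ p)%:E @[n --> \oo] --> 0)%E) ->
  is_trace etam etap s p eta u f.
Proof using p1 sp1 sgE La0 eta_lip w_lip w_gt0 meta mw stripE mu_ u_loc u_gag.
move=> mf hf; split => // r r0.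
have [n0 hn0] := facts_ r.
have pp : 0 < p by move: p1; lra.
have DE z : strip_ball etam etap r z -> closed_part r z && O z.
  move=> zs; rewrite (closure_closed_part sgE La0 eta_lip w_lip stripE (subset_closure zs)) /=.
  by apply/stripE; case: zs.
have DrE' := in_strip_ballP stripE r.
(* The approximations before the threshold may average over points outside the strip and need not be
   continuous up to the closure; for each r they are dropped by a shift of the index. *)
have shift (X : nat -> \bar R) : (X n @[n --> \oo] --> 0)%E -> (X (n + n0)%N @[n --> \oo] --> 0)%E.
  by move=> h; rewrite (cvg_shiftn n0 X).
exists (fun n => mollified (n + n0)%N); split.
- by move=> n; have [_ _ _ h] := hn0 (n + n0)%N (leq_addl _ _).
- apply: (shift (fun n => Lp_norm p (strip_ball etam etap r) (fun z => mollified n z - u z)%R)).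
  rewrite /Lp_norm; apply: root_cvg0; first by move=> n; apply: integral_ge0 => z _; nn.
  apply: cvg0P => [n|e e0]; first by apply: integral_ge0 => z _; nn.
  have [C C0 [n1 h]] := mollified_rate p1 sp1 sgE La0 eta_lip w_lip w_gt0 meta mw stripE mu_ u_loc u_gag r.
  have b0 : 0 < b by move: b1; lra.
  have C1 : 0 < C + 1 by rewrite ltr_wpDl.
  have [n2 _ h2] := pow_small b0 (divr_gt0 e0 C1).
  exists (maxn n1 n2) => // n; rewrite /= geq_max => /andP[n1n n2n].
  rewrite (@int_dom _ _ R (@lebesgue_graph R d) _ (in_strip_ball eta w sg r) _ DrE') -IntZm.
  apply: (@le_trans _ _ (C * dyad n `^ b)%:E); last first.
    rewrite lee_fin; have := ltW (h2 n n2n); rewrite ler_pdivlMr// mulrC; apply: le_trans.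
    by rewrite ler_wpM2r ?powR_ge0// lerDl.
  apply: le_trans (h n n1n); apply: le_Int => z; first by nn.
  by rewrite lee_fin ler_wpM2r ?powR_ge0// ind_le// => /DrE' /DE.
- apply: (shift (fun n => gagliardo s p (strip_ball etam etap r) (fun z => mollified n z - u z)%R)).
  have gE n : gagliardo s p (strip_ball etam etap r) (fun z => mollified n z - u z)%R =
     ((gagliardo s p (strip_ball etam etap r) (fun z => mollified n z - u z)%R `^ p) `^ p^-1)%E.
    by rewrite -poweRrM mulfV ?gt_eqF// poweRe1// poweR_ge0.
  rewrite (_ : (fun n => gagliardo s p _ _) = (fun n => ((gagliardo s p (strip_ball etam etap r) (fun z => mollified n z - u z)%R `^ p) `^ p^-1)%E)); last exact/funext.
  apply: root_cvg0; first by move=> n; exact: poweR_ge0.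
  apply: cvg0P => [n|e e0]; first exact: poweR_ge0.
  have g2 : 0 < 2 `^ gam :> R by exact: powR_gt0.
  have h := mollified_gag p1 sp1 sgE La0 eta_lip w_lip w_gt0 meta mw stripE mu_ u_loc u_gag r.
  have h2 := cvg0_lt h (divr_gt0 e0 g2).
  apply: filterS h2 => n h3; apply: le_trans (gagliardo_le_gag p1 sp1 _ DrE') _.
  apply: (@le_trans _ _ ((2 `^ gam)%:E * (e / 2 `^ gam)%:E)%E); last first.
    by rewrite -EFinM lee_fin mulrC divfK// gt_eqF.
  apply: lee_wpmul2l; first by rewrite lee_fin ltW.
  apply: le_trans (ltW h3); apply: gag_mono => z /DrE' /DE//.
apply: (shift (fun n => (\int[lebesgue_rV d]_(x in [set x | (enorm x < r)%R]) (`|mollified n (x, eta x) - f x| `^ p)%:E)%E)).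
apply: cvg0P => [n|e e0]; first by apply: integral_ge0 => x _; nn.
apply: filterS (cvg0_lt (hf r) e0) => n hn.
rewrite (@int_dom _ _ R (@lebesgue_rV R d) _ (fun x => enorm x < r))// -IntX.
apply: le_trans (ltW hn); apply: le_Int => x; first by nn.
rewrite lee_fin ler_wpM2r ?powR_ge0// ind_le// => xr; apply: le_trans (norm_le_enorm x) _; exact: ltW.
Qed.

Lemma trace_exists : exists f, is_trace etam etap s p eta u f.
Proof using p1 sp1 sgE La0 eta_lip w_lip w_gt0 meta mw stripE mu_ u_loc u_gag.
by have [f mf hf] := edge_limit; exists f; exact: is_trace_edge.
Qed.

Lemma is_trace_hardy (f : 'rV[R]_d -> R) : measurable_fun setT f ->
  (\I[mZ d]_z ((O z)%:R * (tau z `^ (- (s * p)) * `|u z - f z.1| `^ p))%:E < +oo)%E ->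
  is_trace etam etap s p eta u f.
Proof using p1 sp1 sgE La0 eta_lip w_lip w_gt0 meta mw stripE mu_ u_loc u_gag.
by move=> mf Hf; apply: is_trace_edge => //; exact: edge_hardy.
Qed.
End edge.

(** * The extension operator *)

Section wavg2.
Context d (T : measurableType d) (R : realType) (m : {sigma_finite_measure set T -> \bar R}).
Variables (phi psi : T -> R) (M M' : R).
Hypotheses (mphi : measurable_fun setT phi) (phi0 : forall x, 0 <= phi x) (phiM : (\I[m]_x (phi x)%:E = M%:E)%E).
Hypotheses (mpsi : measurable_fun setT psi) (psi0 : forall x, 0 <= psi x) (psiM : (\I[m]_x (psi x)%:E = M'%:E)%E).

Let mass_diff (l V : R) (b : T -> bool) (f g : T -> R) (A B : R) : measurable_fun setT b -> measurable_fun setT g ->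
  (forall x, 0 <= f x) -> (forall x, 0 <= g x) ->
  (\I[m]_x (f x)%:E = A%:E)%E -> (\I[m]_x (g x)%:E = B%:E)%E -> 0 <= l -> (forall x, f x <= g x + l * (b x)%:R) ->
  (\I[m]_x (b x)%:R%:E <= V%:E)%E -> A <= B + l * V.
Proof.
move=> mb mg f0 g0 hf hg l0 fg hV; rewrite -lee_fin -hf EFinD -hg EFinM.
apply: (@le_trans _ _ (\I[m]_x ((g x)%:E + l%:E * (b x)%:R%:E))%E).
  by apply: le_Int => x; [rewrite lee_fin|rewrite -EFinM -EFinD lee_fin].
rewrite IntD; [|mm|mm|by move=> x; rewrite lee_fin|by move=> x; rewrite -EFinM lee_fin mulr_ge0].
by rewrite leeD2l// IntZ//; apply: lee_wpmul2l; rewrite ?lee_fin.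
Qed.

(** Two means whose weights have different masses: after normalisation both masses are 1 and
    [wavg_diff] allows subtraction of a. The masses themselves differ by at most [l * V], by
    integrating the bound on the weights. *)
Lemma wavg2 (f : T -> R) (a l t V mm : R) (b : T -> bool) : measurable_fun setT b -> measurable_fun setT f ->
  (\I[m]_x ((b x)%:R * `|f x|)%:E < +oo)%E ->
  0 <= l -> 0 < mm -> mm <= M -> mm <= M' -> 0 <= t ->
  (forall x, `|phi x - psi x| <= l * (b x)%:R) -> (forall x, phi x <= t * (b x)%:R) -> (forall x, psi x <= t * (b x)%:R) ->
  (\I[m]_x (b x)%:R%:E <= V%:E)%E ->
  ((`|M^-1 * RI m (fun x => phi x * f x) - M'^-1 * RI m (fun x => psi x * f x)|)%:E <=
    (l * (mm^-1 + t * V / mm ^+ 2))%:E * \I[m]_x ((b x)%:R * `|f x - a|)%:E)%E.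
Proof using mphi phi0 phiM mpsi psi0 psiM.
move=> mb mf fb l0 m0 mM mM' t0 hl hphi hpsi hV.
have M0 : 0 < M := lt_le_trans m0 mM; have M0' : 0 < M' := lt_le_trans m0 mM'.
have Mi : 0 <= M^-1 by rewrite invr_ge0 ltW.
have Mi' : 0 <= M'^-1 by rewrite invr_ge0 ltW.
have fin (g : T -> R) : (forall x, 0 <= g x) -> (forall x, g x <= t * (b x)%:R) -> (\I[m]_x (g x * `|f x|)%:E < +oo)%E.
  move=> g0 gb; apply: (@le_lt_trans _ _ (t%:E * \I[m]_x ((b x)%:R * `|f x|)%:E)%E).
    rewrite -IntZ//; apply: le_Int => x; first by have := g0 x => ?; nn.
    by rewrite -EFinM lee_fin mulrA ler_wpM2r.
  by apply: lte_mul_pinfty => //; rewrite lee_fin.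
have fphi := fin _ phi0 hphi; have fpsi := fin _ psi0 hpsi.
have norm1 (k : R) (g : T -> R) (A : R) : 0 < A -> measurable_fun setT g -> (forall x, 0 <= g x) -> (\I[m]_x (g x)%:E = A%:E)%E ->
  (\I[m]_x (g x * `|f x|)%:E < +oo)%E ->
  [/\ (\I[m]_x (A^-1 * g x)%:E = 1%:E)%E, (\I[m]_x (A^-1 * g x * `|f x|)%:E < +oo)%E & RI m (fun x => A^-1 * g x * f x) = A^-1 * RI m (fun x => g x * f x)].
  move=> A0 mg g0 gA gf; have Ai : 0 <= A^-1 by rewrite invr_ge0 ltW.
  split; first by rewrite IntZR// gA -EFinM mulVf// gt_eqF.
    under eq_Int do rewrite -mulrA.
    rewrite IntZR//; last by move=> x; have := g0 x => ?; nn.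
    by apply: lte_mul_pinfty => //; rewrite lee_fin.
  have zero : (\I[m]_x (`|0 : R|)%:E < +oo)%E.
    by under eq_Int do rewrite normr0; rewrite Int0 ltry.
  have gf' : (\I[m]_x (`|g x * f x|)%:E < +oo)%E by rewrite int_norm_weight.
  have := @RI_lin _ _ _ m A^-1 (fun x => g x * f x) (fun=> 0) _ gf' _ zero.
  rewrite (RI_cst_ge0 (F := fun=> 0) (c := 0)) ?addr0// ?Int0// => <-; [|mm|mm].
  by apply: eq_RI => x; rewrite addr0 mulrA.
have [i1 i2 i3] := norm1 0 _ _ M0 mphi phi0 phiM fphi.
have [j1 j2 j3] := norm1 0 _ _ M0' mpsi psi0 psiM fpsi.
rewrite -i3 -j3.
have mp1 : measurable_fun setT (fun x => M^-1 * phi x) by mm.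
have mp2 : measurable_fun setT (fun x => M'^-1 * psi x) by mm.
have p10 x : 0 <= M^-1 * phi x by rewrite mulr_ge0.
have p20 x : 0 <= M'^-1 * psi x by rewrite mulr_ge0.
apply: le_trans (@wavg_diff _ _ _ m _ 1 mp1 p10 i1 _ mp2 p20 j1 f a mf i2 j2) _.
have V0 : 0 <= V by rewrite -lee_fin; apply: le_trans hV; apply: Int_ge0 => x; nn.
have MM : `|M - M'| <= l * V.
  rewrite ler_norml; apply/andP; split.
    have h : M' <= M + l * V; last by lra.
    apply: (mass_diff mb mphi psi0 phi0 psiM phiM l0 _ hV) => x.
    by have := hl x; rewrite ler_norml => /andP[h1 h2]; lra.
  have h : M <= M' + l * V; last by lra.
  apply: (mass_diff mb mpsi phi0 psi0 phiM psiM l0 _ hV) => x.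
  by have := hl x; rewrite ler_norml => /andP[h1 h2]; lra.
have K0 : 0 <= l * (mm^-1 + t * V / mm ^+ 2).
  by rewrite mulr_ge0// addr_ge0 ?invr_ge0 ?(ltW m0)// divr_ge0 ?mulr_ge0 ?exprn_ge0 ?(ltW m0).
rewrite -IntZ//; apply: le_Int => x; first by nn.
rewrite -EFinM lee_fin [leRHS]mulrA; apply: ler_wpM2r => //.
(* The first part is the change of the weight, giving [mm^-1]; the second is the change of the
   normalisation, giving [t * V / mm ^+ 2]. *)
have -> : M^-1 * phi x - M'^-1 * psi x = M^-1 * (phi x - psi x) + (M' - M) * (M^-1 * M'^-1) * psi x.
  by field; rewrite !gt_eqF.
apply: le_trans (ler_normD _ _) _; rewrite !normrM [in leRHS]mulrDr [in leRHS]mulrDl; apply: lerD.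
  have -> : l / mm * (b x)%:R = mm^-1 * (l * (b x)%:R) by ring.
  by rewrite (ger0_norm Mi); apply: ler_pM => //; rewrite lef_pV2.
rewrite (ger0_norm Mi) (ger0_norm Mi') (ger0_norm (psi0 x)) [`|M' - M|]distrC.
have -> : l * (t * V / mm ^+ 2) * (b x)%:R = (l * V) * (mm^-1 * mm^-1) * (t * (b x)%:R).
  by field; rewrite gt_eqF.
apply: ler_pM => //; first by rewrite !mulr_ge0.
apply: ler_pM => //; first by rewrite !mulr_ge0.
by apply: ler_pM => //; rewrite lef_pV2.
Qed.
End wavg2.

Section tent.
Context {R : realType} (d : nat).
Implicit Types (x y : 'rV[R]_d) (t : R).

(** The radius t varies with the height, unlike that of [bump], so Lipschitz dependence is required
    in the radius as well as in the centre. *)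
Definition tent t x y : R := Num.max 0 (t - `|x - y|).
Definition nearX t x y : bool := `|x - y| < t.

Lemma tent_ge0 t x y : 0 <= tent t x y. Proof. by rewrite le_max lexx. Qed.
Lemma tent_le t x y : 0 < t -> tent t x y <= t * (nearX t x y)%:R.
Proof.
move=> t0; rewrite /tent /nearX; have := normr_ge0 (x - y); move: (`|x - y|) => r r0.
have [h|h] := ltP r t; last by rewrite max_l ?mulr0//; lra.
by rewrite mulr1 max_r; lra.
Qed.
Lemma tent_ge t x y : 0 < t -> t / 2 * (nearX (t / 2) x y)%:R <= tent t x y.
Proof.
move=> t0; rewrite /tent /nearX; have := normr_ge0 (x - y); move: (`|x - y|) => r r0.
have [h|h] := ltP r (t / 2); last by rewrite mulr0 le_max lexx.
by rewrite mulr1 le_max; apply/orP; right; lra.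
Qed.
Lemma tent_lip t t' x x' y : `|tent t x y - tent t' x' y| <= `|t - t'| + `|x - x'|.
Proof.
rewrite /tent; have h1 := ler_normD (x - x') (x' - y); rewrite subrKA in h1.
have h2 := ler_normD (x' - x) (x - y); rewrite subrKA [`|x' - x|]distrC in h2.
have h3 := ler_norm (t - t'); have h4 := ler_norm (t' - t); rewrite distrC in h4.
have n1 := normr_ge0 (x - x'); have n2 := normr_ge0 (t - t').
move: (`|x - y|) (`|x' - y|) (`|x - x'|) (`|t - t'|) h1 h2 h3 h4 n1 n2 => A B C D h1 h2 h3 h4 n1 n2.
have [a1|a1] := leP 0 (t - A); have [a2|a2] := leP 0 (t' - B); rewrite ler_norml; apply/andP; split; lra.
Qed.
Lemma measurable_tent : measurable_fun setT (fun q : R * 'rV[R]_d * 'rV[R]_d => tent q.1.1 q.1.2 q.2).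
Proof. rewrite /tent; mm. Qed.
Lemma measurable_tent_section t x : measurable_fun setT (tent t x).
Proof. rewrite /tent; mm. Qed.

Definition massX t x : R := fine (\I[mX d]_y (tent t x y)%:E)%E.

Lemma nearX_vol t x : 0 < t -> (\I[mX d]_y (nearX t x y)%:R%:E = ((2 * t) ^+ d)%:E)%E.
Proof. by move=> t0; rewrite -(IvolX x t0); apply: eq_Int => y; rewrite /nearX distrC. Qed.

Lemma massXE t x : 0 < t -> (\I[mX d]_y (tent t x y)%:E = (massX t x)%:E)%E.
Proof.
move=> t0; rewrite fineK// ge0_fin_numE; last by apply: Int_ge0 => y; rewrite lee_fin tent_ge0.
apply: (@le_lt_trans _ _ (t%:E * \I[mX d]_y (nearX t x y)%:R%:E)%E).
  have t0' := ltW t0; rewrite -IntZ//; apply: le_Int => y; first by rewrite lee_fin tent_ge0.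
  by rewrite -EFinM lee_fin tent_le.
by rewrite nearX_vol// -EFinM ltry.
Qed.

Lemma massX_ge t x : 0 < t -> t / 2 * t ^+ d <= massX t x.
Proof.
move=> t0; have t2 : 0 < t / 2 by lra.
rewrite -lee_fin -(massXE x t0).
have -> : t ^+ d = (2 * (t / 2)) ^+ d by congr (_ ^+ _); field.
rewrite EFinM -(nearX_vol x t2).
have t2' := ltW t2; rewrite -IntZ//; apply: le_Int => y; first by nn.
by rewrite -EFinM lee_fin tent_ge.
Qed.
End tent.

Section ext.
Context {R : realType} (d : nat).
Local Notation Z := ('rV[R]_d * measurableTypeR R)%type.
Variables (s p : R).
Variables (eta w : 'rV[R]_d -> R) (sg c : R).
Hypotheses (meta : measurable_fun setT eta) (mw : measurable_fun setT w).
Notation O := (inO eta w sg).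
Notation tau := (tau eta sg).

(* The tent-weighted mean of [f] over the ball of radius [c * tau z] about [z.1]. *)
Definition ext (f : 'rV[R]_d -> R) (z : Z) : R :=
  (massX (c * tau z) z.1)^-1 * RI (mX d) (fun y => tent (c * tau z) z.1 y * f y).
(** The ball has twice the averaging radius so as to contain also the averaging balls of points
    close to z. *)
Definition osc (f : 'rV[R]_d -> R) (z : Z) : \bar R :=
  (\I[mX d]_y ((nearX (2 * c * tau z) z.1 y)%:R * `|f y - f z.1| `^ p)%:E)%E.
Definition loc_int (f : 'rV[R]_d -> R) := forall x r, (\I[mX d]_y ((nearX r x y)%:R * `|f y|)%:E < +oo)%E.

Lemma measurable_ext f : measurable_fun setT f -> measurable_fun setT (ext f).
Proof using meta.
move=> mf; have mtau := measurable_tau sg meta; have mt := @measurable_tent R d.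
have mt' : measurable_fun setT (fun q : Z * 'rV[R]_d => tent (c * tau q.1) q.1.1 q.2).
  have h : measurable_fun setT (fun q : Z * 'rV[R]_d => (c * tau q.1, q.1.1, q.2)) by mm.
  exact: (measurableT_comp mt h).
rewrite /ext; apply: measurable_funM.
  rewrite (_ : (fun z => _) = (fun z : Z => massX (c * tau z) z.1 `^ (-1))); last first.
    by apply/funext => z; rewrite powR_inv1// fine_ge0//; apply: Int_ge0 => y; rewrite lee_fin tent_ge0.
  apply: (@measurableT_comp _ _ _ _ _ _ (fun x : R => x `^ (-1))); first exact: measurable_powR.
  rewrite /massX; apply: (@measurableT_comp _ _ _ _ _ _ (@fine R)) => //.
  apply: (@measurable_Int _ _ _ _ _ (mX d) (fun z y => (tent (c * tau z) z.1 y)%:E)) => [|z y]; last by rewrite lee_fin tent_ge0.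
  by mm.
by apply: (@measurable_RI _ _ _ _ _ (mX d) (fun z y => tent (c * tau z) z.1 y * f y)); mm.
Qed.

Lemma osc_ge0 f z : (0 <= osc f z)%E. Proof. by apply: Int_ge0 => y; nn. Qed.

Lemma measurable_osc f : measurable_fun setT f -> measurable_fun setT (osc f).
Proof using meta.
move=> mf; have mtau := measurable_tau sg meta; rewrite /osc.
apply: (@measurable_Int _ _ _ _ _ (mX d) (fun z y => ((nearX (2 * c * tau z) z.1 y)%:R * `|f y - f z.1| `^ p)%:E)) => [|z y]; last by nn.
rewrite /nearX; mm.
Qed.

Lemma measurable_nearX t x : measurable_fun setT (nearX t x : 'rV[R]_d -> bool).
Proof. rewrite /nearX; mm. Qed.

(** The Hardy weight tau^(-sp) together with tau^(-d), which normalises the oscillation by the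
    volume of the ball. *)
Definition Qosc f := (\I[mZ d]_z (((O z)%:R * tau z `^ (- (s * p + d%:R)))%:E * osc f z))%E.

End ext.

Section ext_bounds.
Context {R : realType} (d : nat).
Local Notation Z := ('rV[R]_d * measurableTypeR R)%type.
Variables (s p La L c : R).
Hypotheses (p1 : 1 < p) (sp1 : 1 < s * p) (La0 : 0 <= La) (L0 : 0 < L).
Hypotheses (c0 : 0 < c) (cLa : c * (1 + La) <= 1) (cL : 4 * c * d%:R * L <= 1).
Notation gam := (gam d s p).

Let p0 : 0 < p. Proof. exact: lt_trans ltr01 p1. Qed.
Let p0' : 0 <= p. Proof. exact: ltW. Qed.

(** Jensen's inequality for the tent mean about the value at the foot z.1; the volume of the
    averaging ball is of order tau^d. *)
Lemma ext_hardy : exists2 C, 0 < C & forall (eta : 'rV[R]_d -> R) (sg : R) (f : 'rV[R]_d -> R) z, measurable_fun setT f -> loc_int f -> 0 < (tau eta sg) z ->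
  ((`|(ext eta sg c) f z - f z.1| `^ p)%:E <= (C * (tau eta sg) z `^ (- d%:R))%:E * (osc p eta sg c) f z)%E.
Proof using p1 c0.
pose C := 2 `^ p * 2 `^ p * (2 ^+ d) `^ (p - 1) * c `^ (- d%:R).
exists C; first by rewrite !mulr_gt0 ?powR_gt0 ?exprn_gt0.
move=> eta sg f z mf lf t0; have ct : 0 < c * (tau eta sg) z by rewrite mulr_gt0.
have [t tE] : exists t, c * (tau eta sg) z = t by exists (c * (tau eta sg) z).
rewrite tE in ct; have td : 0 < t ^+ d by rewrite exprn_gt0.
have mg := massX_ge z.1 ct.
have m0 : 0 < massX t z.1 by apply: lt_le_trans mg; rewrite mulr_gt0// divr_gt0.
have M0 : 0 < (2 * t) ^+ d by rewrite exprn_gt0// mulr_gt0.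
have hv : (\I[mX d]_y (nearX t z.1 y)%:R%:E <= ((2 * t) ^+ d)%:E)%E by rewrite nearX_vol.
have lf' : (\I[mX d]_y (tent t z.1 y * `|f y|)%:E < +oo)%E.
  apply: (@le_lt_trans _ _ (t%:E * \I[mX d]_y ((nearX t z.1 y)%:R * `|f y|)%:E)%E).
    have ct' := ltW ct; rewrite -IntZ//; apply: le_Int => y; first by have := tent_ge0 t z.1 y => ?; nn.
    by rewrite -EFinM lee_fin mulrA ler_wpM2r// tent_le.
  by apply: lte_mul_pinfty => //; rewrite lee_fin ltW.
have := @wavg_pow _ _ _ (mX d) _ _ (measurable_tent_section t z.1) (tent_ge0 t z.1) (massXE z.1 ct) f (f z.1) p t _ _ p1 m0 ct M0 (measurable_nearX t z.1) (fun y => tent_le z.1 y ct) hv mf lf'.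
rewrite (_ : _ * RI _ _ = (ext eta sg c) f z); last by rewrite /ext tE.
move=> h; apply: (le_trans h).
apply: lee_pmul; [|by apply: Int_ge0 => y; nn| |].
- by rewrite lee_fin !mulr_ge0 ?powR_ge0.
- have tdi : 0 <= t ^- d by rewrite invr_ge0 ltW.
  have h1 : t / massX t z.1 <= 2 * t ^- d.
    rewrite ler_pdivrMr//; apply: le_trans (_ : 2 * t ^- d * (t / 2 * t ^+ d) <= _); last first.
      by rewrite ler_wpM2l// mulr_ge0.
    by rewrite le_eqVlt; apply/orP; left; apply/eqP; field; rewrite gt_eqF.
  have h2 : (t / massX t z.1) `^ p <= 2 `^ p * (t ^- d) `^ p.
    by rewrite -powRM//; apply: powR_mono => //; rewrite divr_ge0// ltW.
  have td' := ltW td.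
  rewrite lee_fin /C exprMn [(2 ^+ d * _) `^ _]powRM ?exprn_ge0 ?(ltW ct)//.
  have -> : c `^ (- d%:R) = t `^ (- d%:R) / (tau eta sg) z `^ (- d%:R).
    by rewrite -tE powRM ?(ltW c0) ?(ltW t0)// mulfK// gt_eqF ?powR_gt0.
  have -> : 2 `^ p * 2 `^ p * (2 ^+ d) `^ (p - 1) * (t `^ (- d%:R) / (tau eta sg) z `^ (- d%:R)) * (tau eta sg) z `^ (- d%:R) =
     (2 `^ p * (t ^- d) `^ p) * 2 `^ p * ((2 ^+ d) `^ (p - 1) * (t ^+ d) `^ (p - 1)).
    have -> : t `^ (- d%:R) = (t ^- d) `^ p * (t ^+ d) `^ (p - 1).
      rewrite -(@powR_inv1 _ (t ^+ d))// -powRrM -powRD_gt0// mulN1r -powR_mulrn ?(ltW ct)// -powRrM; congr (_ `^ _); ring.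
    move: ((t ^- d) `^ p) ((t ^+ d) `^ (p - 1)) ((tau eta sg) z `^ (- d%:R)) (powR_gt0 (- d%:R) t0) => X Y W W0.
    by field; rewrite gt_eqF.
  by rewrite ler_wpM2r ?mulr_ge0 ?powR_ge0// ler_wpM2r ?powR_ge0.
apply: le_Int => y; first by nn.
rewrite lee_fin ler_wpM2r ?powR_ge0// ind_le// /nearX => h3; apply: lt_le_trans h3 _.
by rewrite -mulrA tE ler_peMl ?(ltW ct)// ler1n.
Qed.

(** The value of the constant of [wavg2], up to [r * t ^- d.+1], for l = 2r, weights at most 2t, V =
    (4t)^d and minimal mass (t/4)(t/2)^d. *)
Let K1 : R := 2 * (4 * 2 ^+ d + 32 * 16 ^+ d).
Let K10 : 0 < K1. Proof. by rewrite mulr_gt0// addr_gt0// mulr_gt0// exprn_gt0. Qed.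

(** As c (1 + La) <= 1, the averaging radii t and t' differ by at most [rho z z' < t / 2], so both
    balls lie in the ball of radius 2t about z.1. [wavg2] gives a factor rho / t^(d+1) for the mean
    oscillation, and Jensen's inequality turns it into rho^p t^(-p - d). *)
Lemma ext_near : exists2 C, 0 < C & forall (eta : 'rV[R]_d -> R) (sg : R), sg * sg = 1 -> (forall x y, `|eta x - eta y| <= La * `|x - y|) ->
  forall (f : 'rV[R]_d -> R) z z', measurable_fun setT f -> loc_int f -> 0 < (tau eta sg) z ->
  rho z z' < c / 2 * (tau eta sg) z ->
  ((`|(ext eta sg c) f z - (ext eta sg c) f z'| `^ p)%:E <= (C * (rho z z' `^ p * (tau eta sg) z `^ (- (p + d%:R))))%:E * (osc p eta sg c) f z)%E.
Proof using p1 c0 cLa La0.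
pose C := K1 `^ p * 2 `^ p * (4 ^+ d) `^ (p - 1) * c `^ (- (p + d%:R)).
have C0 : 0 < C by rewrite !mulr_gt0 ?powR_gt0 ?exprn_gt0.
exists C => // eta sg sgE eta_lip f z z' mf lf t0 hr.
have [rz|rz] := eqVneq (rho z z') 0.
  rewrite (rho_eq0 rz) subrr normr0 powR0 ?gt_eqF//; apply: mule_ge0; last exact: osc_ge0.
  by rewrite lee_fin mulr_ge0 ?mulr_ge0 ?powR_ge0// ltW.
have r0 : 0 < rho z z' by rewrite lt_def rz rho_ge0.
have [r rE] : exists r, rho z z' = r by exists (rho z z').
have [t tE] : exists t, t = c * (tau eta sg) z by exists (c * (tau eta sg) z).
have [t' t'E] : exists t, t = c * (tau eta sg) z' by exists (c * (tau eta sg) z').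
have ct : 0 < t by rewrite tE mulr_gt0.
have rt : r < t / 2 by move: hr; rewrite rE tE; lra.
have ht := tau_lip (sg_abs sgE) La0 eta_lip z z'; rewrite rE in ht r0.
have tt : `|t - t'| <= r.
  rewrite tE t'E -mulrBr normrM gtr0_norm//; apply: le_trans (ler_wpM2l (ltW c0) ht) _.
  by rewrite mulrA ler_piMl// ltW.
have xx : `|z.1 - z'.1| <= r by rewrite -rE /rho lerDl.
have tb := tt; rewrite ler_norml in tb; have /andP[tb1 tb2] := tb.
have ct' : 0 < t' by lra.
have t'2 : t' <= 2 * t by lra.
have t't : t / 2 <= t' by lra.
pose b y := nearX (2 * t) z.1 y.
have mb : measurable_fun setT b by exact: measurable_nearX.
have b1 y : nearX t z.1 y -> b y by rewrite /b /nearX => h; apply: lt_trans h _; lra.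
have b2 y : nearX t' z'.1 y -> b y.
  rewrite /b /nearX => h; have h1 := ler_normD (z.1 - z'.1) (z'.1 - y); rewrite subrKA in h1.
  by apply: le_lt_trans h1 _; move: (`|z.1 - z'.1|) (`|z'.1 - y|) xx h => *; lra.
have hphi y : tent t z.1 y <= 2 * t * (b y)%:R.
  apply: le_trans (tent_le z.1 y ct) _; apply: ler_pM => //; [exact: ltW|by lra|exact/ind_le/b1].
have hpsi y : tent t' z'.1 y <= 2 * t * (b y)%:R.
  apply: le_trans (tent_le z'.1 y ct') _; apply: ler_pM => //; [exact: ltW|exact/ind_le/b2].
have hl y : `|tent t z.1 y - tent t' z'.1 y| <= 2 * r * (b y)%:R.
  have [by_|nb] := boolP (b y).
    by rewrite mulr1; apply: le_trans (tent_lip _ _ _ _ _) _; lra.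
  have e1 : tent t z.1 y = 0.
    apply/eqP; rewrite eq_le tent_ge0 andbT; have := tent_le z.1 y ct.
    by rewrite (negbTE (contra (@b1 y) nb)) mulr0.
  have e2 : tent t' z'.1 y = 0.
    apply/eqP; rewrite eq_le tent_ge0 andbT; have := tent_le z'.1 y ct'.
    by rewrite (negbTE (contra (@b2 y) nb)) mulr0.
  by rewrite e1 e2 subrr normr0 mulr0.
(* A common lower bound for both masses, from [massX_ge] and t' >= t / 2. *)
pose mm := t / 4 * (t / 2) ^+ d.
have m0 : 0 < mm by rewrite mulr_gt0 ?exprn_gt0 ?divr_gt0.
have mM' : mm <= massX t' z'.1.
  apply: le_trans (massX_ge z'.1 ct'); apply: ler_pM.
  - by lra.
  - by rewrite exprn_ge0//; lra.
  - by lra.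
  - by rewrite lerXn2r ?nnegrE//; lra.
have mM : mm <= massX t z.1.
  apply: le_trans (massX_ge z.1 ct); apply: ler_pM.
  - by lra.
  - by rewrite exprn_ge0//; lra.
  - by lra.
  - by rewrite lerXn2r ?nnegrE//; lra.
have hV : (\I[mX d]_y (b y)%:R%:E <= ((2 * (2 * t)) ^+ d)%:E)%E by rewrite nearX_vol// mulr_gt0.
have r2 : 0 <= 2 * r by lra.
have t2 : 0 <= 2 * t by lra.
have := @wavg2 _ _ _ (mX d) _ _ _ _ (measurable_tent_section t z.1) (tent_ge0 t z.1) (massXE z.1 ct) (measurable_tent_section t' z'.1) (tent_ge0 t' z'.1) (massXE z'.1 ct') f (f z.1) (2 * r) (2 * t) ((2 * (2 * t)) ^+ d) mm b mb mf (lf _ _) r2 m0 mM mM' t2 hl hphi hpsi hV.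
rewrite (_ : (massX t z.1)^-1 * RI _ _ = (ext eta sg c) f z); last by rewrite /ext -tE.
rewrite (_ : (massX t' z'.1)^-1 * RI _ _ = (ext eta sg c) f z'); last by rewrite /ext -t'E.
move=> h.
have V0 : 0 < (2 * (2 * t)) ^+ d by apply/exprn_gt0/mulr_gt0 => //; apply: mulr_gt0.
have kE : 2 * r * (mm^-1 + 2 * t * (2 * (2 * t)) ^+ d / mm ^+ 2) = r * K1 * t ^- d.+1.
  rewrite /mm /K1 expr_div_n [t ^+ d.+1]exprS [(2 * (2 * t)) ^+ d]exprMn [(2 * t) ^+ d]exprMn.
  have -> : 16 ^+ d = 2 ^+ d * 2 ^+ d * (2 ^+ d * 2 ^+ d) :> R by rewrite -!exprMn; congr (_ ^+ _); ring.
  have T0 : 0 < t ^+ d by rewrite exprn_gt0.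
  have U0 : 0 < 2 ^+ d :> R by rewrite exprn_gt0.
  by move: (t ^+ d) (2 ^+ d) T0 U0 => T U T0 U0; field; rewrite !gt_eqF.
rewrite kE in h.
have k0 : 0 < r * K1 * t ^- d.+1 by rewrite !mulr_gt0// invr_gt0 exprn_gt0.
have mfz : measurable_fun setT (fun y => `|f y - f z.1|) by mm.
have := Iavg_power p1 V0 k0 (normr_ge0 ((ext eta sg c) f z - (ext eta sg c) f z')) mb mfz (fun y => normr_ge0 _) hV h.
move=> h2; apply: (le_trans h2).
have -> : (osc p eta sg c) f z = (\I[mX d]_y ((b y)%:R * `|f y - f z.1| `^ p)%:E)%E.
  by apply: eq_Int => y; rewrite /b tE mulrA.
apply: lee_wpmul2r; first by apply: Int_ge0 => y; nn.
rewrite lee_fin rE /C le_eqVlt; apply/orP; left; apply/eqP.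
have td0 : 0 <= t ^- d.+1 by rewrite invr_ge0 exprn_ge0// ltW.
have ct0 := ltW ct; have K0' := ltW K10; have r0' := ltW r0.
rewrite mulrA exprMn [2 * 2](_ : _ = 4) ?exprMn; last by ring.
rewrite [(r * _ * _) `^ _]powRM ?mulr_ge0// [(r * _) `^ _]powRM// [(4 ^+ d * _) `^ _]powRM ?exprn_ge0//.
have -> : (t ^- d.+1) `^ p = t `^ (- d.+1%:R * p) by rewrite powRrM powRN powR_mulrn.
have -> : (t ^+ d) `^ (p - 1) = t `^ (d%:R * (p - 1)) by rewrite powRrM powR_mulrn.
have -> : c `^ (- (p + d%:R)) = t `^ (- (p + d%:R)) / (tau eta sg) z `^ (- (p + d%:R)).
  by rewrite tE powRM ?(ltW c0) ?(ltW t0)// mulfK// gt_eqF ?powR_gt0.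
have -> : t `^ (- (p + d%:R)) = t `^ (- d.+1%:R * p) * t `^ (d%:R * (p - 1)).
  by rewrite -powRD_gt0//; congr (_ `^ _); rewrite -natr1; ring.
move: ((tau eta sg) z `^ (- (p + d%:R))) (powR_gt0 (- (p + d%:R)) t0) => W W0.
by field; rewrite gt_eqF.
Qed.

(** Fubini: for fixed x and y the height is confined to tau > |x - y| / (2c), and the tail of
    tau^(-(sp + d)) there is |x - y|^(-(sp + d - 1)), the exponent being [gam - 2]. The condition 4
    c d L <= 1 forces such a pair to satisfy the screening inequality |x - y| < w x / (2 L). *)
Lemma Qosc_le : exists2 C, 0 < C & forall (eta w : 'rV[R]_d -> R) (sg : R), side La L eta w sg ->
  forall f : 'rV[R]_d -> R, measurable_fun setT f ->
  ((Qosc s p eta w sg c) f <= C%:E * \I[mX d]_x \I[mX d]_y ((enorm (x - y) < (w x / (2 * L)))%R%:R * (`|f x - f y| `^ p * enorm (x - y) `^ (- (gam - 2))))%:E)%E.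
Proof using p1 sp1 c0 cL L0.
pose be := s * p + d%:R - 1.
have d0 : 0 <= d%:R :> R by [].
have be0 : 0 < be by rewrite /be; move: sp1 d0; move: (d%:R : R) => D; lra.
have [C C0 hC] := tailR be0.
pose K := C * (2 * c * d.+1%:R) `^ be; have K0 : 0 < K by rewrite mulr_gt0// powR_gt0// !mulr_gt0.
exists K => // eta w sg [sgE eta_lip w_lip w_gt0 w_elip meta mw] f mf.
have mO := measurable_inO sg meta mw; have mtau := measurable_tau sg meta; have mosc := measurable_osc p sg c meta mf.
have K0' := ltW K0.
rewrite /Qosc IntZ2; [|mm|by move=> z; apply: mule_ge0; [rewrite lee_fin; nn|exact: osc_ge0]].
rewrite -IntZ//; last by move=> x; nn.
apply: le_Int => x; first by apply: Int_ge0 => t; apply: mule_ge0; [rewrite lee_fin; nn|exact: osc_ge0].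
have -> : (\I[mR]_t ((((inO eta w sg) (x, t))%:R * (tau eta sg) (x, t) `^ (- (s * p + d%:R)))%:E * (osc p eta sg c) f (x, t)) =
  \I[mX d]_y \I[mR]_t (((inO eta w sg) (x, t))%:R * (tau eta sg) (x, t) `^ (- (s * p + d%:R)) * ((nearX (2 * c * (tau eta sg) (x, t)) x y)%:R * `|f y - f x| `^ p))%:E)%E.
  rewrite -(@Int_swap _ _ _ _ _ mR (mX d) (fun t y => (((inO eta w sg) (x, t))%:R * (tau eta sg) (x, t) `^ (- (s * p + d%:R)) * ((nearX (2 * c * (tau eta sg) (x, t)) x y)%:R * `|f y - f x| `^ p))%:E)) => [||t y]; last 2 first.
  - rewrite /nearX; mm.
  - by nn.
  apply: eq_Int => t; rewrite /osc -IntZR//; first by nn.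
rewrite -IntZ//; last by move=> y; nn.
apply: le_Int => y; first by nn.
have [xy|xy] := eqVneq x y.
  rewrite xy subrr normr0 (@powR0 _ p) ?gt_eqF//.
  rewrite (_ : (\I[mR]_t _)%E = 0%E); last by rewrite -[RHS](@Int0 _ _ _ mR); apply: eq_Int => t; rewrite !mulr0.
  by rewrite mul0r mulr0 mule0.
have n0 : 0 < `|x - y| by rewrite normr_gt0 subr_eq0.
have ne := norm_le_enorm (x - y); have en := enorm_le_norm (x - y).
have e0 : 0 < enorm (x - y) by exact: lt_le_trans ne.
have key t : (inO eta w sg) (x, t) -> nearX (2 * c * (tau eta sg) (x, t)) x y -> enorm (x - y) < w x / (2 * L).
  move=> /andP[t0 tw]; rewrite /nearX /= => h.
  apply: le_lt_trans en _; rewrite ltr_pdivlMr ?mulr_gt0//.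
  have h1 : d%:R * `|x - y| <= d%:R * (2 * c * (tau eta sg) (x, t)) by rewrite ler_wpM2l// ltW.
  have h2 : d%:R * `|x - y| * (2 * L) <= d%:R * (2 * c * (tau eta sg) (x, t)) * (2 * L) by rewrite ler_wpM2r// mulr_ge0// ltW.
  apply: le_lt_trans h2 _.
  have -> : d%:R * (2 * c * (tau eta sg) (x, t)) * (2 * L) = 4 * c * d%:R * L * (tau eta sg) (x, t) by ring.
  by apply: le_lt_trans tw; rewrite ler_piMl// ltW.
have [hd|hd] := boolP (enorm (x - y) < (w x / (2 * L))); last first.
  rewrite mul0r mule0 (_ : (\I[mR]_t _)%E = 0%E)//; rewrite -[RHS](@Int0 _ _ _ mR); apply: eq_Int => t.
  have [Ot|_] := boolP ((inO eta w sg) (x, t)); last by rewrite !mul0r.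
  have [nt|_] := boolP (nearX (2 * c * (tau eta sg) (x, t)) x y); last by rewrite mul0r mulr0.
  by rewrite (key _ Ot nt) in hd.
pose a := `|x - y| / (2 * c); have a0 : 0 < a by rewrite divr_gt0// mulr_gt0.
have F0 : 0 <= `|f y - f x| `^ p by exact: powR_ge0.
apply: (@le_trans _ _ ((`|f y - f x| `^ p)%:E * \I[mR]_t ((a <= `|(t : R) - eta x|)%R%:R * `|(t : R) - eta x| `^ (- (1 + be)))%:E)%E).
  rewrite -IntZR//.
  apply: le_Int => t; first by nn.
  rewrite lee_fin [leLHS]mulrA [leLHS]mulrC ler_wpM2l//.
  have [/andP[t0 tw]|_] := boolP ((inO eta w sg) (x, t)); last by rewrite !mul0r; nn.
  have [nt|_] := boolP (nearX (2 * c * (tau eta sg) (x, t)) x y); last by rewrite mulr0; nn.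
  have te : `|(t : R) - eta x| = (tau eta sg) (x, t) by rewrite -(tau_norm eta (sg_abs sgE) (x, t)) gtr0_norm.
  rewrite te (_ : a <= _); last by rewrite ler_pdivrMr ?mulr_gt0// mulrC ltW.
  by rewrite !mul1r mulr1 (_ : 1 + be = s * p + d%:R)// /be; ring.
apply: le_trans (lee_wpmul2l _ (hC (eta x) a a0)) _; first by rewrite lee_fin.
rewrite -!EFinM lee_fin mul1r distrC [leRHS]mulrCA ler_wpM2l//.
have -> : - (gam - 2) = - be by rewrite /gam /be -natr1; ring.
rewrite /K -[leRHS]mulrA ler_wpM2l ?(ltW C0)//.
have q0 : 0 < 2 * c * d.+1%:R by rewrite !mulr_gt0.
have -> : (2 * c * d.+1%:R) `^ be * enorm (x - y) `^ (- be) = (enorm (x - y) / (2 * c * d.+1%:R)) `^ (- be).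
  have q0' := ltW q0; have e0' := ltW e0; rewrite [RHS]powRM ?invr_ge0//.
  have inv q : 0 <= q -> q^-1 `^ (- be) = q `^ be :> R by move=> q1; rewrite -(powR_inv1 q1) -powRrM mulrNN mul1r.
  by rewrite inv// mulrC.
apply: powR_anti; [exact: ltW|by rewrite divr_gt0|].
rewrite ler_pdivrMr// /a; apply: (le_trans en).
have -> : `|x - y| / (2 * c) * (2 * c * d.+1%:R) = d.+1%:R * `|x - y| by field; rewrite gt_eqF.
by rewrite ler_wpM2r// ler_nat.
Qed.
End ext_bounds.

Lemma IntZ_ereal d (T : measurableType d) (R : realType) (m : {sigma_finite_measure set T -> \bar R}) (k : \bar R) (F : T -> \bar R) :
  (0 <= k)%E -> measurable_fun setT F -> (forall x, 0 <= F x)%E -> (\I[m]_x (k * F x) = k * Int m F)%E.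
Proof. by move=> k0 mF F0; rewrite !IntE ge0_integralZl. Qed.

Lemma two_term_le (R : realDomainType) (k t a m b : R) (Q S : \bar R) : 0 < k -> 0 <= t -> 0 <= a -> 0 <= m -> 0 <= b ->
  (0 <= Q)%E -> (0 <= S)%E ->
  (k%:E * Q + t%:E * (a%:E * Q + m%:E * S + b%:E * Q) <= (k + t * (a + b + m))%:E * (Q + S))%E.
Proof.
move=> k0 t0 a0 m0 b0; have K0 : 0 < k + t * (a + b + m) by rewrite ltr_pwDl// mulr_ge0// !addr_ge0.
case: Q S => [Q||] [S||]//; rewrite ?lee_fin => Q0 S0; first last.
- by rewrite [in leRHS]addye// [in leRHS]gt0_muley ?lte_fin// leey.
- by rewrite [in leRHS]addye// [in leRHS]gt0_muley ?lte_fin// leey.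
- by rewrite [in leRHS]addey// [in leRHS]gt0_muley ?lte_fin// leey.
change ((k * Q + t * (a * Q + m * S + b * Q))%:E <= ((k + t * (a + b + m)) * (Q + S))%:E)%E.
rewrite lee_fin -subr_ge0.
have -> : (k + t * (a + b + m)) * (Q + S) - (k * Q + t * (a * Q + m * S + b * Q)) = k * S + t * ((a + b) * S + m * Q) by ring.
by rewrite addr_ge0// mulr_ge0// ?addr_ge0// ?mulr_ge0// ?addr_ge0// ltW.
Qed.

(** * Energy of the extension from one graph *)

Section energies.
Context {R : realType} (d : nat).
Local Notation Z := ('rV[R]_d * measurableTypeR R)%type.
Variables (s p : R) (eta w : 'rV[R]_d -> R) (sg L : R).
Notation gam := (gam d s p).
Notation del x := (w x / (2 * L)).
Notation O := (inO eta w sg).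
Notation tau := (tau eta sg).

(** The p-th power of the seminorm [screened_le] of order s - 1/p; [far_energy] is that of
    [screened_ge] of order s + 1/p. *)
Definition near_energy (f : 'rV[R]_d -> R) : \bar R :=
  (\I[mX d]_x \I[mX d]_y ((enorm (x - y) < del x)%R%:R * (`|f x - f y| `^ p * enorm (x - y) `^ (- (gam - 2))))%:E)%E.
Definition far_energy (f : 'rV[R]_d -> R) : \bar R :=
  (\I[mX d]_x \I[mX d]_y ((~~ (enorm (x - y) < del x)%R)%:R * (del x * del y * (`|f x - f y| `^ p * enorm (x - y) `^ (- gam))))%:E)%E.
Definition hardy_energy (u : Z -> R) (f : 'rV[R]_d -> R) : \bar R :=
  (\I[mZ d]_z ((O z)%:R * (tau z `^ (- (s * p)) * `|u z - f z.1| `^ p))%:E)%E.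

End energies.

Section ext_energy.
Context {R : realType} (d : nat).
Local Notation Z := ('rV[R]_d * measurableTypeR R)%type.
Variables (s p La L c : R).
Hypotheses (p1 : 1 < p) (s0 : 0 < s) (s1 : s < 1) (sp1 : 1 < s * p) (La0 : 0 <= La) (L0 : 0 < L).
Hypotheses (c0 : 0 < c) (cLa : c * (1 + La) <= 1) (cL : 4 * c * d%:R * L <= 1).
Notation gam := (gam d s p).

Let p0 : 0 < p. Proof. exact: lt_trans ltr01 p1. Qed.
Let p0' : 0 <= p. Proof. exact: ltW. Qed.

Lemma hardy_energy_ext : exists2 C, 0 < C & forall (eta w : 'rV[R]_d -> R) (sg : R), side La L eta w sg ->
  forall f : 'rV[R]_d -> R, measurable_fun setT f -> loc_int f ->
  ((hardy_energy s p eta w sg) ((ext eta sg c) f) f <= C%:E * (Qosc s p eta w sg c) f)%E.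
Proof using p1 c0.
have [C C0 hC] := ext_hardy d p1 c0.
exists C => // eta w sg sd f mf lf; have C0' := ltW C0.
rewrite /Qosc -IntZ//; last by move=> z; apply: mule_ge0; [rewrite lee_fin; nn|exact: osc_ge0].
apply: le_Int => z; first by nn.
have [Oz|_] := boolP ((inO eta w sg) z); last by rewrite !mul0r mul0e mule0.
have /andP[t0 _] := Oz; rewrite !mul1r EFinM.
apply: le_trans (lee_wpmul2l _ (hC eta sg f z mf lf t0)) _; first by rewrite lee_fin powR_ge0.
rewrite !muleA -!EFinM; apply: lee_wpmul2r; first exact: osc_ge0.
by rewrite lee_fin opprD powRD_gt0// le_eqVlt; apply/orP; left; apply/eqP; ring.
Qed.

(** Chosen so that [1 + be] is [gam / 2]: the kernel is shared evenly between the two columns, and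
    integration along each lowers the exponent by one. *)
Let be := gam / 2 - 1.
Let be_gt0 : 0 < be.
Proof.
have d0 : 0 <= d%:R :> R by []. rewrite /be /gam -natr1; move: sp1 d0; move: (d%:R : R) (s * p) => D q h1 h2; lra.
Qed.

Lemma column_kernel_bound : exists2 C, 0 < C & forall (eta : 'rV[R]_d -> R) (sg : R), sg * sg = 1 -> forall (x : 'rV[R]_d) a, 0 < a ->
  (\I[mR]_t ((0 < (tau eta sg) (x, t))%R%:R * (a + (tau eta sg) (x, t)) `^ (- (1 + be)))%:E <= (C * a `^ (- be))%:E)%E.
Proof using sp1.
have [C C0 hC] := tailR be_gt0; exists C => // eta sg sgE x a a0.
apply: le_trans (hC (eta x + sg * a) a a0); apply: le_Int => t; first by nn.
have [t0|_] := boolP (0 < (tau eta sg) (x, t)); last by rewrite mul0r; nn.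
have -> : `|(t : R) - (eta x + sg * a)| = a + (tau eta sg) (x, t).
  have -> : (t : R) - (eta x + sg * a) = - (sg * (a + (tau eta sg) (x, t))) by rewrite /tau mulrDr mulrA sgE /=; ring.
  by rewrite normrN normrM (sg_abs sgE) mul1r gtr0_norm// addr_gt0.
by rewrite lerDl (ltW t0).
Qed.

(* For |x - y| < delta, rho^-gam is at most a constant times
   (|x-y| + tau)^(-gam/2) (|x-y| + tau')^(-gam/2), which integrates along the two
   columns to |x-y|^(2-gam); otherwise rho^-gam <= |x-y|^-gam and the columns
   have lengths w x and w y. *)
Lemma middle_bound k : 0 < k -> exists2 C, 0 < C & forall (eta w : 'rV[R]_d -> R) (sg : R), side La L eta w sg ->
  forall f : 'rV[R]_d -> R, measurable_fun setT f ->
  (\I[mZ d]_z \I[mZ d]_z' (((inO eta w sg) z && (inO eta w sg) z' && (k * (tau eta sg) z <= rho z z') && (k * (tau eta sg) z' <= rho z z'))%R%:R *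
     (`|f z.1 - f z'.1| `^ p * rho z z' `^ (- gam)))%:E <= C%:E * ((near_energy s p w L) f + (far_energy s p w L) f))%E.
Proof using p1 sp1 L0.
move=> k0; have [C C0 hC] := column_kernel_bound; have g0 := gam_gt0 d sp1.
(* From [a <= r] and [k * t <= r] follows [k * (a + t) <= (1 + k) * r], hence
   [ka * (a + t) <= r]. *)
pose ka := k / (1 + k); have ka0 : 0 < ka by rewrite divr_gt0// addr_gt0.
pose D : R := d.+1%:R; have D0 : 0 < D by [].
pose Ka := ka `^ (- gam) * (C * C) * D `^ (gam - 2).
pose Kb := D `^ gam * (2 * L) ^+ 2.
have Ka0 : 0 < Ka by rewrite !mulr_gt0 ?powR_gt0.
have Kb0 : 0 < Kb by rewrite mulr_gt0 ?powR_gt0 ?exprn_gt0 ?mulr_gt0.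
have K0 : 0 < Ka + Kb by rewrite addr_gt0.
exists (Ka + Kb) => // eta w sg sd f mf; have K0' := ltW K0.
have [sgE eta_lip w_lip w_gt0 w_elip meta mw] := sd.
have mO := measurable_inO sg meta mw; have mtau := measurable_tau sg meta.
have d0 x : 0 <= (w x / (2 * L)) by rewrite divr_ge0 ?mulr_ge0// ltW.
pose P z z' := (inO eta w sg) z && (inO eta w sg) z' && (k * (tau eta sg) z <= rho z z') && (k * (tau eta sg) z' <= rho z z').
pose A x y := ((enorm (x - y) < (w x / (2 * L)))%R%:R * (`|f x - f y| `^ p * enorm (x - y) `^ (- (gam - 2))))%:E.
pose B x y := ((~~ (enorm (x - y) < (w x / (2 * L)))%R)%:R * ((w x / (2 * L)) * (w y / (2 * L)) * (`|f x - f y| `^ p * enorm (x - y) `^ (- gam))))%:E.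
have A0 x y : (0 <= A x y)%E by rewrite /A; nn.
have B0 x y : (0 <= B x y)%E by rewrite /B; have := d0 x => ?; have := d0 y => ?; nn.
have mA : measurable_fun setT (fun q => A q.1 q.2) by rewrite /A; mm.
have mB : measurable_fun setT (fun q => B q.1 q.2) by rewrite /B; mm.
rewrite /near_energy /far_energy -(Int2D _ _ mA A0 mB B0) fubini4; last 2 first.
- by mm.
- by move=> z z'; nn.
have AB0 x y : (0 <= A x y + B x y)%E by exact: adde_ge0.
rewrite -(Int2Z _ _ K0' AB0).
apply: le_Int => x; first by nn.
apply: le_Int => y; first by nn.
rewrite /A /B; have [xy|xy] := eqVneq x y.
  rewrite (_ : (\I[mR]_t _)%E = 0%E).
    by apply: mule_ge0; [rewrite lee_fin|exact: (AB0 x y)].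
  by rewrite -[RHS](@Int0 _ _ _ mR); apply: eq_Int => t; rewrite -[RHS](@Int0 _ _ _ mR); apply: eq_Int => t'; rewrite /= xy subrr normr0 (@powR0 _ p) ?gt_eqF// mul0r mulr0.
have a0 : 0 < `|x - y| by rewrite normr_gt0 subr_eq0.
have [a aE] : exists a, `|x - y| = a by exists `|x - y|.
have ne := norm_le_enorm (x - y); have en := enorm_le_norm (x - y).
rewrite aE in a0 ne en.
have [e eE] : exists e, enorm (x - y) = e by exists (enorm (x - y)).
rewrite eE in ne en *; have e0 : 0 < e := lt_le_trans a0 ne.
have eD : e <= D * a by apply: le_trans en _; rewrite ler_wpM2r ?(ltW a0)// ler_nat.
have aw (q : R) : 0 <= q -> a `^ (- q) <= D `^ q * e `^ (- q).
  move=> q0; have -> : D `^ q = D^-1 `^ (- q) by rewrite -(@powR_inv1 _ D)// -powRrM mulrNN mul1r.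
  rewrite -powRM ?invr_ge0 ?(ltW e0)//; apply: powR_anti => //; first by rewrite mulr_gt0 ?invr_gt0.
  by rewrite mulrC ler_pdivrMr// mulrC.
have [F FE] : exists F, `|f x - f y| `^ p = F by exists (`|f x - f y| `^ p).
have F0 : 0 <= F by rewrite -FE powR_ge0.
rewrite FE.
have hr t t' : a <= rho ((x, t) : Z) (y, t') by rewrite -aE /rho lerDl.
have [hd|hd] := boolP (e < (w x / (2 * L))); last first.
  rewrite mul0r add0e mul1r.
  apply: (@le_trans _ _ (\I[mR]_t \I[mR]_t' ((((0 < (tau eta sg) (x, t)) && ((tau eta sg) (x, t) < w x))%:R * ((0 < (tau eta sg) (y, t')) && ((tau eta sg) (y, t') < w y))%:R)%:E * (F * a `^ (- gam))%:E))%E).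
    apply: le_Int => t; first by nn.
    apply: le_Int => t'; first by nn.
    rewrite -EFinM lee_fin; apply: ler_pM => //; first by rewrite mulr_ge0// powR_ge0.
      by rewrite indM ind_le// => /andP[/andP[/andP[h1 h2] _] _]; apply/andP.
    by rewrite ler_wpM2l// powR_anti// ltW.
  have fa0 : 0 <= F * a `^ (- gam) by rewrite mulr_ge0 ?powR_ge0.
  under eq_Int do rewrite IntZr//.
  rewrite IntZr//; last by move=> t; apply: Int_ge0 => t'; nn.
  rewrite slice2// -!EFinM lee_fin.
  apply: le_trans (_ : w x * w y * (F * (D `^ gam * e `^ (- gam))) <= _).
    by rewrite ler_wpM2l ?mulr_ge0 ?(ltW (w_gt0 _))// ler_wpM2l// aw// ltW.
  apply: le_trans (_ : Kb * ((w x / (2 * L)) * (w y / (2 * L)) * (F * e `^ (- gam))) <= _).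
    by rewrite /Kb le_eqVlt; apply/orP; left; apply/eqP; field; exact: lt0r_neq0.
  rewrite ler_wpM2r ?lerDr ?(ltW Ka0)//.
  have dx := d0 x; have dy := d0 y.
  by apply: mulr_ge0; [exact: mulr_ge0|rewrite mulr_ge0// powR_ge0].
rewrite mul0r adde0 mul1r.
pose J t := (0 < (tau eta sg) t)%R%:R * (a + (tau eta sg) t) `^ (- (1 + be)).
have J0 t : 0 <= J t by rewrite /J; nn.
have cst0 : 0 <= F * ka `^ (- gam) by rewrite mulr_ge0 ?powR_ge0.
have kin t r : 0 < t -> a <= r -> k * t <= r -> r `^ (- (1 + be)) <= ka `^ (- (1 + be)) * (a + t) `^ (- (1 + be)).
  move=> t0 ar kt; have at0 : 0 < a + t by rewrite addr_gt0.
  rewrite -powRM ?(ltW ka0) ?(ltW at0)//; apply: powR_anti; [by move: be_gt0; lra|by rewrite mulr_gt0|].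
  rewrite /ka mulrAC ler_pdivrMr ?addr_gt0// mulrDr [r * _]mulrC mulrDl mul1r addrC lerD//.
  by rewrite ler_wpM2l// ltW.
apply: (@le_trans _ _ (\I[mR]_t \I[mR]_t' ((J (x, t))%:E * ((J (y, t'))%:E * (F * ka `^ (- gam))%:E)))%E).
  apply: le_Int => t; first by nn.
  apply: le_Int => t'; first by nn.
  rewrite -!EFinM lee_fin; set r := rho _ _.
  have [/andP[/andP[/andP[/andP[t0 _] /andP[t0' _]] h1] h2]|_] := boolP (_ && _); last first.
    by rewrite mul0r; apply: mulr_ge0 => //; apply: mulr_ge0.
  have gE : - gam = - (1 + be) + - (1 + be) by rewrite /be; field.
  have r0 : 0 < r := lt_le_trans a0 (hr t t').
  rewrite mul1r /J t0 t0' !mul1r gE !powRD_gt0//.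
  have -> : forall X Y W G : R, X * (Y * (G * (W * W))) = G * ((W * X) * (W * Y)) by move=> *; ring.
  rewrite ler_wpM2l// ler_pM ?powR_ge0//; apply: kin => //; exact: hr.
rewrite (_ : (\I[mR]_t _)%E = (\I[mR]_t ((J (x, t))%:E * (\I[mR]_t (J (y, t))%:E * (F * ka `^ (- gam))%:E)))%E); last first.
  apply: eq_Int => t; rewrite IntZ//; last by move=> t'; rewrite -EFinM lee_fin mulr_ge0.
  by rewrite IntZr// => t'; rewrite lee_fin.
have JI z : (0 <= \I[mR]_t (J (z, t))%:E)%E by apply: Int_ge0 => t; rewrite lee_fin.
have hj z := hC eta sg sgE z a a0.
have IJ : (\I[mR]_t ((J (x, t))%:E * (\I[mR]_t (J (y, t))%:E * (F * ka `^ (- gam))%:E)) <= (C * a `^ (- be) * (C * a `^ (- be) * (F * ka `^ (- gam))))%:E)%E.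
  have ca : 0 <= C * a `^ (- be) by rewrite mulr_ge0 ?powR_ge0// ltW.
  apply: (@le_trans _ _ (\I[mR]_t ((J (x, t))%:E * (C * a `^ (- be) * (F * ka `^ (- gam)))%:E))%E).
    apply: le_Int => t; first by rewrite mule_ge0 ?mule_ge0 ?lee_fin.
    apply: lee_wpmul2l; first by rewrite lee_fin.
    by rewrite [in leRHS]EFinM; apply: lee_wpmul2r; [rewrite lee_fin|exact: hj].
  rewrite IntZr ?mulr_ge0 ?powR_ge0 ?(ltW C0)//; last by move=> t; rewrite lee_fin.
  rewrite [in leRHS]EFinM; apply: lee_wpmul2r; [by rewrite lee_fin mulr_ge0|exact: hj].
apply: (le_trans IJ); rewrite -EFinM lee_fin.
have -> : C * a `^ (- be) * (C * a `^ (- be) * (F * ka `^ (- gam))) = ka `^ (- gam) * (C * C) * (F * a `^ (- (gam - 2))).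
  have -> : - (gam - 2) = - be + - be by rewrite /be; field.
  by rewrite powRD_gt0//; ring.
have g2 : 0 <= gam - 2 by have := be_gt0; rewrite /be; lra.
apply: le_trans (_ : Ka * (F * e `^ (- (gam - 2))) <= _).
  rewrite /Ka -[leRHS]mulrA ler_wpM2l ?mulr_ge0 ?powR_ge0 ?(ltW C0)// [leRHS]mulrCA ler_wpM2l// aw//.
by rewrite ler_wpM2r ?mulr_ge0 ?powR_ge0// lerDl ltW.
Qed.

(** For close pairs [ext_near] integrated by [nearZ] gives tau^(-p - d) tau^(p - sp), the weight of
    [Qosc]. For the others the outer differences ext - f are far terms controlled by the Hardy
    energy, and the middle difference f x - f y falls under [middle_bound]. *)
Lemma gag_ext : exists2 C, 0 < C & forall (eta w : 'rV[R]_d -> R) (sg : R), side La L eta w sg ->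
  forall f : 'rV[R]_d -> R, measurable_fun setT f -> loc_int f ->
  (gag s p (inO eta w sg) ((ext eta sg c) f) <= C%:E * ((Qosc s p eta w sg c) f + (near_energy s p w L) f + (far_energy s p w L) f))%E.
Proof using p1 s0 s1 sp1 La0 L0 c0 cLa.
pose c1 := c / 2; have c10 : 0 < c1 by rewrite divr_gt0.
(* If [rho z z' >= c1 * tau z], the Lipschitz bound gives [tau z' <= (c1^-1 + 1 + La) * rho z z']: a
   pair that is not close to z is far relative to both heights. *)
pose k := (c1^-1 + 1 + La)^-1.
have k0 : 0 < k by rewrite invr_gt0 ltr_wpDr// addr_gt0 ?invr_gt0.
have kc : k <= c1.
  by rewrite /k -[leRHS]invrK lef_pV2 ?posrE ?invr_gt0// ?ltr_wpDr ?addr_gt0 ?invr_gt0// -addrA lerDl addr_ge0.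
have [Ce Ce0 he] := ext_near d p1 La0 c0 cLa.
have [Ch Ch0 hh] := hardy_energy_ext.
have [Cn Cn0 hn] := nearZ d p1 s0 s1 sp1.
have [Cl Cl0 hl] := far_l d sp1 k0.
have [Cr Cr0 hr] := far_r d sp1 k0.
have [Cm Cm0 hm] := middle_bound k0.
have g0 := gam_gt0 d sp1.
pose K1 := Ce * (Cn * c1 `^ (p - s * p)).
have K10 : 0 < K1 by rewrite !mulr_gt0 ?powR_gt0.
pose K := K1 + 3 `^ p * ((Cl + Cr) * Ch + Cm).
exists K; first by rewrite !addr_gt0// mulr_gt0 ?powR_gt0// addr_gt0// mulr_gt0// addr_gt0.
move=> eta w sg sd f mf lf; have [sgE eta_lip w_lip w_gt0 w_elip meta mw] := sd.
have mE := measurable_ext sg c meta mf.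
have mO := measurable_inO sg meta mw; have mtau := measurable_tau sg meta.
have mosc := measurable_osc p sg c meta mf.
pose g z := `|(ext eta sg c) f z - f z.1| `^ p.
have g_ge0 z : 0 <= g z by exact: powR_ge0.
have mg : measurable_fun setT g by rewrite /g; mm.
pose N z z' := (((((inO eta w sg) z)%:R * (Ce * (tau eta sg) z `^ (- (p + d%:R))) * ((rho z z' < c1 * (tau eta sg) z)%R%:R * (rho z z' `^ p * rho z z' `^ (- gam))))%:E) * (osc p eta sg c) f z)%E.
pose A z z' := (((inO eta w sg) z)%:R * (g z * ((k * (tau eta sg) z <= rho z z')%R%:R * rho z z' `^ (- gam))))%:E.
pose B z z' := (((inO eta w sg) z')%:R * (g z' * ((k * (tau eta sg) z' <= rho z z')%R%:R * rho z z' `^ (- gam))))%:E.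
pose U z z' := (((inO eta w sg) z && (inO eta w sg) z' && (k * (tau eta sg) z <= rho z z') && (k * (tau eta sg) z' <= rho z z'))%R%:R * (`|f z.1 - f z'.1| `^ p * rho z z' `^ (- gam)))%:E.
have Ce0' := ltW Ce0.
have N0 z z' : (0 <= N z z')%E by rewrite /N; apply: mule_ge0; [rewrite lee_fin; nn|exact: osc_ge0].
have A0 z z' : (0 <= A z z')%E by rewrite /A; have := g_ge0 z => ?; nn.
have B0 z z' : (0 <= B z z')%E by rewrite /B; have := g_ge0 z' => ?; nn.
have U0 z z' : (0 <= U z z')%E by rewrite /U; nn.
have mN : measurable_fun setT (fun q : Z * Z => N q.1 q.2) by rewrite /N; mm.
have mA : measurable_fun setT (fun q : Z * Z => A q.1 q.2) by rewrite /A; mm.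
have mB : measurable_fun setT (fun q : Z * Z => B q.1 q.2) by rewrite /B; mm.
have mU : measurable_fun setT (fun q : Z * Z => U q.1 q.2) by rewrite /U; mm.
have p3 : 0 <= 3 `^ p :> R by exact: powR_ge0.
have AU0 z z' : (0 <= A z z' + U z z')%E by apply: adde_ge0.
have AUB0 z z' : (0 <= A z z' + U z z' + B z z')%E by apply: adde_ge0.
have F0 z z' : (0 <= (3 `^ p)%:E * (A z z' + U z z' + B z z'))%E by apply: mule_ge0 => //; rewrite lee_fin.
have mAU : measurable_fun setT (fun q : Z * Z => A q.1 q.2 + U q.1 q.2)%E by exact: emeasurable_funD.
have mAUB : measurable_fun setT (fun q : Z * Z => A q.1 q.2 + U q.1 q.2 + B q.1 q.2)%E by exact: emeasurable_funD.
have mF : measurable_fun setT (fun q : Z * Z => (3 `^ p)%:E * (A q.1 q.2 + U q.1 q.2 + B q.1 q.2))%E by exact: measurable_funeM.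
apply: (@le_trans _ _ (\I[mZ d]_z \I[mZ d]_z' (N z z' + (3 `^ p)%:E * (A z z' + U z z' + B z z')))%E).
  apply: le_Int => z; first by nn.
  apply: le_Int => z'; first by nn.
  have NF : (0 <= N z z' + (3 `^ p)%:E * (A z z' + U z z' + B z z'))%E by apply: adde_ge0.
  have [Oz|_] := boolP ((inO eta w sg) z); last by rewrite mul0r.
  have [Oz'|_] := boolP ((inO eta w sg) z'); last by rewrite mul0r mulr0.
  have /andP[tz _] := Oz; have /andP[tz' _] := Oz'.
  rewrite !mul1r; have [hn1|hf1] := ltP (rho z z') (c1 * (tau eta sg) z).
    apply: le_trans (_ : N z z' <= _)%E; last by rewrite leeDl.
    rewrite /N Oz hn1 !mul1r EFinM.
    apply: le_trans (lee_wpmul2r _ (he eta sg sgE eta_lip f z z' mf lf tz hn1)) _; first by rewrite lee_fin powR_ge0.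
    rewrite muleAC -EFinM; apply: lee_wpmul2r; first exact: osc_ge0.
    by rewrite lee_fin le_eqVlt; apply/orP; left; apply/eqP; ring.
  apply: le_trans (_ : (3 `^ p)%:E * (A z z' + U z z' + B z z') <= _)%E; last by rewrite leeDr.
  have f1 : k * (tau eta sg) z <= rho z z' by apply: le_trans hf1; rewrite ler_wpM2r// ltW.
  have f2 : k * (tau eta sg) z' <= rho z z'.
    rewrite /k mulrC ler_pdivrMr; last by rewrite ltr_wpDr// addr_gt0 ?invr_gt0.
    have h1 := tau_lip (sg_abs sgE) La0 eta_lip z z'; rewrite ler_norml in h1; have /andP[h2 _] := h1.
    have h3 : (tau eta sg) z <= c1^-1 * rho z z' by rewrite ler_pdivlMl.
    have -> : rho z z' * (c1^-1 + 1 + La) = c1^-1 * rho z z' + (1 + La) * rho z z' by ring.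
    by apply: le_trans (lerD h3 (lexx _)); rewrite -lerBlDl -lerN2 opprB.
  rewrite /A /B /U Oz Oz' f1 f2 !mul1r -!EFinD -EFinM lee_fin -!mulrDl mulrA.
  apply: ler_wpM2r; rewrite ?powR_ge0//.
  have := dist3 ((ext eta sg c) f z) (f z.1) (f z'.1) ((ext eta sg c) f z') p0'.
  by rewrite [`|f z'.1 - (ext eta sg c) f z'|]distrC.
rewrite (Int2D _ _ mN N0 mF F0) (Int2Z _ _ p3 AUB0) (Int2D _ _ mAU AU0 mB B0) (Int2D _ _ mA A0 mU U0).
have Q0 : (0 <= (Qosc s p eta w sg c) f)%E by apply: Int_ge0 => z; apply: mule_ge0; [rewrite lee_fin; nn|exact: osc_ge0].
have d0 x : 0 <= (w x / (2 * L)) by rewrite divr_ge0 ?mulr_ge0// ltW.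
have LE0 : (0 <= (near_energy s p w L) f)%E by apply: Int_ge0 => x; nn.
have GE0 : (0 <= (far_energy s p w L) f)%E by apply: Int_ge0 => x; apply: Int_ge0 => y; have := d0 x => ?; have := d0 y => ?; nn.
have iN : (\I[mZ d]_z \I[mZ d]_z' N z z' <= K1%:E * (Qosc s p eta w sg c) f)%E.
  have K1' := ltW K10.
  rewrite -IntZ//; last by move=> z; apply: mule_ge0; [rewrite lee_fin; nn|exact: osc_ge0].
  apply: le_Int => z; first by apply: Int_ge0 => z'; exact: N0.
  have [Oz|nO] := boolP ((inO eta w sg) z); last first.
    rewrite mul0r mul0e mule0 (_ : (\I[mZ d]_z' _)%E = 0%E)//; rewrite -[RHS](@Int0 _ _ _ (mZ d)).
    by apply: eq_Int => z'; rewrite /N (negbTE nO) !mul0r mul0e.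
  have /andP[t0 _] := Oz; rewrite /N Oz.
    apply: (@le_trans _ _ ((Ce * (tau eta sg) z `^ (- (p + d%:R)))%:E * ((Cn * (c1 * (tau eta sg) z) `^ (p - s * p))%:E * (osc p eta sg c) f z))%E).
    apply: (@le_trans _ _ (\I[mZ d]_z' ((Ce * (tau eta sg) z `^ (- (p + d%:R)))%:E * (((rho z z' < c1 * (tau eta sg) z)%R%:R * (rho z z' `^ p * rho z z' `^ (- gam)))%:E * (osc p eta sg c) f z)))%E).
      apply: le_Int => z'; first by have := N0 z z'; rewrite /N Oz.
      by rewrite mul1r EFinM muleA.
    rewrite IntZ; [|by rewrite mulr_ge0 ?powR_ge0|by move=> z'; apply: mule_ge0; [rewrite lee_fin; nn|exact: osc_ge0]].
    apply: lee_wpmul2l; first by rewrite lee_fin mulr_ge0 ?powR_ge0.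
    under eq_Int do rewrite muleC.
    have ct0 : 0 < c1 * (tau eta sg) z by rewrite mulr_gt0.
    rewrite IntZ_ereal//; [|exact: osc_ge0|mm|by move=> z'; nn].
    by rewrite [leRHS]muleC; apply: lee_wpmul2l; [exact: osc_ge0|exact: hn].
  rewrite !muleA -!EFinM; apply: lee_wpmul2r; first exact: osc_ge0.
  rewrite lee_fin mul1r powRM ?(ltW c10) ?(ltW t0)//.
  have -> : - (s * p + d%:R) = - (p + d%:R) + (p - s * p) by ring.
  by rewrite [in leRHS]powRD_gt0// /K1 le_eqVlt; apply/orP; left; apply/eqP; ring.
have hH := hh eta w sg sd f mf lf.
have iA : (\I[mZ d]_z \I[mZ d]_z' A z z' <= (Cl * Ch)%:E * (Qosc s p eta w sg c) f)%E.
  apply: le_trans (hl eta w sg g mg g_ge0) _; rewrite EFinM -muleA; apply: lee_wpmul2l; last exact: hH.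
  by rewrite lee_fin ltW.
have iB : (\I[mZ d]_z \I[mZ d]_z' B z z' <= (Cr * Ch)%:E * (Qosc s p eta w sg c) f)%E.
  apply: le_trans (hr eta w sg meta mw g mg g_ge0) _; rewrite EFinM -muleA; apply: lee_wpmul2l; last exact: hH.
  by rewrite lee_fin ltW.
have iU := hm eta w sg sd f mf.
have Cl0' := ltW Cl0; have Cr0' := ltW Cr0; have Ch0' := ltW Ch0; have Cm0' := ltW Cm0; have K10' := ltW K10.
apply: (@le_trans _ _ (K1%:E * (Qosc s p eta w sg c) f + (3 `^ p)%:E * ((Cl * Ch)%:E * (Qosc s p eta w sg c) f + Cm%:E * ((near_energy s p w L) f + (far_energy s p w L) f) + (Cr * Ch)%:E * (Qosc s p eta w sg c) f))%E).
  apply: leeD => //; apply: lee_wpmul2l; first by rewrite lee_fin.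
  by apply: leeD => //; apply: leeD.
have S0 : (0 <= (near_energy s p w L) f + (far_energy s p w L) f)%E by exact: adde_ge0.
rewrite -[X in (_ <= _ * X)%E]addeA.
move: ((Qosc s p eta w sg c) f) ((near_energy s p w L) f + (far_energy s p w L) f)%E Q0 S0 => Q S Q0 S0.
by rewrite /K mulrDl; apply: two_term_le; rewrite ?mulr_ge0.
Qed.
End ext_energy.

(** * Gluing the two extensions *)

Section blend.
Context {R : realType} (d : nat).
Local Notation Z := ('rV[R]_d * measurableTypeR R)%type.
Variables (s p La L : R).
Hypotheses (p1 : 1 < p) (s0 : 0 < s) (s1 : s < 1) (sp1 : 1 < s * p) (La0 : 0 <= La).
Notation gam := (gam d s p).

Let p0 : 0 < p. Proof. exact: lt_trans ltr01 p1. Qed.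
Let p0' : 0 <= p. Proof. exact: ltW. Qed.
Let spp : s * p < p. Proof. exact: (sp_lt_p p1 s0 s1). Qed.
Let sp0 : 0 < s * p. Proof. exact: lt_trans ltr01 sp1. Qed.

Definition width_energy (D : Z -> bool) (w : 'rV[R]_d -> R) (u v : Z -> R) : \bar R :=
  (\I[mZ d]_z ((D z)%:R * (w z.1 `^ (- (s * p)) * `|u z - v z| `^ p))%:E)%E.

Lemma width_energy_ge0 D w u v : (0 <= width_energy D w u v)%E.
Proof. by apply: Int_ge0 => z; nn. Qed.

Lemma width_energyC D w u v : width_energy D w u v = width_energy D w v u.
Proof. by apply: eq_Int => z; rewrite distrC. Qed.

Lemma ratio_lip (t t' w w' r : R) : 0 < w -> 0 < w' -> 0 < t' -> t' < w' ->
  `|t - t'| <= (1 + La) * r -> `|w - w'| <= La * r -> 0 <= r ->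
  `|t / w - t' / w'| <= (1 + 2 * La) * r / w.
Proof using La0.
move=> w0 w0' t0' tw' h1 h2 r0.
have -> : t / w - t' / w' = ((t - t') + (t' / w') * (w' - w)) / w.
  by field; rewrite !gt_eqF.
rewrite normrM [`|w^-1|]gtr0_norm ?invr_gt0// ler_pM2r ?invr_gt0//.
apply: le_trans (ler_normD _ _) _.
have -> : (1 + 2 * La) * r = (1 + La) * r + La * r by ring.
apply: lerD => //; rewrite normrM distrC; apply: le_trans h2; apply: ler_piMl => //.
by rewrite gtr0_norm ?divr_gt0// ler_pdivrMr// mul1r ltW.
Qed.

(** At distances below w the ratio tau / w varies by at most (1 + 2 La) rho / w, and beyond by at
    most 1, being between 0 and 1; the near and the tail integrals both give w^(-sp). *)
Lemma ratio_kernel : exists2 C, 0 < C & forall (eta w : 'rV[R]_d -> R) (sg : R), side La L eta w sg ->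
  forall z, inO eta w sg z ->
  (\I[mZ d]_z' ((inO eta w sg z')%:R * (`|tau eta sg z / w z.1 - tau eta sg z' / w z'.1| `^ p * rho z z' `^ (- gam)))%:E
    <= (C * w z.1 `^ (- (s * p)))%:E)%E.
Proof using p1 s0 s1 sp1 La0 p0' sp0.
have [Cn Cn0 hn] := nearZ d p1 s0 s1 sp1.
have [Ct Ct0 ht] := tailZ d sp1.
pose k := (1 + 2 * La) `^ p; have k0 : 0 <= k by exact: powR_ge0.
exists (k * Cn + Ct); first by rewrite ltr_wpDl// mulr_ge0// ltW.
move=> eta w sg sd z Oz; have [sgE eta_lip w_lip w_gt0 w_elip meta mw] := sd.
have mO := measurable_inO sg meta mw; have mtau := measurable_tau sg meta.
have w0 := w_gt0 z.1; have w0' := ltW w0.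
pose A z' := ((rho z z' < w z.1)%R%:R * (rho z z' `^ p * rho z z' `^ (- gam)))%:E.
pose B z' := ((w z.1 <= rho z z')%R%:R * rho z z' `^ (- gam))%:E.
have A0 z' : (0 <= A z')%E by rewrite /A; nn.
have B0 z' : (0 <= B z')%E by rewrite /B; nn.
have mA : measurable_fun setT A by rewrite /A; mm.
have mB : measurable_fun setT B by rewrite /B; mm.
have kw0 : 0 <= k * w z.1 `^ (- p) by rewrite mulr_ge0 ?powR_ge0.
apply: (@le_trans _ _ (\I[mZ d]_z' ((k * w z.1 `^ (- p))%:E * A z' + B z'))%E).
  apply: le_Int => z'; first by nn.
  have [Oz'|_] := boolP (inO eta w sg z'); last first.
    by rewrite mul0r; apply: adde_ge0 => //; apply: mule_ge0 => //; rewrite lee_fin.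
  have /andP[t0 tw] := Oz; have /andP[t0' tw'] := Oz'; have wz' := w_gt0 z'.1.
  have r0 := rho_ge0 z z'.
  rewrite /A /B mul1r -EFinM -EFinD lee_fin.
  have [h|h] := ltP (rho z z') (w z.1).
    rewrite mul1r mul0r addr0 mulrA; apply: ler_wpM2r; first exact: powR_ge0.
    have xr : `|z.1 - z'.1| <= rho z z' by rewrite /rho lerDl.
    have wl : `|w z.1 - w z'.1| <= La * rho z z'.
      by apply: le_trans (w_lip _ _) _; rewrite ler_wpM2l.
    have := ratio_lip w0 wz' t0' tw' (tau_lip (sg_abs sgE) La0 eta_lip z z') wl r0 => h1.
    apply: le_trans (powR_mono p0' (normr_ge0 _) h1) _.
    have La1 : 0 <= 1 + 2 * La by rewrite addr_ge0// mulr_ge0.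
    rewrite !powRM ?invr_ge0// ?mulr_ge0//.
    by rewrite -(@powR_inv1 _ (w z.1))// -powRrM mulN1r mulrAC.
  rewrite mul0r mulr0 add0r mul1r ler_piMl ?powR_ge0//.
  have : `|tau eta sg z / w z.1 - tau eta sg z' / w z'.1| <= 1.
    have a1 : 0 < tau eta sg z / w z.1 by rewrite divr_gt0.
    have a2 : tau eta sg z / w z.1 < 1 by rewrite ltr_pdivrMr// mul1r.
    have b1 : 0 < tau eta sg z' / w z'.1 by rewrite divr_gt0.
    have b2 : tau eta sg z' / w z'.1 < 1 by rewrite ltr_pdivrMr// mul1r.
    move: (tau eta sg z / w z.1) (tau eta sg z' / w z'.1) a1 a2 b1 b2 => X Y a1 a2 b1 b2.
    by rewrite ler_norml; apply/andP; split; lra.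
  by move=> /(powR_mono p0' (normr_ge0 _)); rewrite powR1.
have kA0 z' : (0 <= (k * w z.1 `^ (- p))%:E * A z')%E by apply: mule_ge0 => //; rewrite lee_fin.
rewrite IntD//; last by exact: measurable_funeM.
rewrite IntZ// mulrDl EFinD; apply: leeD.
  apply: le_trans (lee_wpmul2l _ (hn z (w z.1) w0)) _; first by rewrite lee_fin.
  rewrite -EFinM lee_fin powRD_gt0// powRN.
  rewrite le_eqVlt; apply/orP; left; apply/eqP; field.
  by rewrite gt_eqF// powR_gt0.
exact: ht.
Qed.

(** A product rule for the blend: the energies of u and v enter with weights at most 1, and the
    variation of the ratio multiplies u - v, whose price is [width_energy] by [ratio_kernel]. *)
Lemma gag_blend : exists2 C, 0 < C & forall (eta w : 'rV[R]_d -> R) (sg : R), side La L eta w sg ->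
  forall u v T : Z -> R, measurable_fun setT u -> measurable_fun setT v ->
  (forall z, inO eta w sg z -> T z = u z + tau eta sg z / w z.1 * (v z - u z)) ->
  (gag s p (inO eta w sg) T <= C%:E * (gag s p (inO eta w sg) u + gag s p (inO eta w sg) v + width_energy (inO eta w sg) w u v))%E.
Proof using p1 s0 s1 sp1 La0 p0' sp0.
have [C C0 hC] := ratio_kernel.
have K0 : 0 < 3 `^ p * (1 + 1 + C) by rewrite mulr_gt0 ?powR_gt0// !addr_gt0.
exists (3 `^ p * (1 + 1 + C)) => // eta w sg sd u v T mu_ mv TE; have [sgE eta_lip w_lip w_gt0 w_elip meta mw] := sd.
have mO := measurable_inO sg meta mw; have mtau := measurable_tau sg meta.
pose O := inO eta w sg; pose th z := tau eta sg z / w z.1.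
have thE z : th z = tau eta sg z * w z.1 `^ (-1) by rewrite /th powR_inv1// ltW.
have mth : measurable_fun setT th by rewrite (_ : th = fun z => tau eta sg z * w z.1 `^ (-1)); [mm|apply/funext].
pose A z z' := ((O z)%:R * ((O z')%:R * (`|u z - u z'| `^ p * rho z z' `^ (- gam))))%:E.
pose B z z' := ((O z)%:R * ((O z')%:R * (`|v z - v z'| `^ p * rho z z' `^ (- gam))))%:E.
pose U z z' := (((O z)%:R * `|u z - v z| `^ p) * ((O z')%:R * (`|th z - th z'| `^ p * rho z z' `^ (- gam))))%:E.
have A0 z z' : (0 <= A z z')%E by rewrite /A; nn.
have B0 z z' : (0 <= B z z')%E by rewrite /B; nn.
have U0 z z' : (0 <= U z z')%E by rewrite /U; nn.
have mA : measurable_fun setT (fun q : Z * Z => A q.1 q.2) by rewrite /A /O; mm.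
have mB : measurable_fun setT (fun q : Z * Z => B q.1 q.2) by rewrite /B /O; mm.
have mU : measurable_fun setT (fun q : Z * Z => U q.1 q.2) by rewrite /U /O; mm.
have p3 : 0 <= 3 `^ p :> R by exact: powR_ge0.
have AB0 z z' : (0 <= A z z' + B z z')%E by apply: adde_ge0.
have ABU0 z z' : (0 <= A z z' + B z z' + U z z')%E by apply: adde_ge0.
have mAB : measurable_fun setT (fun q : Z * Z => A q.1 q.2 + B q.1 q.2)%E by exact: emeasurable_funD.
apply: (@le_trans _ _ (\I[mZ d]_z \I[mZ d]_z' ((3 `^ p)%:E * (A z z' + B z z' + U z z')))%E).
  apply: le_Int => z; first by nn.
  apply: le_Int => z'; first by nn.
  have [Oz|_] := boolP (inO eta w sg z); last first.
    by rewrite mul0r; apply: mule_ge0 => //; rewrite lee_fin.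
  have [Oz'|_] := boolP (inO eta w sg z'); last first.
    by rewrite mul0r mulr0; apply: mule_ge0 => //; rewrite lee_fin.
  rewrite /A /B /U /O Oz Oz' !mul1r -!EFinD -EFinM lee_fin [`|u z - v z| `^ p * _]mulrA -!mulrDl mulrA.
  apply: ler_wpM2r; first exact: powR_ge0.
  have th1 : 0 <= th z' <= 1.
    have /andP[t0' tw'] := Oz'; have wz' := w_gt0 z'.1.
    by rewrite /th divr_ge0 ?(ltW t0') ?(ltW wz')//= ler_pdivrMr// mul1r ltW.
  rewrite TE// TE// -/(th z) -/(th z').
  (* The convex weights are taken at z' and the factor u - v at z, so that the last term can be
     integrated in z' by [ratio_kernel]. *)
  have -> : u z + th z * (v z - u z) - (u z' + th z' * (v z' - u z')) =
    (1 - th z') * (u z - u z') + th z' * (v z - v z') + (u z - v z) * (th z' - th z) by ring.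
  have /andP[h0 h1] := th1; have h2 : 0 <= 1 - th z' by rewrite subr_ge0.
  apply: le_trans (powR_mono p0' (normr_ge0 _) (_ : _ <= `|u z - u z'| + `|v z - v z'| + `|u z - v z| * `|th z - th z'|)) _.
    apply: le_trans (ler_normD _ _) _; apply: lerD.
      apply: le_trans (ler_normD _ _) _; apply: lerD; rewrite normrM ger0_norm//; apply: ler_piMl => //.
      by rewrite gerBl.
    by rewrite normrM [`|th z' - _|]distrC.
  have uv0 : 0 <= `|u z - v z| * `|th z - th z'| by exact: mulr_ge0.
  by have := powD3 p0' (normr_ge0 (u z - u z')) (normr_ge0 (v z - v z')) uv0; rewrite [in leRHS]powRM.
rewrite (Int2Z _ _ p3 ABU0) (Int2D _ _ mAB AB0 mU U0) (Int2D _ _ mA A0 mB B0).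
have iU : (\I[mZ d]_z \I[mZ d]_z' U z z' <= C%:E * width_energy O w u v)%E.
  have C0' := ltW C0; rewrite -IntZ//; last by move=> z; nn.
  apply: le_Int => z; first by apply: Int_ge0 => z'; exact: U0.
  rewrite /U IntZR; [|by rewrite mulr_ge0 ?powR_ge0|by move=> z'; nn].
  have [Oz|nO] := boolP (O z); last by rewrite !mul0r mul0e mule0.
  apply: le_trans (lee_wpmul2l _ (hC eta w sg sd z Oz)) _; first by rewrite lee_fin mul1r powR_ge0.
  by rewrite -!EFinM lee_fin !mul1r le_eqVlt; apply/orP; left; apply/eqP; ring.
rewrite [in leRHS]EFinM -muleA; apply: lee_wpmul2l; first by rewrite lee_fin.
have ga := gag_ge0 s p O u; have gb := gag_ge0 s p O v; have W0 := width_energy_ge0 O w u v.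
apply: (@le_trans _ _ (gag s p O u + gag s p O v + C%:E * width_energy O w u v)%E).
  exact: leeD.
have C0' := ltW C0; have G0 : (0 <= gag s p O u + gag s p O v)%E by apply: adde_ge0.
rewrite ge0_muleDr//; apply: leeD.
  by rewrite -[leLHS]mul1e; apply: lee_wpmul2r => //; rewrite lee_fin -addrA lerDl addr_ge0.
by apply: lee_wpmul2r => //; rewrite lee_fin lerDr.
Qed.

Section one_side.
Variables (eta w : 'rV[R]_d -> R) (sg : R).
Hypothesis sd : side La L eta w sg.
Notation O := (inO eta w sg).
Notation tau := (tau eta sg).

(** As tau / w < 1 and s p < p, (tau / w)^p is at most (tau / w)^(sp), which turns the singular
    weight tau^(-sp) into w^(-sp). *)
Lemma hardy_energy_blend (u v T : Z -> R) f : measurable_fun setT u -> measurable_fun setT v -> measurable_fun setT f ->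
  (forall z, O z -> T z = u z + tau z / w z.1 * (v z - u z)) ->
  (hardy_energy s p eta w sg T f <= (2 `^ p)%:E * (hardy_energy s p eta w sg u f + width_energy O w u v))%E.
Proof using sd p0' spp.
move=> mu_ mv mf TE; have [sgE eta_lip w_lip w_gt0 w_elip meta mw] := sd.
have mO := measurable_inO sg meta mw; have mtau := measurable_tau sg meta.
have p2 : 0 <= 2 `^ p :> R by exact: powR_ge0.
rewrite /hardy_energy /width_energy -IntD; [|mm|mm|by move=> z; nn|by move=> z; nn].
rewrite -IntZ//; last by move=> z; apply: adde_ge0; nn.
apply: le_Int => z; first by nn.
have [Oz|_] := boolP (O z); last by rewrite !mul0r adde0 mule0.
have /andP[t0 tw] := Oz; have w0 := w_gt0 z.1.
rewrite !mul1r -EFinD -EFinM lee_fin TE//.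
have -> : u z + tau z / w z.1 * (v z - u z) - f z.1 = (u z - f z.1) + (tau z / w z.1) * (v z - u z) by ring.
apply: le_trans (ler_wpM2l (powR_ge0 _ _) (le_trans (powR_mono p0' (normr_ge0 _) (ler_normD _ _)) (powD2 p0' (normr_ge0 _) (normr_ge0 _)))) _.
rewrite mulrCA; apply: ler_wpM2l => //; rewrite mulrDr lerD2l normrM [`|v z - _|]distrC.
have tw0 : 0 < tau z / w z.1 by rewrite divr_gt0.
rewrite (gtr0_norm tw0) [(_ / _ * _) `^ _]powRM ?(ltW tw0)// mulrA; apply: ler_wpM2r; first exact: powR_ge0.
have -> : w z.1 `^ (- (s * p)) = tau z `^ (- (s * p)) * (tau z / w z.1) `^ (s * p).
  rewrite -[X in _ = _ * X `^ _]invrK invf_div.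
  have wt0 : 0 <= w z.1 / tau z by rewrite divr_ge0// ltW.
  rewrite -(@powR_inv1 _ (w z.1 / tau z))// -powRrM mulN1r -powRM ?(ltW t0)//.
  by rewrite [tau z * _]mulrC divfK// gt_eqF.
apply: ler_wpM2l; first exact: powR_ge0.
apply: ger_powR; last exact: ltW.
by rewrite tw0 ler_pdivrMr// mul1r ltW.
Qed.
End one_side.

(** u - v passes through f and f'. The weight w^(-sp) is below the Hardy weight of each graph, and
    on f - f' its integral along a column is w^(1 - sp), the weight of the jump. *)
Lemma width_energy_le (eta eta' w : 'rV[R]_d -> R) (sg sg' : R) : side La L eta w sg -> side La L eta' w sg' ->
  (forall z, inO eta w sg z = inO eta' w sg' z) ->
  forall (u v : Z -> R) (f f' : 'rV[R]_d -> R), measurable_fun setT u -> measurable_fun setT v ->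
  measurable_fun setT f -> measurable_fun setT f' ->
  (width_energy (inO eta w sg) w u v <= (3 `^ p)%:E * (hardy_energy s p eta w sg u f + hardy_energy s p eta' w sg' v f' +
    \I[mX d]_x (`|f x - f' x| `^ p * w x `^ (- (s * p - 1)))%:E))%E.
Proof using p0' sp0.
move=> [sgE eta_lip w_lip w_gt0 w_elip meta mw] [sgE' _ _ _ _ meta' _] OO u v f f' mu_ mv mf mf'.
have mO := measurable_inO sg meta mw; have mtau := measurable_tau sg meta.
have mO' := measurable_inO sg' meta' mw; have mtau' := measurable_tau sg' meta'.
have p3 : 0 <= 3 `^ p :> R by exact: powR_ge0.
pose F x := w x `^ (- (s * p)) * `|f x - f' x| `^ p.
have F0 x : 0 <= F x by rewrite /F; nn.
have mF : measurable_fun setT F by rewrite /F; mm.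
have -> : (\I[mX d]_x (`|f x - f' x| `^ p * w x `^ (- (s * p - 1)))%:E = \I[mZ d]_z ((inO eta w sg z)%:R * F z.1)%:E)%E.
  rewrite (Int_inO sgE w_gt0 meta mw mF F0); apply: eq_Int => x; congr (_%:E); rewrite /F.
  have -> : - (s * p - 1) = - (s * p) + 1 by ring.
  by rewrite powRD_gt0// powRr1 ?(ltW (w_gt0 x))//; ring.
pose A z := ((inO eta w sg z)%:R * (tau eta sg z `^ (- (s * p)) * `|u z - f z.1| `^ p))%:E.
pose B z := ((inO eta' w sg' z)%:R * (tau eta' sg' z `^ (- (s * p)) * `|v z - f' z.1| `^ p))%:E.
pose E z := ((inO eta w sg z)%:R * F z.1)%:E.
have A0 z : (0 <= A z)%E by rewrite /A; nn.
have B0 z : (0 <= B z)%E by rewrite /B; nn.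
have E0 z : (0 <= E z)%E by rewrite /E; have := F0 z.1 => ?; nn.
have mA : measurable_fun setT A by rewrite /A; mm.
have mB : measurable_fun setT B by rewrite /B; mm.
have mE : measurable_fun setT E by rewrite /E; mm.
have AB0 z : (0 <= A z + B z)%E by exact: adde_ge0.
have mAB : measurable_fun setT (fun z => A z + B z)%E by exact: emeasurable_funD.
rewrite /hardy_energy /width_energy -/A -/B -/E -(IntD _ mA mB A0 B0) -(IntD _ mAB mE AB0 E0) -IntZ//; last by move=> z; exact: adde_ge0.
apply: le_Int => z; first by nn.
rewrite /A /B /E -OO; have [Oz|_] := boolP (inO eta w sg z); last first.
  by rewrite !mul0r !adde0 mule0.
have Oz' := Oz; rewrite OO in Oz'; have /andP[t0 tw] := Oz; have /andP[t0' tw'] := Oz'.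
rewrite !mul1r -!EFinD -EFinM lee_fin /F.
apply: le_trans (ler_wpM2l (powR_ge0 _ _) (dist3 (u z) (f z.1) (f' z.1) (v z) p0')) _.
rewrite mulrCA; apply: ler_wpM2l => //; rewrite !mulrDr [`|f' z.1 - v z|]distrC addrAC; apply: lerD => //; apply: lerD; apply: ler_wpM2r; rewrite ?powR_ge0//; apply: powR_anti => //; exact: ltW.
Qed.
End blend.

(** * Conclusion *)

Section geometry.
Context {R : realType} (d : nat).
Local Notation Z := ('rV[R]_d * measurableTypeR R)%type.
Implicit Types eta : 'rV[R]_d -> R.

Lemma lipschitz_const_ge0 eta : is_lipschitz eta -> 0 <= lipschitz_const eta.
Proof. by move=> h; apply: lb_le_inf => // K []. Qed.

(** The infimum is itself a Lipschitz constant: for distinct points the difference quotient is a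
    lower bound of all of them. *)
Lemma lipschitz_constP eta x y : is_lipschitz eta -> `|eta x - eta y| <= lipschitz_const eta * enorm (x - y).
Proof.
move=> h; have [e0|e0] := eqVneq (enorm (x - y)) 0.
  by rewrite (enorm_eq0 e0) subrr normr0 mulr_ge0 ?enorm_ge0 ?lipschitz_const_ge0.
have {}e0 : 0 < enorm (x - y) by rewrite lt_def e0 enorm_ge0.
rewrite -ler_pdivrMr//; apply: lb_le_inf => // K [_ hK].
by rewrite ler_pdivrMr.
Qed.

(** Passing from the Euclidean to the sup norm costs the factor d; this is the origin of
    [La = L * d], whereas the screen keeps the Euclidean constant L. *)
Lemma lip_enorm_norm eta K : 0 <= K -> (forall x y, `|eta x - eta y| <= K * enorm (x - y)) ->
  forall x y, `|eta x - eta y| <= K * d%:R * `|x - y|.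
Proof.
move=> K0 h x y; apply: le_trans (h x y) _; rewrite -mulrA ler_wpM2l//; exact: enorm_le_norm.
Qed.

Variables (etam etap : 'rV[R]_d -> R) (L : R).
Hypotheses (lm : is_lipschitz etam) (lp : is_lipschitz etap) (hL : lipschitz_const etam + lipschitz_const etap = L).
Hypothesis lt_eta : forall x, etam x < etap x.
Notation w := (fun x => etap x - etam x).

Let L0 : 0 <= L. Proof. by rewrite -hL addr_ge0// lipschitz_const_ge0. Qed.

Let lip_of eta K : 0 <= K -> K <= L -> (forall x y, `|eta x - eta y| <= K * enorm (x - y)) ->
  forall x y, `|eta x - eta y| <= L * d%:R * `|x - y|.
Proof.
move=> K0 KL h x y; apply: le_trans (lip_enorm_norm K0 h x y) _.
by rewrite ler_wpM2r// ler_wpM2r.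
Qed.

Lemma width_lip x y : `|w x - w y| <= L * enorm (x - y).
Proof using lm lp hL.
have -> : w x - w y = (etap x - etap y) - (etam x - etam y) by rewrite /=; ring.
apply: le_trans (ler_normB _ _) _; rewrite -hL addrC mulrDl; apply: lerD; exact: lipschitz_constP.
Qed.

Let measurable_lip eta K : (forall x y, `|eta x - eta y| <= K * `|x - y|) -> measurable_fun setT eta.
Proof. by move=> h; apply: continuous_measurable_rV; exact: lip_continuous_rV h. Qed.

Lemma side_of eta sg : eta = etam \/ eta = etap -> sg * sg = 1 -> side (L * d%:R) L eta w sg.
Proof using L0 lm lp hL lt_eta.
move=> he sg1; have le x y : `|eta x - eta y| <= L * d%:R * `|x - y|.
  case: he => ->.
    by apply: (lip_of (lipschitz_const_ge0 lm)) => [|x' y']; [rewrite -hL lerDl lipschitz_const_ge0|exact: lipschitz_constP].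
  by apply: (lip_of (lipschitz_const_ge0 lp)) => [|x' y']; [rewrite -hL lerDr lipschitz_const_ge0|exact: lipschitz_constP].
have lw x y : `|w x - w y| <= L * d%:R * `|x - y| by exact: (lip_enorm_norm L0 width_lip).
split => //.
- by move=> x; rewrite subr_gt0.
- exact: width_lip.
- exact: measurable_lip le.
- exact: (@measurable_lip w _ lw).
Qed.

Lemma strip_top z : strip etam etap z <-> inO etap w 1 z.
Proof.
rewrite /strip /inO /tau /= !mul1r; split=> /andP[h1 h2]; apply/andP; split.
- by rewrite subr_gt0.
- by rewrite ltrD2l ltrN2.
- by move: h2; rewrite ltrD2l ltrN2.
- by rewrite -subr_gt0.
Qed.

Lemma inO_bottom z : inO etap w 1 z = inO etam w (-1) z.
Proof.
rewrite /inO /tau /= !mul1r !mulN1r !opprB subr_gt0 ltrD2l ltrN2 subr_gt0 andbC.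
by rewrite ltrD2r.
Qed.

Lemma strip_bottom z : strip etam etap z <-> inO etam w (-1) z.
Proof. by rewrite -inO_bottom; exact: strip_top. Qed.
End geometry.

Section roots.
Context {R : realType}.
Local Open Scope ereal_scope.

Lemma root_le (p K : R) (X Y : \bar R) : (0 < p)%R -> (0 <= K)%R -> 0 <= X -> 0 <= Y ->
  X `^ p <= K%:E * Y `^ p -> X <= (K `^ p^-1)%:E * Y.
Proof.
move=> p0 K0 X0 Y0 h.
have pi0 : (0 <= p^-1)%R by rewrite invr_ge0 ltW.
have := @gt0_ler_poweR R p^-1 pi0 (X `^ p) (K%:E * Y `^ p).
rewrite !in_itv /= !leey !andbT poweR_ge0 mule_ge0 ?lee_fin ?poweR_ge0//= => /(_ isT isT h).
rewrite poweRM ?lee_fin ?poweR_ge0// -!poweRrM mulfV ?gt_eqF// !poweRe1// poweR_EFin//.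
Qed.

Lemma le_sum (a b : R) (X Y N : \bar R) : (0 <= a)%R -> (0 <= b)%R -> 0 <= N ->
  X <= a%:E * N -> Y <= b%:E * N -> X + Y <= (a + b)%:E * N.
Proof. by move=> a0 b0 N0 h1 h2; rewrite EFinD ge0_muleDl ?lee_fin//; apply: leeD. Qed.

Lemma le_scale (k a : R) (X N : \bar R) : (0 <= k)%R -> X <= a%:E * N -> k%:E * X <= (k * a)%:E * N.
Proof. by move=> k0 h; rewrite EFinM -muleA; apply: lee_wpmul2l. Qed.
End roots.

(** * Dependence on the values in the strip and local integrability *)

Section locality.
Context {R : realType} (d : nat).
Local Notation Z := ('rV[R]_d * measurableTypeR R)%type.
Variables (s p : R).
Hypotheses (p1 : 1 < p).

Let p0 : 0 < p. Proof. exact: lt_trans ltr01 p1. Qed.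
Let p0' : 0 <= p. Proof. exact: ltW. Qed.

Lemma set_asbool (U : set ('rV[R]_d * R)) z : U z <-> `[< U z >].
Proof. by split=> /asboolP. Qed.

Lemma Lp_norm_eq U (u v : 'rV[R]_d * R -> R) : (forall z, U z -> u z = v z) -> Lp_norm p U u = Lp_norm p U v.
Proof.
move=> uv; rewrite /Lp_norm !(@int_dom _ _ R (@lebesgue_graph R d) _ (fun z => `[< U z >]) _ (set_asbool U)) -!IntZm.
congr (_ `^ _)%E; apply: eq_Int => z; have [/asboolP/uv ->|_] := boolP `[< U z >] => //.
by rewrite !mul0r.
Qed.

Lemma gagliardo_eq U (u v : 'rV[R]_d * R -> R) : (forall z, U z -> u z = v z) -> gagliardo s p U u = gagliardo s p U v.
Proof using p1 p0.
move=> uv; have gE t : gagliardo s p U t = ((gagliardo s p U t `^ p) `^ p^-1)%E.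
  by rewrite -poweRrM mulfV ?gt_eqF// poweRe1// poweR_ge0.
have E : (gagliardo s p U u `^ p = gagliardo s p U v `^ p)%E.
  apply: (etrans (gagliardo_pow s p1 u (set_asbool U))); apply/esym/(etrans (gagliardo_pow s p1 v (set_asbool U)))/esym.
  apply: eq_Int => z; apply: eq_Int => z'; have [/asboolP/uv ->|_] := boolP `[< U z >]; last by rewrite !mul0r.
  by have [/asboolP/uv ->|_] := boolP `[< U z' >] => //; rewrite !mul0r.
exact: (etrans (gE u) (etrans (congr1 (fun x => x `^ p^-1)%E E) (esym (gE v)))).
Qed.

Lemma is_trace_eq (etam etap eta : 'rV[R]_d -> R) (u v : 'rV[R]_d * R -> R) f :
  (forall z, strip etam etap z -> u z = v z) -> is_trace etam etap s p eta u f -> is_trace etam etap s p eta v f.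
Proof using p1 p0.
move=> uv [mf h]; split; first exact: mf.
move=> r r0; have [V [h1 h2 h3 h4]] := h r r0.
have uv' n z : strip_ball etam etap r z -> V n z - u z = V n z - v z by move=> [/uv ->].
exists V; split; [exact: h1| | |exact: h4].
  have -> : (fun n => Lp_norm p (strip_ball etam etap r) (fun z => V n z - v z)) =
    (fun n => Lp_norm p (strip_ball etam etap r) (fun z => V n z - u z)); last exact: h2.
  by apply/funext => n; rewrite (Lp_norm_eq (uv' n)).
have -> : (fun n => gagliardo s p (strip_ball etam etap r) (fun z => V n z - v z)) =
  (fun n => gagliardo s p (strip_ball etam etap r) (fun z => V n z - u z)); last exact: h3.
by apply/funext => n; rewrite (gagliardo_eq (uv' n)).
Qed.

Lemma Lploc_ball (f : 'rV[R]_d -> R) r : Lploc_rV p f -> (\I[mX d]_x ((`|x| <= r)%R%:R * `|f x| `^ p)%:E < +oo)%E.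
Proof.
move=> [_ h]; have := h _ (@compact_ball R d r).
by rewrite (@int_dom _ _ R (@lebesgue_rV R d) _ (fun x => `|x| <= r))// IntX.
Qed.

Lemma Lploc_loc_int (f : 'rV[R]_d -> R) : Lploc_rV p f -> loc_int f.
Proof using p1 p0.
move=> lf x r; have [mf _] := lf; pose q := `|x| + `|r|.
have q0 : 0 < q + 1 by rewrite ltr_wpDl// addr_ge0.
apply: (@le_lt_trans _ _ (\I[mX d]_y ((`|y - 0| < q + 1)%R%:R%:E + ((`|y| <= q)%R%:R * `|f y| `^ p)%:E))%E); last first.
  rewrite IntD; [|mm|mm|by move=> y; nn|by move=> y; nn].
  by rewrite IvolX//; apply: lte_add_pinfty; [exact: ltry|exact: Lploc_ball].
apply: le_Int => y; first by nn.
rewrite -EFinD lee_fin /nearX; have [h|_] := ltP (`|x - y|) r; last by rewrite mul0r; nn.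
have yq : `|y| <= q.
  have := ler_normB x (x - y); rewrite opprB addrC subrK => h1.
  by apply: le_trans h1 _; rewrite lerD2l; apply: le_trans (ltW h) (ler_norm _).
rewrite yq subr0 (_ : _ < _)%R; last by apply: le_lt_trans yq _; rewrite ltrDl.
rewrite !mul1r; have [f1|f1] := leP `|f y| 1.
  by apply: le_trans f1 _; rewrite lerDl powR_ge0.
apply: le_trans (_ : `|f y| `^ p <= _); last by rewrite lerDr.
by rewrite -[leLHS]powRr1//; apply: ler_powR; exact: ltW.
Qed.

Variables (La L : R) (etam etap eta w : 'rV[R]_d -> R) (sg : R).
Hypothesis sp0 : 0 < s * p.
Hypothesis La0 : 0 <= La.
Hypothesis sd : side La L eta w sg.
Hypothesis stripE : forall z, strip etam etap z <-> inO eta w sg z.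

(** Over a compact set the width is at most some B, so the Hardy weight is at least B^(-sp) and
    controls [|u - f| ^ p]; the remaining [|f| ^ p] is integrated over columns of length at most
    B. *)
Lemma hardy_energy_loc (u : Z -> R) (f : 'rV[R]_d -> R) : measurable_fun setT u -> Lploc_rV p f ->
  (hardy_energy s p eta w sg u f < +oo)%E ->
  forall K : set ('rV[R]_d * R), compact K -> K `<=` strip etam etap ->
  (\int[lebesgue_graph d]_(x in K) (`|u x| `^ p)%:E < +oo)%E.
Proof using p0' sp0 La0 sd stripE.
move=> mu_ lf H K cK KO; have [mf _] := lf; have [sgE eta_lip w_lip w_gt0 w_elip meta mw] := sd.
have mO := measurable_inO sg meta mw; have mtau := measurable_tau sg meta.
have [M [_ hM]] := compact_bounded cK; pose r := `|M| + 1.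
have Kr z : K z -> `|z.1| <= r.
  move=> Kz; have Mr : M < r by rewrite /r ltr_pwDr// ler_norm.
  by apply: le_trans (hM r Mr z Kz); rewrite prod_normE le_max lexx.
pose B := w 0 + La * r.
have r0 : 0 <= r by rewrite addr_ge0.
have B0 : 0 < B by rewrite ltr_pwDl// mulr_ge0.
have wB x : `|x| <= r -> w x <= B.
  move=> xr; have := w_lip x 0; rewrite subr0 ler_norml => /andP[_ h].
  have k : La * `|x| <= La * r by rewrite ler_wpM2l.
  by move: h k; rewrite /B -lerBlDl; exact: le_trans.
pose A z := ((inO eta w sg z)%:R * (tau eta sg z `^ (- (s * p)) * `|u z - f z.1| `^ p))%:E.
pose E z := ((inO eta w sg z)%:R * ((`|z.1| <= r)%R%:R * `|f z.1| `^ p))%:E.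
have A0 z : (0 <= A z)%E by rewrite /A; nn.
have E0 z : (0 <= E z)%E by rewrite /E; nn.
have mA : measurable_fun setT A by rewrite /A; mm.
have mE : measurable_fun setT E by rewrite /E; mm.
have k0 : 0 <= B `^ (s * p) by exact: powR_ge0.
have p2 : 0 <= 2 `^ p :> R by exact: powR_ge0.
have kA0 z : (0 <= (B `^ (s * p))%:E * A z)%E by apply: mule_ge0 => //; rewrite lee_fin.
apply: (@le_lt_trans _ _ (\I[mZ d]_z ((2 `^ p)%:E * ((B `^ (s * p))%:E * A z + E z)))%E); last first.
  rewrite IntZ//; last by move=> z; apply: adde_ge0.
  apply: lte_mul_pinfty => //; rewrite IntD//; last by exact: measurable_funeM.
  apply: lte_add_pinfty.
    by rewrite IntZ//; apply: lte_mul_pinfty => //.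
  rewrite /E (@Int_inO _ _ eta w sg sgE w_gt0 meta mw (fun x => (`|x| <= r)%R%:R * `|f x| `^ p)); [|mm|by move=> x; nn].
  apply: (@le_lt_trans _ _ (B%:E * \I[mX d]_x ((`|x| <= r)%R%:R * `|f x| `^ p)%:E)%E); last first.
    by apply: lte_mul_pinfty => //; [rewrite lee_fin ltW|exact: Lploc_ball].
  have B0' := ltW B0; rewrite -IntZR//.
  apply: le_Int => x; first by have := ltW (w_gt0 x) => w0'; nn.
  rewrite lee_fin; have [xE|xE] := boolP (`|x| <= r); last by rewrite mul0r mulr0; nn.
  by rewrite !mul1r ler_wpM2r ?powR_ge0// wB.
rewrite (@int_dom _ _ R (@lebesgue_graph R d) _ (fun z => `[< K z >])); last by move=> z; split=> /asboolP.
rewrite -IntZm; apply: le_Int => z; first by nn.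
have [Kz|_] := boolP `[< K z >]; last first.
  by rewrite mul0r; apply: mule_ge0; [rewrite lee_fin|apply: adde_ge0].
move/asboolP: Kz => Kz; have Oz : inO eta w sg z by apply/stripE/KO.
have /andP[t0 tw] := Oz; have zr := Kr _ Kz.
rewrite /A /E Oz zr !mul1r.
change ((`|u z| `^ p)%:E <= (2 `^ p * (B `^ (s * p) * (tau eta sg z `^ (- (s * p)) * `|u z - f z.1| `^ p) + `|f z.1| `^ p))%:E)%E.
rewrite lee_fin; have h := dist2 (u z) (f z.1) 0 p0'; rewrite !subr0 in h; apply: (le_trans h).
apply: ler_wpM2l => //; rewrite lerD2r mulrA ler_peMl ?powR_ge0//.
have tB : tau eta sg z <= B by apply: le_trans (ltW tw) _; exact: wB.
have sp0' := ltW sp0; have := powR_anti sp0' t0 tB.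
have e1 : 1 = B `^ (s * p) * B `^ (- (s * p)) by rewrite powRN mulfV// gt_eqF// powR_gt0.
by rewrite [X in _ -> X <= _]e1 ler_pM2l// powR_gt0.
Qed.
End locality.

Section ext_algebra.
Context {R : realType} (d : nat).
Local Notation Z := ('rV[R]_d * measurableTypeR R)%type.
Variables (eta : 'rV[R]_d -> R) (sg c : R).

Lemma tent_int t x (f : 'rV[R]_d -> R) : 0 < t -> loc_int f -> (\I[mX d]_y (`|tent t x y * f y|)%:E < +oo)%E.
Proof.
move=> t0 lf; apply: (@le_lt_trans _ _ (t%:E * \I[mX d]_y ((nearX t x y)%:R * `|f y|)%:E)%E).
  have t0' := ltW t0; rewrite -IntZ//; apply: le_Int => y; first by nn.
  by rewrite -EFinM lee_fin normrM mulrA ler_wpM2r// ger0_norm ?tent_ge0// tent_le.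
by apply: lte_mul_pinfty => //; rewrite lee_fin ltW.
Qed.

Lemma ext_lin (a : R) (f g : 'rV[R]_d -> R) z : 0 < c -> 0 < tau eta sg z -> measurable_fun setT f -> measurable_fun setT g ->
  loc_int f -> loc_int g ->
  ext eta sg c (fun x => a * f x + g x) z = a * ext eta sg c f z + ext eta sg c g z.
Proof.
move=> c0 t0 mf mg lf lg; have ct : 0 < c * tau eta sg z by rewrite mulr_gt0.
have mt := measurable_tent_section (c * tau eta sg z) z.1.
rewrite /ext [a * (_ * _)]mulrCA -mulrDr -RI_lin; [|mm|exact: tent_int|mm|exact: tent_int].
by congr (_ * _); apply: eq_RI => y; ring.
Qed.

Lemma ext_ae (f g : 'rV[R]_d -> R) z : measurable_fun setT f -> measurable_fun setT g ->
  {ae lebesgue_rV d, forall x, f x = g x} -> ext eta sg c f z = ext eta sg c g z.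
Proof.
move=> mf mg fg; rewrite /ext; congr (_ * _); rewrite RI.unlock /Rintegral -!IntE !IntX; congr fine.
have mt := measurable_tent_section (c * tau eta sg z) z.1.
apply: ae_eq_integral => //; [mm|mm|].
by apply: filterS fg => x ->.
Qed.
End ext_algebra.

(** * The glued extension *)

Section extension.
Context {R : realType} (d : nat).
Local Notation Z := ('rV[R]_d * measurableTypeR R)%type.
Variables (s p La L c : R).
Hypotheses (p1 : 1 < p) (s0 : 0 < s) (s1 : s < 1) (sp1 : 1 < s * p) (La0 : 0 <= La) (L0 : 0 < L).
Hypotheses (c0 : 0 < c) (cLa : c * (1 + La) <= 1) (cL : 4 * c * d%:R * L <= 1).
Local Notation width etam etap := (fun x => etap x - etam x).

Definition extension (etam etap fp fm : 'rV[R]_d -> R) (z : Z) : R :=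
  ext etap 1 c fp z + tau etap 1 z / (etap z.1 - etam z.1) * (ext etam (-1) c fm z - ext etap 1 c fp z).

(** The two heights add up to the width, so the blend has the same form seen from the bottom graph,
    and the one-sided estimates apply to both traces. *)
Lemma extensionE (etam etap fp fm : 'rV[R]_d -> R) z : inO etam (width etam etap) (-1) z ->
  extension etam etap fp fm z =
  ext etam (-1) c fm z + tau etam (-1) z / (etap z.1 - etam z.1) * (ext etap 1 c fp z - ext etam (-1) c fm z).
Proof.
move=> /andP[/= t0 tw]; have w0 := lt_trans t0 tw; rewrite /extension.
have -> : tau etam (-1) z = (etap z.1 - etam z.1) - tau etap 1 z by rewrite /tau; ring.
by rewrite mulrBl divff ?gt_eqF//; ring.
Qed.

Definition energy (etam etap fp fm : 'rV[R]_d -> R) : \bar R :=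
  (near_energy s p (width etam etap) L fp + near_energy s p (width etam etap) L fm +
   (far_energy s p (width etam etap) L fp + far_energy s p (width etam etap) L fm) +
   \I[mX d]_x (`|fp x - fm x| `^ p * (etap x - etam x) `^ (- (s * p - 1)))%:E)%E.

(** The Hardy bounds for the extension serve twice: they identify its traces through
    [is_trace_hardy] and yield its local integrability through [hardy_energy_loc]. *)
Lemma extension_bounds : exists2 C, 0 < C & forall etam etap : 'rV[R]_d -> R,
  side La L etap (width etam etap) 1 -> side La L etam (width etam etap) (-1) ->
  forall fp fm : 'rV[R]_d -> R, measurable_fun setT fp -> measurable_fun setT fm -> loc_int fp -> loc_int fm ->
  [/\ (gag s p (inO etap (width etam etap) 1) (extension etam etap fp fm) <= C%:E * energy etam etap fp fm)%E,
      (hardy_energy s p etap (width etam etap) 1 (extension etam etap fp fm) fp <= C%:E * energy etam etap fp fm)%E &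
      (hardy_energy s p etam (width etam etap) (-1) (extension etam etap fp fm) fm <= C%:E * energy etam etap fp fm)%E].
Proof using p1 s0 s1 sp1 La0 L0 c0 cLa cL.
have [CH CH0 hH] := hardy_energy_ext d s La L p1 c0.
have [CQ CQ0 hQ] := Qosc_le La p1 sp1 L0 c0 cL.
have [CG CG0 hG] := gag_ext d p1 s0 s1 sp1 La0 L0 c0 cLa.
have [CB CB0 hB] := gag_blend d L p1 s0 s1 sp1 La0.
have CH0' := ltW CH0; have CQ0' := ltW CQ0; have CG0' := ltW CG0; have CB0' := ltW CB0.
have p2 : 0 <= 2 `^ p :> R by exact: powR_ge0.
have p3 : 0 <= 3 `^ p :> R by exact: powR_ge0.
(* Multiples of the total energy: h bounds the Hardy energies of the one-sided extensions, g their
   Gagliardo energies, W the width energy; K1 and K2 bound the same quantities for the blend. *)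
pose h := CH * (CQ * 1); have h0 : 0 <= h by rewrite !mulr_ge0.
pose g := CG * (CQ * 1 + 1); have g0 : 0 <= g by rewrite mulr_ge0// addr_ge0// mulr_ge0.
pose W := 3 `^ p * (h + h + 1); have W0 : 0 <= W by rewrite mulr_ge0// !addr_ge0.
pose K1 := CB * (g + g + W); have K10 : 0 <= K1 by rewrite mulr_ge0// !addr_ge0.
pose K2 := 2 `^ p * (h + W); have K20 : 0 <= K2 by rewrite mulr_ge0// addr_ge0.
have K0 : 0 < K1 + K2 + 1 by rewrite ltr_pwDr// addr_ge0.
exists (K1 + K2 + 1) => // etam etap sdp sdm fp fm mfp mfm lfp lfm.
have [_ _ _ w_gt0 _ metap mw] := sdp; have [_ _ _ _ _ metam _] := sdm.
pose w := width etam etap; rewrite -/w in sdp sdm w_gt0 mw *.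
pose Up := ext etap 1 c fp; pose Um := ext etam (-1) c fm.
have mUp : measurable_fun setT Up by exact: measurable_ext.
have mUm : measurable_fun setT Um by exact: measurable_ext.
have OO z : inO etap w 1 z = inO etam w (-1) z by exact: inO_bottom.
have LE0 (f : 'rV[R]_d -> R) : (0 <= near_energy s p w L f)%E by apply: Int_ge0 => x; nn.
have d0 x : 0 <= w x / (2 * L) by apply/ltW/divr_gt0; [exact: w_gt0|rewrite mulr_gt0].
have GE0 (f : 'rV[R]_d -> R) : (0 <= far_energy s p w L f)%E.
  by apply: Int_ge0 => x; apply: Int_ge0 => y; have := d0 x => ?; have := d0 y => ?; nn.
pose J := (\I[mX d]_x (`|fp x - fm x| `^ p * w x `^ (- (s * p - 1)))%:E)%E.
have J0 : (0 <= J)%E by apply: Int_ge0 => x; nn.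
have [N NE] : exists N, energy etam etap fp fm = N by exists (energy etam etap fp fm).
rewrite NE; have lp := LE0 fp; have lm := LE0 fm; have gp := GE0 fp; have gm := GE0 fm.
have N0 : (0 <= N)%E by rewrite -NE /energy; do !apply: adde_ge0.
have lpN : (near_energy s p w L fp <= 1%:E * N)%E by rewrite mul1e -NE /energy -!addeA leeDl// !adde_ge0.
have lmN : (near_energy s p w L fm <= 1%:E * N)%E.
  by rewrite mul1e -NE /energy -!addeA addeCA leeDl// !adde_ge0.
have JN : (J <= 1%:E * N)%E by rewrite mul1e -NE /energy leeDr// !adde_ge0.
have sp_ : (near_energy s p w L fp + far_energy s p w L fp <= 1%:E * N)%E.
  by rewrite mul1e -NE /energy [X in (_ <= X + _)%E]addeACA -addeA leeDl// !adde_ge0.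
have sm_ : (near_energy s p w L fm + far_energy s p w L fm <= 1%:E * N)%E.
  by rewrite mul1e -NE /energy [X in (_ <= X + _)%E]addeACA [X in (_ <= X + _)%E]addeC -addeA leeDl// !adde_ge0.
have qN eta sg (sd : side La L eta w sg) f (mf : measurable_fun setT f) : (near_energy s p w L f <= 1%:E * N)%E ->
  (Qosc s p eta w sg c f <= (CQ * 1)%:E * N)%E.
  by move=> lN; apply: le_trans (hQ eta w sg sd f mf) _; exact: le_scale.
have hN eta sg (sd : side La L eta w sg) f (mf : measurable_fun setT f) (lf : loc_int f) : (near_energy s p w L f <= 1%:E * N)%E ->
  (hardy_energy s p eta w sg (ext eta sg c f) f <= h%:E * N)%E.
  by move=> lN; apply: le_trans (hH eta w sg sd f mf lf) _; apply: le_scale => //; exact: qN.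
have gN eta sg (sd : side La L eta w sg) f (mf : measurable_fun setT f) (lf : loc_int f) : (near_energy s p w L f <= 1%:E * N)%E ->
  (near_energy s p w L f + far_energy s p w L f <= 1%:E * N)%E ->
  (gag s p (inO eta w sg) (ext eta sg c f) <= g%:E * N)%E.
  move=> lN sN; apply: le_trans (hG eta w sg sd f mf lf) _; apply: le_scale => //.
  by rewrite -addeA; apply: le_sum; rewrite ?mulr_ge0//; exact: qN.
have WN : (width_energy s p (inO etap w 1) w Up Um <= W%:E * N)%E.
  apply: le_trans (width_energy_le p1 sp1 sdp sdm OO mUp mUm mfp mfm) _; apply: le_scale => //.
  apply: le_sum; rewrite ?addr_ge0//; apply: le_sum => //; exact: hN.
have TE z : inO etap w 1 z -> extension etam etap fp fm z = Up z + tau etap 1 z / w z.1 * (Um z - Up z) by [].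
have TE' z : inO etam w (-1) z -> extension etam etap fp fm z = Um z + tau etam (-1) z / w z.1 * (Up z - Um z).
  by move=> /extensionE.
have up (k : R) X : k <= K1 + K2 + 1 -> (X <= k%:E * N)%E -> (X <= (K1 + K2 + 1)%:E * N)%E.
  by move=> kK /le_trans; apply; apply: lee_wpmul2r; rewrite ?lee_fin.
split.
- apply: (up K1); first by rewrite -addrA lerDl addr_ge0.
  apply: le_trans (hB etap w 1 sdp Up Um _ mUp mUm TE) _; apply: le_scale => //.
  apply: le_sum; rewrite ?addr_ge0//; apply: le_sum => //; first exact: gN.
  by rewrite /gag; under eq_Int => z do under eq_Int => z' do rewrite !OO; exact: gN.
- apply: (up K2); first by rewrite addrAC lerDr addr_ge0.
  by apply: le_trans (hardy_energy_blend p1 s0 s1 sdp mUp mUm mfp TE) _; apply: le_scale => //; apply: le_sum => //; exact: hN.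
apply: (up K2); first by rewrite addrAC lerDr addr_ge0.
apply: le_trans (hardy_energy_blend p1 s0 s1 sdm mUm mUp mfm TE') _; apply: le_scale => //; apply: le_sum => //; first exact: hN.
by rewrite width_energyC /width_energy; under eq_Int => z do rewrite -OO.
Qed.
End extension.

(** * The trace estimates and the extension theorem *)

Section main.
Context {R : realType} (d : nat).
Local Notation Z := ('rV[R]_d * measurableTypeR R)%type.
Variables (s p L : R).
Hypotheses (p1 : 1 < p) (s0 : 0 < s) (s1 : s < 1) (sp1 : 1 < s * p) (L0 : 0 < L).
Local Notation La := (L * d%:R).
Local Notation width etam etap := (fun x => etap x - etam x).

Let p0 : 0 < p. Proof. exact: lt_trans ltr01 p1. Qed.
Let p0' : 0 <= p. Proof. exact: ltW. Qed.
Let La0 : 0 <= La. Proof. by rewrite mulr_ge0// ltW. Qed.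

Lemma inO_sides (etam etap : 'rV[R]_d -> R) : inO etam (width etam etap) (-1) = inO etap (width etam etap) 1 :> (Z -> bool).
Proof. by apply/funext => z; rewrite inO_bottom. Qed.

Lemma screened_leE (etam etap f : 'rV[R]_d -> R) :
  (screened_le (s - p^-1) p (screen etam etap L) setT f `^ p = near_energy s p (width etam etap) L f)%E.
Proof using p1. exact: screened_le_pow. Qed.

Lemma screened_geE (etam etap f : 'rV[R]_d -> R) : (forall x, etam x < etap x) ->
  (screened_ge (s + p^-1) p (screen etam etap L) setT f `^ p = far_energy s p (width etam etap) L f)%E.
Proof using p1 L0.
move=> lt_eta; apply: screened_ge_pow => // x.
by rewrite /screen; apply/ltW/divr_gt0; [rewrite subr_gt0|rewrite mulr_gt0].
Qed.

(** Provides, for the function set to 0 outside the strip, global measurability and local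
    integrability, the form in which the mollification lemmas take u. *)
Lemma Wdot_masked (etam etap : 'rV[R]_d -> R) (u : 'rV[R]_d * R -> R) eta sg :
  (forall z, strip etam etap z <-> inO eta (width etam etap) sg z) -> side La L eta (width etam etap) sg ->
  Wdot s p (strip etam etap) u ->
  [/\ measurable_fun setT (fun z : Z => (inO eta (width etam etap) sg z)%:R * u z),
      forall K : set ('rV[R]_d * R), compact K -> K `<=` strip etam etap ->
        (\int[lebesgue_graph d]_(z in K) (`|(inO eta (width etam etap) sg z)%:R * u z| `^ p)%:E < +oo)%E &
      (gag s p (inO eta (width etam etap) sg) u < +oo)%E].
Proof using p1 sp1 p0.
move=> stripE [_ _ _ _ _ meta mw] [[mu_ ul] ug]; have mO := measurable_inO sg meta mw; split.
- exact: measurable_mask stripE mO mu_.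
- move=> K cK KO; apply: le_lt_trans (ul K cK KO).
  rewrite !(@int_dom _ _ R (@lebesgue_graph R d) _ (fun z => `[< K z >]) _ (set_asbool K)).
  rewrite -!IntZm; apply: le_Int => z; first by nn.
  rewrite lee_fin; apply: ind_le_mul => _; apply: powR_mono => //; rewrite normrM ler_piMl//.
  by case: (inO _ _ _ _); rewrite ?normr1 ?normr0.
apply: le_lt_trans (gag_le_gagliardo p1 sp1 u stripE) _.
by apply: lte_mul_pinfty => //; exact: poweR_lty.
Qed.

Lemma trace_estimates : exists C : R, 0 < C /\
  forall etam etap : 'rV[R]_d -> R, is_lipschitz etam -> is_lipschitz etap ->
  lipschitz_const etam + lipschitz_const etap = L -> (forall x, etam x < etap x) ->
  forall u : 'rV[R]_d * R -> R, Wdot s p (strip etam etap) u ->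
     (exists fp fm, is_trace etam etap s p etap u fp /\ is_trace etam etap s p etam u fm) /\
     (forall fp fm, is_trace etam etap s p etap u fp -> is_trace etam etap s p etam u fm ->
      [/\ (jump etam etap s p fp fm <= C%:E * gagliardo s p (strip etam etap) u `^ p)%E,
          (screened_le (s - p^-1) p (screen etam etap L) setT fp <= C%:E * gagliardo s p (strip etam etap) u)%E,
          (screened_le (s - p^-1) p (screen etam etap L) setT fm <= C%:E * gagliardo s p (strip etam etap) u)%E,
          (screened_ge (s + p^-1) p (screen etam etap L) setT fp <= C%:E * gagliardo s p (strip etam etap) u)%E &
          (screened_ge (s + p^-1) p (screen etam etap L) setT fm <= C%:E * gagliardo s p (strip etam etap) u)%E]).
Proof using p1 s0 s1 sp1 L0 p0 p0' La0.
have [Ch Ch0 hH] := hardy_trace d L p1 s0 s1 sp1 La0.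
have [Cl Cl0 hl] := screened_le_bound d p1 sp1 La0 L0.
have [Cg Cg0 hg] := screened_ge_bound d p1 sp1 La0 L0.
pose K : R := d.+1%:R `^ (gam d s p); have K0 : 0 < K by rewrite powR_gt0.
pose A := Cl * (K + Ch * K); have A0 : 0 < A by rewrite mulr_gt0// addr_gt0// mulr_gt0.
pose B := Cg * (K + Ch * K); have B0 : 0 < B by rewrite mulr_gt0// addr_gt0// mulr_gt0.
pose J := 2 `^ p * (Ch * K + Ch * K); have J0 : 0 < J by rewrite mulr_gt0 ?powR_gt0// addr_gt0// mulr_gt0.
(* The screened seminorms are bounded without the p-th power, so their constants are roots, while
   the jump keeps J. *)
pose A' := A `^ p^-1; pose B' := B `^ p^-1.
have A'0 : 0 < A' by rewrite powR_gt0.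
have B'0 : 0 < B' by rewrite powR_gt0.
exists (J + A' + B'); split; first by rewrite !addr_gt0.
move=> etam etap lm lp hL lt_eta u Wu.
have sdp : side La L etap (width etam etap) 1 by apply: side_of => //; [right|rewrite mulr1].
have sdm : side La L etam (width etam etap) (-1) by apply: side_of => //; [left|rewrite mulrNN mulr1].
have OE := inO_sides etam etap; have stp := strip_top etam etap; have stm := strip_bottom etam etap.
have [mu0 ul0 ug] := Wdot_masked stp sdp Wu.
set O := inO etap (width etam etap) 1 in stp OE mu0 ul0 ug.
pose u0 z := (O z)%:R * u z.
have ug0 : gag s p O u0 = gag s p O u by apply: gag_eq => z Oz; rewrite /u0 Oz mul1r.
have ue z : strip etam etap z -> u0 z = u z by move=> /stp Oz; rewrite /u0 Oz mul1r.
have [sgE1 elp wl w_gt0 wel metap mw] := sdp; have [sgE2 elm _ _ _ metam _] := sdm.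
have [[mu_ _] _] := Wu.
have [Y YE] : exists Y, gagliardo s p (strip etam etap) u = Y by exists (gagliardo s p (strip etam etap) u).
have Y0 : (0 <= Y)%E by rewrite -YE poweR_ge0.
have Yp0 : (0 <= Y `^ p)%E by exact: poweR_ge0.
have gY : (gag s p O u <= K%:E * Y `^ p)%E by rewrite -YE; exact: gag_le_gagliardo.
split.
  have ug' : (gag s p O u0 < +oo)%E by rewrite ug0.
  have [fp hfp] := trace_exists p1 sp1 sgE1 La0 elp wl w_gt0 metap mw stp mu0 ul0 ug'.
  have ugm : (gag s p (inO etam (width etam etap) (-1)) u0 < +oo)%E by rewrite OE.
  have [fm hfm] := trace_exists p1 sp1 sgE2 La0 elm wl w_gt0 metam mw stm mu0 ul0 ugm.
  by exists fp, fm; split; [exact: is_trace_eq ue hfp|exact: is_trace_eq ue hfm].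
rewrite YE => fp fm tp tm; have [mfp _] := tp; have [mfm _] := tm.
have hard eta sg f : side La L eta (width etam etap) sg -> inO eta (width etam etap) sg = O -> is_trace etam etap s p eta u f ->
  (hardy_energy s p eta (width etam etap) sg u0 f <= (Ch * K)%:E * Y `^ p)%E.
  move=> sd Oe tr; have st z : strip etam etap z <-> inO eta (width etam etap) sg z by rewrite Oe.
  have := hH etam etap eta (width etam etap) sg sd st u f mu_ tr; rewrite Oe.
  have -> : hardy_energy s p eta (width etam etap) sg u0 f =
    (\I[mZ d]_z ((O z)%:R * (tau eta sg z `^ (- (s * p)) * `|u z - f z.1| `^ p))%:E)%E.
    by rewrite /hardy_energy Oe; apply: eq_Int => z; rewrite /u0; have [Oz|_] := boolP (O z); rewrite ?mul0r// !mul1r.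
  by move=> h; apply: le_trans h _; apply: le_scale => //; exact: ltW.
have sum eta sg f : side La L eta (width etam etap) sg -> inO eta (width etam etap) sg = O -> is_trace etam etap s p eta u f ->
  (gag s p (inO eta (width etam etap) sg) u0 + hardy_energy s p eta (width etam etap) sg u0 f <= (K + Ch * K)%:E * Y `^ p)%E.
  move=> sd Oe tr; apply: le_sum => //; [exact: ltW|by rewrite mulr_ge0// ltW| |exact: hard].
  by rewrite Oe ug0.
have up (k : R) X : k <= J + A' + B' -> (X <= k%:E * Y)%E -> (X <= (J + A' + B')%:E * Y)%E.
  by move=> kK h; apply: le_trans h _; apply: lee_wpmul2r; rewrite ?lee_fin.
have lA : A' <= J + A' + B' by rewrite addrAC lerDr addr_ge0// ltW.
have lB : B' <= J + A' + B' by rewrite lerDr addr_ge0// ltW.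
have le_b eta sg f : side La L eta (width etam etap) sg -> inO eta (width etam etap) sg = O -> is_trace etam etap s p eta u f ->
  (screened_le (s - p^-1) p (screen etam etap L) setT f <= (J + A' + B')%:E * Y)%E.
  move=> sd Oe tr; have [mf _] := tr; apply: (up A') => //; apply: root_le => //; [exact: ltW|exact: poweR_ge0|].
  rewrite screened_leE; apply: le_trans (hl _ _ _ sd u0 f mu0 mf) _.
  by apply: le_scale; [exact: ltW|exact: sum].
have ge_b eta sg f : side La L eta (width etam etap) sg -> inO eta (width etam etap) sg = O -> is_trace etam etap s p eta u f ->
  (screened_ge (s + p^-1) p (screen etam etap L) setT f <= (J + A' + B')%:E * Y)%E.
  move=> sd Oe tr; have [mf _] := tr; apply: (up B') => //; apply: root_le => //; [exact: ltW|exact: poweR_ge0|].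
  rewrite screened_geE//; apply: le_trans (hg _ _ _ sd u0 f mu0 mf) _.
  by apply: le_scale; [exact: ltW|exact: sum].
split; [|exact: le_b sdp _ tp|exact: le_b sdm OE tm|exact: ge_b sdp _ tp|exact: ge_b sdm OE tm].
rewrite (@jumpE _ _ _ _ _ _ (width etam etap))//.
have OO z : inO etap (width etam etap) 1 z = inO etam (width etam etap) (-1) z by exact: inO_bottom.
apply: le_trans (jump_bound p1 sp1 sgE1 w_gt0 metap metam mw OO mu0 mfp mfm) _.
apply: (@le_trans _ _ (J%:E * Y `^ p)%E); last first.
  by apply: lee_wpmul2r => //; rewrite lee_fin -addrA lerDl addr_ge0// ltW.
apply: le_scale; first exact: powR_ge0.
by apply: le_sum => //; rewrite ?mulr_ge0 ?(ltW Ch0) ?(ltW K0)//; [exact: hard sdp _ tp|exact: hard sdm OE tm].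
Qed.

Lemma energyE (etam etap fp fm : 'rV[R]_d -> R) : (forall x, etam x < etap x) ->
  energy s p L etam etap fp fm =
  ((screened_le (s - p^-1) p (screen etam etap L) setT fp `^ p + screened_le (s - p^-1) p (screen etam etap L) setT fm `^ p) +
   (screened_ge (s + p^-1) p (screen etam etap L) setT fp `^ p + screened_ge (s + p^-1) p (screen etam etap L) setT fm `^ p) +
   jump etam etap s p fp fm)%E.
Proof using p1 L0.
move=> lt_eta; have jE := jumpE s p fp fm (fun x : 'rV[R]_d => erefl (etap x - etam x)).
apply: esym; apply: (congr2 adde (congr2 adde _ _) jE).
  exact: (congr2 adde (screened_leE etam etap fp) (screened_leE etam etap fm)).
exact: (congr2 adde (screened_geE fp lt_eta) (screened_geE fm lt_eta)).
Qed.

Let three_energies (k : R) (X Y J : \bar R) : (0 <= X -> 0 <= Y -> 0 <= J -> k%:E * (X + Y + J) = k%:E * J + k%:E * X + k%:E * Y)%E.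
Proof. by move=> X0 Y0 J0; rewrite addeC addeA ge0_muleDr ?adde_ge0// ge0_muleDr. Qed.

Lemma extension_exists : exists C : R, 0 < C /\
  forall etam etap : 'rV[R]_d -> R, is_lipschitz etam -> is_lipschitz etap ->
  lipschitz_const etam + lipschitz_const etap = L -> (forall x, etam x < etap x) ->
  exists T : ('rV[R]_d -> R) -> ('rV[R]_d -> R) -> ('rV[R]_d * R -> R),
     [/\ forall fp fm gp gm, trace_data etam etap s p L fp fm -> trace_data etam etap s p L gp gm ->
           {ae lebesgue_rV d, forall x, fp x = gp x} -> {ae lebesgue_rV d, forall x, fm x = gm x} ->
           {ae lebesgue_graph d, forall z, strip etam etap z -> T fp fm z = T gp gm z},
         forall (a : R) fp fm gp gm, trace_data etam etap s p L fp fm -> trace_data etam etap s p L gp gm ->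
           {ae lebesgue_graph d, forall z, strip etam etap z ->
              T (fun x => a * fp x + gp x) (fun x => a * fm x + gm x) z = a * T fp fm z + T gp gm z} &
         forall fp fm, trace_data etam etap s p L fp fm ->
           [/\ Wdot s p (strip etam etap) (T fp fm),
               is_trace etam etap s p etap (T fp fm) fp,
               is_trace etam etap s p etam (T fp fm) fm &
               (gagliardo s p (strip etam etap) (T fp fm) `^ p
                <= C%:E * jump etam etap s p fp fm
                 + C%:E * (screened_le (s - p^-1) p (screen etam etap L) setT fp `^ p
                  + screened_le (s - p^-1) p (screen etam etap L) setT fm `^ p)
                 + C%:E * (screened_ge (s + p^-1) p (screen etam etap L) setT fp `^ p
                  + screened_ge (s + p^-1) p (screen etam etap L) setT fm `^ p))%E]].
Proof using p1 s0 s1 sp1 L0 p0 p0' La0.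
(* The averaging ratio c is the inverse of M, which meets both smallness conditions at once and
   depends on d and L only. *)
pose M : R := 4 * d%:R * L + 1 + La.
have L0' := ltW L0.
have dL : 0 <= 4 * d%:R * L by rewrite !mulr_ge0.
have M0 : 0 < M by rewrite /M ltr_wpDr// ltr_wpDl.
pose c := M^-1; have c0 : 0 < c by rewrite invr_gt0.
have cLa : c * (1 + La) <= 1 by rewrite mulrC ler_pdivrMr// mul1r /M -addrA lerDr.
have cL : 4 * c * d%:R * L <= 1.
  have -> : 4 * c * d%:R * L = (4 * d%:R * L) / M by rewrite /c; ring.
  by rewrite ler_pdivrMr// mul1r /M -addrA lerDl addr_ge0.
have [CE CE0 hE] := extension_bounds p1 s0 s1 sp1 La0 L0 c0 cLa cL.
have G0 : 0 < 2 `^ (gam d s p) :> R by rewrite powR_gt0.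
exists (2 `^ (gam d s p) * CE); split; first exact: mulr_gt0.
move=> etam etap lm lp hL lt_eta; exists (extension c etam etap).
have sdp : side La L etap (width etam etap) 1 by apply: side_of => //; [right|rewrite mulr1].
have sdm : side La L etam (width etam etap) (-1) by apply: side_of => //; [left|rewrite mulrNN mulr1].
have OE := inO_sides etam etap; have stp := strip_top etam etap; have stm := strip_bottom etam etap.
have [sgE1 elp wl w_gt0 wel metap mw] := sdp; have [sgE2 elm _ _ _ metam _] := sdm.
split.
(* Almost everywhere equality of the data gives equality of the extensions at every point, since
   tent means ignore null sets; linearity below likewise holds at every point of the strip. *)
- move=> fp fm gp gm [[[mfp _] [mfm _]] _ _ _] [[[mgp _] [mgm _]] _ _ _] ep em; apply: aeW => z _.
  by rewrite /extension (ext_ae etap 1 c z mfp mgp ep) (ext_ae etam (-1) c z mfm mgm em).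
- move=> a fp fm gp gm [[lfp lfm] _ _ _] [[lgp lgm] _ _ _]; apply: aeW => z Oz.
  have /andP[tp _] := proj1 (stp z) Oz; have /andP[tm _] := proj1 (stm z) Oz.
  have [mfp _] := lfp; have [mfm _] := lfm; have [mgp _] := lgp; have [mgm _] := lgm.
  have := @ext_lin R d etap 1 c a fp gp z c0 tp mfp mgp (Lploc_loc_int p1 lfp) (Lploc_loc_int p1 lgp).
  have := @ext_lin R d etam (-1) c a fm gm z c0 tm mfm mgm (Lploc_loc_int p1 lfm) (Lploc_loc_int p1 lgm).
  by rewrite /extension => -> ->; ring.
move=> fp fm [[lfp lfm] fj [flp flm] [fgp fgm]].
have [mfp _] := lfp; have [mfm _] := lfm.
have [gT Hp Hm] := hE etam etap sdp sdm fp fm mfp mfm (Lploc_loc_int p1 lfp) (Lploc_loc_int p1 lfm).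
pose T : Z -> R := extension c etam etap fp fm; rewrite -/T in gT Hp Hm *.
have fin : (energy s p L etam etap fp fm < +oo)%E.
  by rewrite energyE//; do !apply: lte_add_pinfty => //; exact: poweR_lty.
have CE0' : (0 <= CE%:E)%E by rewrite lee_fin ltW.
have cfin X : (X <= CE%:E * energy s p L etam etap fp fm)%E -> (X < +oo)%E.
  by move=> /le_lt_trans; apply; exact: lte_mul_pinfty.
have mT : measurable_fun setT T.
  have mE1 := measurable_ext 1 c metap mfp; have mE2 := measurable_ext (-1) c metam mfm.
  have mtau := measurable_tau 1 metap.
  rewrite (_ : T = fun z => ext etap 1 c fp z + tau etap 1 z * (etap z.1 - etam z.1) `^ (-1) * (ext etam (-1) c fm z - ext etap 1 c fp z)); first by mm.
  by apply/funext => z; rewrite powR_inv1//; apply/ltW/w_gt0.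
have sp0 : 0 < s * p := lt_trans ltr01 sp1.
have Tloc := hardy_energy_loc p1 sp0 La0 sdp stp mT lfp (cfin _ Hp).
have gTm : (gag s p (inO etam (width etam etap) (-1)) T < +oo)%E by rewrite OE; exact: cfin.
have gp : (gagliardo s p (strip etam etap) T `^ p <= (2 `^ (gam d s p) * CE)%:E * energy s p L etam etap fp fm)%E.
  apply: le_trans (gagliardo_le_gag p1 sp1 T stp) _; apply: le_scale => //; exact: ltW.
split.
- split; first by split; [exact: measurable_funTS|exact: Tloc].
  apply: (@lty_poweRy _ _ p); first by rewrite gt_eqF.
  by apply: le_lt_trans gp _; apply: lte_mul_pinfty => //; rewrite lee_fin mulr_ge0// ltW.
- exact: (is_trace_hardy p1 sp1 sgE1 La0 elp wl w_gt0 metap mw stp mT Tloc (cfin _ gT) mfp (cfin _ Hp)).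
- exact: (is_trace_hardy p1 sp1 sgE2 La0 elm wl w_gt0 metam mw stm mT Tloc gTm mfm (cfin _ Hm)).
apply: (le_trans gp); rewrite energyE//.
rewrite three_energies//; [by apply: adde_ge0; exact: poweR_ge0|by apply: adde_ge0; exact: poweR_ge0|].
by rewrite (jumpE s p fp fm (fun x : 'rV[R]_d => erefl (etap x - etam x))); apply: Int_ge0 => x; nn.
Qed.
End main.

Theorem theorem1p6 (R : realType) (N : nat) (s p L : R)
    (hN : (2 <= N)%N) (hp : 1 < p) (hs : 0 < s < 1) (hsp : 1 < s * p)
    (hL : 0 < L) :
  (exists C : R, 0 < C /\
   forall etam etap : 'rV[R]_N.-1 -> R,
     is_lipschitz etam -> is_lipschitz etap ->
     lipschitz_const etam + lipschitz_const etap = L ->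
     (forall x, etam x < etap x) ->
   forall u : 'rV[R]_N.-1 * R -> R, Wdot s p (strip etam etap) u ->
     (exists fp fm, is_trace etam etap s p etap u fp /\
                    is_trace etam etap s p etam u fm) /\
     (forall fp fm, is_trace etam etap s p etap u fp ->
                    is_trace etam etap s p etam u fm ->
      [/\ (jump etam etap s p fp fm
             <= C%:E * gagliardo s p (strip etam etap) u `^ p)%E,
          (screened_le (s - p^-1) p (screen etam etap L) setT fp
             <= C%:E * gagliardo s p (strip etam etap) u)%E,
          (screened_le (s - p^-1) p (screen etam etap L) setT fm
             <= C%:E * gagliardo s p (strip etam etap) u)%E,
          (screened_ge (s + p^-1) p (screen etam etap L) setT fp
             <= C%:E * gagliardo s p (strip etam etap) u)%E &
          (screened_ge (s + p^-1) p (screen etam etap L) setT fm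
             <= C%:E * gagliardo s p (strip etam etap) u)%E])) /\
  (exists C : R, 0 < C /\
   forall etam etap : 'rV[R]_N.-1 -> R,
     is_lipschitz etam -> is_lipschitz etap ->
     lipschitz_const etam + lipschitz_const etap = L ->
     (forall x, etam x < etap x) ->
   exists T : ('rV[R]_N.-1 -> R) -> ('rV[R]_N.-1 -> R) ->
              ('rV[R]_N.-1 * R -> R),
     [/\ forall fp fm gp gm,
           trace_data etam etap s p L fp fm ->
           trace_data etam etap s p L gp gm ->
           {ae lebesgue_rV N.-1, forall x, fp x = gp x} ->
           {ae lebesgue_rV N.-1, forall x, fm x = gm x} ->
           {ae lebesgue_graph N.-1, forall z,
              strip etam etap z -> T fp fm z = T gp gm z},
         forall (a : R) fp fm gp gm,
           trace_data etam etap s p L fp fm ->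
           trace_data etam etap s p L gp gm ->
           {ae lebesgue_graph N.-1, forall z, strip etam etap z ->
              T (fun x => a * fp x + gp x) (fun x => a * fm x + gm x) z
              = a * T fp fm z + T gp gm z} &
         forall fp fm, trace_data etam etap s p L fp fm ->
           [/\ Wdot s p (strip etam etap) (T fp fm),
               is_trace etam etap s p etap (T fp fm) fp,
               is_trace etam etap s p etam (T fp fm) fm &
               (gagliardo s p (strip etam etap) (T fp fm) `^ p
                <= C%:E * jump etam etap s p fp fm
                 + C%:E *
                   (screened_le (s - p^-1) p (screen etam etap L) setT fp `^ p
                  + screened_le (s - p^-1) p (screen etam etap L) setT fm `^ p)
                 + C%:E *
                   (screened_ge (s + p^-1) p (screen etam etap L) setT fp `^ p
                  + screened_ge (s + p^-1) p (screen etam etap L) setT fm `^ p)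
               )%E]]).
Proof.
have [s0 s1] := andP hs; split; first exact: trace_estimates.
exact: extension_exists.
Qed.
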